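(* Let $S$, $\psi$, $\Delta$, $\Omega$, $L$, $D_\Omega$, $H_\Omega$ and $\Theta_{S,\Omega}$ be as in the context, and assume there exist a discriminant form $D$, a subgroup $H_D\subseteq D$ and a group isomorphism $\phi:H_\Omega\to H_D$ with $q_D(\phi(x))=-q_{D_\Omega}(x)$ for all $x\in H_\Omega$, such that, for the horizontal isotropic subgroup $H:=\{(x,\phi(x)):x\in H_\Omega\}\subseteq D_\Omega\oplus D$, there is an isomorphism of discriminant forms $H^\perp/H\cong\Delta$ carrying the image $(y,0)+H$ of each $y\in H_\Omega^\perp=D_{\Omega,S}$ to $\psi(a)$ for any $a\in\mathbb{Z}^{c_+}$ with $a+\Omega=y$; use it to identify $\mathbb{C}[H^\perp/H]$ with $\mathbb{C}[\Delta]$. Then every Jacobi form $\Phi$ of weight $k$, representation $\rho_\Delta$ and index $(S,\psi)$ with respect to $\Gamma$ is given by $\Phi(\tau,z)=\downarrow_{H}\big(\Theta_{S,\Omega}(\tau,z)\otimes F(\tau)\big)$ for a unique modular form $F$ of weight $k-\frac{b_{+}}{2}$ and representation $\rho_{D}$ with respect to $\Gamma$; moreover $F$ is holomorphic on $\mathcal{H}$ if and only if $\Phi$ is holomorphic in $\tau$.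
   Context: Let $S$ be a positive semidefinite symmetric $c_+\times c_+$ matrix over $\mathbb{Q}$. Let $V:=\mathbb{Q}^{c_+}/\ker S$, of dimension $b_+$, with the positive definite quadratic form induced by $a\mapsto a^tSa$ (bilinear form $(\pi a,\pi b)=2a^tSb$), $\pi:\mathbb{Q}^{c_+}\to V$ the projection. Discriminant forms are finite abelian groups with $\mathbb{Q}/\mathbb{Z}$-valued quadratic form $q$ with non-degenerate bilinear form $(\cdot,\cdot)$; $Y^\perp$ orthogonal; for a discriminant form $E$, $\rho_E$ is its Weil representation of $\operatorname{Mp}_2(\mathbb{Z})$ on $\mathbb{C}[E]$ ($\rho_E(T)\mathfrak{e}_\gamma=\mathbf{e}(q(\gamma))\mathfrak{e}_\gamma$, $\rho_E(S)\mathfrak{e}_\gamma=\frac{\mathbf{e}(-\operatorname{sign}(E)/8)}{\sqrt{|E|}}\sum_\delta\mathbf{e}(-(\gamma,\delta))\mathfrak{e}_\delta$), $\mathbf{e}(z)=e^{2\pi iz}$; for $\delta\in E$, $t_\delta\mathfrak{e}_\beta=\mathfrak{e}_{\beta-\delta}$, $\chi_\delta\mathfrak{e}_\beta=\mathbf{e}((\delta,\beta))\mathfrak{e}_\beta$; for isotropic $Y$, $\downarrow_Y:\mathbb{C}[E]\to\mathbb{C}[Y^\perp/Y]$, $\mathfrak{e}_\delta\mapsto\mathfrak{e}_{\delta+Y}$ if $\delta\in Y^\perp$, $0$ otherwise; $\mathbb{C}[A]\otimes\mathbb{C}[B]=\mathbb{C}[A\oplus B]$. Let $\Delta$ be a discriminant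 form and $\psi:\mathbb{Z}^{c_+}\to\Delta$ a homomorphism with $q_\Delta(\psi a)=a^tSa+\mathbb{Z}$ for all $a$ and $\psi(a)=0$ whenever $Sa=0$. Set $\Omega_\mathbb{Z}:=\ker\psi$, $\Omega:=\Omega_\mathbb{Z}+\ker S$, $L:=\pi(\Omega)$ (an even lattice in $V$, with $\pi(\mathbb{Z}^{c_+})\subseteq L^*$), $\Omega^*:=\pi^{-1}(L^* )$, $D_\Omega:=\Omega^*/\Omega\cong D_L$ (with its quadratic form), $D_{\Omega,S}:=(\mathbb{Z}^{c_+}+\Omega)/\Omega\subseteq D_\Omega$, and $H_\Omega:=D_{\Omega,S}^\perp\subseteq D_\Omega$ (so $H_\Omega^\perp=D_{\Omega,S}$). $\Theta_{S,\Omega}(\tau,z):=\sum_{a\in\Omega^*/\ker S}\mathbf{e}(\tau a^tSa+2a^tSz)\mathfrak{e}_{a+\Omega}$ for $\tau\in\mathcal{H}$, $z\in\mathbb{C}^{c_+}$. Let $\Gamma\subseteq\operatorname{Mp}_2(\mathbb{Z})$ be of finite index, $k\in\frac12\mathbb{Z}$; for $A$ with underlying matrix $\begin{pmatrix}a&b\\c&d\end{pmatrix}$, $j(A,\tau)=c\tau+d$ (half-integral powers via the metaplectic data), $j'_A=c$. A Jacobi form of weight $k$, representation $\rho_\Delta$ and index $(S,\psi)$ w.r.t. $\Gamma$ is a smooth $\Phi:\mathcal{H}\times\mathbb{C}^{c_+}\to\mathbb{C}[\Delta]$, holomorphic in $z$, such that $\Phi(\tau,z+\tau u+v)=\mathbf{e}(-\tau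 u^tSu-2u^tSz)\chi_{\psi v}t_{\psi u}\Phi(\tau,z)$ for all $u,v\in\mathbb{Z}^{c_+}$, $\Phi(A\tau,\frac{z}{j(A,\tau)})=j(A,\tau)^k\mathbf{e}\big(\frac{j'_A\,z^tSz}{j(A,\tau)}\big)\rho_\Delta(A)\Phi(\tau,z)$ for all $A\in\Gamma$, and such that the smooth coefficient functions $g_{\beta,\gamma}(\tau)$ in the (unique) expansion of each component $\Phi_\beta$ as $\sum_{\gamma\in D_\Omega}g_{\beta,\gamma}(\tau)\cdot(\text{the }\mathfrak{e}_\gamma\text{-component of }\Theta_{S,\Omega})$ grow at most linearly exponentially towards every cusp of $\Gamma$. A modular form of weight $k'$ and representation $\rho_D$ w.r.t. $\Gamma$ is a smooth $F:\mathcal{H}\to\mathbb{C}[D]$ with $F(A\tau)=j(A,\tau)^{k'}\rho_D(A)F(\tau)$ for $A\in\Gamma$ and at most linear exponential growth at the cusps. *)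

(* Defs.v *)
From HB Require Import structures.
From mathcomp Require Import all_boot all_order all_algebra all_fingroup.
From mathcomp Require Import ring_quotient cyclic.
From mathcomp Require Import all_classical all_reals all_analysis.
From mathcomp Require Import complex.
From mathcomp Require Import ring lra.
From mathcomp Require summability.
From mathcomp Require Import generic_quotient.

Set Implicit Arguments.
Unset Strict Implicit.
Unset Printing Implicit Defensive.

Import Order.TTheory GRing.Theory Num.Theory.
Import numFieldNormedType.Exports.

Local Open Scope ring_scope.
Local Open Scope quotient_scope.

(* Q/Z as a quotient group, so that discriminant forms take genuine Q/Z values. *)
Definition Zrat : {pred rat} := fun x => x \is a Num.int.
Fact Zrat_zmod_closed : zmod_closed Zrat.
Proof. by split=> [|x y]; rewrite -!topredE /= /Zrat ?rpred0 //; exact: rpredB. Qed.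
HB.instance Definition _ := GRing.isZmodClosed.Build rat Zrat Zrat_zmod_closed.
Definition QZ : zmodType := Quotient.quot Zrat.
Definition toQZ (x : rat) : QZ := \pi_QZ x.

Fact toQZ_is_zmod_morphism : zmod_morphism toQZ.
Proof. exact: pi_is_zmod_morphism. Qed.
HB.instance Definition _ :=
  GRing.isZmodMorphism.Build rat QZ toQZ toQZ_is_zmod_morphism.

Lemma toQZ_eq0 x : (toQZ x == 0) = (x \is a Num.int).
Proof.
rewrite /toQZ (_ : 0 = \pi_QZ 0); last by rewrite raddf0.
by rewrite -Quotient.idealrBE subr0.
Qed.

Lemma eq_toQZ x y : (toQZ x = toQZ y) <-> (x - y \is a Num.int).
Proof.
rewrite -toQZ_eq0 raddfB subr_eq0; split=> [h|/eqP//]; exact/eqP.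
Qed.

(* A finite abelian group with a Q/Z-valued quadratic form, possibly degenerate:
   D_Omega and the orthogonal sums below are built at this level, and
   [discForm] adds non-degeneracy. *)
Record quadMod := QuadMod {
  qm_sort :> finZmodType;
  qform : qm_sort -> QZ;
  qformZ : forall (n : int) x, qform (x *~ n) = qform x *~ (n ^+ 2);
  qform_bilin : forall x y z,
    qform (x + y + z) - qform (x + y) - qform z =
    (qform (x + z) - qform x - qform z) + (qform (y + z) - qform y - qform z)
}.

Definition bform (E : quadMod) (x y : E) : QZ :=
  qform (x + y) - qform x - qform y.

Definition nondegenerate (E : quadMod) : Prop :=
  forall x : E, (forall y, bform x y = 0) -> x = 0.

Record discForm := DiscForm {
  df_quadMod :> quadMod;
  df_nondegenerate : nondegenerate df_quadMod }.

Definition perp (E : quadMod) (Y : {set E}) : {set E} :=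
  [set x | [forall y in Y, bform x y == 0]].

HB.instance Definition _ (A B : finZmodType) := GRing.Zmodule.on (A * B)%type.

Section DirectSum.
Variables E1 E2 : quadMod.
Definition dsum_q (p : E1 * E2) : QZ := qform p.1 + qform p.2.

Fact dsum_qZ (n : int) p : dsum_q (p *~ n) = dsum_q p *~ (n ^+ 2).
Proof.
have e1 : (p *~ n).1 = p.1 *~ n by exact: (raddfMz fst).
have e2 : (p *~ n).2 = p.2 *~ n by exact: (raddfMz snd).
by rewrite /dsum_q e1 e2 mulrzDl !qformZ.
Qed.

Fact dsum_qD x y z :
  dsum_q (x + y + z) - dsum_q (x + y) - dsum_q z =
  (dsum_q (x + z) - dsum_q x - dsum_q z) +
  (dsum_q (y + z) - dsum_q y - dsum_q z).
Proof.
have sub (a b c a' b' c' : QZ) : (a + a') - (b + b') - (c + c') =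
    (a - b - c) + (a' - b' - c').
  by rewrite !opprD (addrACA a a') (addrACA (a - b)).
rewrite /dsum_q !sub [RHS]addrACA.
exact: (congr2 +%R (qform_bilin x.1 y.1 z.1) (qform_bilin x.2 y.2 z.2)).
Qed.

Definition dsum : quadMod := QuadMod dsum_qZ dsum_qD.
End DirectSum.

(* a^t S b *)
Definition sform (F : pzRingType) c (S : 'M[F]_c) (a b : 'cV[F]_c) : F :=
  (a^T *m S *m b) 0 0.

Definition ratcV c (a : 'cV[int]_c) : 'cV[rat]_c := map_mx intr a.

Lemma mulrn_card (E : finZmodType) (x : E) : x *+ #|E| = 0.
Proof.
have := @order_dvdG E [set: E]%G x (finset.in_setT x).
by rewrite cardsT order_dvdn => /eqP.
Qed.

(* The data (S, psi): S is positive semidefinite, q(psi a) = a^t S a mod Z, and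
   psi kills the integral points of ker S. *)
Record jacobi_index c (S : 'M[rat]_c) (Delta : discForm) := JacobiIndex {
  psi_of :> {additive 'cV[int]_c -> Delta};
  index_sym : S^T = S;
  index_psd : forall a : 'cV[rat]_c, 0 <= sform S a a;
  index_qform : forall a, qform (psi_of a) = toQZ (sform S (ratcV a) (ratcV a));
  index_ker : forall a, S *m ratcV a = 0 -> psi_of a = 0 }.

Section Sform.
Variables (F : comPzRingType) (c : nat) (S : 'M[F]_c).
Implicit Types a b : 'cV[F]_c.
Lemma sformDl a1 a2 b : sform S (a1 + a2) b = sform S a1 b + sform S a2 b.
Proof. by rewrite /sform raddfD /= !mulmxDl mxE. Qed.
Lemma sformDr a b1 b2 : sform S a (b1 + b2) = sform S a b1 + sform S a b2.
Proof. by rewrite /sform mulmxDr mxE. Qed.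
Lemma sformNl a b : sform S (- a) b = - sform S a b.
Proof. by rewrite /sform raddfN /= !mulNmx mxE. Qed.
Lemma sformNr a b : sform S a (- b) = - sform S a b.
Proof. by rewrite /sform mulmxN mxE. Qed.
Lemma sform0l b : sform S 0 b = 0.
Proof. by rewrite /sform trmx0 !mul0mx mxE. Qed.
Lemma sform_kerr a b : S *m b = 0 -> sform S a b = 0.
Proof. by move=> Sb; rewrite /sform -mulmxA Sb mulmx0 mxE. Qed.
Hypothesis symS : S^T = S.
Lemma sformC a b : sform S a b = sform S b a.
Proof.
rewrite /sform (_ : b^T *m S *m a = (a^T *m S *m b)^T); first by rewrite [RHS]mxE.
by rewrite !trmx_mul trmxK symS mulmxA.
Qed.
End Sform.

Section Omega.
Variables (c : nat) (S : 'M[rat]_c) (Delta : discForm).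
Variable psi : jacobi_index S Delta.

Definition kerS : {pred 'cV[rat]_c} := fun a => S *m a == 0.

Fact kerS_closed : zmod_closed kerS.
Proof.
split=> [|x y]; rewrite !unfold_in ?mulmx0 // => /eqP hx /eqP hy.
by rewrite mulmxBr hx hy subrr.
Qed.
HB.instance Definition _ := GRing.isZmodClosed.Build _ kerS kerS_closed.

(* V = Q^c / ker S, with (pi a, pi b) = 2 a^t S b; see [VformE]. *)
Definition Vquot : zmodType := Quotient.quot kerS.
Definition piV (a : 'cV[rat]_c) : Vquot := \pi_Vquot a.

Definition Vform (v w : Vquot) : rat := 2 * sform S (repr v) (repr w).

Lemma piV_repr a : S *m (repr (piV a) - a) = 0.
Proof.
apply/eqP; rewrite -[_ == 0]/(_ \in kerS) Quotient.idealrBE.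
by rewrite reprK.
Qed.

Lemma VformE a b : Vform (piV a) (piV b) = 2 * sform S a b.
Proof.
have symS := index_sym psi.
congr (2 * _).
rewrite -[repr (piV a)](subrK a) -[repr (piV b)](subrK b).
rewrite sformDr sform_kerr ?add0r ?piV_repr //.
by rewrite sformC // sformDr sform_kerr ?add0r ?piV_repr // sformC.
Qed.

(* Omega = ker psi + ker S; L = pi Omega; L^* its dual in V;
   Omega^* = pi^-1 L^*. *)
Definition Omega : {pred 'cV[rat]_c} := fun a =>
  `[< exists b : 'cV[int]_c, exists k : 'cV[rat]_c,
        [/\ psi b = 0, k \in kerS & a = ratcV b + k] >].

Fact Omega_closed : zmod_closed Omega.
Proof.
split=> [|x y].
  apply/asboolP; exists 0, 0; rewrite raddf0 rpred0 addr0; split=> //.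
  by rewrite /ratcV raddf0.
move=> /asboolP[b1 [k1 [h1 kk1 ->]]] /asboolP[b2 [k2 [h2 kk2 ->]]].
apply/asboolP; exists (b1 - b2), (k1 - k2); rewrite raddfB h1 h2 subrr rpredB //.
by split=> //; rewrite /ratcV raddfB opprD addrACA.
Qed.
HB.instance Definition _ := GRing.isZmodClosed.Build _ Omega Omega_closed.

Definition lattice : {pred Vquot} := fun v =>
  `[< exists2 a, a \in Omega & v = piV a >].

Definition dual_lattice : {pred Vquot} := fun v =>
  `[< forall w, w \in lattice -> Vform v w \is a Num.int >].

Definition Omega_star : {pred 'cV[rat]_c} := fun a => piV a \in dual_lattice.

Lemma Omega_starP a :
  reflect (forall b, b \in Omega -> 2 * sform S a b \is a Num.int)
          (a \in Omega_star).
Proof.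
rewrite [_ \in _]/(asbool _); apply: (iffP (asboolP _)) => [h b bO|h _ /asboolP[b bO ->]].
  by rewrite -VformE; apply: h; apply/asboolP; exists b.
by rewrite VformE; exact: h.
Qed.

Fact Omega_star_closed : zmod_closed Omega_star.
Proof.
split=> [|x y]; first by apply/Omega_starP => b _; rewrite sform0l mulr0.
move=> /Omega_starP hx /Omega_starP hy; apply/Omega_starP => b bO.
by rewrite sformDl sformNl mulrBr rpredB ?hx ?hy.
Qed.
HB.instance Definition _ := GRing.isZmodClosed.Build _ Omega_star Omega_star_closed.

Definition OmegaStar : Type := {a | a \in Omega_star}.
HB.instance Definition _ := SubChoice.on OmegaStar.
HB.instance Definition _ := [SubChoice_isSubZmodule of OmegaStar by <:].

Definition Omega_in : {pred OmegaStar} := fun a => val a \in Omega.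
Fact Omega_in_closed : zmod_closed Omega_in.
Proof.
split=> [|x y hx hy]; first exact: (rpred0 Omega).
by rewrite -[_ \in _]/(val (x - y) \in Omega) raddfB; exact: rpredB.
Qed.
HB.instance Definition _ := GRing.isZmodClosed.Build _ Omega_in Omega_in_closed.

(* Omega^* / Omega, where [Omega_in] is Omega inside Omega^* (Omega is contained in
   Omega^* by [Omega_sub]). *)
Definition DOmega : Type := Quotient.quot Omega_in.
HB.instance Definition _ := GRing.Zmodule.on DOmega.

(* a + Omega for a in Omega^* ; the junk value 0 is taken outside Omega^*. *)
Definition DOmega_class (a : 'cV[rat]_c) : DOmega :=
  \pi_(Quotient.quot Omega_in) (insubd (0 : OmegaStar) a).
Definition DOmega_repr (x : DOmega) : 'cV[rat]_c :=
  val (repr (x : Quotient.quot Omega_in)).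

Lemma DOmega_classK x : DOmega_class (DOmega_repr x) = x.
Proof. by rewrite /DOmega_class /DOmega_repr valKd reprK. Qed.

Lemma DOmega_reprP x : DOmega_repr x \in Omega_star.
Proof. exact: (valP (repr (x : Quotient.quot Omega_in))). Qed.

Lemma DOmega_classB a b : a \in Omega_star -> b \in Omega_star ->
  DOmega_class (a - b) = DOmega_class a - DOmega_class b.
Proof.
move=> aO bO; rewrite /DOmega_class.
rewrite -[RHS](raddfB (\pi_(Quotient.quot Omega_in))); congr (\pi _).
by apply: val_inj; rewrite raddfB /= !insubdK // -?topredE //= rpredB.
Qed.

Lemma DOmega_classD a b : a \in Omega_star -> b \in Omega_star ->
  DOmega_class (a + b) = DOmega_class a + DOmega_class b.
Proof.
move=> aO bO; rewrite /DOmega_class.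
rewrite -[RHS](raddfD (\pi_(Quotient.quot Omega_in))); congr (\pi _).
by apply: val_inj; rewrite raddfD /= !insubdK // -?topredE //= rpredD.
Qed.

Lemma eq_DOmega_class a b : a \in Omega_star -> b \in Omega_star ->
  (DOmega_class a == DOmega_class b) = (a - b \in Omega).
Proof.
move=> aO bO; rewrite /DOmega_class -Quotient.idealrBE.
by rewrite -[_ \in _]/(val _ \in Omega) raddfB /= !insubdK.
Qed.

Lemma qform0 (E : quadMod) : qform (0 : E) = 0.
Proof. by have := qformZ 0 (0 : E); rewrite !mulr0z. Qed.

Lemma sform_Omega b : b \in Omega -> sform S b b \is a Num.int.
Proof.
move=> /asboolP[b0 [k [h /eqP kk ->]]].
rewrite sformDr (sform_kerr _ kk) addr0 sformC ?(index_sym psi) //.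
rewrite sformDr (sform_kerr _ kk) addr0.
by rewrite -toQZ_eq0 -(index_qform psi) h qform0.
Qed.

Lemma Omega_sub a : a \in Omega -> a \in Omega_star.
Proof.
have symS := index_sym psi.
move=> aO; apply/Omega_starP => b bO.
have -> : 2 * sform S a b = sform S (a + b) (a + b) - sform S a a - sform S b b.
  by rewrite sformDl !sformDr (sformC symS b a); ring.
by rewrite !rpredB ?sform_Omega // rpredD.
Qed.

Definition DOmega_q (x : DOmega) : QZ :=
  toQZ (sform S (DOmega_repr x) (DOmega_repr x)).

Lemma DOmega_q_class a : a \in Omega_star ->
  DOmega_q (DOmega_class a) = toQZ (sform S a a).
Proof.
have symS := index_sym psi.
move=> aO; apply/eq_toQZ; set b := DOmega_repr _.
have bO : b \in Omega_star by exact: DOmega_reprP.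
have h : b - a \in Omega.
  by rewrite -eq_DOmega_class // DOmega_classK.
rewrite -(subrK a b); move: (b - a) h => d dO.
have -> : sform S (d + a) (d + a) - sform S a a = sform S d d + 2 * sform S a d.
  by rewrite sformDl !sformDr (sformC symS d a); ring.
by rewrite rpredD ?sform_Omega //; move/Omega_starP: aO; exact.
Qed.

Fact DOmega_qZ (n : int) x : DOmega_q (x *~ n) = DOmega_q x *~ (n ^+ 2).
Proof.
have aO := DOmega_reprP x; set a := DOmega_repr x in aO.
have -> : x *~ n = DOmega_class (a *~ n).
  rewrite -[x in LHS]DOmega_classK -/a /DOmega_class.
  rewrite -[LHS](raddfMz (\pi_(Quotient.quot Omega_in))); congr (\pi _).
  by apply: val_inj; rewrite raddfMz /= !insubdK // -?topredE //= rpredMz.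
rewrite DOmega_q_class ?rpredMz // /DOmega_q -/a -(raddfMz toQZ) /=.
congr (toQZ _); move: (a) => d.
rewrite /sform -[d *~ n]scaler_int.
have -> : (n%:~R *: d)^T = n%:~R *: d^T by exact: linearZ.
rewrite -!scalemxAl -scalemxAr scalerA mxE -[RHS]mulrzl.
by rewrite -expr2 rmorphXn.
Qed.

Fact DOmega_qD x y z :
  DOmega_q (x + y + z) - DOmega_q (x + y) - DOmega_q z =
  (DOmega_q (x + z) - DOmega_q x - DOmega_q z) +
  (DOmega_q (y + z) - DOmega_q y - DOmega_q z).
Proof.
have symS := index_sym psi.
rewrite -(DOmega_classK x) -(DOmega_classK y) -(DOmega_classK z).
have [xO yO zO] := And3 (DOmega_reprP x) (DOmega_reprP y) (DOmega_reprP z).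
move: (DOmega_repr x) (DOmega_repr y) (DOmega_repr z) xO yO zO => a b d aO bO dO.
rewrite -!DOmega_classD ?rpredD // !DOmega_q_class ?rpredD //.
rewrite -!raddfB -raddfD /=; congr (toQZ _).
by rewrite !sformDl !sformDr (sformC symS d a) (sformC symS d b); ring.
Qed.

(* Omega^*/Omega is finite: with N = #|Delta| one has N Z^c <= Omega, so 2N S maps
   Omega^* to Z^c with kernel ker S, and a multiple of a partial inverse of 2N S
   maps Z^c into N Z^c. *)
Lemma card_int_Omega (b : 'cV[int]_c) : ratcV b *+ #|Delta| \in Omega.
Proof.
apply/asboolP; exists (b *+ #|Delta|), 0; rewrite rpred0 addr0; split => //.
  by rewrite raddfMn mulrn_card.
by rewrite /ratcV raddfMn.
Qed.

Lemma common_den m n (G : 'M[rat]_(m, n)) :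
  exists2 d : nat, (0 < d)%N & exists G' : 'M[int]_(m, n),
    d%:R *: G = map_mx intr G'.
Proof.
pose p (ij : 'I_m * 'I_n) : nat := `|denq (G ij.1 ij.2)|%N.
exists (\prod_ij p ij)%N.
  by rewrite prodn_gt0 // => ij; rewrite absz_gt0 denq_neq0.
exists (\matrix_(i, j) ((\prod_(ij | ij != (i, j)) p ij)%:Z * numq (G i j))).
apply/matrixP => i j; rewrite !mxE (bigD1 (i, j)) //= natrM.
have -> : (p (i, j))%:R = (denq (G i j))%:~R :> rat.
  by rewrite /p /= pmulrn gez0_abs // denq_ge0.
by rewrite rmorphM /= numqE -pmulrn; ring.
Qed.

Lemma Omega_star_int a : a \in Omega_star ->
  exists v : 'cV[int]_c, (2 * #|Delta|%:R) *: (S *m a) = ratcV v.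
Proof.
move=> /Omega_starP aO; exists (\col_i Num.floor (2 * #|Delta|%:R * (S *m a) i 0)).
apply/colP => i; rewrite !mxE; apply/esym/eqP; rewrite -[_ == _]intrEfloor.
pose e : 'cV[int]_c := delta_mx i 0.
have := aO _ (card_int_Omega e).
suff -> : sform S a (ratcV e *+ #|Delta|) = #|Delta|%:R * (S *m a) i 0.
  by rewrite mulrA mxE.
rewrite (sformC (index_sym psi)) /sform.
have -> : (ratcV e *+ #|Delta|)^T = #|Delta|%:R *: delta_mx 0 i.
  by apply/matrixP => j k; rewrite mxE mulmxnE !mxE mulr_natl andbC; case: (_ && _).
by rewrite -!scalemxAl mxE -mulmxA -rowE mxE.
Qed.

Lemma DOmega_finite_ex : exists s : seq DOmega, forall x, x \in s.
Proof.
pose N := #|Delta|; have N0 : (0 < N)%N by apply/card_gt0P; exists 0.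
pose S' : 'M[rat]_c := (2 * N%:R) *: S.
have [d d0 [G' dG]] := common_den (pinvmx S').
pose m := (N * d)%N; have m0 : (0 < m)%N by rewrite muln_gt0 N0.
pose vec (x : DOmega) := sval (cid (Omega_star_int (DOmega_reprP x))).
have vecP x : S' *m DOmega_repr x = ratcV (vec x).
  by rewrite -scalemxAl; exact: (svalP (cid (Omega_star_int (DOmega_reprP x)))).
pose f (x : DOmega) : 'cV['I_m.-1.+1]_c :=
  \col_i inord `|((vec x i ord0) %% m%:Z)%Z|%N.
have f_inj : injective f.
  move=> x y fxy; rewrite -(DOmega_classK x) -(DOmega_classK y).
  apply/eqP; rewrite eq_DOmega_class ?DOmega_reprP //.
  have mz : (m%:Z != 0) by rewrite eqz_nat -lt0n.
  have [w hw] : exists w : 'cV[int]_c, vec x - vec y = m%:Z *: w.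
    exists (\col_i ((vec x - vec y) i ord0 %/ m%:Z)%Z); apply/colP => i; rewrite !mxE.
    rewrite mulrC divzK // -eqz_mod_dvd.
    have /(congr1 val) := congr1 (fun v : 'cV['I_m.-1.+1]_c => v i 0) fxy.
    have lt z : (`|(z %% m%:Z)%Z| < m.-1.+1)%N.
      by rewrite prednK // -ltz_nat gez0_abs ?modz_ge0 // ltz_pmod // ltz_nat.
    rewrite !mxE /= !inordK // => /(congr1 Posz).
    by rewrite !gez0_abs ?modz_ge0 // => ->.
  set t := DOmega_repr x - DOmega_repr y.
  have St : S' *m t = m%:R *: ratcV w.
    rewrite mulmxBr !vecP; have := congr1 (@ratcV c) hw; rewrite /ratcV raddfB /=.
    by move=> ->; apply/colP => i; rewrite !mxE rmorphM.
  have kt : t - pinvmx S' *m S' *m t \in kerS.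
    have : S' *m (t - pinvmx S' *m S' *m t) = 0.
      rewrite mulmxBr (mulmxA S') (mulmxA S' (pinvmx S')).
      by rewrite mulmxKpV ?submx_refl // subrr.
    rewrite -scalemxAl => /eqP; rewrite scaler_eq0 mulf_eq0 pnatr_eq0 /=.
    by rewrite pnatr_eq0 -leqn0 leqNgt N0.
  rewrite -[t](subrK (pinvmx S' *m S' *m t)) rpredD //.
    apply/asboolP; exists 0, (t - pinvmx S' *m S' *m t).
    by rewrite raddf0 kt /ratcV raddf0 add0r; split.
  rewrite -mulmxA St -scalemxAr scalemxAl natrM -scalerA dG -scalemxAl.
  have -> : map_mx intr G' *m ratcV w = ratcV (G' *m w) by rewrite /ratcV map_mxM.
  by rewrite scaler_nat; exact: card_int_Omega.
pose g t := if pselect (exists x, f x = t) is left h then Some (sval (cid h)) else None.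
exists (pmap g (enum {: 'cV['I_m.-1.+1]_c})) => x.
rewrite mem_pmap; apply/mapP; exists (f x); first by rewrite mem_enum.
rewrite /g; case: pselect => [h|[]]; last by exists x.
by congr Some; apply: f_inj; rewrite (svalP (cid h)).
Qed.

Definition DOmega_finite := cid DOmega_finite_ex.

Fact DOmega_pickleK : pcancel
  (fun x : DOmega => index x (sval DOmega_finite))
  (fun n => nth None [seq Some x | x <- sval DOmega_finite] n).
Proof.
move=> x; have xs := svalP DOmega_finite x.
by rewrite (nth_map x) ?nth_index ?index_mem.
Qed.
HB.instance Definition _ := isCountable.Build DOmega DOmega_pickleK.

Fact DOmega_enumP : forall x, count_mem x (undup (sval DOmega_finite)) = 1%N.
Proof.
by move=> x; rewrite count_uniq_mem ?undup_uniq // mem_undup (svalP DOmega_finite).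
Qed.
HB.instance Definition _ := fintype.isFinite.Build DOmega DOmega_enumP.

Definition D_Omega : quadMod :=
  @QuadMod DOmega DOmega_q DOmega_qZ DOmega_qD.

End Omega.

Local Open Scope complex_scope.

Section UpperHalfPlane.
Local Open Scope classical_set_scope.
Variable R : realType.

Definition uhp : Type := set_type [set t : R[i]^o | 0 < complex.Im t].
HB.instance Definition _ := Topological.on uhp.
HB.instance Definition _ := Choice.on uhp.

Definition uval (t : uhp) : R[i] := \val t.

Definition mk_uhp (t : R[i]) (t0 : 0 < complex.Im t) : uhp :=
  exist _ (t : R[i]^o) (mem_set t0).

Lemma uvalP t : 0 < complex.Im (uval t).
Proof. exact: (set_mem (svalP t)). Qed.

Lemma uval_inj : injective uval. Proof. exact: val_inj. Qed.

Lemma uval_mk t t0 : uval (@mk_uhp t t0) = t. Proof. by []. Qed.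

Lemma uval_continuous : continuous (uval : uhp -> R[i]^o).
Proof. exact: initial_continuous. Qed.

Lemma to_uhp_continuous (T : topologicalType) (f : T -> uhp) :
  continuous (uval \o f : T -> R[i]^o) -> continuous f.
Proof. exact: continuous_comp_initial. Qed.

Definition jfac (A : 'M[int]_2) (t : uhp) : R[i] :=
  (A 1 0)%:~R * uval t + (A 1 1)%:~R.

Definition moebius_val (A : 'M[int]_2) (t : uhp) : R[i] :=
  ((A 0 0)%:~R * uval t + (A 0 1)%:~R) / jfac A t.

Lemma intC (n : int) : n%:~R = (n%:~R)%:C :> R[i].
Proof. by rewrite [in RHS]rmorph_int. Qed.

Lemma det2 (A : 'M[int]_2) : \det A = A 0 0 * A 1 1 - A 0 1 * A 1 0.
Proof.
rewrite (expand_det_row _ 0) !big_ord_recl big_ord0 /cofactor /= !det_mx11 !mxE.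
rewrite /= !expr0 !mul1r addr0 /bump /= expr1 mulN1r mulrN.
by congr (A _ _ * A _ _ - A _ _ * A _ _); apply/val_inj.
Qed.

Lemma jfac_neq0 A t : \det A = 1 -> jfac A t != 0.
Proof.
move=> dA; rewrite /jfac; have := uvalP t; case: (uval t) => x y /= y0.
rewrite !intC; apply/eqP => /eqP; rewrite eq_complex /= => /andP[/eqP h1 /eqP h2].
have c0 : (A 1 0)%:~R = 0 :> R.
  move: h2; rewrite mul0r !addr0 => /eqP.
  by rewrite mulf_eq0 (gt_eqF y0) orbF => /eqP.
move: h1; rewrite c0 !mul0r subr0 add0r => d0.
move: dA; rewrite det2 => /(congr1 (fun n : int => n%:~R : R)).
by rewrite rmorphB !rmorphM /= c0 d0 !mulr0 subrr => /esym/eqP; rewrite oner_eq0.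
Qed.

Lemma moebius_Im A t : \det A = 1 -> 0 < complex.Im (moebius_val A t).
Proof.
move=> dA; have := jfac_neq0 t dA; rewrite /moebius_val /jfac.
have := uvalP t; case: (uval t) => x y /= y0.
have := congr1 (fun n : int => n%:~R : R) dA.
rewrite det2 rmorphB !rmorphM /= !intC.
set a := (A 0 0)%:~R; set b := (A 0 1)%:~R.
set c := (A 1 0)%:~R; set d := (A 1 1)%:~R => dR.
rewrite eq_complex /= !mul0r !addr0 !subr0.
set n := _ ^+ 2 + _ ^+ 2 => nz.
have n0 : 0 < n.
  rewrite lt_neqAle addr_ge0 ?sqr_ge0 // andbT eq_sym /n.
  by rewrite paddr_eq0 ?sqr_ge0 // !sqrf_eq0.
rewrite (_ : _ + _ = y / n) ?divr_gt0 //.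
rewrite -[y in RHS]mulr1 -[1 in RHS]dR.
by ring.
Qed.

Definition moebius (A : 'M[int]_2) (dA : \det A = 1) (t : uhp) : uhp :=
  mk_uhp (moebius_Im t dA).

Lemma moebius_continuous A (dA : \det A = 1) : continuous (moebius dA).
Proof.
apply: to_uhp_continuous => t.
rewrite /comp /= /moebius_val.
have lin a b : continuous (fun t : uhp => a * uval t + b : R[i]^o).
  move=> u; apply: continuousD; last exact: cst_continuous.
  apply: continuousM; first exact: cst_continuous.
  exact: uval_continuous.
apply: continuousM; first exact: lin.
apply: continuousV; first exact: jfac_neq0.
exact: lin.
Qed.

End UpperHalfPlane.

Section Metaplectic.
Local Open Scope classical_set_scope.
Variable R : realType.
Local Notation uhp := (uhp R).

Lemma mulmx2E (A B : 'M[int]_2) i j :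
  (A *m B) i j = A i 0 * B 0 j + A i 1 * B 1 j.
Proof.
rewrite mxE !big_ord_recl big_ord0 addr0.
by congr (A _ _ * B _ _ + A _ _ * B _ _); apply/val_inj.
Qed.

Lemma det_mulmx1 (A B : 'M[int]_2) :
  \det A = 1 -> \det B = 1 -> \det (A *m B) = 1.
Proof. by move=> dA dB; rewrite det_mulmx dA dB mulr1. Qed.

Lemma jfacM (A B : 'M[int]_2) (dB : \det B = 1) (t : uhp) :
  jfac (A *m B) t = jfac A (moebius dB t) * jfac B t.
Proof.
have nz := jfac_neq0 t dB.
rewrite /jfac uval_mk /moebius_val mulrDl mulrA divfK // !mulmx2E.
by rewrite /jfac !rmorphD !rmorphM /=; ring.
Qed.

Lemma moebiusM (A B : 'M[int]_2) (dA : \det A = 1) (dB : \det B = 1) dAB (t : uhp) :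
  @moebius R (A *m B) dAB t = moebius dA (moebius dB t).
Proof.
apply: uval_inj; rewrite !uval_mk /moebius_val (jfacM _ dB).
have nzB := jfac_neq0 t dB; have nzA := jfac_neq0 (moebius dB t) dA.
rewrite invfM mulrC -mulrA [RHS]mulrC; congr (_ * _).
apply: (mulfI nzB); rewrite mulrA divff // mul1r.
rewrite uval_mk /moebius_val mulrDr mulrCA [jfac B t * _]mulrC divfK //.
by rewrite !mulmx2E /jfac !rmorphD !rmorphM /=; ring.
Qed.

Lemma jfac1 (t : uhp) : jfac 1%:M t = 1.
Proof. by rewrite /jfac !mxE /= mul0r add0r. Qed.

Lemma moebius1 d1 (t : uhp) : @moebius R 1%:M d1 t = t.
Proof.
by apply: uval_inj; rewrite uval_mk /moebius_val jfac1 !mxE /= mul1r addr0 divr1.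
Qed.

(* Mp_2(Z): pairs (A, phi) with A in SL_2(Z) and phi a continuous (hence
   holomorphic) square root of c t + d on the upper half-plane; the product is
   (A, phi)(B, chi) = (AB, phi(B t) chi(t)). Half-integral powers j(A,t)^k are
   phi(t)^(2k). *)
Record Mp2Z := MkMp2Z {
  mp_mat : 'M[int]_2;
  mp_phi : uhp -> R[i];
  mp_det : \det mp_mat = 1;
  mp_cont : continuous (mp_phi : uhp -> R[i]^o);
  mp_sqr : forall t, mp_phi t ^+ 2 = jfac mp_mat t }.

HB.instance Definition _ := gen_eqMixin Mp2Z.
HB.instance Definition _ := gen_choiceMixin Mp2Z.

Lemma Mp2Z_eq (x y : Mp2Z) : mp_mat x = mp_mat y ->
  (forall t, mp_phi x t = mp_phi y t) -> x = y.
Proof.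
case: x y => [A f d1 c1 s1] [B g d2 c2 s2] /= eAB /funext efg.
by subst; congr MkMp2Z; apply: Prop_irrelevance.
Qed.

Definition mp_act (x : Mp2Z) : uhp -> uhp := moebius (mp_det x).
Definition mp_j (x : Mp2Z) : uhp -> R[i] := jfac (mp_mat x).

Lemma mp_phi_neq0 x t : mp_phi x t != 0.
Proof.
by have := jfac_neq0 t (mp_det x); rewrite -mp_sqr expf_eq0.
Qed.

Program Definition mp_one : Mp2Z :=
  @MkMp2Z 1%:M (fun=> 1) (det1 _ _) _ _.
Next Obligation. by move=> t; exact: cst_continuous. Qed.
Next Obligation. by move=> t; rewrite jfac1 expr1n. Qed.

Program Definition mp_mul (x y : Mp2Z) : Mp2Z :=
  @MkMp2Z (mp_mat x *m mp_mat y)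
    (fun t => mp_phi x (mp_act y t) * mp_phi y t)
    (det_mulmx1 (mp_det x) (mp_det y)) _ _.
Next Obligation.
move=> x y t.
apply: (@continuousM R[i] uhp (fun t => mp_phi x (mp_act y t)) (mp_phi y) t);
  last exact: mp_cont.
apply: (@continuous_comp _ _ R[i]^o (mp_act y) (mp_phi x)).
  exact: moebius_continuous.
exact: mp_cont.
Qed.
Next Obligation. by move=> x y t; rewrite exprMn !mp_sqr -jfacM. Qed.

Lemma det_adj2 (A : 'M[int]_2) : \det A = 1 -> \det (\adj A) = 1.
Proof.
by move=> dA; have := det_mulmx A (\adj A); rewrite mul_mx_adj dA det1 mul1r.
Qed.

Lemma mp_inv_jfac (A : 'M[int]_2) (dA : \det A = 1) (t : uhp) :
  jfac A (moebius (det_adj2 dA) t) * jfac (\adj A) t = 1.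
Proof. by rewrite -jfacM mul_mx_adj dA jfac1. Qed.

Program Definition mp_inv (x : Mp2Z) : Mp2Z :=
  @MkMp2Z (\adj (mp_mat x))
    (fun t => (mp_phi x (moebius (det_adj2 (mp_det x)) t))^-1)
    (det_adj2 (mp_det x)) _ _.
Next Obligation.
move=> x t.
apply: (@continuousV R[i] uhp
  (fun t => mp_phi x (moebius (det_adj2 (mp_det x)) t)) t); first exact: mp_phi_neq0.
apply: (@continuous_comp _ _ R[i]^o (moebius _) (mp_phi x)).
  exact: moebius_continuous.
exact: mp_cont.
Qed.
Next Obligation.
move=> x t; rewrite exprVn mp_sqr.
have h := mp_inv_jfac (mp_det x) t.
have nz : jfac (mp_mat x) (moebius (det_adj2 (mp_det x)) t) != 0.
  exact: jfac_neq0 (mp_det x).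
by apply: (mulfI nz); rewrite h divff.
Qed.

Lemma moebius_ext (A B : 'M[int]_2) (dA : \det A = 1) (dB : \det B = 1) (t : uhp) :
  A = B -> @moebius R A dA t = @moebius R B dB t.
Proof. by move=> e; subst; congr moebius; apply: Prop_irrelevance. Qed.

Lemma mp_mulA : associative mp_mul.
Proof.
move=> x y z; apply: Mp2Z_eq => [|t]; first exact: mulmxA.
rewrite /= mulrA; congr (mp_phi x _ * _ * _).
exact: moebiusM.
Qed.

Lemma mp_mul1 : left_id mp_one mp_mul.
Proof. by move=> x; apply: Mp2Z_eq => [|t]; rewrite /= ?mul1mx ?mul1r. Qed.

Lemma mp_mulr1 : right_id mp_one mp_mul.
Proof.
move=> x; apply: Mp2Z_eq => [|t]; rewrite /= ?mulmx1 ?mulr1 //.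
by congr mp_phi; exact: moebius1.
Qed.

Lemma mp_mulV : right_inverse mp_one mp_inv mp_mul.
Proof.
move=> x; apply: Mp2Z_eq => [|t] /=; first by rewrite mul_mx_adj mp_det.
by rewrite mulfV ?mp_phi_neq0.
Qed.

Lemma mp_mulVl : left_inverse mp_one mp_inv mp_mul.
Proof.
move=> x; apply: Mp2Z_eq => [|t] /=; first by rewrite mul_adj_mx mp_det.
rewrite (_ : moebius _ _ = t) ?mulVf ?mp_phi_neq0 //.
have d1 : \det (\adj (mp_mat x) *m mp_mat x) = 1 by rewrite mul_adj_mx mp_det det1.
rewrite -(moebiusM _ _ d1) (moebius_ext d1 (det1 _ _)) ?moebius1 //.
by rewrite mul_adj_mx mp_det.
Qed.

HB.instance Definition _ :=
  isGroup.Build Mp2Z mp_mulA mp_mul1 mp_mulr1 mp_mulVl mp_mulV.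

Definition matT : 'M[int]_2 :=
  \matrix_(i, j) (if (i == 1) && (j == 0) then 0 else 1).
Definition matS : 'M[int]_2 :=
  \matrix_(i, j) (if i == j then 0 else if i == 0 then -1 else 1).

Lemma det_matT : \det matT = 1. Proof. by rewrite det2 !mxE. Qed.
Lemma det_matS : \det matS = 1. Proof. by rewrite det2 !mxE. Qed.

Program Definition mpT : Mp2Z := @MkMp2Z matT (fun=> 1) det_matT _ _.
Next Obligation. by move=> t; exact: cst_continuous. Qed.
Next Obligation. by move=> t; rewrite /jfac !mxE /= mul0r add0r expr1n. Qed.

(* The principal branch, by [usqrt_Re]. *)
Definition usqrt (t : uhp) : R[i] := sqrtc (uval t).

Lemma Re_continuous : continuous (@complex.Re R : R[i]^o -> R).
Proof.
move=> z; apply/(@cvgrPdist_lt R R R[i]^o _ (nbhs_filter z)) => e e0.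
exists e%:C => /=; first by rewrite ltcR.
move=> w /= hw; rewrite -raddfB -ltcR.
exact: le_lt_trans (normc_ge_Re _) hw.
Qed.

Lemma Im_continuous : continuous (@complex.Im R : R[i]^o -> R).
Proof.
have -> : @complex.Im R = (fun z : R[i] => complex.Re (- 'i * z)).
  by apply/funext => -[a b] /=; ring.
move=> z; apply: (@continuous_comp R[i]^o R[i]^o R (fun z => - 'i * z)).
  by apply: (@continuousM R[i] R[i]^o); [exact: cst_continuous|exact: id].
exact: Re_continuous.
Qed.

Lemma real_complex_continuous : continuous (fun x : R => x%:C : R[i]^o).
Proof.
move=> x; apply/(@cvgrPdist_lt R[i] R[i]^o) => e e0.
have [r r0 er] : exists2 r : R, 0 < r & e = r%:C.
  by case: e e0 => a b; rewrite ltcE /= => /andP[/eqP-> a0]; exists a.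
exists r => //= y hy; rewrite -raddfB er normc_def /= expr0n addr0 sqrtr_sqr.
by rewrite ltcR.
Qed.

Lemma complex_continuous (T : topologicalType) (f g : T -> R) :
  continuous f -> continuous g -> continuous (fun t => f t +i* g t : R[i]^o).
Proof.
move=> cf cg.
have -> : (fun t => f t +i* g t) = (fun t => (f t)%:C + 'i * (g t)%:C).
  by apply/funext => t; apply/eqP; rewrite eq_complex /=; apply/andP; split; apply/eqP; ring.
move=> t; apply: (@continuousD R[i] R[i]^o T).
  apply: (@continuous_comp T R R[i]^o f); first exact: cf.
  exact: real_complex_continuous.
apply: (@continuousM R[i] T); first exact: cst_continuous.
apply: (@continuous_comp T R R[i]^o g); first exact: cg.
exact: real_complex_continuous.
Qed.

Lemma usqrtE t (x := complex.Re (uval t)) (y := complex.Im (uval t)) :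
  usqrt t = Num.sqrt ((Num.sqrt (x ^+ 2 + y ^+ 2) + x) / 2) +i*
            Num.sqrt ((Num.sqrt (x ^+ 2 + y ^+ 2) - x) / 2).
Proof.
have := uvalP t; rewrite /usqrt /x /y; case: (uval t) => a b /= b0.
by rewrite gt_eqF // gtr0_sg // mul1r.
Qed.

Lemma usqrt_Re t : 0 < complex.Re (usqrt t).
Proof.
rewrite usqrtE /= sqrtr_gt0 divr_gt0 // -ltrBlDr sub0r.
have y0 := uvalP t; move: (complex.Re _) (complex.Im _) y0 => x y y0.
apply: (@le_lt_trans _ _ `|x|); first by rewrite -normrN ler_norm.
have y2 : 0 < y ^+ 2 by rewrite exprn_gt0.
by rewrite -sqrtr_sqr ltr_sqrt ?ltrDl // (lt_le_trans y2) // lerDr sqr_ge0.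
Qed.

Lemma usqrt_continuous : continuous (usqrt : uhp -> R[i]^o).
Proof.
have cx : continuous (fun t : uhp => complex.Re (uval t)).
  move=> t; apply: (@continuous_comp uhp R[i]^o R); first exact: uval_continuous.
  exact: Re_continuous.
have cy : continuous (fun t : uhp => complex.Im (uval t)).
  move=> t; apply: (@continuous_comp uhp R[i]^o R); first exact: uval_continuous.
  exact: Im_continuous.
have csq (f : uhp -> R) : continuous f -> continuous (fun t => Num.sqrt (f t)).
  move=> cf t; apply: (@continuous_comp uhp R R f); first exact: cf.
  exact: sqrt_continuous.
have cr : continuous (fun t : uhp =>
    Num.sqrt (complex.Re (uval t) ^+ 2 + complex.Im (uval t) ^+ 2)).
  apply: csq => t.
  apply: (@continuousD R R uhp (fun t => complex.Re (uval t) ^+ 2)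
    (fun t => complex.Im (uval t) ^+ 2)).
    by apply: (@continuousM R uhp); exact: cx.
  by apply: (@continuousM R uhp); exact: cy.
pose r t := Num.sqrt (complex.Re (uval t) ^+ 2 + complex.Im (uval t) ^+ 2) : R.
have -> : usqrt = (fun t => Num.sqrt ((r t + complex.Re (uval t)) / 2) +i*
                            Num.sqrt ((r t - complex.Re (uval t)) / 2)).
  by apply/funext => t; exact: usqrtE.
apply: complex_continuous; apply: csq => t;
  apply: (@continuousM R uhp); try exact: cst_continuous.
- by apply: (@continuousD R R uhp); [exact: cr|exact: cx].
- by apply: (@continuousB R R uhp); [exact: cr|exact: cx].
Qed.

Program Definition mpS : Mp2Z := @MkMp2Z matS usqrt det_matS usqrt_continuous _.
Next Obligation. by move=> t; rewrite /jfac !mxE /= mul1r addr0 sqr_sqrtc. Qed.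
End Metaplectic.

(* dim V *)
Definition bplus c (S : 'M[rat]_c) : nat := \rank S.

Section DOmegaSubgroups.
Variables (c : nat) (S : 'M[rat]_c) (Delta : discForm).
Variable psi : jacobi_index S Delta.

Lemma ratcV_Omega_star (a : 'cV[int]_c) : ratcV a \in Omega_star psi.
Proof.
have symS := index_sym psi.
apply/Omega_starP => _ /asboolP[b [k [pb /eqP kk ->]]].
rewrite sformDr (sform_kerr _ kk) addr0 -toQZ_eq0.
have -> : 2 * sform S (ratcV a) (ratcV b) =
    sform S (ratcV (a + b)) (ratcV (a + b)) - sform S (ratcV a) (ratcV a)
    - sform S (ratcV b) (ratcV b).
  have -> : ratcV (a + b) = ratcV a + ratcV b by exact: raddfD.
  by rewrite sformDl !sformDr (sformC symS (ratcV b)); ring.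
rewrite !raddfB /= -!(index_qform psi) raddfD /= pb addr0.
by rewrite qform0 // subr0 subrr.
Qed.

(* (Z^c + Omega) / Omega; Z^c lies in Omega^* by [ratcV_Omega_star]. *)
Definition D_OmegaS : {set D_Omega psi} :=
  [set x | `[< exists a : 'cV[int]_c, x = DOmega_class psi (ratcV a) >]]%SET.

Definition H_Omega : {set D_Omega psi} := perp D_OmegaS.
End DOmegaSubgroups.

(* H = {(x, phi x) : x in H_Omega}. *)
Definition graphH c (S : 'M[rat]_c) (Delta D : discForm)
    (psi : jacobi_index S Delta) (phi : D_Omega psi -> D) :
    {set dsum (D_Omega psi) D} :=
  [set p | (p.1 \in H_Omega psi) && (p.2 == phi p.1)]%SET.

Section Analysis.
Local Open Scope classical_set_scope.
Variable R : realType.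
Local Notation uhp := (uhp R).

(* exp(2 pi i z) *)
Definition ee (z : R[i]) : R[i] :=
  (expR (- (2 * trigo.pi * complex.Im z)))%:C *
  (cos (2 * trigo.pi * complex.Re z) +i* sin (2 * trigo.pi * complex.Re z)).

(* Independent of the representative of x in Q/Z, as exp(2 pi i z) is 1-periodic. *)
Definition eQZ (x : QZ) : R[i] := ee (ratr (repr x)).

(* f is C^n on the open set U: all iterated directional derivatives of order at
   most n exist and are continuous on U. *)
Fixpoint Cn (V : normedModType R) (U : set V) (n : nat) (f : V -> R) : Prop :=
  (forall x, U x -> {for x, continuous f}) /\
  if n is m.+1 then
    forall v, (forall x, U x -> derivable f x v) /\ Cn U m ('D_v f)
  else True.

Definition smooth_on (V : normedModType R) (U : set V) (f : V -> R[i]) : Prop :=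
  forall n, Cn U n (fun x => complex.Re (f x)) /\
            Cn U n (fun x => complex.Im (f x)).

Lemma ImI_gt0 : 0 < complex.Im ('i : R[i]). Proof. exact: ltr01. Qed.

(* Only the values at points of the upper half-plane matter: the functions built
   from [uhp_of] are only ever tested at points of this open set. *)
Definition uhp_of (w : R[i]) : uhp :=
  if pselect (0 < complex.Im w) is left w0 then mk_uhp w0 else mk_uhp ImI_gt0.

Definition smooth_uhp (g : uhp -> R[i]) : Prop :=
  smooth_on [set p : R * R | 0 < p.2] (fun p => g (uhp_of (p.1 +i* p.2))).

Definition smooth_uhp_cV c (g : uhp -> 'cV[R[i]]_c -> R[i]) : Prop :=
  smooth_on [set p : (R * R) * ('cV[R]_c * 'cV[R]_c) | 0 < p.1.2]
    (fun p => g (uhp_of (p.1.1 +i* p.1.2))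
                (\col_i (p.2.1 i 0 +i* p.2.2 i 0))).

(* Differentiability over the field R[i]. *)
Definition holomorphic_at (V : normedModType R[i]) (f : V -> R[i]) (z : V) : Prop :=
  differentiable (f : V -> R[i]^o) z.

Definition holomorphic_uhp (g : uhp -> R[i]) : Prop :=
  forall t : uhp,
    holomorphic_at (V := R[i]^o) (fun w => g (uhp_of w)) (uval t).

Definition holomorphic_cV c (f : 'cV[R[i]]_c -> R[i]) : Prop :=
  forall z, holomorphic_at (V := 'cV[R[i]]_c) f z.

(* At the cusp M oo: |g(M t)| <= exp(C Im t) as Im t -> +oo with Re t in any bounded
   set. On such a region the automorphy factor c t + d is polynomially bounded in
   Im t, so slashing g by M would not change the condition; and every cusp of a
   finite index subgroup is M oo for some M. *)
Definition exp_growth (g : uhp -> R[i]) : Prop :=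
  forall (M : Mp2Z R) (B : R), exists C y0 : R, forall t : uhp,
    `|complex.Re (uval t)| <= B -> y0 <= complex.Im (uval t) ->
    `|g (mp_act M t)| <= (expR (C * complex.Im (uval t)))%:C.

Definition finite_index (Gamma : {pred Mp2Z R}) : Prop :=
  exists s : seq (Mp2Z R), forall x, exists2 y, y \in s & (x * y^-1)%g \in Gamma.

Definition galg (E : finType) := {ffun E -> R[i]}.
HB.instance Definition _ (E : finType) := GRing.Lmodule.on (galg E).

Definition gbasis (E : finType) (x : E) : galg E := [ffun y => (y == x)%:R].

(* The signature modulo 8 of a discriminant form, through Milgram's formula
   sum_x e(q(x)) = sqrt|E| e(sign/8); only its class modulo 8 is used. *)
Definition dsign (E : quadMod) : int :=
  xget 0 [set s : int | \sum_(x : E) eQZ (qform x) =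
                        (Num.sqrt #|E|%:R)%:C * ee (s%:~R / 8)].

(* T and S generate Mp_2(Z), so these conditions characterize the Weil
   representation. *)
Definition weil_representation (E : quadMod)
    (rho : Mp2Z R -> {linear galg E -> galg E}) : Prop :=
  [/\ forall v, rho 1%g v = v,
      forall x y v, rho (x * y)%g v = rho x (rho y v),
      forall x : E, rho (mpT R) (gbasis x) = eQZ (qform x) *: gbasis x
    & forall x : E, rho (mpS R) (gbasis x) =
        (ee (- (dsign E)%:~R / 8) / (Num.sqrt #|E|%:R)%:C) *:
        \sum_(y : E) eQZ (- bform x y) *: gbasis y].

(* [k2] is twice the weight. *)
Definition modular_form (Gamma : {pred Mp2Z R}) (k2 : int) (E : quadMod)
    (rho : Mp2Z R -> {linear galg E -> galg E}) (F : uhp -> galg E) : Prop :=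
  [/\ forall x : E, smooth_uhp (fun t => F t x),
      forall A t, A \in Gamma ->
        F (mp_act A t) = exprz (mp_phi A t) k2 *: rho A (F t)
    & forall x : E, exp_growth (fun t => F t x)].

Definition tensor (E1 E2 : quadMod) (f : galg E1) (g : galg E2) :
  galg (dsum E1 E2) := [ffun p : E1 * E2 => f p.1 * g p.2].

(* e_d |-> e_(d+Y) for d in Y^perp and 0 otherwise; elements of C[Y^perp/Y] are
   functions on E/Y, here supported on Y^perp/Y. *)
Definition arrow_down (E : quadMod) (Y : {set E}) (f : galg E) : galg (coset_of Y) :=
  [ffun x => \sum_(d in perp Y | coset Y d == x) f d].

(* The map C[Y^perp/Y] -> C[E'] induced by iota : Y^perp/Y -> E'. *)
Definition push_iso (E : quadMod) (Y : {set E}) (E' : quadMod)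
    (iota : coset_of Y -> E') (f : galg (coset_of Y)) : galg E' :=
  [ffun x => \sum_(y in (perp Y / Y)%g | iota y == x) f y].

(* e_b |-> e_(b-d), by [shift_op_basis]; and e_b |-> e((d,b)) e_b. *)
Definition shift_op (E : quadMod) (d : E) (f : galg E) : galg E :=
  [ffun x => f (x + d)].
Definition char_op (E : quadMod) (d : E) (f : galg E) : galg E :=
  [ffun x => eQZ (bform d x) * f x].

Lemma shift_op_basis (E : quadMod) (d b : E) :
  shift_op d (gbasis b) = gbasis (b - d).
Proof. by apply/ffunP => x; rewrite !ffunE eq_sym -subr_eq eq_sym. Qed.

Section Theta.
Variables (c : nat) (S : 'M[rat]_c) (Delta : discForm).
Variable psi : jacobi_index S Delta.

Definition SC : 'M[R[i]]_c := map_mx ratr S.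

(* The e_gamma-component is the unconditional sum of e(t a^t S a + 2 a^t S z) over
   the classes v = a + ker S in Omega^*/ker S with a + Omega = gamma; the summand
   and both tests do not depend on the representative a of v. *)
Definition theta (t : uhp) (z : 'cV[R[i]]_c) : galg (D_Omega psi) :=
  [ffun gamma => @summability.sum (Vquot S) R[i] R[i]^o (fun v =>
    let a := repr v in
    if (a \in Omega_star psi) && (DOmega_class psi a == gamma) then
      ee (uval t * ratr (sform S a a) + 2 * sform SC (map_mx ratr a) z)
    else 0)].

Definition intC_cV (a : 'cV[int]_c) : 'cV[R[i]]_c := map_mx intr a.

(* [k2] is twice the weight. The last condition is stated for every smooth family of
   coefficients in the theta expansion (it exists and is unique, given the other
   conditions), so that the expansion itself is not part of the hypothesis. *)
Definition jacobi_form (Gamma : {pred Mp2Z R}) (k2 : int)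
    (rho : Mp2Z R -> {linear galg Delta -> galg Delta})
    (Phi : uhp -> 'cV[R[i]]_c -> galg Delta) : Prop :=
  [/\ forall b : Delta, smooth_uhp_cV (fun t z => Phi t z b),
      forall (b : Delta) t, holomorphic_cV (fun z => Phi t z b),
      forall t z (u v : 'cV[int]_c),
        Phi t (z + uval t *: intC_cV u + intC_cV v) =
        ee (- (uval t * sform SC (intC_cV u) (intC_cV u))
            - 2 * sform SC (intC_cV u) z)
        *: char_op (psi v) (shift_op (psi u) (Phi t z)),
      forall A t z, A \in Gamma ->
        Phi (mp_act A t) ((mp_j A t)^-1 *: z) =
        (exprz (mp_phi A t) k2 *
         ee ((mp_mat A 1 0)%:~R * sform SC z z / mp_j A t))
        *: rho A (Phi t z)
    & forall g : Delta -> D_Omega psi -> uhp -> R[i],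
        (forall b x, smooth_uhp (g b x)) ->
        (forall t z b, Phi t z b = \sum_x g b x t * theta t z x) ->
        forall b x, exp_growth (g b x)].
End Theta.
End Analysis.

(* Main.v *)
Require Import Defs.
From HB Require Import structures.
From mathcomp Require Import all_boot all_order all_algebra all_fingroup.
From mathcomp Require Import all_classical all_reals all_analysis complex.
From mathcomp Require Import ring lra zify.
From mathcomp Require summability.
From mathcomp Require Import generic_quotient.
Import Order.TTheory GRing.Theory Num.Theory.
Import numFieldNormedType.Exports.

Set Implicit Arguments.
Unset Strict Implicit.
Unset Printing Implicit Defensive.

Local Open Scope ring_scope.
Local Open Scope complex_scope.

(** In [z], a Jacobi form is a holomorphic function that is quasi-periodic with
    respect to [ker psi]. Choosing an [S]-orthogonal family of full rank in
    [ker psi] and splitting by finite Fourier averages reduces such functions to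
    products of functions of one variable, and in one variable quasi-periodicity
    determines a holomorphic function up to a scalar. This gives the expansion
    [Phi_b = \sum_x g_(b,x) theta_x]. Shifts by the remaining vectors of [Z^c]
    show that [g_(b,x)] vanishes unless [b] is the class of some [(x, y)] in
    [H^\perp], and that it depends only on [y]: this is [F_y(tau)].

    The same one-variable uniqueness gives the law of [theta] under [S] up to a
    constant, independent of [tau]. The relation [T S T S T = S] ties this
    constant, as well as the constants of the two Weil representations, to Gauss
    sums, and Gauss sums are multiplicative under gluing along [H]; hence
    [F |-> down_H (theta \otimes F)] intertwines [rho_D] and [rho_Delta] up to the
    automorphy factor. Uniqueness, modularity, smoothness and holomorphy of [F]
    then follow from the linear independence of the [theta_x]. *)

(** * Complex numbers and the exponential *)

(** Holomorphy is only the existence of a complex derivative, so the analysis rests on Taylor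
    expansions with quadratic remainder. In [z] the remainder is uniform on discs, by smoothness of
    [Phi]. Fourier coefficients become Riemann sums with [N = 2 n + 1] nodes: inversion is then
    exact, and translating the line of summation costs [O(1/N)]. That the inversion constant does
    not depend on tau comes from a rescaling: splitting by residues mod [N] shows that the square of
    the scalar relating both sides, divided by tau, is invariant under [tau -> tau / N^2]. Its
    derivative is therefore zero, and connectedness of the half-plane fixes the branch of the root.
    Read at the zero component, [T S T S T = S] gives [k^2 G = k] for each of the three constants
    [k] and the corresponding Gauss sum [G]; since [k] is nonzero, it is the inverse of [G]. The
    coefficients [g_(b,x)(tau)] are chosen pointwise in tau. Cramer's rule recovers their regularity
    from values at finitely many fixed points [z_j], and only then does the growth clause of
    [jacobi_form], which speaks of smooth families, apply to them. *)

Section Norm.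
Variable R : realType.
Implicit Types (z w : R[i]) (x y : R).

(* The norm of [R[i]] takes its values in [R[i]]; [nc] is the same norm with
   values in [R]. *)
Definition nc z : R := Num.sqrt (complex.Re z ^+ 2 + complex.Im z ^+ 2).

Lemma ncE z : `|z| = (nc z)%:C. Proof. exact: normc_def. Qed.
Lemma nc_ge0 z : 0 <= nc z. Proof. exact: sqrtr_ge0. Qed.
Lemma realC_inj : injective (fun x : R => x%:C). Proof. by move=> x y []. Qed.
Lemma ncM z w : nc (z * w) = nc z * nc w.
Proof. by apply: realC_inj; rewrite /= -ncE normrM !ncE -rmorphM. Qed.
Lemma ncD z w : nc (z + w) <= nc z + nc w.
Proof. by rewrite -lecR rmorphD /= -!ncE ler_normD. Qed.
Lemma ncN z : nc (- z) = nc z.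
Proof. by apply: realC_inj; rewrite /= -!ncE normrN. Qed.
Lemma ncB z w : nc (z - w) <= nc z + nc w.
Proof. by rewrite -[nc w]ncN ncD. Qed.
Lemma ncBC z w : nc (z - w) = nc (w - z).
Proof. by rewrite -opprB ncN. Qed.
Lemma nc_tri z w t : nc (z - w) <= nc (z - t) + nc (t - w).
Proof. by rewrite (le_trans _ (ncD _ _)) // addrA subrK. Qed.
Lemma nc0 : nc 0 = 0. Proof. by apply: realC_inj; rewrite /= -!ncE normr0. Qed.
Lemma nc1 : nc 1 = 1. Proof. by apply: realC_inj; rewrite /= -!ncE normr1. Qed.
Lemma nc_eq0 z : (nc z == 0) = (z == 0).
Proof. by rewrite -(inj_eq realC_inj) -ncE normr_eq0. Qed.
Lemma nc_gt0 z : (0 < nc z) = (z != 0).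
Proof. by rewrite lt_neqAle nc_ge0 andbT eq_sym nc_eq0. Qed.
Lemma ncV z : nc z^-1 = (nc z)^-1.
Proof. by apply: realC_inj; rewrite /= -ncE normfV ncE fmorphV. Qed.
Lemma ncX z n : nc (z ^+ n) = nc z ^+ n.
Proof. by elim: n => [|n IH]; rewrite ?expr0 ?nc1 // !exprS ncM IH. Qed.
Lemma nc_real x : nc x%:C = `|x|.
Proof. by rewrite /nc /= expr0n /= addr0 sqrtr_sqr. Qed.
Lemma nc_nat n : nc n%:R = n%:R.
Proof. by rewrite -(rmorph_nat (real_complex R)) nc_real ger0_norm. Qed.
Lemma nc_int (n : int) : nc n%:~R = `|n|%:~R.
Proof. by rewrite -(rmorph_int (real_complex R)) nc_real intr_norm. Qed.
Lemma nc_i : nc 'i = 1.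
Proof. by rewrite /nc /= expr0n /= add0r expr1n sqrtr1. Qed.
Lemma nc_Re z : `|complex.Re z| <= nc z.
Proof. by rewrite -sqrtr_sqr ler_wsqrtr // lerDl sqr_ge0. Qed.
Lemma nc_Im z : `|complex.Im z| <= nc z.
Proof. by rewrite -sqrtr_sqr ler_wsqrtr // lerDr sqr_ge0. Qed.
Lemma nc_le z : nc z <= `|complex.Re z| + `|complex.Im z|.
Proof.
rewrite -[leRHS]ger0_norm ?addr_ge0 // -sqrtr_sqr ler_wsqrtr //.
by rewrite sqrrD !real_normK ?num_real // lerD2r lerDl mulrn_wge0 // mulr_ge0.
Qed.
Lemma nc_sum I (s : seq I) (F : I -> R[i]) :
  nc (\sum_(i <- s) F i) <= \sum_(i <- s) nc (F i).
Proof.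
elim: s => [|i s IH]; rewrite ?big_nil ?nc0 // !big_cons.
by rewrite (le_trans (ncD _ _)) // lerD2l.
Qed.
Lemma nc_eqP z w : (forall e : R, 0 < e -> nc (z - w) <= e) -> z = w.
Proof.
move=> h; apply/eqP; rewrite -subr_eq0 -nc_eq0 eq_le nc_ge0 andbT.
by apply/ler_addgt0Pl => e e0; rewrite addr0 h.
Qed.
Lemma nc_prod I (s : seq I) (F : I -> R[i]) :
  nc (\prod_(i <- s) F i) = \prod_(i <- s) nc (F i).
Proof. by elim: s => [|i s IH]; rewrite ?big_nil ?nc1 // !big_cons ncM IH. Qed.
Lemma ReM z w : complex.Re (z * w) = complex.Re z * complex.Re w - complex.Im z * complex.Im w.
Proof. by case: z w => a b [c d]. Qed.
Lemma ImM z w : complex.Im (z * w) = complex.Re z * complex.Im w + complex.Im z * complex.Re w.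
Proof. by case: z w => a b [c d]. Qed.
Lemma ReD z w : complex.Re (z + w) = complex.Re z + complex.Re w.
Proof. by case: z w => a b [c d]. Qed.
Lemma ImD z w : complex.Im (z + w) = complex.Im z + complex.Im w.
Proof. by case: z w => a b [c d]. Qed.
Lemma ReB z w : complex.Re (z - w) = complex.Re z - complex.Re w.
Proof. by case: z w => a b [c d]. Qed.
Lemma ImB z w : complex.Im (z - w) = complex.Im z - complex.Im w.
Proof. by case: z w => a b [c d]. Qed.
Lemma ratrC (x : rat) : ratr x = (ratr x)%:C :> R[i].
Proof. by rewrite /ratr rmorphM fmorphV !rmorph_int. Qed.
Lemma cP z w : complex.Re z = complex.Re w -> complex.Im z = complex.Im w -> z = w.
Proof. by case: z w => a b [c d] /= -> ->. Qed.
End Norm.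

Section Exponential.
Variable R : realType.
Implicit Types (z w : R[i]) (x y : R).
Local Notation ee := (@ee R).
Local Notation pi := (@trigo.pi R).

Lemma eeD z w : ee (z + w) = ee z * ee w.
Proof.
rewrite /ee mulrACA -rmorphM /= -expRD !raddfD /= !mulrDr opprD; congr (_ * _).
by rewrite cosD sinD; apply: cP; rewrite /=; ring.
Qed.
Lemma ee0 : ee 0 = 1.
Proof. by rewrite /ee /= !mulr0 oppr0 expR0 cos0 sin0; apply: cP => /=; ring. Qed.
Lemma ee_neq0 z : ee z != 0.
Proof.
apply/eqP => h; have := eeD z (- z); rewrite h mul0r subrr ee0 => /eqP.
by rewrite oner_eq0.
Qed.
Lemma eeN z : ee (- z) = (ee z)^-1.
Proof.
by apply: (mulfI (ee_neq0 z)); rewrite -eeD subrr ee0 divff ?ee_neq0.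
Qed.
Lemma eeB z w : ee (z - w) = ee z / ee w. Proof. by rewrite eeD eeN. Qed.
Lemma ee1 : ee 1 = 1.
Proof.
rewrite /ee /= mulr0 oppr0 expR0 mulr1 mulr_natl cos2pi sin2pi.
by apply: cP => /=; ring.
Qed.
Lemma ee_natM z n : ee (z * n%:R) = ee z ^+ n.
Proof.
elim: n => [|n IH]; first by rewrite mulr0 ee0.
by rewrite -natr1 mulrDr mulr1 eeD IH exprSr.
Qed.
Lemma ee_nat n : ee n%:R = 1.
Proof. by rewrite -[n%:R]mul1r ee_natM ee1 expr1n. Qed.
Lemma ee_int (n : int) : ee n%:~R = 1.
Proof. by case: n => n; rewrite ?NegzE ?rmorphN /= ?eeN -?pmulrn ?ee_nat ?invr1. Qed.
Lemma ee_intq (x : rat) : x \is a Num.int -> ee (ratr x) = 1.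
Proof. by move=> /intrP[n ->]; rewrite ratr_int ee_int. Qed.
Lemma nc_ee z : nc (ee z) = expR (- (2 * pi * complex.Im z)).
Proof.
rewrite /ee ncM nc_real ger0_norm ?expR_ge0 // [X in _ * X](_ : _ = 1) ?mulr1 //.
by rewrite /nc /= cos2Dsin2 sqrtr1.
Qed.
Lemma nc_ee_real x : nc (ee x%:C) = 1.
Proof. by rewrite nc_ee /= mulr0 oppr0 expR0. Qed.

(** Only the real part is used: [cos (2 pi x) = 1] forces [sin (pi x) = 0], and [sin] is positive
    strictly between 0 and [pi]. *)
Lemma ee_eq1_real x : 0 <= x < 1 -> ee x%:C = 1 -> x = 0.
Proof.
move=> /andP[x0 x1]; rewrite /ee /= mulr0 oppr0 expR0 => -[].
rewrite !mul1r ?mul0r ?subr0 => c1 _.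
have pi0 := pi_gt0 R.
have s0 : sin (pi * x) = 0.
  apply/eqP; rewrite -sqrf_eq0.
  move: c1; rewrite -mulrA mulr_natl cos_mulr2n cos2sin2 => h.
  by apply/eqP; lra.
apply/eqP; rewrite eq_le x0 andbT leNgt; apply/negP => xp.
have : 0 < sin (pi * x).
  apply: sin_gt0_pi; rewrite mulr_gt0 //=.
  by rewrite -[ltRHS]mulr1 ltr_pM2l.
by rewrite s0 ltxx.
Qed.

Lemma eQZ_toQZ (x : rat) : eQZ R (toQZ x) = ee (ratr x).
Proof.
rewrite /eQZ.
have : toQZ (repr (toQZ x)) = toQZ x by rewrite /toQZ reprK.
by move=> /eq_toQZ h; rewrite -[repr (toQZ x)](subrK x) rmorphD /= eeD (ee_intq h) mul1r.
Qed.
Lemma toQZ_repr (x : QZ) : toQZ (repr x) = x. Proof. by rewrite /toQZ reprK. Qed.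
Lemma eQZD (x y : QZ) : eQZ R (x + y) = eQZ R x * eQZ R y.
Proof.
by rewrite -(toQZ_repr x) -(toQZ_repr y) -raddfD !eQZ_toQZ rmorphD eeD.
Qed.
Lemma eQZ0 : eQZ R 0 = 1.
Proof. by rewrite -[0](raddf0 toQZ) eQZ_toQZ rmorph0 ee0. Qed.
Lemma eQZ_neq0 (x : QZ) : eQZ R x != 0. Proof. exact: ee_neq0. Qed.
Lemma eQZN (x : QZ) : eQZ R (- x) = (eQZ R x)^-1.
Proof.
by apply: (mulfI (eQZ_neq0 x)); rewrite -eQZD subrr eQZ0 divff ?eQZ_neq0.
Qed.
(** Comparing coefficients yields equalities of roots of unity; this faithfulness turns them back
    into orthogonality relations in Q/Z. *)
Lemma eQZ_eq1 (x : QZ) : eQZ R x = 1 -> x = 0.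
Proof.
rewrite -(toQZ_repr x) eQZ_toQZ; move: (repr x) => r h.
apply/eqP; rewrite toQZ_eq0.
pose f := r - (Num.floor r)%:~R.
have hf : ee (ratr f) = 1.
  by rewrite rmorphB /= ratr_int eeB h ee_int divr1.
have : (ratr f : R) = 0.
  apply: ee_eq1_real; last by rewrite -ratrC.
  rewrite ler0q subr_ge0 floor_le /=.
  rewrite -[ltRHS](ratr_int R 1) ltr_rat /f.
  by rewrite ltrBlDr addrC -intrD floorD1_gt.
move=> /eqP; rewrite fmorph_eq0 subr_eq0 => /eqP ->; exact: intr_int.
Qed.

Lemma mvt_bound (f df : R -> R) (a b M : R) : a <= b ->
  (forall x, is_derive x 1 f (df x)) ->
  (forall x, a <= x <= b -> `|df x| <= M) -> `|f b - f a| <= M * (b - a).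
Proof.
move=> ab h hM.
have cf : ({within `[a, b], continuous f})%classic.
  apply: continuous_subspaceT => x; apply: differentiable_continuous.
  by apply/derivable1_diffP; have [] := h x.
have [c cab ->] := MVT_segment ab (fun x _ => h x) cf.
rewrite normrM (ger0_norm (x := b - a)) ?subr_ge0 // ler_wpM2r ?subr_ge0 //.
by apply: hM; move: cab; rewrite in_itv.
Qed.

(** Real and imaginary parts of [exp (t (a + i b))] as functions of a real variable, so that the
    mean value theorem on [[0, 1]] yields the complex Taylor bounds. *)
Definition cexp (a b t : R) : R := expR (t * a) * cos (t * b).
Definition sexp (a b t : R) : R := expR (t * a) * sin (t * b).

Lemma is_derive_linear (a t : R) : is_derive t (1 : R) ( *%R^~ a : R -> R) a.
Proof.
have h := is_deriveM (is_derive_id t 1) (is_derive_cst a t 1).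
by apply: (is_derive_eq h); rewrite /GRing.scale /= mulr0 add0r mulr1.
Qed.

Lemma is_derive_cexp (a b t : R) :
  is_derive t (1 : R) (cexp a b) (a * cexp a b t - b * sexp a b t).
Proof.
have h1 := @is_derive1_comp R _ ( *%R^~ a) t _ _ (is_derive_expR (t * a)) (is_derive_linear a t).
have h2 := @is_derive1_comp R _ ( *%R^~ b) t _ _ (is_derive_cos (t * b)) (is_derive_linear b t).
have h := is_deriveM h1 h2.
by apply: (is_derive_eq h); rewrite /cexp /sexp /GRing.scale /=; ring.
Qed.

Lemma is_derive_sexp (a b t : R) :
  is_derive t (1 : R) (sexp a b) (a * sexp a b t + b * cexp a b t).
Proof.
have h1 := @is_derive1_comp R _ ( *%R^~ a) t _ _ (is_derive_expR (t * a)) (is_derive_linear a t).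
have h2 := @is_derive1_comp R _ ( *%R^~ b) t _ _ (is_derive_sin (t * b)) (is_derive_linear b t).
have h := is_deriveM h1 h2.
by apply: (is_derive_eq h); rewrite /cexp /sexp /GRing.scale /=; ring.
Qed.

Lemma cexp0 a b : cexp a b 0 = 1. Proof. by rewrite /cexp !mul0r expR0 cos0 mulr1. Qed.
Lemma sexp0 a b : sexp a b 0 = 0. Proof. by rewrite /sexp !mul0r expR0 sin0 mulr0. Qed.

Lemma expR_bound01 (a t : R) : 0 <= t <= 1 -> expR (t * a) <= expR `|a|.
Proof.
move=> /andP[t0 t1]; rewrite ler_expR (le_trans (ler_norm _)) // normrM.
by rewrite (ger0_norm t0) ler_piMl.
Qed.
Lemma cexp_bound (a b t : R) : 0 <= t <= 1 -> `|cexp a b t| <= expR `|a|.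
Proof.
move=> h; rewrite normrM (ger0_norm (expR_ge0 _)).
rewrite (le_trans _ (expR_bound01 a h)) // ler_piMr ?expR_ge0 //; exact: cos_max.
Qed.
Lemma sexp_bound (a b t : R) : 0 <= t <= 1 -> `|sexp a b t| <= expR `|a|.
Proof.
move=> h; rewrite normrM (ger0_norm (expR_ge0 _)).
rewrite (le_trans _ (expR_bound01 a h)) // ler_piMr ?expR_ge0 //; exact: sin_max.
Qed.

Lemma lin_comb_bound (a b x y M : R) : `|x| <= M -> `|y| <= M ->
  `|a * x + b * y| <= (`|a| + `|b|) * M.
Proof.
move=> hx hy; rewrite (le_trans (ler_normD _ _)) // !normrM mulrDl.
by rewrite lerD // ler_wpM2l.
Qed.

Lemma exp_bound1 (a b t : R) (M := (`|a| + `|b|) * expR `|a|) : 0 <= t <= 1 ->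
  `|cexp a b t - 1| <= M /\ `|sexp a b t| <= M.
Proof.
move=> /andP[t0 t1].
have M0 : 0 <= M by rewrite mulr_ge0 ?expR_ge0 ?addr_ge0.
have le1 x : 0 <= x <= t -> 0 <= x <= 1.
  by move=> /andP[-> /le_trans]; apply.
split.
  rewrite -(cexp0 a b) (le_trans (mvt_bound (M := M) t0 (is_derive_cexp a b) _)) //.
    move=> x /le1 hx; rewrite -mulNr (le_trans (lin_comb_bound _ _ (cexp_bound _ _ hx) (sexp_bound _ _ hx))) //.
    by rewrite normrN.
  by rewrite subr0 ler_piMr.
rewrite -[sexp a b t]subr0 -[X in _ - X](sexp0 a b).
rewrite (le_trans (mvt_bound (M := M) t0 (is_derive_sexp a b) _)) //.
  by move=> x /le1 hx; rewrite lin_comb_bound ?cexp_bound ?sexp_bound.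
by rewrite subr0 ler_piMr.
Qed.

Lemma exp_bound2 (a b : R) (M := (`|a| + `|b|) ^+ 2 * expR `|a|) :
  `|cexp a b 1 - 1 - a| <= M /\ `|sexp a b 1 - b| <= M.
Proof.
split.
  have hd t : is_derive t (1 : R) (cexp a b - *%R^~ a)
      (a * (cexp a b t - 1) + (- b) * sexp a b t).
    apply: (is_derive_eq (is_deriveB (is_derive_cexp a b t) (is_derive_linear a t))).
    by ring.
  have := mvt_bound (M := M) ler01 hd; rewrite !fctE cexp0 mul1r mul0r subr0 mulr1.
  rewrite addrAC; apply=> x /(exp_bound1 a b) [h1 h2].
  rewrite (le_trans (lin_comb_bound _ _ h1 h2)) //.
  by rewrite normrN mulrA -expr2.
have hd t : is_derive t (1 : R) (sexp a b - *%R^~ b)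
    (a * sexp a b t + b * (cexp a b t - 1)).
  apply: (is_derive_eq (is_deriveB (is_derive_sexp a b t) (is_derive_linear b t))).
  by ring.
have := mvt_bound (M := M) ler01 hd; rewrite !fctE sexp0 mul1r mul0r !subr0 mulr1.
apply=> x /(exp_bound1 a b) [h1 h2].
rewrite (le_trans (lin_comb_bound _ _ h2 h1)) //.
by rewrite mulrA -expr2.
Qed.

Lemma ReC_ee z : complex.Re (ee z) = cexp (- (2 * pi * complex.Im z)) (2 * pi * complex.Re z) 1.
Proof. by rewrite /ee /cexp /= !mul1r; ring. Qed.
Lemma ImC_ee z : complex.Im (ee z) = sexp (- (2 * pi * complex.Im z)) (2 * pi * complex.Re z) 1.
Proof. by rewrite /ee /sexp /= !mul1r; ring. Qed.

Definition twopii : R[i] := (2 * pi)%:C * 'i.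
Lemma nc_twopii : nc twopii = 2 * pi.
Proof. by rewrite ncM nc_i mulr1 nc_real ger0_norm // mulr_ge0 ?pi_ge0. Qed.
Lemma Re_twopii z : complex.Re (twopii * z) = - (2 * pi * complex.Im z).
Proof. by case: z => x y; rewrite /twopii /=; ring. Qed.
Lemma Im_twopii z : complex.Im (twopii * z) = 2 * pi * complex.Re z.
Proof. by case: z => x y; rewrite /twopii /=; ring. Qed.

(** The 8 is [2 * 4]: the real and the imaginary part each contribute [(|a| + |b|)^2 <= (2 u)^2]. *)
Lemma ee_bound2 z (u := 2 * pi * nc z) :
  nc (ee z - 1 - twopii * z) <= 8 * u ^+ 2 * expR u.
Proof.
have pi0 : 0 <= 2 * pi by rewrite mulr_ge0 ?pi_ge0.
have [h1 h2] := exp_bound2 (- (2 * pi * complex.Im z)) (2 * pi * complex.Re z).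
rewrite (le_trans (nc_le _)) // 2!ReB 2!ImB.
rewrite Re_twopii Im_twopii ReC_ee ImC_ee /= subr0.
rewrite (le_trans (lerD h1 h2)) // -mulr2n -mulrnAl.
have ha : `|- (2 * pi * complex.Im z)| <= u.
  by rewrite normrN normrM (ger0_norm pi0) ler_wpM2l // nc_Im.
have hb : `|2 * pi * complex.Re z| <= u.
  by rewrite normrM (ger0_norm pi0) ler_wpM2l // nc_Re.
have u0 : 0 <= u by rewrite mulr_ge0 ?nc_ge0.
rewrite ler_pM ?ler_expR ?mulrn_wge0 ?sqr_ge0 ?expR_ge0 //.
move: (normr_ge0 (- (2 * pi * complex.Im z))) (normr_ge0 (2 * pi * complex.Re z)) ha hb.
move: `|_| `|_| => p q p0 q0 pu qu.
have : (p + q) ^+ 2 <= (u + u) ^+ 2 by rewrite lerXn2r ?nnegrE ?addr_ge0 ?lerD.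
have -> : (u + u) ^+ 2 = 4 * u ^+ 2 by ring.
by rewrite -mulr_natl [q + p]addrC; move: ((p + q) ^+ 2) (u ^+ 2) => w v; lra.
Qed.
End Exponential.

(** * Unconditional sums *)

Section Sums.
Variable R : realType.
Local Notation C := R[i].

(** Unconditional convergence, phrased with duplicate-free lists so that all estimates concern
    finite sums; [hs_sumE] links it to the sum in the definition of [theta]. *)
Definition hs (I : choiceType) (x : I -> C) (l : C) : Prop :=
  forall e : R, 0 < e -> exists A : seq I, forall B : seq I,
    uniq B -> {subset A <= B} -> nc (\sum_(i <- B) x i - l) <= e.

Definition csum (I : choiceType) (x : I -> C) : C := xget 0 [set l | hs x l]%classic.

Definition absb (I : choiceType) (x : I -> C) (W : R) : Prop :=
  forall A : seq I, uniq A -> \sum_(i <- A) nc (x i) <= W.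

Lemma sub_undup_catl (I : eqType) (A B : seq I) : {subset A <= undup (A ++ B)}.
Proof. by move=> i iA; rewrite mem_undup mem_cat iA. Qed.
Lemma sub_undup_catr (I : eqType) (A B : seq I) : {subset B <= undup (A ++ B)}.
Proof. by move=> i iA; rewrite mem_undup mem_cat iA orbT. Qed.

Lemma ler_sum_sub (I : eqType) (A B : seq I) (y : I -> R) :
  uniq A -> uniq B -> {subset A <= B} -> (forall i, 0 <= y i) ->
  \sum_(i <- A) y i <= \sum_(i <- B) y i.
Proof.
move=> uA uB sAB y0.
have pA : perm_eq A ([seq i <- B | i \in A]).
  apply: uniq_perm; rewrite ?filter_uniq // => i; rewrite mem_filter /=.
  by apply/idP/andP => [iA|[]//]; split=> //; exact: sAB.
rewrite (perm_big _ pA) big_filter big_mkcond; apply: ler_sum => i _.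
by case: ifP.
Qed.

Section Basic.
Variable I : choiceType.
Implicit Types (x y : I -> C) (l : C) (A B : seq I).

Lemma hs_unique x l l' : hs x l -> hs x l' -> l = l'.
Proof.
move=> h h'; apply: nc_eqP => e e0.
have e2 : 0 < e / 2 by rewrite divr_gt0.
have [A hA] := h _ e2; have [A' hA'] := h' _ e2.
rewrite (le_trans (nc_tri _ _ (\sum_(i <- undup (A ++ A')) x i))) //.
rewrite [leRHS]splitr lerD //.
  by rewrite ncBC hA ?undup_uniq //; exact: sub_undup_catl.
by rewrite hA' ?undup_uniq //; exact: sub_undup_catr.
Qed.

Lemma hs_csum x l : hs x l -> csum x = l.
Proof.
move=> h; apply: (hs_unique _ h).
by rewrite /csum; case: xgetP => [y -> //|/(_ l) []].
Qed.
Lemma hsP x l : hs x l -> hs x (csum x).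
Proof. by move=> h; rewrite (hs_csum h). Qed.

Lemma hs_ext x y l : x =1 y -> hs x l -> hs y l.
Proof. by move=> /funext ->. Qed.

Lemma hs0 : hs (fun _ : I => 0) 0.
Proof.
by move=> e e0; exists [::] => B _ _; rewrite big1 // subrr nc0 ltW.
Qed.

Lemma hs_delta (i0 : I) (a : C) : hs (fun i => if i == i0 then a else 0) a.
Proof.
move=> e e0; exists [:: i0] => B uB sB; have i0B : i0 \in B by apply: sB; rewrite inE.
rewrite (bigD1_seq i0) //= eqxx big1 ?addr0 ?subrr ?nc0 ?ltW // => i /negPf -> //.
Qed.

Lemma hsD x y l l' : hs x l -> hs y l' -> hs (fun i => x i + y i) (l + l').
Proof.
move=> h h' e e0; have e2 : 0 < e / 2 by rewrite divr_gt0.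
have [A hA] := h _ e2; have [A' hA'] := h' _ e2.
exists (A ++ A') => B uB sB; rewrite big_split /= opprD addrACA [leRHS]splitr.
rewrite (le_trans (ncD _ _)) // lerD //.
  by rewrite hA // => i iA; rewrite sB // mem_cat iA.
by rewrite hA' // => i iA; rewrite sB // mem_cat iA orbT.
Qed.

Lemma hsZ (c : C) x l : hs x l -> hs (fun i => c * x i) (c * l).
Proof.
move=> h e e0.
have c1 : 0 < nc c + 1 by rewrite ltr_wpDl ?nc_ge0.
have [A hA] := h (e / (nc c + 1)) (divr_gt0 e0 c1).
exists A => B uB sB; rewrite -big_distrr /= -mulrBr ncM.
rewrite (le_trans (ler_wpM2l (nc_ge0 _) (hA _ uB sB))) // mulrA ler_pdivrMr //.
by rewrite mulrC ler_wpM2l ?ltW // ltrDl.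
Qed.

Lemma hs_sum (J : Type) (s : seq J) (x : J -> I -> C) (l : J -> C) :
  (forall j, hs (x j) (l j)) ->
  hs (fun i => \sum_(j <- s) x j i) (\sum_(j <- s) l j).
Proof.
move=> h; elim: s => [|j s IH].
  by rewrite big_nil; apply: hs_ext hs0 => i; rewrite big_nil.
by rewrite big_cons; apply: hs_ext (hsD (h j) IH) => i; rewrite big_cons.
Qed.

Lemma hs_bound x l W : hs x l -> absb x W -> nc l <= W.
Proof.
move=> h hW; apply/ler_addgt0Pr => e e0; have [A hA] := h _ e0.
have uA := undup_uniq A.
have sA : {subset A <= undup A} by move=> i; rewrite mem_undup.
rewrite -[l](subKr (\sum_(i <- undup A) x i)) (le_trans (ncB _ _)) // lerD ?hA //.
exact: le_trans (nc_sum _ _) (hW _ uA).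
Qed.

Lemma absb_le x W y : (forall i, nc (y i) <= nc (x i)) -> absb x W -> absb y W.
Proof. by move=> h hW A uA; apply: le_trans (hW A uA); apply: ler_sum. Qed.

Lemma absb_dom x (w : I -> R) W : (forall i, nc (x i) <= w i) ->
  (forall A, uniq A -> \sum_(i <- A) w i <= W) -> absb x W.
Proof. by move=> h hW A uA; apply: le_trans (hW A uA); apply: ler_sum. Qed.

Lemma hs_nonneg (y : I -> R) W : (forall i, 0 <= y i) ->
  (forall A, uniq A -> \sum_(i <- A) y i <= W) ->
  exists l : R, hs (fun i => (y i)%:C) l%:C.
Proof.
move=> y0 hW.
pose E : set R := [set r | exists2 A, uniq A & r = \sum_(i <- A) y i]%classic.
have supE : has_sup E.
  split; first by exists (\sum_(i <- [::]) y i); exists [::].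
  by exists W => _ [A uA ->]; exact: hW.
exists (sup E) => e e0.
have [_ [A uA ->] hA] := sup_adherent e0 supE.
exists A => B uB sB; rewrite -rmorph_sum -rmorphB nc_real.
have ub : \sum_(i <- B) y i <= sup E.
  by apply: ub_le_sup; [case: supE | exists B].
rewrite ler0_norm ?subr_le0 // opprB lerBlDr -lerBlDl.
exact: le_trans (ltW hA) (ler_sum_sub uA uB sB y0).
Qed.

(** A real or imaginary part plus the norm is nonnegative, so that [hs_nonneg] applies; the sum of
    the norms is then subtracted. *)
Lemma hs_exists x W : absb x W -> exists l, hs x l.
Proof.
move=> hW.
have [ln hn] := hs_nonneg (fun i => nc_ge0 (x i)) hW.
have part (f : C -> R) : (forall z, `|f z| <= nc z) ->
    exists l, hs (fun i => (f (x i))%:C) l.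
  move=> hf.
  have [|A uA|l hl] := @hs_nonneg (fun i => f (x i) + nc (x i)) (W + W).
  - by move=> i; rewrite -lerBlDr sub0r; have := hf (x i); rewrite ler_norml => /andP[].
  - rewrite big_split /= lerD ?hW //; apply: le_trans (hW _ uA).
    by apply: ler_sum => i _; apply: le_trans (ler_norm _) (hf _).
  - exists (l%:C + (-1) * ln%:C).
    apply: hs_ext (hsD hl (hsZ (-1) hn)) => i /=.
    by rewrite rmorphD mulN1r addrK.
have [l1 h1] := part (@complex.Re R) (@nc_Re R).
have [l2 h2] := part (@complex.Im R) (@nc_Im R).
exists (l1 + 'i * l2); apply: hs_ext (hsD h1 (hsZ 'i h2)) => i.
by case: (x i) => a b; apply: cP => /=; ring.
Qed.

Lemma absb_hs x W : absb x W -> hs x (csum x).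
Proof. by move=> /hs_exists[l]; exact: hsP. Qed.

Lemma hs_sumE x l : hs x l -> @summability.sum I R[i] R[i]^o x = l.
Proof.
move=> h; rewrite /summability.sum.
have FF := @summability.totally_filter I.
apply: (@cvg_lim R[i]^o) => //.
apply/(@cvgrPdist_le R[i] R[i]^o _ _ (@filter_filter _ _ FF)) => e e0.
have [r r0 er] : exists2 r : R, 0 < r & e = r%:C.
  by case: e e0 => a b; rewrite ltcE /= => /andP[/eqP-> a0]; exists a.
have [A hA] := h r r0.
exists (finmap.seq_fset tt A) => // B sB; have {}sB : finmap.fsubset (finmap.seq_fset tt A) B := sB.
rewrite /= er distrC ncE lecR /summability.partial_sum.
rewrite -(finmap.big_seq_fsetE _ B predT x) /=.
apply: hA => [|i iA]; first exact: finmap.fset_uniq.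
by apply: (finmap.fsubsetP sB); rewrite finmap.seq_fsetE.
Qed.
End Basic.

(** Reindexing in which [k] and [h] need be mutually inverse only where the terms are nonzero. This
    lets a series over residue classes, or over classes modulo [ker S], be compared with one over
    all integer vectors. *)
Lemma hs_transport (I J : choiceType) (x : I -> C) (y : J -> C) (k : I -> J)
    (h : J -> I) l :
  (forall i, x i != 0 -> h (k i) = i /\ y (k i) = x i) ->
  (forall j, y j != 0 -> k (h j) = j /\ x (h j) = y j) ->
  hs y l -> hs x l.
Proof.
move=> hI hJ hy e e0; have [A hA] := hy _ e0.
exists (map h A) => B uB sB.
pose B' := [seq i <- B | x i != 0].
have uB' : uniq B' by rewrite filter_uniq.
have kinj : {in B' &, injective k}.
  move=> i i'; rewrite !mem_filter => /andP[/hI[e1 _] _] /andP[/hI[e2 _] _] ek.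
  by rewrite -e1 ek e2.
(* The second part only makes [Cs] contain [A]. It contributes zeros, because a nonzero [y j] with
   [j] in [A] would have [h j] in [B']. *)
pose Cs := map k B' ++ [seq j <- undup A | j \notin map k B'].
have uC : uniq Cs.
  rewrite cat_uniq map_inj_in_uniq // uB' /= filter_uniq ?undup_uniq // andbT.
  by apply/hasPn => j; rewrite mem_filter => /andP[].
have -> : \sum_(i <- B) x i = \sum_(j <- Cs) y j.
  rewrite big_cat /= [X in _ + X]big1_seq ?addr0.
    rewrite big_map big_filter [RHS]big_mkcond [LHS]big_mkcond /=.
    apply: eq_bigr => i _; case: ifPn => [/hI[] //|]; by rewrite negbK => /eqP.
  move=> j; rewrite mem_filter mem_undup => /andP[_ /andP[jn jA]].
  apply/eqP/negPn/negP => yj; have [kh xh] := hJ _ yj.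
  move/negP: jn; apply; apply/mapP; exists (h j); rewrite ?kh // mem_filter xh yj.
  by apply: sB; apply: map_f.
apply: hA => // j jA; rewrite mem_cat mem_filter mem_undup jA andbT.
by case: (j \in map k B').
Qed.

Lemma sqr_le4exp (t : R) : 0 <= t -> t ^+ 2 <= 4 * expR t.
Proof.
move=> t0; have := expR_ge1Dx (t / 2) => h.
have -> : expR t = expR (t / 2) ^+ 2 by rewrite expr2 -expRD -splitr.
by nra.
Qed.

(** * Termwise differentiation of dominated exponential series *)

Section ExpSeries.
Variables (I : choiceType) (x B : I -> C) (rho W : R).
Hypothesis rho0 : 0 < rho.
Hypothesis hW : forall A, uniq A ->
  \sum_(i <- A) nc (x i) * expR (2 * trigo.pi * rho * nc (B i)) <= W.

Let p2 : 0 <= 2 * trigo.pi :> R.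
Proof. by rewrite mulr_ge0 ?pi_ge0. Qed.

Lemma expser_deriv_absb : absb (fun i => twopii R * B i * x i) (W / rho).
Proof.
move=> A uA; rewrite ler_pdivlMr // mulrC mulr_sumr; apply: le_trans (hW uA).
apply: ler_sum => i _; rewrite 2!ncM nc_twopii mulrA [leLHS]mulrC ler_wpM2l ?nc_ge0 //.
have := expR_ge1Dx (2 * trigo.pi * rho * nc (B i)).
by rewrite (_ : rho * _ = 2 * trigo.pi * rho * nc (B i)); [lra|ring].
Qed.

Lemma expser_shift_absb (h : C) : nc h <= rho ->
  absb (fun i => x i * ee (h * B i)) W.
Proof.
move=> hh A uA; apply: le_trans (hW uA); apply: ler_sum => i _.
rewrite ncM ler_wpM2l ?nc_ge0 // nc_ee ler_expR -mulrN -!mulrA.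
rewrite !ler_wpM2l ?pi_ge0 // (le_trans (ler_norm _)) // normrN.
by rewrite (le_trans (nc_Im _)) // ncM ler_wpM2r ?nc_ge0.
Qed.

Lemma expser_absb : absb x W.
Proof.
have := @expser_shift_absb 0; rewrite nc0 => /(_ (ltW rho0)).
by apply: absb_le => i; rewrite mul0r ee0 mulr1.
Qed.

(** With [t = pi * rho * |B|] the weight in [hW] is [expR t * expR t]: one factor absorbs the
    exponential of [ee_bound2], the other absorbs [t^2 <= 4 expR t]. The remaining constant is
    [32 / rho^2], whence 128. *)
Lemma expser_diff (h l0 l1 lh : C) : nc h <= rho / 2 ->
  hs x l0 -> hs (fun i => twopii R * B i * x i) l1 ->
  hs (fun i => x i * ee (h * B i)) lh ->
  nc (lh - l0 - h * l1) <= 128 / rho ^+ 2 * W * nc h ^+ 2.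
Proof.
move=> hh h0 h1 h2.
have hd := hsD (hsD h2 (hsZ (-1) h0)) (hsZ (- h) h1).
have -> : lh - l0 - h * l1 = lh + (-1) * l0 + - h * l1 by ring.
apply: (hs_bound hd) => A uA.
have -> : 128 / rho ^+ 2 * W * nc h ^+ 2 = 128 / rho ^+ 2 * nc h ^+ 2 * W by ring.
apply: le_trans (ler_wpM2l _ (hW uA)); last first.
  by rewrite mulr_ge0 ?sqr_ge0 // divr_ge0 ?sqr_ge0.
rewrite mulr_sumr; apply: ler_sum => i _.
have -> : x i * ee (h * B i) + (-1) * x i + - h * (twopii R * B i * x i) =
  x i * (ee (h * B i) - 1 - twopii R * (h * B i)) by ring.
rewrite ncM [leRHS]mulrCA ler_wpM2l ?nc_ge0 //.
apply: le_trans (ee_bound2 _) _; rewrite ncM.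
set b := nc (B i); set H := nc h.
have b0 : 0 <= b by exact: nc_ge0.
have H0 : 0 <= H by exact: nc_ge0.
set t := trigo.pi * rho * b.
have t0 : 0 <= t by rewrite !mulr_ge0 ?pi_ge0 // ltW.
have ut : 2 * trigo.pi * (H * b) <= t.
  rewrite (_ : 2 * _ * _ = trigo.pi * (2 * H) * b); last by ring.
  by rewrite ler_wpM2r // ler_wpM2l ?pi_ge0 // -ler_pdivlMl // mulrC.
have -> : expR (2 * trigo.pi * rho * b) = expR t * expR t.
  by rewrite -expRD; congr expR; rewrite /t; ring.
rewrite [leRHS]mulrA ler_pM ?ler_expR ?expR_ge0 ?mulr_ge0 ?sqr_ge0 ?pi_ge0 //.
have -> : 8 * (2 * trigo.pi * (H * b)) ^+ 2 = 32 / rho ^+ 2 * H ^+ 2 * t ^+ 2.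
  by rewrite /t; field; rewrite gt_eqF.
have := sqr_le4exp t0.
have : 0 <= 32 / rho ^+ 2 * H ^+ 2 by rewrite mulr_ge0 ?divr_ge0 ?sqr_ge0.
have -> : 128 / rho ^+ 2 * H ^+ 2 * expR t = 32 / rho ^+ 2 * H ^+ 2 * (4 * expR t) by ring.
by move=> c0 ht; rewrite ler_wpM2l.
Qed.
End ExpSeries.

Definition win (n : nat) : seq int := [seq i%:Z - n%:Z | i <- iota 0 n.*2.+1].

Lemma win_uniq n : uniq (win n).
Proof. by rewrite map_inj_uniq ?iota_uniq // => i j /addIr []. Qed.
Lemma mem_win n (k : int) : (k \in win n) = (`|k| <= n)%N.
Proof.
apply/mapP/idP => [hk|kn].
  by case: hk => j; rewrite mem_iota add0n => /andP[_ hj] ->; lia.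
exists (absz (k + n%:Z)); last by lia.
by rewrite mem_iota; lia.
Qed.
Lemma big_win n (F : int -> C) :
  \sum_(k <- win n) F k = \sum_(i < n.*2.+1) F (i%:Z - n%:Z).
Proof. by rewrite /win big_map -[iota _ _]/(index_iota 0 n.*2.+1) big_mkord. Qed.

Lemma hs_win (x : int -> C) l : hs x l -> forall e : R, 0 < e ->
  exists n0, forall n, (n0 <= n)%N -> nc (\sum_(k <- win n) x k - l) <= e.
Proof.
move=> h e e0; have [A hA] := h _ e0.
exists (\max_(k <- A) `|k|)%N => n hn; apply: hA (win_uniq _) _ => k kA.
by rewrite mem_win (leq_trans (@leq_bigmax_seq _ A predT absz k kA isT)).
Qed.

Lemma geo_half n : \sum_(j < n) (2^-1 : R) ^+ j <= 2.
Proof.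
have -> : \sum_(j < n) (2^-1 : R) ^+ j = 2 - 2 * 2^-1 ^+ n.
  elim: n => [|n IH]; first by rewrite big_ord0 expr0; ring.
  by rewrite big_ord_recr /= IH exprS; field.
by rewrite lerBlDr lerDl mulr_ge0 ?exprn_ge0.
Qed.

Lemma geo_int (A : seq int) : uniq A -> \sum_(k <- A) (2^-1 : R) ^+ `|k|%N <= 4.
Proof.
move=> uA; pose n := (\max_(k <- A) `|k|)%N.
have sA : {subset A <= win n}.
  by move=> k kA; rewrite mem_win (@leq_bigmax_seq _ A predT absz k kA isT).
apply: le_trans (ler_sum_sub uA (win_uniq n) sA _) _ => [k|]; first exact: exprn_ge0.
rewrite /win big_map -[iota _ _]/(index_iota 0 n.*2.+1) (big_cat_nat _ (n := n)) //=; last by lia.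
have -> : 4 = 2 + 2 :> R by ring.
rewrite lerD //.
  rewrite big_mkord (reindex_inj rev_ord_inj) /=.
  apply: le_trans (geo_half n); apply: ler_sum => i _.
  have -> : `|(n - i.+1)%N%:Z - n%:Z|%N = i.+1 by have := ltn_ord i; lia.
  by rewrite ler_wiXn2l // invf_le1 // ler1n.
rewrite -{1}[n]add0n big_addn big_mkord.
have -> : (n.*2.+1 - n = n.+1)%N by lia.
apply: le_trans (geo_half n.+1); apply: ler_sum => i _.
by have -> : `|(i + n)%N%:Z - n%:Z|%N = i by lia.
Qed.

Lemma pow_le_exp (t : R) p : 0 <= t -> t ^+ p <= p%:R ^+ p * expR t.
Proof.
move=> t0; case: p => [|p]; first by rewrite !expr0 mul1r -expR0 ler_expR.
have := expR_ge1Dx (t / p.+1%:R) => h.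
have -> : t = t / p.+1%:R * p.+1%:R by rewrite divfK // pnatr_eq0.
rewrite mulrC exprMn ler_wpM2l ?exprn_ge0 ?ler0n // expRM_natl.
rewrite lerXn2r ?nnegrE ?divr_ge0 ?ler0n ?expR_ge0 //.
by rewrite (le_trans _ h) // lerDr.
Qed.

(** Completing the square: the linear coefficient [be + 3] collects [be], then 1 from
    [n^p <= p^p expR n] and 2 from [4^n <= expR (2 n)]. *)
Lemma gauss_bound (al be : R) p : 0 < al -> exists2 K : R, 0 <= K & forall k : int,
  (`|k|%N%:R) ^+ p * expR (- al * (`|k|%N%:R) ^+ 2 + be * `|k|%N%:R)
    <= K * (4^-1) ^+ `|k|%N.
Proof.
move=> al0; exists (p%:R ^+ p * expR ((be + 3) ^+ 2 / (4 * al))).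
  by rewrite mulr_ge0 ?exprn_ge0 ?ler0n ?expR_ge0.
move=> k; move: `|k|%N => n; rewrite exprVn ler_pdivlMr ?exprn_gt0 //.
have e4 : (4 : R) ^+ n <= expR (2 * n%:R).
  rewrite mulrC expRM_natl lerXn2r ?nnegrE ?expR_ge0 //.
  have -> : (2 : R) = 1 + 1 by ring.
  by rewrite expRD; have := expR_ge1Dx (1 : R); nra.
have hp := pow_le_exp p (ler0n R n).
set E := expR (- al * _ + _).
apply: (@le_trans _ _ (p%:R ^+ p * expR n%:R * E * expR (2 * n%:R))).
  rewrite ler_pM ?mulr_ge0 ?exprn_ge0 ?expR_ge0 ?ler0n //.
  by rewrite ler_wpM2r ?expR_ge0.
rewrite -2!mulrA ler_wpM2l ?exprn_ge0 ?ler0n // /E -!expRD ler_expR.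
rewrite -subr_ge0.
have -> : (be + 3) ^+ 2 / (4 * al) - (n%:R + (- al * n%:R ^+ 2 + be * n%:R + 2 * n%:R))
  = al * (n%:R - (be + 3) / (2 * al)) ^+ 2 by field; rewrite gt_eqF.
by rewrite mulr_ge0 ?sqr_ge0 ?ltW.
Qed.

(** The decay [4^-n] is kept so that one factor [2^-n] can be summed while the other remains as
    smallness, as in [th_nonzero]. *)
Lemma quarter_half n : (4^-1 : R) ^+ n = 2^-1 ^+ n * 2^-1 ^+ n.
Proof. by rewrite -exprMn; congr (_ ^+ n); field. Qed.
Lemma quarter_le n : (4^-1 : R) ^+ n <= 2^-1 ^+ n.
Proof.
rewrite quarter_half ler_piMr ?exprn_ge0 // exprn_ile1 //.
by rewrite invf_le1 // ler1n.
Qed.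

Lemma absb_half (x : int -> C) (K : R) : 0 <= K ->
  (forall k, nc (x k) <= K * 2^-1 ^+ `|k|%N) -> absb x (K * 4).
Proof.
move=> K0 h; apply: absb_dom h _ => A uA.
by rewrite -mulr_sumr ler_wpM2l // geo_int.
Qed.

Section Box.
Variable c : nat.
Implicit Types (m : {ffun 'I_c -> int}).
Definition box n : seq {ffun 'I_c -> int} :=
  [seq [ffun i => (f i)%:Z - n%:Z] | f : {ffun 'I_c -> 'I_(n.*2.+1)}].
Lemma box_uniq n : uniq (box n).
Proof.
rewrite map_inj_uniq ?enum_uniq // => f g /ffunP h; apply/ffunP => i.
by apply/val_inj; have := h i; rewrite !ffunE => /addIr [].
Qed.
Lemma mem_box n m : (forall i, `|m i| <= n)%N -> m \in box n.
Proof.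
move=> h; apply/mapP; exists [ffun i => inord (absz (m i + n%:Z))]; rewrite ?mem_enum //.
apply/ffunP => i; have := h i; rewrite !ffunE; move: (m i) => k hk.
by rewrite inordK; lia.
Qed.
Lemma big_box (T : comNzSemiRingType) n (F : 'I_c -> int -> T) :
  \sum_(m <- box n) \prod_i F i (m i) = \prod_i \sum_(k <- win n) F i k.
Proof.
rewrite big_map big_enum /=.
transitivity (\sum_(f : {ffun 'I_c -> 'I_(n.*2.+1)}) \prod_i F i ((f i)%:Z - n%:Z)).
  by apply: eq_bigr => f _; apply: eq_bigr => i _; rewrite ffunE.
rewrite -(bigA_distr_bigA (fun i (j : 'I_(n.*2.+1)) => F i (j%:Z - n%:Z))) /=.
apply: eq_bigr => i _; by rewrite /win big_map -[iota _ _]/(index_iota 0 n.*2.+1) big_mkord.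
Qed.
Lemma sub_box (A : seq {ffun 'I_c -> int}) : exists n, forall n', (n <= n')%N -> {subset A <= box n'}.
Proof.
exists (\max_(m <- A) \max_i `|m i|)%N => n hn m mA; apply: mem_box => i.
apply: leq_trans hn; apply: leq_trans (@leq_bigmax_seq _ A predT (fun m : {ffun 'I_c -> int} => \max_i `|m i|)%N m mA isT).
exact: (leq_bigmax i).
Qed.

Lemma box_half (A : seq {ffun 'I_c -> int}) : uniq A ->
  \sum_(m <- A) \prod_i (2^-1 : R) ^+ `|m i|%N <= 4 ^+ c.
Proof.
move=> uA; have [n /(_ n (leqnn n)) sA] := sub_box A.
apply: le_trans (ler_sum_sub uA (box_uniq n) sA _) _.
  by move=> m; apply: prodr_ge0 => i _; exact: exprn_ge0.
rewrite (big_box n (fun _ k => 2^-1 ^+ `|k|%N)) prodr_const card_ord.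
by rewrite lerXn2r ?nnegrE ?geo_int ?win_uniq // sumr_ge0.
Qed.

Lemma prodr_cvg (x : nat -> 'I_c -> C) (l : 'I_c -> C) :
  (forall i e, 0 < e -> exists n0, forall n, (n0 <= n)%N -> nc (x n i - l i) <= e) ->
  forall e, 0 < e -> exists n0, forall n, (n0 <= n)%N ->
    nc (\prod_i x n i - \prod_i l i) <= e.
Proof.
move=> h; rewrite /index_enum; elim: (Finite.enum _) => [|i s IH] e e0.
  by exists 0%N => n _; rewrite !big_nil subrr nc0 ltW.
set L := nc (\prod_(j <- s) l j); set L1 := nc (l i).
have L0 : 0 <= L by exact: nc_ge0.
have L10 : 0 <= L1 by exact: nc_ge0.
pose d := Num.min 1 (e / (L + L1 + 1)).
have D0 : 0 < L + L1 + 1 by rewrite ltr_wpDl // addr_ge0.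
have d0 : 0 < d by rewrite lt_min ltr01 divr_gt0.
have [n1 h1] := h i _ d0; have [n2 h2] := IH _ d0.
exists (maxn n1 n2) => n; rewrite geq_max => /andP[/h1 g1 /h2 g2].
rewrite !big_cons.
set X := \prod_(j <- s) x n j in g2 *; set Y := \prod_(j <- s) l j in g2 *.
have -> : x n i * X - l i * Y = (x n i - l i) * (X - Y) + (x n i - l i) * Y + l i * (X - Y).
  by ring.
rewrite (le_trans (ncD _ _)) // (le_trans (lerD (ncD _ _) (lexx _))) // !ncM.
have d1 : d <= 1 by rewrite ge_min lexx.
have dE : d * (L + L1 + 1) <= e by rewrite -ler_pdivlMr // ge_min lexx orbT.
apply: le_trans dE.
have a0 := nc_ge0 (x n i - l i); have b0 := nc_ge0 (X - Y).
rewrite -/L1 -/Y -/L.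
have : nc (x n i - l i) * nc (X - Y) <= d * 1 by rewrite ler_pM // (le_trans g2).
have : nc (x n i - l i) * L <= d * L by rewrite ler_wpM2r.
have : L1 * nc (X - Y) <= L1 * d by rewrite ler_wpM2l.
lra.
Qed.

(** Domination gives some limit [L] along all finite sets. On the cubes [box n] the sum factors into
    one-variable sums, which identifies [L]. *)
Lemma hs_prod (x : 'I_c -> int -> C) (l : 'I_c -> C) (K : R) : 0 <= K ->
  (forall i k, nc (x i k) <= K * 2^-1 ^+ `|k|%N) -> (forall i, hs (x i) (l i)) ->
  absb (fun m : {ffun 'I_c -> int} => \prod_i x i (m i)) (K ^+ c * 4 ^+ c) /\
  hs (fun m : {ffun 'I_c -> int} => \prod_i x i (m i)) (\prod_i l i).
Proof.
move=> K0 hK hl.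
have hb : absb (fun m : {ffun 'I_c -> int} => \prod_i x i (m i)) (K ^+ c * 4 ^+ c).
  apply: (@absb_dom _ _ (fun m => K ^+ c * \prod_i (2^-1 : R) ^+ `|m i|%N)) => [m|A uA].
    rewrite nc_prod -[c in K ^+ c]card_ord -prodr_const -big_split /=.
    by apply: ler_prod => i _; rewrite nc_ge0 hK.
  by rewrite -mulr_sumr ler_wpM2l ?exprn_ge0 // box_half.
split=> //; have [L hL] := hs_exists hb.
suff -> : \prod_i l i = L by [].
apply: nc_eqP => e e0; have e2 : 0 < e / 2 by rewrite divr_gt0.
have [A hA] := hL _ e2; have [n1 hn1] := sub_box A.
have [n2 hn2] := prodr_cvg (x := fun n i => \sum_(k <- win n) x i k) (fun i => hs_win (hl i)) e2.
pose n := maxn n1 n2.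
have := hA _ (box_uniq n) (hn1 _ (leq_maxl n1 n2)).
have := hn2 _ (leq_maxr n1 n2); rewrite -/n big_box => g1 g2.
rewrite (le_trans (nc_tri _ _ (\prod_i \sum_(k <- win n) x i k))) // [leRHS]splitr.
by rewrite lerD // ncBC.
Qed.
End Box.
End Sums.

(** * Theta series in one variable *)

Section Theta1.
Variable R : realType.
Local Notation C := R[i].
Local Notation ee := (@ee R).
Local Notation pi := (@trigo.pi R).
Local Notation ImC := (@complex.Im R).

Lemma ee_rat_eq1 (x : rat) : ee (ratr x) = 1 -> x \is a Num.int.
Proof. by rewrite -eQZ_toQZ => /eQZ_eq1/eqP; rewrite toQZ_eq0. Qed.

Lemma natC_neq0 n : (0 < n)%N -> n%:R != 0 :> C.
Proof. by rewrite pnatr_eq0 -lt0n. Qed.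

Lemma root_sum N (k : int) : (0 < N)%N ->
  \sum_(j < N) ee (k%:~R * j%:R / N%:R) = if (N%:Z %| k)%Z then N%:R else 0.
Proof.
move=> N0; have Nz := natC_neq0 N0; set z := ee (k%:~R / N%:R).
have -> : \sum_(j < N) ee (k%:~R * j%:R / N%:R) = \sum_(j < N) z ^+ j.
  by apply: eq_bigr => j _; rewrite -ee_natM; congr ee; ring.
case: ifPn => hk.
  have z1 : z = 1 by move/dvdzP: hk => [m hm]; rewrite /z hm rmorphM /= -pmulrn mulfK // ee_int.
  under eq_bigr do rewrite z1 expr1n.
  by rewrite sumr_const card_ord.
have zn1 : z - 1 != 0.
  rewrite subr_eq0; apply/eqP => z1; move/negP: hk; apply.
  have : (k%:~R / N%:R : rat) \is a Num.int.
    by apply: ee_rat_eq1; rewrite fmorph_div /= ratr_int ratr_nat.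
  move=> /intrP[m hm]; apply/dvdzP; exists m.
  apply/(@intr_inj rat); rewrite rmorphM /= -hm -pmulrn divfK //.
  by rewrite pnatr_eq0 -lt0n.
apply: (mulfI zn1); rewrite mulr0 -subrX1 /z -ee_natM divfK // ee_int subrr //.
Qed.

Definition qe (A B : C) (k : int) : C := ee (A * k%:~R ^+ 2 + B * k%:~R).

Lemma nc_qe A B k : nc (qe A B k) <=
  expR (- (2 * pi * ImC A) * `|k|%N%:R ^+ 2 + 2 * pi * nc B * `|k|%N%:R).
Proof.
have p2 : 0 <= 2 * pi by rewrite mulr_ge0 ?pi_ge0.
rewrite nc_ee ler_expR ImD.
have -> : complex.Im (A * k%:~R ^+ 2) = ImC A * `|k|%N%:R ^+ 2.
  rewrite intC -rmorphXn ImM /= mulr0 add0r.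
  by rewrite natr_absz intr_norm real_normK // num_real.
have -> : complex.Im (B * k%:~R) = ImC B * k%:~R by rewrite intC ImM /= mulr0 add0r.
rewrite mulrDr opprD mulrA mulNr lerD2l // -mulrN -!mulrA ler_wpM2l //.
rewrite ler_wpM2l ?pi_ge0 //.
rewrite (le_trans (ler_norm _)) // normrN normrM natr_absz intr_norm ler_wpM2r //.
exact: nc_Im.
Qed.

Definition bchar (chi : int -> C) : Prop := forall k, nc (chi k) <= 1.

(* The factor [(2 i pi k^2)^j] comes from differentiating [j] times in [A]. *)
Definition thterm (chi : int -> C) (j : nat) (A B : C) (k : int) : C :=
  chi k * (twopii R * k%:~R ^+ 2) ^+ j * qe A B k.

Definition thw chi j A B : C := csum (thterm chi j A B).

(** The factor [expR (q |k|)] leaves room for the weight demanded by [ExpSeries]; the constant is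
    uniform in [chi], [A] and [B]. *)
Lemma thterm_bound (j : nat) (d r q : R) : 0 < d -> exists2 K : R, 0 <= K &
  forall chi A B k, bchar chi -> d <= ImC A -> nc B <= r ->
  nc (thterm chi j A B k) * expR (q * `|k|%N%:R) <= K * 4^-1 ^+ `|k|%N.
Proof.
move=> d0; have p2 : 0 < 2 * pi by rewrite mulr_gt0 ?pi_gt0.
have [K K0 hK] := @gauss_bound R (2 * pi * d) (2 * pi * r + q) j.*2 (mulr_gt0 p2 d0).
exists ((2 * pi) ^+ j * K); first by rewrite mulr_ge0 // exprn_ge0 // ltW.
move=> chi A B k hchi hA hB; rewrite /thterm 2!ncM ncX (ncM (twopii R)) nc_twopii ncX nc_int.
have := hK k; set n : R := `|k|%N%:R => hk.
have -> : (`|k|%:~R : R) = n by rewrite /n natr_absz.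
have n0 : 0 <= n by exact: ler0n.
have h1 : nc (qe A B k) * expR (q * n) <= expR (- (2 * pi * d) * n ^+ 2 + (2 * pi * r + q) * n).
  apply: le_trans (ler_wpM2r (expR_ge0 _) (nc_qe _ _ _)) _.
  rewrite -expRD ler_expR -/n [(2 * pi * r + q) * n]mulrDl addrA lerD2r lerD //.
    by rewrite !mulNr lerN2 ler_wpM2r ?sqr_ge0 // ler_wpM2l // ltW.
  by rewrite ler_wpM2r // ler_wpM2l // ltW.
rewrite -[leRHS]mulrA; apply: le_trans (ler_wpM2l _ hk); last by rewrite exprn_ge0 // ltW.
have -> : (2 * pi * n ^+ 2) ^+ j = (2 * pi) ^+ j * n ^+ j.*2.
  by rewrite exprMn -exprM mul2n.
rewrite [leLHS](_ : _ = nc (chi k) * ((2 * pi) ^+ j * n ^+ j.*2 * (nc (qe A B k) * expR (q * n)))); last by ring.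
rewrite [leRHS]mulrA.
apply: le_trans (ler_wpM2l _ h1); last by rewrite mulr_ge0 ?exprn_ge0 // ltW.
by rewrite ler_piMl // !mulr_ge0 ?exprn_ge0 ?nc_ge0 ?expR_ge0 // ltW.
Qed.

Lemma thterm_half (j : nat) (d r : R) : 0 < d -> exists2 K : R, 0 <= K &
  forall chi A B k, bchar chi -> d <= ImC A -> nc B <= r ->
  nc (thterm chi j A B k) <= K * 2^-1 ^+ `|k|%N.
Proof.
move=> d0; have [K K0 hK] := thterm_bound j r 0 d0.
exists K => // chi A B k h1 h2 h3; have := hK chi A B k h1 h2 h3.
rewrite mul0r expR0 mulr1 => /le_trans; apply.
by rewrite ler_wpM2l // quarter_le.
Qed.

Lemma hs_thw chi j A B : bchar chi -> 0 < ImC A -> hs (thterm chi j A B) (thw chi j A B).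
Proof.
move=> hc hA; have [K K0 hK] := thterm_half j (nc B) hA.
apply: (@absb_hs _ _ _ (K * 4)); apply: absb_half => // k.
exact: hK.
Qed.

Lemma thtermD chi j A B h k :
  thterm chi j (A + h) B k = thterm chi j A B k * ee (h * k%:~R ^+ 2).
Proof.
by rewrite /thterm -[RHS]mulrA; congr (_ * _); rewrite /qe -eeD; congr ee; ring.
Qed.
Lemma thtermDB chi j A B h k :
  thterm chi j A (B + h) k = thterm chi j A B k * ee (h * k%:~R).
Proof.
by rewrite /thterm -[RHS]mulrA; congr (_ * _); rewrite /qe -eeD; congr ee; ring.
Qed.

Lemma thw_diffA chi j A B : bchar chi -> 0 < ImC A ->
  exists M rho : R, [/\ 0 <= M, 0 < rho & forall h, nc h <= rho ->
    nc (thw chi j (A + h) B - thw chi j A B - h * thw chi j.+1 A B) <= M * nc h ^+ 2].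
Proof.
move=> hc hA; have p2 : 0 < 2 * pi by rewrite mulr_gt0 ?pi_gt0.
pose rho := ImC A / 2; have rho0 : 0 < rho by rewrite divr_gt0.
have [K K0 hK] := thterm_half j (nc B) rho0.
have hW Af : uniq Af -> \sum_(k <- Af) nc (thterm chi j A B k) *
    expR (2 * pi * rho * nc (k%:~R ^+ 2)) <= K * 4.
  move=> uA; apply: (@le_trans _ _ (\sum_(k <- Af) K * 2^-1 ^+ `|k|%N)); last first.
    by rewrite -mulr_sumr ler_wpM2l // geo_int.
  apply: ler_sum => k _.
  (* Weighting a term by [expR (2 pi rho k^2)] amounts to lowering [Im A] by [rho], which leaves
     [Im A / 2]. *)
  have := hK chi (A - 'i * rho%:C) B k hc.
  have -> : complex.Im (A - 'i * rho%:C) = rho.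
    by rewrite ImB ImM /= mul1r mul0r add0r /rho; field.
  move=> /(_ (lexx _) (lexx _)); rewrite thtermD ncM nc_ee.
  have -> // : - (2 * pi * complex.Im (- ('i * rho%:C) * k%:~R ^+ 2)) =
     2 * pi * rho * nc (k%:~R ^+ 2).
  rewrite intC -rmorphXn nc_real ger0_norm ?sqr_ge0 // -mulNr ImM /=; ring.
exists (128 / rho ^+ 2 * (K * 4)), (Num.min (rho / 2) (ImC A / 2)).
split.
- by rewrite mulr_ge0 ?mulr_ge0 ?invr_ge0 ?sqr_ge0.
- by rewrite lt_min !divr_gt0.
move=> h; rewrite le_min => /andP[h1 h2].
have hAh : 0 < ImC (A + h).
  rewrite ImD; have := nc_Im h; rewrite ler_norml => /andP[+ _].
  by have := hA; have := h2; lra.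
apply: (expser_diff rho0 hW h1 (hs_thw _ _ hc hA)).
  apply: hs_ext (hs_thw _ _ hc hA) => k; rewrite /thterm exprS; ring.
by apply: hs_ext (hs_thw _ _ hc hAh) => k; rewrite thtermD.
Qed.

(** Jacobi's theta function at the point [B], with modulus [2 A]. *)
Definition th A B : C := thw (fun=> 1) 0 A B.

Lemma bchar1 : bchar (fun=> 1). Proof. by move=> k; rewrite nc1. Qed.
Lemma thterm0 A B k : thterm (fun=> 1) 0 A B k = qe A B k.
Proof. by rewrite /thterm expr0 !mul1r. Qed.
Lemma hs_th A B : 0 < ImC A -> hs (qe A B) (th A B).
Proof. by move=> hA; apply: hs_ext (hs_thw 0 B bchar1 hA) => k; rewrite thterm0. Qed.

(* Entire functions, described by a Taylor expansion with a quadratic remainder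
   that is uniform on discs: this avoids any use of Cauchy's theorem. *)
Definition qreg (f : C -> C) : Prop := exists f' : C -> C, forall r : R,
  exists M : R, forall s, nc s <= r ->
    [/\ nc (f s) <= M, nc (f' s) <= M &
      forall h, nc h <= 1 -> nc (f (s + h) - f s - h * f' s) <= M * nc h ^+ 2].

Lemma th_qreg A : 0 < ImC A -> qreg (th A).
Proof.
move=> hA; have p2 : 0 <= 2 * pi by rewrite mulr_ge0 ?pi_ge0.
exists (fun s => csum (fun k => twopii R * k%:~R * qe A s k)) => r.
have [K K0 hK] := thterm_bound 0 r (2 * pi * 2) hA.
have hW s Af : nc s <= r -> uniq Af -> \sum_(k <- Af) nc (qe A s k) *
    expR (2 * pi * 2 * nc k%:~R) <= K * 4.
  move=> hs uA; apply: (@le_trans _ _ (\sum_(k <- Af) K * 2^-1 ^+ `|k|%N)); last first.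
    by rewrite -mulr_sumr ler_wpM2l // geo_int.
  apply: ler_sum => k _; rewrite nc_int -natr_absz -thterm0.
  apply: le_trans (hK _ _ _ _ bchar1 (lexx _) hs) _.
  by rewrite ler_wpM2l // quarter_le.
(* The radius 2 makes [expser_diff] available for all [|h| <= 1], as [qreg] demands. *)
have h2 : (0 < 2 :> R) by [].
exists (128 / 2 ^+ 2 * (K * 4)) => s hs.
have hd := absb_hs (expser_deriv_absb h2 (fun Af => @hW s Af hs)).
have K4 : 0 <= K * 4 by rewrite mulr_ge0.
split.
- rewrite (le_trans (hs_bound (hs_th s hA) (expser_absb h2 (fun Af => @hW s Af hs)))) //.
  rewrite ler_peMl //; lra.
- rewrite (le_trans (hs_bound hd (expser_deriv_absb h2 (fun Af => @hW s Af hs)))) //.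
  rewrite mulrC ler_wpM2r //; lra.
move=> h hh.
apply: (expser_diff h2 (fun Af => @hW s Af hs) _ (hs_th _ hA)) => //.
  by rewrite divff // pnatr_eq0.
apply: hs_ext (hs_th (s + h) hA) => k.
by rewrite -!thterm0 thtermDB.
Qed.

Lemma th_period A B : 0 < ImC A -> th A (B + 1) = th A B.
Proof.
move=> hA; apply: hs_unique (hs_th _ hA) _; apply: hs_ext (hs_th _ hA) => k.
by rewrite -!thterm0 thtermDB mul1r ee_int mulr1.
Qed.

Lemma th_shift A B : 0 < ImC A -> th A (B + A *+ 2) = ee (- A - B) * th A B.
Proof.
move=> hA; apply: hs_unique (hs_th _ hA) _.
apply: hs_ext (hsZ (ee (- A - B)) _) => [k|]; last first.
  apply: (@hs_transport _ _ _ (fun k => qe A B (k + 1)) (qe A B) (fun k => k + 1) (fun k => k - 1)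
            _ _ _ (hs_th B hA)) => k _; by rewrite ?addrK ?subrK.
by rewrite /qe -eeD; congr ee; rewrite rmorphD /=; ring.
Qed.

(** If theta vanished at all rational points, averaging over [j / N] would keep only the terms with
    [N] dividing [k]; the term 1 at [k = 0] cannot be cancelled by the others once [N] is large. A
    rational witness is wanted because it turns the Gaussian series into one over a congruence class
    in [qd_minv]. *)
Lemma th_nonzero A : 0 < ImC A ->
  exists (N : nat) (j : nat), (0 < N)%N /\ th A (j%:R / N%:R) != 0.
Proof.
move=> hA; apply: contrapT => hno.
have z N j : (0 < N)%N -> th A (j%:R / N%:R) = 0.
  by move=> N0; apply/eqP/negPn/negP => h; apply: hno; exists N, j.
have [K K0 hK] := thterm_bound 0 0 0 hA.
have [N N0 KN] : exists2 N, (0 < N)%N & K * 4 * 2^-1 ^+ N < 1.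
  exists (Num.bound (K * 4)).+1 => //.
  rewrite exprVn ltr_pdivrMr ?exprn_gt0 // mul1r.
  apply: lt_le_trans (archi_boundP _) _; first by rewrite mulr_ge0.
  rewrite -natrX ler_nat; apply: leq_trans (leqnSn _) (ltnW _).
  exact: ltn_expl.
have h1 : hs (fun k => \sum_(j < N) qe A (j%:R / N%:R) k) 0.
  rewrite -[X in hs _ X](_ : \sum_(j < N) th A (j%:R / N%:R) = 0).
    apply: hs_sum => j; exact: hs_th.
  by rewrite big1 // => j _; exact: z.
(* Removing the term [k = 0], equal to [N], leaves a series with sum [-N] whose norm is less than
   [N]. *)
have h2 := hsD h1 (hsZ (-1) (hs_delta (0 : int) N%:R)).
have : absb (fun k => \sum_(j < N) qe A (j%:R / N%:R) k + (-1) * (if k == 0 then N%:R else 0))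
   (N%:R * (K * 2^-1 ^+ N) * 4).
  have P0 : 0 <= N%:R * (K * 2^-1 ^+ N).
    apply: mulr_ge0; first exact: ler0n.
    by apply: mulr_ge0 => //; apply: exprn_ge0; rewrite invr_ge0.
  apply: (absb_half P0) => k.
  have -> : \sum_(j < N) qe A (j%:R / N%:R) k =
     qe A 0 k * if (N%:Z %| k)%Z then N%:R else 0.
    rewrite -root_sum // mulr_sumr; apply: eq_bigr => j _; rewrite /qe -eeD.
    congr ee; ring.
  have [->|k0] := eqVneq k 0.
    by rewrite dvdz0 /qe !mulr0 expr0n /= mulr0 addr0 ee0 mul1r mulN1r subrr nc0
      mulr_ge0 ?exprn_ge0 ?invr_ge0.
  rewrite mulr0 addr0; case: ifPn => [kN|_]; last first.
    by rewrite mulr0 nc0 mulr_ge0 ?exprn_ge0 ?invr_ge0.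
  rewrite ncM nc_nat mulrC -!mulrA ler_wpM2l //.
  have := hK (fun=> 1) A 0 k bchar1 (lexx _); rewrite nc0 lexx => /(_ isT).
  rewrite mul0r expR0 mulr1 thterm0 => /le_trans; apply.
  rewrite ler_wpM2l // quarter_half ler_wpM2r ?exprn_ge0 //.
  rewrite ler_wiXn2l // ?invf_le1 ?ler1n // dvdn_leq ?absz_gt0 //.
move/(hs_bound h2); rewrite add0r mulN1r ncN nc_nat => h3.
have : N%:R * (K * 4 * 2^-1 ^+ N) < N%:R :> R.
  by rewrite -[ltRHS]mulr1 ltr_pM2l // ltr0n.
by rewrite ltNge => /negP; apply; rewrite (le_trans h3) // le_eqVlt; apply/orP; left; apply/eqP; ring.
Qed.
End Theta1.

(** * Operations on regular entire functions, and lower bounds for the sine *)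

Section QReg.
Variable R : realType.
Local Notation C := R[i].
Local Notation ee := (@ee R).
Local Notation pi := (@trigo.pi R).

Lemma qreg_bound (f : C -> C) r : qreg f -> exists2 M : R, 0 <= M & forall s, nc s <= r -> nc (f s) <= M.
Proof.
move=> [f' /(_ (Num.max r 0))[M hM]]; exists M.
  by have [] := hM 0; rewrite ?nc0 ?le_max ?lexx ?orbT // => h _ _; apply: le_trans h; exact: nc_ge0.
by move=> s sr; have [] := hM s; rewrite ?le_max ?sr.
Qed.

Lemma qreg_mul (f g : C -> C) : qreg f -> qreg g -> qreg (fun s => f s * g s).
Proof.
move=> [f' hf] [g' hg]; exists (fun s => f' s * g s + f s * g' s) => r.
have [M1 h1] := hf r; have [M2 h2] := hg r.
pose M := Num.max 1 (Num.max M1 M2).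
have M_1 : 1 <= M by rewrite le_max lexx.
have M_M1 : M1 <= M by rewrite !le_max lexx orbT.
have M_M2 : M2 <= M by rewrite !le_max lexx !orbT.
have M0 : 0 <= M by apply: le_trans M_1.
exists (6 * M ^+ 2) => s sr.
have [a1 a2 a3] := h1 s sr; have [b1 b2 b3] := h2 s sr.
have A1 := le_trans a1 M_M1; have A2 := le_trans a2 M_M1.
have B1 := le_trans b1 M_M2; have B2 := le_trans b2 M_M2.
have MM : M <= M ^+ 2 by rewrite expr2 ler_peMl.
have c1 : nc (f s * g s) <= M ^+ 2 by rewrite ncM expr2 ler_pM ?nc_ge0.
have c2 : nc (f' s * g s) <= M ^+ 2 by rewrite ncM expr2 ler_pM ?nc_ge0.
have c3 : nc (f s * g' s) <= M ^+ 2 by rewrite ncM expr2 ler_pM ?nc_ge0.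
split.
- by lra.
- by apply: le_trans (ncD _ _) _; lra.
move=> h h1'; set u := f (s + h) - f s - h * f' s; set v := g (s + h) - g s - h * g' s.
have hu : nc u <= M * nc h ^+ 2.
  by apply: le_trans (a3 h h1') _; rewrite ler_wpM2r ?sqr_ge0.
have hv : nc v <= M * nc h ^+ 2.
  by apply: le_trans (b3 h h1') _; rewrite ler_wpM2r ?sqr_ge0.
have -> : f (s + h) * g (s + h) - f s * g s - h * (f' s * g s + f s * g' s) =
  h ^+ 2 * (f' s * g' s) + (f s + h * f' s) * v + u * (g s + h * g' s + v).
  by rewrite /u /v; ring.
set H := nc h ^+ 2 in hu hv *.
have H0 : 0 <= H by exact: sqr_ge0.
have H1 : H <= 1 by rewrite /H expr_le1 ?nc_ge0.
have hM x : nc x <= M -> nc (h * x) <= M.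
  by move=> hx; rewrite ncM; apply: le_trans (ler_pM (nc_ge0 _) (nc_ge0 _) h1' hx) _; rewrite mul1r.
have t1 : nc (h ^+ 2 * (f' s * g' s)) <= H * M ^+ 2.
  by rewrite ncM ncX -/H ler_wpM2l // ncM expr2 ler_pM ?nc_ge0.
have t2 : nc ((f s + h * f' s) * v) <= (2 * M) * (M * H).
  rewrite ncM ler_pM ?nc_ge0 //; apply: le_trans (ncD _ _) _.
  by have := hM _ A2; lra.
have t3 : nc (u * (g s + h * g' s + v)) <= (M * H) * (3 * M).
  rewrite ncM ler_pM ?nc_ge0 //; apply: le_trans (ncD _ _) _.
  have := ncD (g s) (h * g' s); have := hM _ B2.
  have : M * H <= M by rewrite ler_piMr.
  by lra.
apply: le_trans (ncD _ _) _; apply: le_trans (lerD (ncD _ _) (lexx _)) _.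
have -> : 6 * M ^+ 2 * H = H * M ^+ 2 + (2 * M) * (M * H) + (M * H) * (3 * M) by ring.
by rewrite !lerD.
Qed.

Lemma qreg_affine (f : C -> C) (b d : C) : qreg f -> qreg (fun s => f (b * s + d)).
Proof.
move=> hf; have [f' hf'] := hf; exists (fun s => b * f' (b * s + d)) => r.
have [M1 h1] := hf' (nc b * Num.max r 0 + nc d).
have [M2 M20 h2] := qreg_bound (nc b * (Num.max r 0 + 1) + nc d) hf.
pose B := Num.max 1 (nc b).
have B1 : 1 <= B by rewrite le_max lexx.
have Bb : nc b <= B by rewrite le_max lexx orbT.
have r0 : 0 <= Num.max r 0 by rewrite le_max lexx orbT.
have M10 : 0 <= M1.
  have [|+ _ _] := h1 0; first by rewrite nc0 addr_ge0 ?mulr_ge0 ?nc_ge0.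
  exact: le_trans (nc_ge0 _).
have B2 : 1 <= B ^+ 2 by rewrite expr_ge1 // (le_trans ler01).
have BB : B <= B ^+ 2 by rewrite expr2 ler_peMl // (le_trans ler01).
exists ((2 * M1 + M2) * B ^+ 2) => s sr.
have sb : nc (b * s + d) <= nc b * Num.max r 0 + nc d.
  apply: le_trans (ncD _ _) _; rewrite lerD2r ncM ler_wpM2l ?nc_ge0 //.
  by rewrite le_max sr.
have [a1 a2 a3] := h1 _ sb.
have MB : M1 <= M1 * B ^+ 2 by rewrite ler_peMr.
have MB2 : 0 <= M2 * B ^+ 2 by rewrite mulr_ge0 ?sqr_ge0.
split.
- by apply: le_trans a1 _; lra.
- rewrite ncM; apply: le_trans (ler_pM (nc_ge0 _) (nc_ge0 _) Bb a2) _.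
  have : B * M1 <= M1 * B ^+ 2 by rewrite mulrC ler_wpM2l.
  have : 0 <= M1 * B ^+ 2 by rewrite mulr_ge0 ?sqr_ge0.
  by lra.
move=> h hh.
have -> : f (b * (s + h) + d) - f (b * s + d) - h * (b * f' (b * s + d)) =
  f (b * s + d + b * h) - f (b * s + d) - (b * h) * f' (b * s + d).
  by rewrite (_ : b * (s + h) + d = b * s + d + b * h); ring.
have hB : nc (b * h) ^+ 2 <= B ^+ 2 * nc h ^+ 2.
  by rewrite ncM exprMn ler_wpM2r ?sqr_ge0 // lerXn2r ?nnegrE ?nc_ge0 // (le_trans ler01).
have [bh|bh] := lerP (nc (b * h)) 1.
  apply: le_trans (a3 _ bh) _; apply: le_trans (ler_wpM2l M10 hB) _.
  rewrite mulrA ler_wpM2r ?sqr_ge0 // ler_wpM2r ?sqr_ge0 //; lra.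
(* For [|b h| > 1] the expansion of [f] does not apply; boundedness of [f] and [f'] suffices, since
   [|b h|] and [1] are both at most [|b h|^2]. *)
have fb : nc (f (b * s + d + b * h)) <= M2.
  apply: h2; rewrite addrAC -mulrDr; apply: le_trans (ncD _ _) _; rewrite lerD2r ncM.
  rewrite ler_wpM2l ?nc_ge0 //; apply: le_trans (ncD _ _) _.
  by rewrite lerD // le_max sr.
have bh2 : 1 <= nc (b * h) ^+ 2 by rewrite expr_ge1 ?nc_ge0 // ltW.
have bh3 : nc (b * h) <= nc (b * h) ^+ 2 by rewrite expr2 ler_peMl ?nc_ge0 // ltW.
apply: le_trans (ncB _ _) _; apply: le_trans (lerD (ncB _ _) (lexx _)) _.
rewrite (ncM (b * h)) -mulrA.
apply: (@le_trans _ _ ((2 * M1 + M2) * nc (b * h) ^+ 2)); last first.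
  by rewrite ler_wpM2l // addr_ge0 // mulr_ge0.
have e1 : nc (b * h) * nc (f' (b * s + d)) <= nc (b * h) ^+ 2 * M1.
  by rewrite ler_pM ?nc_ge0.
have e2 : M2 <= M2 * nc (b * h) ^+ 2 by rewrite ler_peMr.
have e3 : M1 <= M1 * nc (b * h) ^+ 2 by rewrite ler_peMr.
by rewrite mulrDl; lra.
Qed.

Lemma qreg_gauss (a : C) : qreg (fun s => ee (a * s ^+ 2)).
Proof.
exists (fun s => twopii R * (2 * a * s) * ee (a * s ^+ 2)) => r0.
pose r := Num.max r0 0; have r00 : 0 <= r by rewrite le_max lexx orbT.
have p2 : 0 <= 2 * pi by rewrite mulr_ge0 ?pi_ge0.
have a0 := nc_ge0 a.
pose u := 2 * pi * (nc a * (2 * r + 1)).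
have u0 : 0 <= u.
  by apply: mulr_ge0 => //; apply: mulr_ge0 => //; rewrite addr_ge0 // mulr_ge0.
pose E := expR (2 * pi * (nc a * r ^+ 2)).
have E0 : 0 <= E by exact: expR_ge0.
exists (E * (1 + u + (8 * u ^+ 2 * expR u + u))) => s; move=> sr0.
have sr : nc s <= r by rewrite le_max sr0.
have hE : nc (ee (a * s ^+ 2)) <= E.
  rewrite nc_ee ler_expR -mulrN ler_wpM2l // (le_trans (ler_norm _)) // normrN.
  rewrite (le_trans (nc_Im _)) // ncM ncX ler_wpM2l // lerXn2r ?nnegrE ?nc_ge0 //.
have q0 : 0 <= 8 * u ^+ 2 * expR u.
  apply: mulr_ge0 (expR_ge0 _); apply: mulr_ge0 => //; exact: sqr_ge0.
split.
- by apply: le_trans hE _; rewrite ler_peMr //; lra.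
- rewrite ncM mulrC ler_pM ?nc_ge0 // ncM nc_twopii 2!ncM nc_nat.
  apply: (@le_trans _ _ u); last by lra.
  rewrite /u ler_wpM2l // (_ : 2 * nc a * nc s = nc a * (2 * nc s)); last by ring.
  rewrite ler_wpM2l //; lra.
move=> h hh; set w := 2 * a * s * h + a * h ^+ 2.
have -> : ee (a * (s + h) ^+ 2) - ee (a * s ^+ 2) - h * (twopii R * (2 * a * s) * ee (a * s ^+ 2))
  = ee (a * s ^+ 2) * ((ee w - 1 - twopii R * w) + twopii R * (a * h ^+ 2)).
  have -> : a * (s + h) ^+ 2 = a * s ^+ 2 + w by rewrite /w; ring.
  by rewrite eeD /w; ring.
have H0 := nc_ge0 h.
have hw : 2 * pi * nc w <= u * nc h.
  have -> : u * nc h = 2 * pi * (nc a * (2 * r + 1) * nc h) by rewrite /u; ring.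
  rewrite ler_wpM2l //; apply: le_trans (ncD _ _) _.
  rewrite 3!ncM nc_nat (ncM a) ncX.
  have -> : nc a * (2 * r + 1) * nc h = 2 * nc a * r * nc h + nc a * nc h by ring.
  rewrite lerD //.
    by rewrite ler_wpM2r // ler_wpM2l // mulr_ge0.
  by rewrite ler_wpM2l // expr2 ler_piMl.
rewrite ncM -mulrA ler_pM ?nc_ge0 //; apply: le_trans (ncD _ _) _.
have -> : (1 + u + (8 * u ^+ 2 * expR u + u)) * nc h ^+ 2 =
  8 * (u * nc h) ^+ 2 * expR u + u * nc h ^+ 2 + (1 + u) * nc h ^+ 2 by ring.
have e1 : nc (ee w - 1 - twopii R * w) <= 8 * (u * nc h) ^+ 2 * expR u.
  apply: le_trans (ee_bound2 _) _; rewrite ler_pM ?expR_ge0 ?mulr_ge0 ?sqr_ge0 ?nc_ge0 ?pi_ge0 //.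
    rewrite ler_wpM2l // lerXn2r ?nnegrE //.
      by apply: mulr_ge0 => //; exact: nc_ge0.
    exact: mulr_ge0.
  by rewrite ler_expR (le_trans hw) // ler_piMr.
have e2 : nc (twopii R * (a * h ^+ 2)) <= u * nc h ^+ 2.
  rewrite ncM nc_twopii ncM ncX mulrA ler_wpM2r ?sqr_ge0 // /u ler_wpM2l //.
  by rewrite ler_peMr //; lra.
have e3 : 0 <= (1 + u) * nc h ^+ 2 by rewrite mulr_ge0 ?sqr_ge0 // addr_ge0.
lra.
Qed.

Lemma qreg_exp : qreg (fun s => ee s).
Proof.
exists (fun s => twopii R * ee s) => r.
have p2 : 0 <= 2 * pi by rewrite mulr_ge0 ?pi_ge0.
pose E := expR (2 * pi * r).
have E0 : 0 <= E by exact: expR_ge0.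
pose D := 8 * (2 * pi) ^+ 2 * expR (2 * pi).
have D0 : 0 <= D by rewrite !mulr_ge0 ?expR_ge0 ?pi_ge0 // exprn_ge0.
exists (E * (1 + 2 * pi + D)) => s sr.
have hE : nc (ee s) <= E.
  rewrite nc_ee ler_expR -mulrN ler_wpM2l // (le_trans (ler_norm _)) // normrN.
  by rewrite (le_trans (nc_Im _)).
split.
- by apply: le_trans hE _; rewrite ler_peMr //; lra.
- by rewrite ncM nc_twopii mulrC ler_pM ?nc_ge0 //; lra.
move=> h hh.
have -> : ee (s + h) - ee s - h * (twopii R * ee s) = ee s * (ee h - 1 - twopii R * h).
  by rewrite eeD; ring.
rewrite ncM -mulrA ler_pM ?nc_ge0 //; apply: le_trans (ee_bound2 _) _.
have H0 := nc_ge0 h.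
apply: (@le_trans _ _ (D * nc h ^+ 2)); last by rewrite ler_wpM2r ?exprn_ge0 //; lra.
have -> : D * nc h ^+ 2 = 8 * (2 * pi * nc h) ^+ 2 * expR (2 * pi) by rewrite /D; ring.
rewrite ler_wpM2l ?ler_expR ?mulr_ge0 ?exprn_ge0 ?mulr_ge0 ?pi_ge0 //.
by rewrite ler_piMr.
Qed.

Lemma qreg_explin (a b : C) : qreg (fun s => ee (a - s * b)).
Proof.
have -> : (fun s => ee (a - s * b)) = (fun s => ee (- b * s + a)).
  by apply/funext => s; congr ee; ring.
exact: qreg_affine qreg_exp.
Qed.

(** With [x = y / 2], the bound [x cos x <= sin x] gives [sin y = 2 sin x cos x >= 2 x (cos x)^2 = x
    (1 + cos y) >= x]. *)
Lemma sin_ge_half (y : R) : 0 <= y <= pi / 2 -> y / 2 <= sin y.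
Proof.
move=> /andP[y0 y1]; pose x := y / 2.
have yE : y = x *+ 2 by rewrite /x -mulr_natr divfK // pnatr_eq0.
have p0 := pi_gt0 R.
have x0 : 0 <= x by rewrite divr_ge0.
have xpi : x <= pi / 2 by rewrite /x; lra.
have hd z : is_derive z (1 : R) (sin - id * cos) (z * sin z).
  apply: (is_derive_eq (is_deriveB (is_derive_sin z) (is_deriveM (is_derive_id z 1) (is_derive_cos z)))).
  by rewrite /GRing.scale /=; ring.
have sc : x * cos x <= sin x.
  have cf : ({within `[0, x], continuous (sin - id * cos : R -> R)})%classic.
    apply: continuous_subspaceT => z; apply: differentiable_continuous.
    by apply/derivable1_diffP; have [] := hd z.
  have [c] := MVT_segment x0 (fun z _ => hd z) cf.
  rewrite in_itv /= => /andP[c0 cx]; rewrite !fctE sin0 mul0r !subr0 => e.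
  rewrite -subr_ge0 e !mulr_ge0 //; apply: sin_ge0_pi; rewrite c0 /=; lra.
have cx0 : 0 <= cos x by apply: cos_ge0_pihalf; rewrite xpi andbT; lra.
have cy0 : 0 <= cos y by apply: cos_ge0_pihalf; rewrite y1 andbT; lra.
have : cos y = cos x ^+ 2 *+ 2 - 1 by rewrite yE cos_mulr2n.
rewrite -mulr_natr => cyE.
rewrite {2}yE sin_mulr2n -mulr_natr -/x.
have : cos x * (x * cos x) <= cos x * sin x by rewrite ler_wpM2l.
have : 0 <= x * (cos x ^+ 2 * 2 - 1) by rewrite mulr_ge0 // -cyE.
have -> : x * (cos x ^+ 2 * 2 - 1) = cos x * (x * cos x) * 2 - x by ring.
lra.
Qed.

(** The left factor in a discrete double integration by parts: it equals [- 4 (sin (pi x))^2]. It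
    provides the decay of Fourier coefficients in [av_decay]. *)
Lemma nc_second_diff (x : R) : `|x| <= 2^-1 ->
  4 * x ^+ 2 <= nc (ee x%:C + ee (- x%:C) - 2).
Proof.
move=> hx; have p0 := pi_ge2 R.
have -> : ee x%:C + ee (- x%:C) - 2 = (- (4 * sin (pi * `|x|) ^+ 2))%:C.
  have c : cos (2 * pi * x) = 1 - 2 * sin (pi * `|x|) ^+ 2.
    rewrite -cos_norm (_ : `|2 * pi * x| = (pi * `|x|) *+ 2); last first.
      by rewrite !normrM (ger0_norm (pi_ge0 R)) ger0_norm // -mulr_natl; ring.
    by rewrite cos_mulr2n cos2sin2 -mulr_natr; ring.
  rewrite /ee /= !mulr0 !oppr0 mulr0 oppr0 expR0 mulrN cosN sinN c.
  by apply: cP => /=; ring.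
rewrite nc_real normrN ger0_norm; last by apply: mulr_ge0 => //; exact: sqr_ge0.
have := normr_ge0 x; rewrite -(real_normK (num_real x)); move: `|x| hx => y hy y0.
have : pi * y / 2 <= sin (pi * y).
  apply: sin_ge_half; rewrite mulr_ge0 ?pi_ge0 //= mulrC.
  by rewrite [leRHS]mulrC ler_wpM2r ?pi_ge0.
have yy : y <= pi * y / 2 by rewrite mulrAC ler_peMl //; lra.
move=> /(le_trans yy) h.
by rewrite ler_wpM2l // lerXn2r ?nnegrE // (le_trans y0).
Qed.
End QReg.

Section WinSums.
Variable R : realType.
Local Notation C := R[i].

Lemma win_split (n K : nat) (F : int -> C) : (K <= n)%N ->
  \sum_(k <- win n) F k = \sum_(k <- win K) F k + \sum_(k <- win n | (K < `|k|)%N) F k.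
Proof.
move=> Kn; rewrite (bigID (fun k : int => (`|k| <= K)%N)) /=; congr (_ + _).
  rewrite -big_filter; apply: perm_big; apply: uniq_perm; rewrite ?filter_uniq ?win_uniq //.
  by move=> k; rewrite mem_filter !mem_win; case: leqP => //= h; rewrite (leq_trans h).
by apply: eq_bigl => k; rewrite -ltnNge.
Qed.

Lemma inv_sqr_tail (K n : nat) : (0 < K)%N -> (K <= n)%N ->
  \sum_(j < n.+1 | (K < j)%N) (j%:R ^+ 2)^-1 <= K%:R^-1 - n%:R^-1 :> R.
Proof.
move=> K0; elim: n => [|n IH]; first by rewrite leqNgt K0.
rewrite leq_eqVlt => /orP[/eqP KE|Kn].
  rewrite -KE subrr big1 // => j; rewrite ltnNge.
  by have := ltn_ord j; rewrite ltnS => ->.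
rewrite big_mkcond big_ord_recr /= -big_mkcond /= Kn.
have n0 : (0 < n)%N by rewrite (leq_trans K0).
have := IH Kn => h; apply: le_trans (lerD h (lexx _)) _.
rewrite -addrA lerD2l -subr_ge0.
have -> : - n.+1%:R^-1 - (- n%:R^-1 + (n.+1%:R ^+ 2)^-1) = (n%:R * n.+1%:R ^+ 2)^-1 :> R.
  have nz : n%:R != 0 :> R by rewrite pnatr_eq0 -lt0n.
  rewrite -natr1; field; rewrite nz /= natr1 pnatr_eq0 //.
by rewrite invr_ge0 mulr_ge0 ?sqr_ge0 ?ler0n.
Qed.

Lemma win_tail (K n : nat) : (0 < K)%N -> (K <= n)%N ->
  \sum_(k <- win n | (K < `|k|)%N) (`|k|%N%:R ^+ 2)^-1 <= 2 / K%:R :> R.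
Proof.
move=> K0 Kn; pose g (j : nat) : R := if (K < j)%N then (j%:R ^+ 2)^-1 else 0.
have g0 j : 0 <= g j by rewrite /g; case: ifP => // _; rewrite invr_ge0 sqr_ge0.
have tail : \sum_(j < n.+1) g j <= K%:R^-1.
  rewrite -big_mkcond; apply: le_trans (inv_sqr_tail K0 Kn) _.
  by rewrite lerBlDr lerDl invr_ge0 ler0n.
rewrite big_mkcond -[X in X <= _]/(\sum_(k <- win n) g `|k|%N).
rewrite /win big_map -[iota _ _]/(index_iota 0 n.*2.+1) (big_cat_nat _ (n := n)) //=; last by lia.
have -> : 2 / K%:R = K%:R^-1 + K%:R^-1 :> R by rewrite mulr_natl mulr2n.
rewrite lerD //.
  rewrite big_mkord (reindex_inj rev_ord_inj) /=.
  apply: le_trans tail; rewrite [leRHS]big_ord_recl /=; rewrite -[leLHS]add0r lerD //.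
  apply: ler_sum => i _.
  by have -> : `|(n - i.+1)%N%:Z - n%:Z|%N = bump 0 i by have := ltn_ord i; rewrite /bump; lia.
rewrite -{1}[n]add0n big_addn big_mkord.
have -> : (n.*2.+1 - n = n.+1)%N by lia.
apply: le_trans tail; apply: ler_sum => i _.
by have -> : `|(i + n)%N%:Z - n%:Z|%N = i by lia.
Qed.
End WinSums.

(** * A quasi-periodic entire function is determined up to a scalar *)

Section Rank1.
Variable R : realType.
Local Notation C := R[i].
Local Notation ee := (@ee R).
Variables (t : C) (f : C -> C).
Hypothesis ht : 0 < complex.Im t.
Hypothesis fq : qreg f.
Hypothesis f1 : forall s, f (s + 1) = f s.
Hypothesis ft : forall s, f (s + t) = ee (- (t / 2) - s) * f s.

Let A := t / 2.
Let hA : 0 < complex.Im A.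
Proof.
have -> : complex.Im A = complex.Im t / 2.
  have -> : A = t * (2^-1)%:C by rewrite /A fmorphV rmorph_nat.
  by rewrite ImM /= mulr0 add0r.
by rewrite divr_gt0.
Qed.

Lemma f_shiftn n s : f (s + n%:R * t) = ee (- (A * n%:R ^+ 2) - s * n%:R) * f s.
Proof.
elim: n => [|n IH]; first by rewrite mul0r addr0 expr0n /= !mulr0 oppr0 addr0 ee0 mul1r.
rewrite -natr1 mulrDl mul1r addrA ft IH mulrA -eeD; congr (ee _ * _).
by rewrite /A; field.
Qed.

Lemma f_shiftz (k : int) s : f (s + k%:~R * t) = ee (- (A * k%:~R ^+ 2) - s * k%:~R) * f s.
Proof.
case: k => n; first exact: f_shiftn.
rewrite NegzE rmorphN /= -pmulrn; set m := n.+1%:R.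
have := f_shiftn n.+1 (s - m * t); rewrite subrK -/m => ->.
rewrite mulNr mulrA -eeD -[LHS]mul1r; congr (_ * _).
by rewrite -[LHS]ee0; congr ee; rewrite /A; field.
Qed.

Local Notation N n := (n.*2.+1).
Lemma NC0 n : (N n)%:R != 0 :> C. Proof. by rewrite pnatr_eq0. Qed.
Lemma NR0 n : 0 < (N n)%:R :> R. Proof. by rewrite ltr0n. Qed.

(* Riemann sum with [N n] points for the [k]-th Fourier coefficient of [f] on the
   horizontal line through [s]. By [av_shift] all of them are governed by [k = 0],
   where moving the line changes the sum only by O(1/N). *)
Definition av (n : nat) (k : int) (s : C) : C :=
  (N n)%:R^-1 * \sum_(j < N n) ee (- (k%:~R * j%:R / (N n)%:R)) * f (s + j%:R / (N n)%:R).

(** Discrete Fourier inversion: the [2 n + 1] sample points match the [2 n + 1] frequencies of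
    [win n], so there is no error term. *)
Lemma av_sum n s : \sum_(k <- win n) av n k s = f s.
Proof.
rewrite /av -mulr_sumr exchange_big /=.
have Nz := NC0 n; apply: (mulfI Nz); rewrite mulrA divff // mul1r.
rewrite (bigD1 ord0) //= [X in _ + X]big1 ?addr0 => [|j j0]; rewrite -mulr_suml big_win.
  under eq_bigr do rewrite mulr0 mul0r oppr0 ee0.
  by rewrite sumr_const card_ord mul0r addr0.
have -> : \sum_(i < N n) ee (- ((i%:Z - n%:Z)%:~R * j%:R / (N n)%:R)) =
  ee (n%:R * j%:R / (N n)%:R) * \sum_(i < N n) ee ((- j%:Z)%:~R * i%:R / (N n)%:R).
  rewrite mulr_sumr; apply: eq_bigr => i _; rewrite -eeD; congr ee.
  by rewrite rmorphB rmorphN /= -!pmulrn; ring.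
rewrite root_sum // ifN ?mulr0 ?mul0r // dvdzE abszN /=.
apply/negP => /dvdn_leq; rewrite lt0n => /(_ j0).
by rewrite leqNgt ltn_ord.
Qed.

Lemma av_shift n k s : av n k s = qe A s k * av n 0 (s + k%:~R * t).
Proof.
rewrite /av mulrCA; congr (_ * _); rewrite mulr_sumr; apply: eq_bigr => j _.
rewrite !mul0r oppr0 ee0 mul1r addrAC f_shiftz mulrA /qe -eeD; congr (ee _ * _).
by ring.
Qed.

Lemma cyc_shift n (G : nat -> C) : G n = G 0%N ->
  \sum_(j < n) G j.+1 = \sum_(j < n) G j.
Proof.
move=> e; apply: (addrI (G 0%N)).
have := big_ord_recl n (fun j : 'I_n.+1 => G j); rewrite /= => <-.
by rewrite big_ord_recr /= e addrC.
Qed.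

Lemma f_periodN n s : f (s + (N n)%:R / (N n)%:R) = f s.
Proof. by rewrite divff ?NC0. Qed.

Lemma nc_jN n (j : 'I_(N n)) : nc (j%:R / (N n)%:R : C) <= 1.
Proof.
rewrite ncM ncV !nc_nat ler_pdivrMr ?NR0 // mul1r ler_nat.
exact: ltnW.
Qed.

Lemma av0_bound : exists2 B : R, 0 <= B & forall n, nc (av n 0 0) <= B.
Proof.
have [M M0 hM] := qreg_bound 1 fq; exists M => // n.
rewrite ncM ncV nc_nat ler_pdivrMl ?NR0 //.
apply: le_trans (nc_sum _ _) _.
apply: (@le_trans _ _ (\sum_(j < N n) M)); last by rewrite sumr_const card_ord mulr_natl.
apply: ler_sum => j _; rewrite !mul0r oppr0 ee0 mul1r add0r; apply: hM; exact: nc_jN.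
Qed.

(** Discrete form of the vanishing of the integral of [f'] over a period: the increments of [f]
    telescope to zero, and [N] remainders of size [M / N^2] are left. *)
Lemma avg_deriv_small (f' : C -> C) (M r : R) n p : nc p + 1 <= r ->
  (forall s, nc s <= r -> forall h, nc h <= 1 -> nc (f (s + h) - f s - h * f' s) <= M * nc h ^+ 2) ->
  nc ((N n)%:R^-1 * \sum_(j < N n) f' (p + j%:R / (N n)%:R)) <= M / (N n)%:R.
Proof.
move=> pr hM; have Nz := NC0 n.
have -> : (N n)%:R^-1 * \sum_(j < N n) f' (p + j%:R / (N n)%:R) =
  - \sum_(j < N n) (f (p + j%:R / (N n)%:R + (N n)%:R^-1) - f (p + j%:R / (N n)%:R)
     - (N n)%:R^-1 * f' (p + j%:R / (N n)%:R)).
  rewrite sumrB opprB -mulr_sumr sumrB.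
  have -> : \sum_(j < N n) f (p + j%:R / (N n)%:R + (N n)%:R^-1) =
     \sum_(j < N n) f (p + j.+1%:R / (N n)%:R).
    by apply: eq_bigr => j _; congr f; rewrite -natr1; ring.
  rewrite (@cyc_shift _ (fun j => f (p + j%:R / (N n)%:R))) ?subrr ?subr0 //.
  by rewrite f_periodN mul0r addr0.
rewrite ncN; apply: le_trans (nc_sum _ _) _.
have -> : M / (N n)%:R = \sum_(j < N n) M * nc ((N n)%:R^-1) ^+ 2.
  rewrite sumr_const card_ord ncV nc_nat -mulr_natr.
  by field; rewrite gt_eqF // NR0.
apply: ler_sum => j _; apply: hM.
  apply: le_trans (ncD _ _) _; apply: le_trans pr; rewrite lerD2l; exact: nc_jN.
rewrite ncV nc_nat invf_le1 ?NR0 // ler1n //.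
Qed.

(** Discrete form of moving a contour: the translation by [sg] is made in [N] steps, each changing
    the average by [O(1/N^2)] thanks to [avg_deriv_small]. *)
Lemma av0_almost_const (s sg : C) : exists2 K : R, 0 <= K & forall n,
  nc sg <= (N n)%:R -> nc (av n 0 (s + sg) - av n 0 s) <= K / (N n)%:R.
Proof.
have [f' hf'] := fq; pose r := nc s + nc sg + 1.
have [M hM] := hf' r.
have M0 : 0 <= M.
  have [|+ _ _] := hM 0; last exact: le_trans (nc_ge0 _).
  by rewrite nc0 !addr_ge0 ?nc_ge0.
exists (M * (nc sg ^+ 2 + nc sg)); first by rewrite mulr_ge0 ?addr_ge0 ?nc_ge0 ?sqr_ge0.
move=> n sgN; have Nz := NC0 n; have Np := NR0 n.
set h := sg / (N n)%:R.
have nh : nc h = nc sg / (N n)%:R by rewrite ncM ncV nc_nat.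
have h1 : nc h <= 1 by rewrite nh ler_pdivrMr // mul1r.
have hM' x : nc x <= r -> forall h, nc h <= 1 -> nc (f (x + h) - f x - h * f' x) <= M * nc h ^+ 2.
  by move=> xr; have [] := hM x xr.
have step p : nc p + 1 <= r -> nc (av n 0 (p + h) - av n 0 p) <= M * nc h ^+ 2 + nc h * (M / (N n)%:R).
  move=> pr.
  have -> : av n 0 (p + h) - av n 0 p =
    (N n)%:R^-1 * \sum_(j < N n) (f (p + j%:R / (N n)%:R + h) - f (p + j%:R / (N n)%:R)
       - h * f' (p + j%:R / (N n)%:R)) +
    h * ((N n)%:R^-1 * \sum_(j < N n) f' (p + j%:R / (N n)%:R)).
    rewrite sumrB -mulr_sumr mulrBr mulrCA subrK -mulrBr -sumrB; congr (_ * _).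
    by apply: eq_bigr => j _; rewrite mul0r mul0r oppr0 ee0 !mul1r addrAC.
  apply: le_trans (ncD _ _) _; rewrite lerD //; last first.
    rewrite ncM ler_wpM2l ?nc_ge0 //; exact: (avg_deriv_small n pr hM').
  rewrite ncM ncV nc_nat ler_pdivrMl //; apply: le_trans (nc_sum _ _) _.
  apply: (@le_trans _ _ (\sum_(j < N n) M * nc h ^+ 2)); last by rewrite sumr_const card_ord mulr_natl.
  apply: ler_sum => j _; apply: hM' => //.
  apply: le_trans (ncD _ _) _; apply: le_trans pr; rewrite lerD2l; exact: nc_jN.
have tele : av n 0 (s + sg) - av n 0 s =
   \sum_(i < N n) (av n 0 (s + i%:R * h + h) - av n 0 (s + i%:R * h)).
  rewrite -(big_mkord xpredT (fun i => av n 0 (s + i%:R * h + h) - av n 0 (s + i%:R * h))).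
  rewrite (eq_bigr (fun i => av n 0 (s + i.+1%:R * h) - av n 0 (s + i%:R * h))).
    rewrite telescope_sumr // mul0r addr0; congr (av n 0 (s + _) - _).
    by rewrite /h mulrC divfK.
  by move=> i _; congr (av n 0 _ - _); rewrite -natr1; ring.
rewrite tele; apply: le_trans (nc_sum _ _) _.
have -> : M * (nc sg ^+ 2 + nc sg) / (N n)%:R =
   \sum_(i < N n) (M * nc h ^+ 2 + nc h * (M / (N n)%:R)).
  rewrite sumr_const card_ord nh -mulr_natr; field; rewrite gt_eqF //.
apply: ler_sum => i _; apply: step; rewrite /r lerD2r.
apply: le_trans (ncD _ _) _; rewrite lerD2l ncM nh nc_nat mulrCA ler_piMr ?nc_ge0 //.
by rewrite ler_pdivrMr // mul1r ler_nat ltnW.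
Qed.

(** Summation by parts, twice: replacing [f] by its second difference of step [1 / N] multiplies the
    coefficient by [ee x + ee (- x) - 2] with [x = k / N]. The restriction [|k| <= n] gives
    [|x| <= 1/2], where [nc_second_diff] applies. *)
Lemma av_decay (s : C) : exists2 K : R, 0 <= K & forall n (k : int),
  (0 < `|k| <= n)%N -> nc (av n k s) <= K / `|k|%N%:R ^+ 2.
Proof.
have [f' hf'] := fq; pose r := nc s + 1.
have [M hM] := hf' r.
have M0 : 0 <= M.
  have [|+ _ _] := hM 0; last exact: le_trans (nc_ge0 _).
  by rewrite nc0 !addr_ge0 ?nc_ge0.
exists M => // n k /andP[k0 kn]; have Nz := NC0 n; have Np := NR0 n.
have hM' x : nc x <= r -> forall h, nc h <= 1 -> nc (f (x + h) - f x - h * f' x) <= M * nc h ^+ 2.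
  by move=> xr; have [] := hM x xr.
set iN : C := (N n)%:R^-1.
have niN : nc iN = (N n)%:R^-1 by rewrite ncV nc_nat.
have iN1 : nc iN <= 1 by rewrite niN invf_le1 // ler1n.
pose x : R := k%:~R / (N n)%:R.
have xC : x%:C = k%:~R * iN by rewrite /x fmorph_div /= rmorph_int rmorph_nat.
pose e (j : nat) := ee (- (k%:~R * j%:R / (N n)%:R)).
have eS j : e j.+1 = e j * ee (- x%:C).
  by rewrite /e -eeD xC /iN; congr ee; rewrite -natr1; ring.
have eN : e (N n) = e 0%N.
  by rewrite /e mulfK // mulr0 mul0r oppr0 ee0 eeN ee_int invr1.
pose g (j : nat) := f (s + j%:R / (N n)%:R).
have gN : g (N n) = g 0%N by rewrite /g f_periodN mul0r addr0.
pose d j := f (s + j%:R / (N n)%:R + iN) + f (s + j%:R / (N n)%:R - iN) - 2 * g j.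
have S1 : \sum_(j < N n) e j * f (s + j%:R / (N n)%:R + iN) = ee x%:C * \sum_(j < N n) e j * g j.
  rewrite -(@cyc_shift _ (fun j => e j * g j)); last by rewrite eN gN.
  rewrite mulr_sumr; apply: eq_bigr => j _; rewrite eS mulrA mulrCA -eeD subrr ee0 mulr1.
  by congr (_ * _); rewrite /g -[j.+1%:R]natr1 mulrDl mul1r addrA.
have S2 : \sum_(j < N n) e j * f (s + j%:R / (N n)%:R - iN) = ee (- x%:C) * \sum_(j < N n) e j * g j.
  rewrite -(@cyc_shift _ (fun j => e j * f (s + j%:R / (N n)%:R - iN))); last first.
    rewrite eN -addrA [_ - iN]addrC addrA f_periodN mul0r addr0 //.
  rewrite mulr_sumr; apply: eq_bigr => j _; rewrite eS -mulrA mulrCA.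
  by congr (_ * (_ * _)); rewrite /g -[j.+1%:R]natr1 mulrDl mul1r addrA addrK.
have key : (ee x%:C + ee (- x%:C) - 2) * av n k s = iN * \sum_(j < N n) e j * d j.
  rewrite /av -/iN mulrCA; congr (_ * _).
  under [RHS]eq_bigr do rewrite /d mulrBr mulrDr mulrCA.
  rewrite sumrB big_split /= S1 S2 -mulr_sumr; ring.
have hx : `|x| <= 2^-1.
  rewrite /x normrM normfV (ger0_norm (ltW Np)) ler_pdivrMr // mulrC ler_pdivlMr //.
  rewrite -intr_norm -natr_absz -natrM ler_nat; lia.
have low := nc_second_diff hx.
have up : nc (iN * \sum_(j < N n) e j * d j) <= 2 * M / (N n)%:R ^+ 2.
  rewrite ncM niN ler_pdivrMl //; apply: le_trans (nc_sum _ _) _.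
  apply: (@le_trans _ _ (\sum_(j < N n) 2 * M / (N n)%:R ^+ 2)); last first.
    by rewrite sumr_const card_ord -[leLHS]mulr_natl.
  apply: ler_sum => j _; rewrite ncM.
  have -> : nc (e j) = 1.
    rewrite /e -mulrA -mulrN (_ : k%:~R * _ = (- (k%:~R * (j%:R / (N n)%:R)))%:C) ?nc_ee_real //.
    by rewrite rmorphN rmorphM fmorph_div /= rmorph_int !rmorph_nat mulrN.
  rewrite mul1r; pose p := s + j%:R / (N n)%:R.
  have pr : nc p <= r by apply: le_trans (ncD _ _) _; rewrite lerD2l nc_jN.
  have -> : d j = (f (p + iN) - f p - iN * f' p) + (f (p + - iN) - f p - (- iN) * f' p).
    by rewrite /d /g -/p; ring.
  apply: le_trans (ncD _ _) _.
  have a1 := hM' p pr iN iN1; have a2 := hM' p pr (- iN); rewrite ncN in a2.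
  have -> : 2 * M / (N n)%:R ^+ 2 = M * nc iN ^+ 2 + M * nc iN ^+ 2.
    by rewrite niN exprVn; ring.
  by rewrite lerD // a2.
have := up; rewrite -key ncM => up'.
have k2 : 0 < `|k|%N%:R ^+ 2 :> R by rewrite exprn_gt0 // ltr0n.
have xk : 4 * x ^+ 2 = 4 * `|k|%N%:R ^+ 2 / (N n)%:R ^+ 2.
  by rewrite /x exprMn exprVn natr_absz intr_norm real_normK ?num_real // mulrA.
have := le_trans (ler_wpM2r (nc_ge0 _) low) up'; rewrite xk.
have N2 : 0 < (N n)%:R ^+ 2 :> R by rewrite exprn_gt0.
rewrite mulrAC ler_pM2r ?invr_gt0 // ler_pdivlMr // => hfin.
have a0 := nc_ge0 (av n k s).
rewrite mulrC; lra.
Qed.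

(** By [av_sum] and [av_shift], [f s] is the sum of [qe A s k * av n 0 (s + k t)] over [|k| <= n].
    For [|k| <= K] the averages are replaced by [av n 0 0], and [av_decay] bounds the rest uniformly
    in [n]. *)
Lemma approx (s : C) (e : R) : 0 < e -> exists n0, forall n, (n0 <= n)%N ->
  nc (f s - av n 0 0 * th A s) <= e.
Proof.
move=> e0; have e3 : 0 < e / 3 by rewrite divr_gt0.
have [B B0 hB] := av0_bound.
have [K4 K40 h4] := av_decay s.
have B1 : 0 < B + 1 by rewrite ltr_wpDl.
have [n1 hn1] := hs_win (hs_th s hA) (divr_gt0 e3 B1).
have [K [K0 Kn1 KK]] : exists K, [/\ (0 < K)%N, (n1 <= K)%N & K4 * (2 / K%:R) <= e / 3].
  exists (maxn n1 (Num.bound (K4 * 2 / (e / 3))).+1); split; rewrite ?leq_maxl //.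
    by rewrite leq_max orbT.
  set K := maxn _ _; have K0 : 0 < K%:R :> R by rewrite ltr0n leq_max orbT.
  rewrite mulrA ler_pdivrMr // [leRHS]mulrC -ler_pdivrMr //.
  apply: ltW; apply: lt_le_trans (archi_boundP _) _.
    by rewrite divr_ge0 ?mulr_ge0 // ltW.
  by rewrite ler_nat leq_max leqnSn orbT.
have ck (k : int) : exists K3 : R, 0 <= K3 /\ forall n, nc (s + k%:~R * t) <= (N n)%:R ->
    nc (av n 0 (s + k%:~R * t) - av n 0 0) <= K3 / (N n)%:R.
  by have [K3 ? h] := av0_almost_const 0 (s + k%:~R * t); exists K3; split=> // n; have := h n; rewrite add0r.
have [K3 hK3] := choice ck.
pose D := \sum_(k <- win K) nc (qe A s k) * K3 k.
pose D2 := \sum_(k <- win K) nc (s + k%:~R * t).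
have D0 : 0 <= D by apply: sumr_ge0 => k _; rewrite mulr_ge0 ?nc_ge0 //; have [] := hK3 k.
have D20 : 0 <= D2 by apply: sumr_ge0 => k _; exact: nc_ge0.
exists (K + (Num.bound (D / (e / 3)) + Num.bound D2))%N => n hn.
have Kn : (K <= n)%N by apply: leq_trans hn; rewrite leq_addr.
have Np := NR0 n.
have nN : (n%:R <= (N n)%:R :> R) by rewrite ler_nat leqW // -addnn leq_addr.
have ND : D / (N n)%:R <= e / 3.
  rewrite ler_pdivrMr // mulrC -ler_pdivrMr //; apply: ltW.
  apply: lt_le_trans (archi_boundP _) _; first by rewrite divr_ge0 // ltW.
  by apply: le_trans nN; rewrite ler_nat (leq_trans _ hn) // addnCA leq_addr.
have ND2 : D2 <= (N n)%:R.
  apply: ltW; apply: lt_le_trans (archi_boundP D20) _.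
  by apply: le_trans nN; rewrite ler_nat (leq_trans _ hn) // addnA leq_addl.
have -> : f s - av n 0 0 * th A s =
  \sum_(k <- win K) qe A s k * (av n 0 (s + k%:~R * t) - av n 0 0)
  + \sum_(k <- win n | (K < `|k|)%N) av n k s
  + av n 0 0 * (\sum_(k <- win K) qe A s k - th A s).
  rewrite -[in LHS](av_sum n s) (win_split _ Kn).
  under eq_bigr do rewrite av_shift.
  under [in RHS]eq_bigr do rewrite mulrBr.
  rewrite sumrB -mulr_suml; ring.
have -> : e = e / 3 + e / 3 + e / 3 by field.
apply: le_trans (ncD _ _) _; apply: le_trans (lerD (ncD _ _) (lexx _)) _.
rewrite lerD ?lerD //.
- apply: le_trans (nc_sum _ _) _; apply: le_trans ND.
  rewrite /D mulr_suml big_seq [leRHS]big_seq; apply: ler_sum => k kK.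
  rewrite ncM -mulrA ler_wpM2l ?nc_ge0 //; have [_] := hK3 k; apply.
  apply: le_trans ND2; rewrite /D2 (bigD1_seq k) ?win_uniq //= lerDl.
  by apply: sumr_ge0 => i _; exact: nc_ge0.
- rewrite -big_filter; apply: le_trans (nc_sum _ _) _; rewrite big_filter.
  apply: le_trans KK; apply: le_trans (ler_wpM2l K40 (win_tail R K0 Kn)).
  rewrite mulr_sumr big_seq_cond [leRHS]big_seq_cond; apply: ler_sum => k /andP[kn Kk].
  by apply: h4; rewrite -mem_win kn (leq_trans _ Kk).
rewrite ncM; apply: le_trans (ler_pM (nc_ge0 _) (nc_ge0 _) (hB n) (hn1 K Kn1)) _.
by rewrite mulrA ler_pdivrMr // [leLHS]mulrC ler_wpM2l ?ltW // ltrDl.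
Qed.

(** The scalar [av n 0 0] in [approx] may depend on [n]; taking the same [n] at [s] and at [s0]
    eliminates it. *)
Lemma rank1 (s s0 : C) : f s * th (t / 2) s0 = f s0 * th (t / 2) s.
Proof.
rewrite -/A; apply: nc_eqP => e e0.
pose D := nc (th A s0) + nc (th A s) + 1.
have D0 : 0 < D by rewrite ltr_wpDl // addr_ge0 ?nc_ge0.
have ed := divr_gt0 e0 D0.
have [n1 h1] := approx s ed; have [n2 h2] := approx s0 ed.
pose n := maxn n1 n2; have {h1} g1 := h1 n (leq_maxl _ _); have {h2} g2 := h2 n (leq_maxr _ _).
set c := av n 0 0 in g1 g2.
have -> : f s * th A s0 - f s0 * th A s =
  (f s - c * th A s) * th A s0 - (f s0 - c * th A s0) * th A s by ring.
apply: le_trans (ncB _ _) _; rewrite !ncM.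
apply: le_trans (lerD (ler_wpM2r (nc_ge0 _) g1) (ler_wpM2r (nc_ge0 _) g2)) _.
by rewrite -mulrDr mulrAC ler_pdivrMr // ler_wpM2l ?ltW // ltrDl.
Qed.
End Rank1.

(** * Doubly periodic entire functions *)

Section Rank0.
Variable R : realType.
Local Notation C := R[i].

Lemma qreg_local (f : C -> C) s : qreg f -> f s != 0 ->
  exists2 d : R, 0 < d & forall h, nc h <= d -> f (s + h) != 0.
Proof.
move=> [f' /(_ (nc s))[M /(_ s (lexx _))[_ h1 h2]]] fs.
have M0 : 0 <= M by apply: le_trans h1; exact: nc_ge0.
have M1 : 0 < 2 * M + 1 by rewrite ltr_wpDl // mulr_ge0.
have fs0 : 0 < nc (f s) by rewrite nc_gt0.
exists (Num.min 1 (nc (f s) / (2 * M + 1) / 2)); first by rewrite lt_min ltr01 !divr_gt0.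
move=> h; rewrite le_min => /andP[hh1 hh2]; apply/eqP => fz.
have := h2 h hh1; rewrite fz sub0r.
have : nc (f s) <= nc (- f s - h * f' s) + nc (h * f' s).
  by rewrite -[nc (f s)]ncN; apply: le_trans (ncD _ _); rewrite subrK.
rewrite ncM; have : nc h * nc (f' s) <= nc h * M by rewrite ler_wpM2l ?nc_ge0.
have : M * nc h ^+ 2 <= M * nc h by rewrite ler_wpM2l // expr2 ler_piMl ?nc_ge0.
have : nc h * (2 * M + 1) <= nc (f s) / 2 by rewrite -ler_pdivlMr // mulrAC.
have := nc_ge0 h; lra.
Qed.

(** Liouville's theorem for elliptic functions, through [rank1]: [f (s + w) * th s] has the
    quasi-periods of theta, so [f (. + w)] takes equal values at any two nonzeros of theta. These
    fill a disc, and [w] is arbitrary, so [f] is constant on discs of a fixed radius. *)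
Lemma rank0 (t : C) (f : C -> C) : 0 < complex.Im t -> qreg f ->
  (forall s, f (s + 1) = f s) -> (forall s, f (s + t) = f s) -> forall s s0, f s = f s0.
Proof.
move=> ht fq f1 ft.
have hA : 0 < complex.Im (t / 2).
  have -> : t / 2 = t * (2^-1)%:C by rewrite fmorphV rmorph_nat.
  by rewrite ImM /= mulr0 add0r divr_gt0.
have key w s s0 : th (t / 2) s != 0 -> th (t / 2) s0 != 0 -> f (s + w) = f (s0 + w).
  move=> z z0.
  have gq : qreg (fun s => f (1 * s + w) * th (t / 2) s).
    by apply: qreg_mul (th_qreg hA); exact: qreg_affine.
  have := @rank1 R t _ ht gq _ _ s s0; rewrite !mul1r => h.
  apply: (mulIf (mulf_neq0 z z0)).
  rewrite mulrA h => [|x|x].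
  - by rewrite -mulrA [th _ s0 * _]mulrC.
  - by rewrite !mul1r addrAC f1 th_period.
  - have tE : t / 2 *+ 2 = t by rewrite -mulr_natr divfK // pnatr_eq0.
    by have := th_shift x hA; rewrite tE => e; rewrite !mul1r addrAC ft mulrCA e.
have [N [j [N0 z]]] := th_nonzero hA; set s1 : C := _ / _ in z.
have [d d0 hd] := qreg_local (th_qreg hA) z.
have loc x h : nc h <= d -> f (x + h) = f x.
  move=> hh; have := key (x - s1) (s1 + h) s1 (hd h hh) z.
  have -> : s1 + h + (x - s1) = x + h by ring.
  by have -> : s1 + (x - s1) = x by ring.
have locn x h n : nc h <= d -> f (x + n%:R * h) = f x.
  move=> hh; elim: n => [|n IH]; first by rewrite mul0r addr0.
  by rewrite -natr1 mulrDl mul1r addrA loc.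
move=> s s0; pose n := (Num.bound (nc (s - s0) / d)).+1.
have n0 : (0 < n)%N by [].
have := @locn s0 ((s - s0) / n%:R) n; rewrite [n%:R * _]mulrC divfK ?pnatr_eq0 // [s0 + _]addrC subrK; apply.
rewrite ncM ncV nc_nat ler_pdivrMr ?ltr0n // mulrC -ler_pdivrMr //; apply: ltW.
apply: lt_le_trans (archi_boundP _) _; first by rewrite divr_ge0 ?nc_ge0 // ltW.
by rewrite ler_nat.
Qed.
End Rank0.

(** * Complex derivatives at a point, with quadratic remainder *)

Section QDeriv.
Variable R : realType.
Local Notation C := R[i].
Local Open Scope classical_set_scope.

(** The local counterpart of [qreg], meant for the variable tau, where functions are meaningful only
    on the upper half-plane. *)
Definition qd (f : C -> C) (z l : C) : Prop := exists M rho : R,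
  [/\ 0 <= M, 0 < rho & forall h, nc h <= rho -> nc (f (z + h) - f z - h * l) <= M * nc h ^+ 2].

Lemma qd_ext f g z l (rho : R) : 0 < rho -> (forall h, nc h <= rho -> f (z + h) = g (z + h)) ->
  qd f z l -> qd g z l.
Proof.
move=> r0 e [M [r [M0 r1 h]]]; exists M, (Num.min rho r); split=> //.
  by rewrite lt_min r0.
move=> k; rewrite le_min => /andP[k1 k2].
have := e 0; rewrite nc0 addr0 => /(_ (ltW r0)) <-; rewrite -e //; exact: h.
Qed.

Lemma qd_lip f z l : qd f z l -> exists K rho : R, [/\ 0 <= K, 0 < rho &
  forall h, nc h <= rho -> nc (f (z + h) - f z) <= K * nc h].
Proof.
move=> [M [r [M0 r0 h]]]; exists (M + nc l), (Num.min 1 r); split.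
- by rewrite addr_ge0 ?nc_ge0.
- by rewrite lt_min ltr01.
move=> k; rewrite le_min => /andP[k1 k2].
rewrite -(subrK (k * l) (f (z + k) - f z)); apply: le_trans (ncD _ _) _.
rewrite mulrDl lerD //; last by rewrite ncM mulrC.
apply: le_trans (h k k2) _; by rewrite ler_wpM2l // expr2 ler_piMl // nc_ge0.
Qed.

Lemma qd_cst (a z : C) : qd (fun=> a) z 0.
Proof.
exists 0, 1; split=> // h _; rewrite subrr mulr0 subr0 nc0 mul0r //.
Qed.
Lemma qd_lin (a b z : C) : qd (fun w => a * w + b) z a.
Proof.
exists 0, 1; split=> // h _; rewrite mul0r.
by have -> : a * (z + h) + b - (a * z + b) - h * a = 0; [ring|rewrite nc0].
Qed.

Lemma qd_add f g z l k : qd f z l -> qd g z k -> qd (fun w => f w + g w) z (l + k).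
Proof.
move=> [M [r [M0 r0 h]]] [M' [r' [M0' r0' h']]].
exists (M + M'), (Num.min r r'); split; rewrite ?addr_ge0 ?lt_min ?r0 //.
move=> x; rewrite le_min => /andP[x1 x2].
have -> : f (z + x) + g (z + x) - (f z + g z) - x * (l + k) =
  (f (z + x) - f z - x * l) + (g (z + x) - g z - x * k) by ring.
by apply: le_trans (ncD _ _) _; rewrite mulrDl lerD ?h ?h'.
Qed.

Lemma qd_mul f g z l k : qd f z l -> qd g z k -> qd (fun w => f w * g w) z (l * g z + f z * k).
Proof.
move=> hf hg; have [K1 [r1 [K10 r10 L1]]] := qd_lip hf; have [K2 [r2 [K20 r20 L2]]] := qd_lip hg.
move: hf hg => [M [r [M0 r0 h]]] [M' [r' [M0' r0' h']]].
exists (K1 * K2 + M * nc (g z) + nc (f z) * M'), (Num.min (Num.min r r') (Num.min r1 r2)); split.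
- by rewrite !addr_ge0 // mulr_ge0 ?nc_ge0.
- by rewrite !lt_min r0 r0' r10 r20.
move=> x; rewrite !le_min => /andP[/andP[x1 x2] /andP[x3 x4]].
have -> : f (z + x) * g (z + x) - f z * g z - x * (l * g z + f z * k) =
  (f (z + x) - f z) * (g (z + x) - g z) + (f (z + x) - f z - x * l) * g z
  + f z * (g (z + x) - g z - x * k) by ring.
apply: le_trans (ncD _ _) _; apply: le_trans (lerD (ncD _ _) (lexx _)) _.
rewrite !ncM; have x0 := nc_ge0 x.
have := ler_pM (nc_ge0 _) (nc_ge0 _) (L1 x x3) (L2 x x4).
have := ler_wpM2r (nc_ge0 (g z)) (h x x1); have := ler_wpM2l (nc_ge0 (f z)) (h' x x2).
have -> : K1 * nc x * (K2 * nc x) = K1 * K2 * nc x ^+ 2 by ring.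
have -> : M * nc x ^+ 2 * nc (g z) = M * nc (g z) * nc x ^+ 2 by ring.
have -> : nc (f z) * (M' * nc x ^+ 2) = nc (f z) * M' * nc x ^+ 2 by ring.
rewrite !mulrDl; lra.
Qed.

Lemma qd_nz f z l : qd f z l -> f z != 0 -> exists rho : R, 0 < rho /\
  forall h, nc h <= rho -> nc (f z) / 2 <= nc (f (z + h)).
Proof.
move=> /qd_lip[K [r [K0 r0 L]]] fz.
have fz0 : 0 < nc (f z) by rewrite nc_gt0.
have K1 : 0 < 2 * K + 1 by rewrite ltr_wpDl // mulr_ge0.
exists (Num.min r (nc (f z) / (2 * K + 1))); split; first by rewrite lt_min r0 divr_gt0.
move=> h; rewrite le_min => /andP[h1 h2].
have := L h h1; have : nc (f z) <= nc (f (z + h)) + nc (f (z + h) - f z).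
  by rewrite ncBC; apply: le_trans (ncD _ _); rewrite addrC subrK.
have : nc h * (2 * K + 1) <= nc (f z) by rewrite -ler_pdivlMr.
have := nc_ge0 h; lra.
Qed.

Lemma qd_inv f z l : f z != 0 -> qd f z l -> qd (fun w => (f w)^-1) z (- l / f z ^+ 2).
Proof.
move=> fz hf; have [K [r1 [K0 r10 L]]] := qd_lip hf; have [r2 [r20 nz]] := qd_nz hf fz.
move: hf => [M [r [M0 r0 h]]].
have fz0 : 0 < nc (f z) by rewrite nc_gt0.
set a := nc (f z) in fz0 *.
exists (K * K * (2 / a ^+ 3) + M / a ^+ 2), (Num.min r (Num.min r1 r2)); split.
- by rewrite addr_ge0 ?mulr_ge0 ?invr_ge0 ?exprn_ge0 // ltW.
- by rewrite !lt_min r0 r10.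
move=> x; rewrite !le_min => /and3P[x1 x2 x3].
have nzx := nz x x3.
have fx : f (z + x) != 0 by rewrite -nc_gt0 (lt_le_trans _ nzx) // divr_gt0.
have -> : (f (z + x))^-1 - (f z)^-1 - x * (- l / f z ^+ 2) =
  (f (z + x) - f z) * (f (z + x) - f z) * (f z ^+ 2 * f (z + x))^-1
  - (f (z + x) - f z - x * l) / f z ^+ 2.
  by field; rewrite fz fx.
apply: le_trans (ncB _ _) _; rewrite [leRHS]mulrDl lerD //.
  rewrite 2!ncM ncV ncM ncX -/a.
  have -> : K * K * (2 / a ^+ 3) * nc x ^+ 2 = (K * nc x) * (K * nc x) * (2 / a ^+ 3) by ring.
  rewrite ler_pM ?mulr_ge0 ?invr_ge0 ?mulr_ge0 ?nc_ge0 ?sqr_ge0 //.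
    by rewrite ler_pM ?nc_ge0 // L.
  have -> : 2 / a ^+ 3 = (a ^+ 2 * (a / 2))^-1 by field; rewrite gt_eqF.
  rewrite lef_pV2 ?posrE ?mulr_gt0 ?divr_gt0 ?exprn_gt0 ?nc_gt0 //.
  by rewrite ler_wpM2l ?sqr_ge0.
rewrite ncM ncV ncX -/a.
have -> : M / a ^+ 2 * nc x ^+ 2 = M * nc x ^+ 2 / a ^+ 2 by ring.
by rewrite ler_wpM2r ?invr_ge0 ?sqr_ge0 // h.
Qed.

Lemma qd_comp f g z l k : qd g z k -> qd f (g z) l -> qd (fun w => f (g w)) z (l * k).
Proof.
move=> hg hf; have [K [r1 [K0 r10 L]]] := qd_lip hg.
move: hf hg => [M [r [M0 r0 h]]] [M' [r' [M0' r0' h']]].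
have K1 : 0 < K + 1 by rewrite ltr_wpDl.
exists (M * K ^+ 2 + nc l * M'), (Num.min (r / (K + 1)) (Num.min r1 r')); split.
- by rewrite addr_ge0 ?mulr_ge0 ?sqr_ge0 ?nc_ge0.
- by rewrite !lt_min r10 r0' !andbT divr_gt0.
move=> x; rewrite !le_min => /and3P[x1 x2 x3].
set y := g (z + x) - g z.
have yr : nc y <= r.
  apply: le_trans (L x x2) _; move: x1; rewrite ler_pdivlMr //.
  by have := nc_ge0 x; lra.
have -> : f (g (z + x)) - f (g z) - x * (l * k) =
  (f (g z + y) - f (g z) - y * l) + l * (g (z + x) - g z - x * k).
  have -> : g z + y = g (z + x) by rewrite /y addrC subrK.
  by rewrite /y; ring.
apply: le_trans (ncD _ _) _; rewrite [leRHS]mulrDl lerD //.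
  apply: le_trans (h y yr) _; rewrite -mulrA ler_wpM2l // -exprMn lerXn2r ?nnegrE ?nc_ge0 ?mulr_ge0 ?nc_ge0 //.
  exact: L.
by rewrite ncM -mulrA ler_wpM2l ?nc_ge0 // h'.
Qed.

Lemma normC_lt (e : C) : 0 < e -> exists2 r : R, 0 < r & e = r%:C.
Proof.
by case: e => a b; rewrite ltcE /= => /andP[/eqP-> a0]; exists a.
Qed.

Lemma qd_derivable f z l : qd f z l -> is_derive (z : R[i]^o) (1 : R[i]^o) (f : R[i]^o -> R[i]^o) l.
Proof.
move=> [M [r [M0 r0 h]]].
suff hc : (fun k : R[i] => k^-1 *: ((f \o shift z) (k *: 1) - f z : R[i]^o)) @ (0 : R[i]^o)^' --> (l : R[i]^o).
  by apply: DeriveDef; [apply/cvg_ex; exists l | apply: cvg_lim].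
apply/(@cvgrPdist_le R[i] R[i]^o) => _ /normC_lt[e e0 ->].
have M1 : 0 < M + 1 by rewrite ltr_wpDl.
exists (Num.min r (e / (M + 1)))%:C => /=; first by rewrite ltcR lt_min r0 divr_gt0.
move=> k /=; rewrite sub0r normrN ncE ltcR lt_min => /andP[k1 k2] k0.
have hk := h k (ltW k1).
rewrite ncE lecR /GRing.scale /= mulr1 [k + z]addrC.
have -> : l - k^-1 * (f (z + k) - f z) = - k^-1 * (f (z + k) - f z - k * l).
  by field; exact: k0.
rewrite ncM ncN ncV ler_pdivrMl ?nc_gt0 //; apply: le_trans hk _.
rewrite expr2 mulrA [leRHS]mulrC ler_wpM2r ?nc_ge0 //.
have := ltW k2; rewrite ler_pdivlMr //; have := nc_ge0 k; lra.
Qed.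

Lemma qd_continuous f z l : qd f z l -> {for (z : R[i]^o), continuous (f : R[i]^o -> R[i]^o)}.
Proof.
move=> /qd_derivable[hd _]; apply: differentiable_continuous.
exact/derivable1_diffP.
Qed.

Lemma real_qd (f : R -> R) x d : (exists M rho : R, [/\ 0 <= M, 0 < rho &
   forall h, `|h| <= rho -> `|f (x + h) - f x - h * d| <= M * h ^+ 2]) ->
  is_derive x (1 : R) f d.
Proof.
move=> [M [r [M0 r0 h]]].
suff hc : (fun k : R => k^-1 *: ((f \o shift x) (k *: 1) - f x)) @ (0 : R)^' --> d.
  by apply: DeriveDef; [apply/cvg_ex; exists d | apply: cvg_lim].
apply/cvgrPdist_le => e e0.
have M1 : 0 < M + 1 by rewrite ltr_wpDl.
exists (Num.min r (e / (M + 1))) => /=; first by rewrite lt_min r0 divr_gt0.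
move=> k /=; rewrite sub0r normrN lt_min => /andP[k1 k2] k0.
have hk := h k (ltW k1).
rewrite /GRing.scale /= mulr1 [k + x]addrC.
have -> : d - k^-1 * (f (x + k) - f x) = - k^-1 * (f (x + k) - f x - k * d).
  by field; exact: k0.
rewrite normrM normrN normfV ler_pdivrMl ?normr_gt0 //; apply: le_trans hk _.
rewrite -real_normK ?num_real // expr2 mulrA [leRHS]mulrC ler_wpM2r //.
have := ltW k2; rewrite ler_pdivlMr //; have := normr_ge0 k; lra.
Qed.

Lemma qd_line f z l (a : C) x : qd f (z + x%:C * a) l ->
  is_derive x (1 : R) (fun y : R => complex.Re (f (z + y%:C * a))) (complex.Re (a * l)) /\
  is_derive x (1 : R) (fun y : R => complex.Im (f (z + y%:C * a))) (complex.Im (a * l)).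
Proof.
move=> [M [r [M0 r0 h]]].
have a1 : 0 < nc a + 1 by rewrite ltr_wpDl ?nc_ge0.
have key (y : R) : `|y| <= r / (nc a + 1) ->
  nc (f (z + (x + y)%:C * a) - f (z + x%:C * a) - y%:C * (a * l)) <= M * nc a ^+ 2 * y ^+ 2.
  move=> hy; have := h (y%:C * a); rewrite ncM nc_real => /(_ _).
  rewrite exprMn real_normK ?num_real // [y ^+ 2 * _]mulrC mulrA mulrA.
  rewrite (_ : z + (x + y)%:C * a = z + x%:C * a + y%:C * a); last by rewrite rmorphD; ring.
  apply; move: hy; rewrite ler_pdivlMr //; have := nc_ge0 a; have := normr_ge0 y; nra.
have ReyM (y : R) w : complex.Re (y%:C * w) = y * complex.Re w by rewrite ReM /= mul0r subr0.
have ImyM (y : R) w : complex.Im (y%:C * w) = y * complex.Im w by rewrite ImM /= mul0r addr0.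
split; apply: real_qd; exists (M * nc a ^+ 2), (r / (nc a + 1)); split;
  rewrite ?mulr_ge0 ?exprn_ge0 ?nc_ge0 ?divr_gt0 // => y hy; apply: le_trans (key y hy).
  by rewrite -ReyM -2!ReB nc_Re.
by rewrite -ImyM -2!ImB nc_Im.
Qed.

Lemma qd0_const f z0 z1 :
  (forall x : R, 0 <= x <= 1 -> qd f (z0 + x%:C * (z1 - z0)) 0) -> f z0 = f z1.
Proof.
move=> h.
have part (p : C -> R) :
  (forall x : R, 0 <= x <= 1 -> is_derive x (1 : R) (fun y : R => p (f (z0 + y%:C * (z1 - z0)))) 0) ->
  p (f z0) = p (f z1).
  move=> hp; pose g (y : R) := p (f (z0 + y%:C * (z1 - z0))).
  have cg : ({within `[0, 1], continuous g})%classic.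
    apply: derivable_within_continuous => x; rewrite in_itv /= => x01.
    by have [] := hp x x01.
  have [|c _] := @MVT_segment R g (fun=> 0) 0 1 ler01 _ cg.
    move=> x; rewrite in_itv /= => /andP[x0 x1]; apply: hp.
    by rewrite !ltW.
  rewrite mul0r /g mul0r addr0 mul1r [z0 + _]addrC subrK => /eqP.
  by rewrite subr_eq0 => /eqP ->.
apply: cP; apply: part => x x01; have := qd_line (h x x01); rewrite mulr0.
  by case.
by case.
Qed.
End QDeriv.

(** * The inversion formula for the one-variable theta series *)

Section Inversion.
Variable R : realType.
Local Notation C := R[i].
Local Notation ee := (@ee R).
Local Notation ImC := (@complex.Im R).

Lemma uhp_neq0 (t : C) : 0 < ImC t -> t != 0.
Proof. by move=> h; apply/eqP => e; move: h; rewrite e ltxx. Qed.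

Lemma Im_scale (x : R) (t : C) : complex.Im (t * x%:C) = complex.Im t * x.
Proof. by rewrite ImM /= mulr0 add0r. Qed.

Lemma Im_divn (t : C) n : (0 < n)%N -> 0 < ImC t -> 0 < ImC (t / n%:R).
Proof.
move=> n0 ht; have -> : t / n%:R = t * (n%:R^-1)%:C by rewrite fmorphV rmorph_nat.
by rewrite Im_scale divr_gt0 // ltr0n.
Qed.

Lemma ImN (z : C) : complex.Im (- z) = - complex.Im z. Proof. by case: z. Qed.
Lemma ImV (z : C) : complex.Im z^-1 = - complex.Im z / nc z ^+ 2.
Proof.
by case: z => a b /=; rewrite /nc /= sqr_sqrtr ?addr_ge0 ?sqr_ge0 // mulNr.
Qed.

Lemma Im_inv (t : C) : 0 < ImC t -> 0 < ImC (- t^-1).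
Proof.
move=> ht; rewrite ImN ImV mulNr opprK divr_gt0 // exprn_gt0 // nc_gt0.
exact: uhp_neq0.
Qed.

Definition Aof (t : C) : C := - t^-1 / 2%:R.
(** As a series ([hs_Xinv]) this is the sum of the Gaussians [ee (- (s - k)^2 / (2 t))], one side of
    Poisson summation. The [+ 0] gives it the shape handled by [qreg_affine]. *)
Definition Xinv (t s : C) : C := ee (Aof t * s ^+ 2) * th (Aof t) (t^-1 * s + 0).

Lemma Aof_gt0 t : 0 < ImC t -> 0 < ImC (Aof t).
Proof. by move=> ht; apply: Im_divn => //; exact: Im_inv. Qed.

Lemma hs_Xinv t s : 0 < ImC t -> hs (fun k : int => ee (Aof t * (s - k%:~R) ^+ 2)) (Xinv t s).
Proof.
move=> ht; apply: hs_ext (hsZ _ (hs_th _ (Aof_gt0 ht))) => k.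
rewrite /qe -eeD; congr ee; rewrite /Aof; field; exact: uhp_neq0.
Qed.

Lemma Xinv_rank1 t s s0 : 0 < ImC t ->
  Xinv t s * th (t / 2) s0 = Xinv t s0 * th (t / 2) s.
Proof.
move=> ht; have hA := Aof_gt0 ht; have tz := uhp_neq0 ht.
apply: rank1 => //.
- apply: qreg_mul; first exact: qreg_gauss.
  exact: qreg_affine (th_qreg hA).
- move=> x; rewrite /Xinv.
  have := th_shift (t^-1 * (x + 1) + 0) hA.
  have -> : t^-1 * (x + 1) + 0 + Aof t *+ 2 = t^-1 * x + 0.
    by rewrite /Aof; field; exact: tz.
  move=> ->; rewrite mulrA -eeD; congr (ee _ * _).
  by rewrite /Aof; field; exact: tz.
move=> x; rewrite /Xinv.
have -> : t^-1 * (x + t) + 0 = t^-1 * x + 0 + 1 by field; exact: tz.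
rewrite th_period // mulrA -eeD; congr (ee _ * _).
by rewrite /Aof; field; exact: tz.
Qed.

(* The scalar relating the two sides of the inversion formula. Its square is
   found up to a constant from its behaviour under [t |-> t / N^2] alone. *)
Lemma minv_ex t : exists m : C, 0 < ImC t -> forall s, Xinv t s = m * th (t / 2) s.
Proof.
have [ht|_] := boolP (0 < ImC t); last by exists 0.
have [N [j [N0 z]]] := th_nonzero (Im_divn (isT : (0 < 2)%N) ht).
exists (Xinv t (j%:R / N%:R) / th (t / 2) (j%:R / N%:R)) => _ s.
by apply: (mulIf z); rewrite [RHS]mulrAC divfK // Xinv_rank1.
Qed.
Definition minv t : C := sval (cid (minv_ex t)).
Lemma minvP t s : 0 < ImC t -> Xinv t s = minv t * th (t / 2) s.
Proof. by move=> ht; exact: (svalP (cid (minv_ex t))). Qed.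

Lemma sum_residue N (k : int) (v : C) : (0 < N)%N ->
  \sum_(j < N) (if (k %% N%:Z)%Z == j%:Z then v else 0) = v.
Proof.
move=> N0; have NZ : N%:Z != 0 by rewrite eqz_nat -lt0n.
have lt : (absz (k %% N%:Z)%Z < N)%N.
  by rewrite -ltz_nat gez0_abs ?modz_ge0 // ltz_pmod.
rewrite (bigD1 (Ordinal lt)) //= gez0_abs ?modz_ge0 // eqxx big1 ?addr0 // => j jn.
case: eqP => // e; move/negP: jn; case; apply/eqP/val_inj => /=.
by rewrite e absz_nat.
Qed.

Lemma hs_dilate N (j : nat) (y : int -> C) l : (j < N)%N -> hs (fun m => y (N%:Z * m + j%:Z)) l ->
  hs (fun k => if (k %% N%:Z)%Z == j%:Z then y k else 0) l.
Proof.
move=> jN; have N0 : (0 < N)%N by apply: leq_ltn_trans jN.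
have NZ : N%:Z != 0 by rewrite eqz_nat -lt0n.
have dm (m : int) : (((N%:Z * m + j%:Z) %% N%:Z)%Z = j%:Z) /\ (((N%:Z * m + j%:Z) %/ N%:Z)%Z = m).
  rewrite mulrC modzMDl divzMDl // modz_small ?divz_small ?addr0 //.
apply: (@hs_transport _ _ _ _ _ (fun k => (k %/ N%:Z)%Z) (fun m => N%:Z * m + j%:Z)) => [k|m].
  case: ifP => [/eqP e _|]; last by rewrite eqxx.
  by rewrite mulrC -e -divz_eq.
by move=> _; have [-> ->] := dm m; rewrite eqxx.
Qed.

(** Sorting the Gaussians by the residue of [k] mod [N] writes [Xinv t] as a sum of [N] translates
    of [Xinv] at [t / N^2]. On the theta side, the same sum of translates retains the multiples of
    [N] with weight [N]. *)
Lemma minv_scale t N : (0 < N)%N -> 0 < ImC t -> minv t = N%:R * minv (t / N%:R ^+ 2).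
Proof.
move=> N0 ht; have tz := uhp_neq0 ht.
have Nz : N%:R != 0 :> C by rewrite pnatr_eq0 -lt0n.
set t' := t / N%:R ^+ 2.
have ht' : 0 < ImC t' by rewrite /t' -natrX; apply: Im_divn => //; rewrite expn_gt0 N0.
have [n [j0 [n0 z]]] := th_nonzero (Im_divn (isT : (0 < 2)%N) ht).
set s : C := j0%:R / n%:R in z; apply: (mulIf z); rewrite -minvP //.
have -> : Xinv t s = \sum_(j < N) Xinv t' ((s - j%:R) / N%:R).
  apply: hs_unique (hs_Xinv s ht) _.
  have h (j : 'I_N) : hs (fun k : int => if (k %% N%:Z)%Z == j%:Z then ee (Aof t * (s - k%:~R) ^+ 2) else 0)
      (Xinv t' ((s - j%:R) / N%:R)).
    apply: hs_dilate => //; apply: hs_ext (hs_Xinv _ ht') => m; congr ee.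
    rewrite rmorphD rmorphM /= -!pmulrn /Aof /t'; field; rewrite ?Nz ?tz //.
  by apply: hs_ext (hs_sum (index_enum 'I_N) h) => k; rewrite sum_residue.
under eq_bigr do rewrite minvP //.
rewrite -mulr_sumr (mulrC N%:R) -(mulrA (minv t')); congr (minv t' * _).
have hA := Im_divn (isT : (0 < 2)%N) ht; have hA' := Im_divn (isT : (0 < 2)%N) ht'.
apply: hs_unique (hs_sum (index_enum 'I_N) (fun j : 'I_N => hs_th ((s - j%:R) / N%:R) hA')) _.
have h0 : hs (fun k : int => if (k %% N%:Z)%Z == 0%N%:Z then qe (t' / 2) (s / N%:R) k else 0) (th (t / 2) s).
  apply: hs_dilate => //; apply: hs_ext (hs_th s hA) => m; rewrite /qe; congr ee.
  rewrite addr0 rmorphM /= -!pmulrn /t'; field; exact: Nz.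
apply: hs_ext (hsZ N%:R h0) => k.
transitivity (qe (t' / 2) (s / N%:R) k * \sum_(j < N) ee ((- k)%:~R * j%:R / N%:R)).
  rewrite root_sum // dvdzE abszN -dvdzE.
  have -> : (N %| k)%Z = ((k %% N%:Z)%Z == 0%N%:Z) by apply/dvdz_mod0P/eqP.
  by case: ifP => _; rewrite ?mulr0 // mulrC.
rewrite mulr_sumr; apply: eq_bigr => j _; rewrite /qe -eeD; congr ee.
by rewrite rmorphN /=; field; exact: Nz.
Qed.

Lemma qd_thwA chi j A B : bchar chi -> 0 < ImC A -> qd (fun A => thw chi j A B) A (thw chi j.+1 A B).
Proof. by move=> hc hA; have [M [r [? ? h]]] := thw_diffA j B hc hA; exists M, r. Qed.

Lemma qd_minv t : 0 < ImC t -> exists l, qd minv t l.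
Proof.
move=> ht; have tz := uhp_neq0 ht.
have [N [j [N0 z]]] := th_nonzero (Im_divn (isT : (0 < 2)%N) ht).
have Nz : N%:R != 0 :> C by rewrite pnatr_eq0 -lt0n.
pose j1 := (N - j %% N)%N; pose r := (j1 %% N)%N.
have rN : (r < N)%N by rewrite ltn_mod.
(* At [s = j / N] the exponents are [Aof w / N^2 * (N k - j)^2]: the series runs over the integers
   congruent to [- j], and [w] occurs only in the first argument of [thw], in which derivatives are
   known. *)
pose chi (k : int) : C := if (k %% N%:Z)%Z == ((- j%:Z) %% N%:Z)%Z then 1 else 0.
have hchi : bchar chi by move=> k; rewrite /chi; case: ifP; rewrite ?nc1 ?nc0.
pose g (w : C) := thw chi 0 (Aof w / N%:R ^+ 2) 0.
have gE w : 0 < ImC w -> Xinv w (j%:R / N%:R) = g w.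
  move=> hw; have wz := uhp_neq0 hw.
  have hAw : 0 < ImC (Aof w / N%:R ^+ 2).
    by rewrite -natrX; apply: Im_divn; [rewrite expn_gt0 N0|exact: Aof_gt0].
  apply: hs_unique (hs_Xinv _ hw) _.
  have NZ : N%:Z != 0 by rewrite eqz_nat -lt0n.
  apply: (@hs_transport _ _ _ _ _ (fun k => N%:Z * k - j%:Z) (fun m => ((m + j%:Z) %/ N%:Z)%Z)
     _ _ _ (hs_thw 0 0 hchi hAw)) => [k _|m].
    rewrite subrK mulKz //; split=> //.
    rewrite /thterm expr0 mulr1 /chi [N%:Z * k]mulrC modzMDl eqxx mul1r /qe; congr ee.
    by rewrite rmorphB rmorphM /= -!pmulrn; field.
  rewrite /thterm /chi; case: ifP => [/eqP e _|_]; last by rewrite !mul0r eqxx.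
  have dv : (N %| m + j%:Z)%Z by rewrite -[j%:Z]opprK -eqz_mod_dvd; apply/eqP.
  rewrite mulrC divzK // addrK; split=> //.
  rewrite expr0 !mul1r /qe; congr ee.
  have -> : (((m + j%:Z) %/ N%:Z)%Z%:~R : C) = (m%:~R + j%:R) / N%:R.
    by apply: (mulIf Nz); rewrite divfK // pmulrn -rmorphM /= divzK // rmorphD.
  by field.
have [lA hlA] : exists l, qd (fun w => Aof w / N%:R ^+ 2) t l.
  have h := qd_inv (f := fun w => 1 * w + 0) (z := t) _ (qd_lin 1 0 t).
  rewrite mul1r addr0 in h; have := h tz => {}h.
  eexists; apply: qd_ext (qd_mul (qd_cst (- (2 * N%:R ^+ 2)^-1) t) h); first exact: ltr01.
  move=> x _ /=; rewrite /Aof mul1r addr0 invfM; ring.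
have hAt : 0 < ImC (Aof t / N%:R ^+ 2).
  by rewrite -natrX; apply: Im_divn; [rewrite expn_gt0 N0|exact: Aof_gt0].
have hg := qd_comp hlA (qd_thwA 0 0 hchi hAt).
have h2 : qd (fun w => th (w / 2) (j%:R / N%:R)) t (thw (fun=> 1) 1 (t / 2) (j%:R / N%:R) * 2^-1).
  have hl := qd_lin 2^-1 0 t.
  have := qd_comp hl (qd_thwA 0 (j%:R / N%:R) (bchar1 R) _).
  rewrite addr0 [2^-1 * t]mulrC => /(_ (Im_divn (isT : (0 < 2)%N) ht)).
  by apply: qd_ext ltr01 _ => x _; rewrite addr0 mulrC.
have [rho [rho0 hz]] := qd_nz h2 z.
have hi := @qd_inv R (fun w => th (w / 2) (j%:R / N%:R)) t _ z h2.
have hm := qd_mul hg hi.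
have r0' : 0 < Num.min rho (ImC t / 2) by rewrite lt_min rho0 divr_gt0.
eexists; apply: (@qd_ext R _ minv t _ _ r0' _ hm).
move=> h; rewrite le_min => /andP[h1 h3].
have hth : 0 < ImC (t + h).
  by rewrite ImD; have := nc_Im h; rewrite ler_norml => /andP[+ _]; have := ht; lra.
have zh : th ((t + h) / 2) (j%:R / N%:R) != 0.
  by rewrite -nc_gt0 (lt_le_trans _ (hz h h1)) // divr_gt0 // nc_gt0.
by rewrite -/(g (t + h)) -gE // minvP // mulfK.
Qed.

(** The scalar [minv] is expected to be a constant times a square root of [t]; squaring avoids
    choosing the root. *)
Definition pinv t : C := minv t ^+ 2 / t.

Lemma pinv_scale t N : (0 < N)%N -> 0 < ImC t -> pinv t = pinv (t / N%:R ^+ 2).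
Proof.
move=> N0 ht; have tz := uhp_neq0 ht.
have Nz : N%:R != 0 :> C by rewrite pnatr_eq0 -lt0n.
rewrite /pinv (minv_scale N0 ht); field; rewrite ?Nz ?tz //.
Qed.

(* [pinv] takes the same value at [t] and at the points [t * ((n + 1) / n)^2],
   which accumulate at [t]. *)
Lemma qd_pinv t : 0 < ImC t -> qd pinv t 0.
Proof.
move=> ht; have tz := uhp_neq0 ht; have [l hl] := qd_minv ht.
have [k hk] : exists k, qd pinv t k.
  have h := qd_inv (f := fun w => 1 * w + 0) (z := t) _ (qd_lin 1 0 t).
  rewrite mul1r addr0 in h; have := h tz => {}h.
  eexists; apply: qd_ext (qd_mul (qd_mul hl hl) h); first exact: ltr01.
  by move=> x _; rewrite /pinv mul1r addr0 expr2.
suff -> : (0 : C) = k by [].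
move: hk => [M [rho [M0 rho0 h]]]; apply: nc_eqP => e e0.
have tn : 0 < nc t by rewrite nc_gt0.
(* Since [|x| <= 3 |t| / n], the two bounds put [x] within [rho] and make [M * |x| <= e]. *)
pose n := (Num.bound (3 * nc t / rho) + Num.bound (M * (3 * nc t) / e)).+1.
have n0 : 0 < n%:R :> R by rewrite ltr0n.
have nC : n%:R != 0 :> C by rewrite pnatr_eq0.
pose x : C := t * ((2 * n + 1)%N%:R / n%:R ^+ 2).
have xE : t + x = t / n%:R ^+ 2 * n.+1%:R ^+ 2.
  rewrite /x -[n.+1%:R]natr1 natrD natrM; field; exact: nC.
have px : pinv (t + x) = pinv t.
  have ht1 : 0 < ImC (t / n%:R ^+ 2) by rewrite -natrX; apply: Im_divn => //; rewrite expn_gt0.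
  rewrite [RHS](@pinv_scale t n) // (@pinv_scale (t + x) n.+1) //.
    by rewrite xE mulfK // expf_neq0 // pnatr_eq0.
  have -> : t + x = t / n%:R ^+ 2 * (n.+1%:R ^+ 2 : R)%:C by rewrite xE rmorphXn rmorph_nat.
  by rewrite Im_scale mulr_gt0 // exprn_gt0.
have nx : nc x = nc t * ((2 * n + 1)%N%:R / n%:R ^+ 2) by rewrite 2!ncM ncV ncX !nc_nat.
have x0 : 0 < nc x by rewrite nx mulr_gt0 ?divr_gt0 ?exprn_gt0 ?ltr0n ?addn1.
have nx3 : nc x <= 3 * nc t / n%:R.
  rewrite nx ler_pdivlMr // -mulrA (mulrC 3) ler_wpM2l ?nc_ge0 //.
  rewrite expr2 invfM -!mulrA mulVf ?mulr1 ?gt_eqF // ler_pdivrMr // -natrM ler_nat.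
  by rewrite /n; lia.
have b1 : 3 * nc t / rho <= n%:R.
  apply: ltW; apply: lt_le_trans (archi_boundP _) _; first by rewrite divr_ge0 ?mulr_ge0 ?nc_ge0 // ltW.
  by rewrite ler_nat leqW // leq_addr.
have b2 : M * (3 * nc t) / e <= n%:R.
  apply: ltW; apply: lt_le_trans (archi_boundP _) _; first by rewrite divr_ge0 ?mulr_ge0 ?nc_ge0 // ltW.
  by rewrite ler_nat leqW // leq_addl.
have xr : nc x <= rho.
  by apply: le_trans nx3 _; rewrite ler_pdivrMr // [leRHS]mulrC -ler_pdivrMr.
have := h x xr; rewrite px subrr sub0r ncN ncM sub0r ncN expr2 [M * _]mulrCA ler_pM2l // => hk.
apply: le_trans hk _; apply: le_trans (ler_wpM2l M0 nx3) _.
by rewrite mulrA ler_pdivrMr // [leRHS]mulrC -ler_pdivrMr.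
Qed.

Lemma pinv_const t t' : 0 < ImC t -> 0 < ImC t' -> pinv t = pinv t'.
Proof.
move=> ht ht'; apply: qd0_const => x /andP[x0 x1]; apply: qd_pinv.
rewrite ImD [_ * (t' - t)]mulrC Im_scale ImB.
have -> : ImC t + (ImC t' - ImC t) * x = (1 - x) * ImC t + x * ImC t' by ring.
have [->|xn] := eqVneq x 0; first by rewrite subr0 mul1r mul0r addr0.
apply: ltr_wpDl; first by rewrite mulr_ge0 ?subr_ge0 // ltW.
by rewrite mulr_gt0 // lt_neqAle eq_sym xn.
Qed.
End Inversion.

(** * Connectedness of the half-plane and the branch of the square root *)

Section Connected.
Variable R : realType.
Local Open Scope classical_set_scope.

(** Clamping the parameter keeps the segment between two points of the half-plane inside it for
    every real parameter, so the path is a total function. *)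
Definition clamp (x : R) : R := Num.max 0 (Num.min x 1).
Lemma clamp01 x : 0 <= clamp x <= 1.
Proof. by rewrite /clamp le_max lexx /= ge_max ler01 ge_min lexx orbT. Qed.
Lemma clamp_cont : continuous clamp.
Proof.
move=> x; have hc (a : R) : {for x, continuous (fun=> a : R)} by exact: cst_continuous.
have h1 := @continuous_min R R id (fun=> 1) x (@cvg_id _ (nbhs x)) (hc 1).
exact: (@continuous_max R R (fun=> 0) _ x (hc 0) h1).
Qed.

Lemma path_Im (t0 t1 : uhp R) x : 0 < complex.Im (uval t0 + (clamp x)%:C * (uval t1 - uval t0)).
Proof.
have /andP[x0 x1] := clamp01 x; move: (clamp x) x0 x1 => {}x x0 x1.
rewrite ImD [_ * (_ - _)]mulrC Im_scale ImB.
have ht := uvalP t0; have ht' := uvalP t1.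
set a := complex.Im _ in ht *; set b := complex.Im _ in ht' *.
have -> : a + (b - a) * x = (1 - x) * a + x * b by ring.
have [->|xn] := eqVneq x 0; first by rewrite subr0 mul1r mul0r addr0.
apply: ltr_wpDl; first by rewrite mulr_ge0 ?subr_ge0 // ltW.
by rewrite mulr_gt0 // lt_neqAle eq_sym xn.
Qed.

Definition upath (t0 t1 : uhp R) (x : R) : uhp R := mk_uhp (path_Im t0 t1 x).

Lemma upath_cont t0 t1 : continuous (upath t0 t1).
Proof.
apply: to_uhp_continuous => x.
apply: (@continuousD R[i] R[i]^o R (fun=> uval t0)); first exact: cst_continuous.
apply: (@continuousM R[i] R (fun x => (clamp x)%:C : R[i]^o) (fun=> uval t1 - uval t0)).
  apply: (@continuous_comp R R R[i]^o clamp); first exact: clamp_cont.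
  exact: real_complex_continuous.
exact: cst_continuous.
Qed.

(** Along a path [f / f t0] takes only the values 1 and -1, and by the intermediate value theorem it
    cannot pass from one to the other. *)
Lemma uhp_sq_const (f : uhp R -> R[i]) : continuous (f : uhp R -> R[i]^o) ->
  (forall t t', f t ^+ 2 = f t' ^+ 2) -> forall t t', f t = f t'.
Proof.
move=> cf h t0 t1; have [f0|f0] := eqVneq (f t0) 0.
  have := h t0 t1; rewrite f0 expr0n /= => /esym/eqP.
  by rewrite expf_eq0 /= => /eqP ->.
have /eqP : f t1 ^+ 2 = f t0 ^+ 2 by [].
rewrite eqf_sqr => /orP[/eqP //|/eqP e1].
pose g (x : R) := complex.Re (f (upath t0 t1 x) / f t0).
have gpm x : g x = 1 \/ g x = -1.
  have /eqP := h (upath t0 t1 x) t0; rewrite eqf_sqr /g => /orP[] /eqP ->.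
    by left; rewrite divff.
  by right; rewrite mulNr divff.
have cg : continuous g.
  move=> x; apply: (@continuous_comp R R[i]^o R (fun x => f (upath t0 t1 x) / f t0)); last exact: Re_continuous.
  apply: (@continuousM R[i] R (fun x => f (upath t0 t1 x)) (fun=> (f t0)^-1)); last exact: cst_continuous.
  by apply: (@continuous_comp R _ R[i]^o (upath t0 t1) f); [exact: upath_cont|exact: cf].
have e0' : upath t0 t1 0 = t0.
  apply: uval_inj; rewrite uval_mk /clamp (min_idPl ler01) maxxx mul0r addr0 //.
have e1' : upath t0 t1 1 = t1.
  apply: uval_inj; rewrite uval_mk /clamp minxx (max_idPr ler01) mul1r addrC subrK //.
have g0 : g 0 = 1 by rewrite /g e0' divff.
have g1 : g 1 = -1 by rewrite /g e1' e1 mulNr divff.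
have [|c _ gc] := @IVT R g 0 1 0 ler01 (continuous_subspaceT cg).
  by rewrite g0 g1 ge_min le_max ler01 lerN10 orbT.
by case: (gpm c); rewrite gc => /eqP; rewrite eq_sym ?oppr_eq0 oner_eq0.
Qed.

Lemma usqrt_neq0 (t : uhp R) : usqrt t != 0.
Proof. by apply/eqP => e; have := usqrt_Re t; rewrite e ltxx. Qed.

(** The quotient [minv / usqrt] is continuous with square [pinv], which is constant. The value of
    [kappa] is left open; the Gauss sum relations fix the final constant. *)
Lemma th_inversion : exists kappa : R[i], forall (t : uhp R) (s : R[i]),
  th (- (uval t)^-1 / 2) (s / uval t) =
  kappa * usqrt t * ee (s ^+ 2 / (2 * uval t)) * th (uval t / 2) s.
Proof.
pose f (t : uhp R) := minv (uval t) / usqrt t.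
have cf : continuous (f : uhp R -> R[i]^o).
  move=> t; apply: (@continuousM R[i] _ (fun t : uhp R => minv (uval t) : R[i]^o) (fun t => (usqrt t)^-1)).
    apply: (@continuous_comp _ R[i]^o R[i]^o); first exact: uval_continuous.
    by have [l hl] := qd_minv (uvalP t); exact: qd_continuous hl.
  apply: (@continuousV R[i] _ (@usqrt R)); first exact: usqrt_neq0.
  exact: usqrt_continuous.
have f2 (t : uhp R) : f t ^+ 2 = pinv (uval t).
  by rewrite /f exprMn exprVn /usqrt sqr_sqrtc.
have fc := uhp_sq_const cf (fun t t' => _).
exists (f (mk_uhp (@ImI_gt0 R))) => t s.
have -> : f (mk_uhp (@ImI_gt0 R)) = f t.
  by apply: fc => u v; rewrite !f2; apply: pinv_const; exact: uvalP.
have tz := uhp_neq0 (uvalP t).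
rewrite /f divfK ?usqrt_neq0 // mulrAC -minvP ?uvalP // /Xinv addr0 mulrAC -eeD.
rewrite [(_ : R[i])^-1 * s]mulrC -[LHS]mul1r; congr (_ * _).
by rewrite -[LHS]ee0; congr ee; rewrite /Aof; field; exact: tz.
Qed.
End Connected.

(** * Generators of the metaplectic group *)

Section Mp2Generation.
Variable R : realType.
Local Notation Mp := (Mp2Z R).
Local Open Scope classical_set_scope.

Lemma usqrt_Im (t : uhp R) : 0 < complex.Im (usqrt t).
Proof.
have h := usqrt_Re t; have := congr1 (@complex.Im R) (sqr_sqrtc (uval t)).
rewrite -/(usqrt t) expr2 ImM => e; have := uvalP t; rewrite -e.
move: (complex.Re _) (complex.Im _) h => x y x0.
by rewrite [y * x]mulrC -mulrDl -mulr2n pmulr_rgt0 // mulr2n addr_gt0.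
Qed.

(** Principal roots of points of the upper half-plane lie in the open first quadrant, so the product
    of two has positive imaginary part; this excludes the opposite sign. *)
Lemma usqrt_prod (t u v : uhp R) : uval t = uval u * uval v -> usqrt u * usqrt v = usqrt t.
Proof.
move=> e; have : (usqrt u * usqrt v) ^+ 2 = usqrt t ^+ 2.
  by rewrite exprMn /usqrt !sqr_sqrtc e.
move/eqP; rewrite eqf_sqr => /orP[/eqP //|/eqP h].
exfalso; have := congr1 (@complex.Im R) h; rewrite ImN ImM.
have := usqrt_Im t; have := mulr_gt0 (usqrt_Re u) (usqrt_Im v).
have := mulr_gt0 (usqrt_Im u) (usqrt_Re v); lra.
Qed.

Lemma mp_actM (x y : Mp) t : mp_act (x * y)%g t = mp_act x (mp_act y t).
Proof. exact: moebiusM. Qed.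
Lemma mp_act1 t : mp_act (1%g : Mp) t = t. Proof. exact: moebius1. Qed.
Lemma mp_phiM (x y : Mp) t : mp_phi (x * y)%g t = mp_phi x (mp_act y t) * mp_phi y t.
Proof. by []. Qed.
Lemma mp_matM (x y : Mp) : mp_mat (x * y)%g = mp_mat x *m mp_mat y.
Proof. by []. Qed.
Lemma mp_jM (x y : Mp) t : mp_j (x * y)%g t = mp_j x (mp_act y t) * mp_j y t.
Proof. exact: jfacM. Qed.

Lemma uval_actT t : uval (mp_act (mpT R) t) = uval t + 1.
Proof. by rewrite uval_mk /moebius_val /jfac /= !mxE /= mul0r add0r mul1r divr1. Qed.
Lemma uval_actS t : uval (mp_act (mpS R) t) = - (uval t)^-1.
Proof.
by rewrite uval_mk /moebius_val /jfac /= !mxE /= mul0r add0r mul1r addr0 mulN1r.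
Qed.
Lemma mp_jT t : mp_j (mpT R) t = 1.
Proof. by rewrite /mp_j /jfac /= !mxE /= mul0r add0r. Qed.
Lemma mp_jS t : mp_j (mpS R) t = uval t.
Proof. by rewrite /mp_j /jfac /= !mxE /= mul1r addr0. Qed.
Lemma mp_phiT t : mp_phi (mpT R) t = 1. Proof. by []. Qed.
Lemma mp_phiS t : mp_phi (mpS R) t = usqrt t. Proof. by []. Qed.

Lemma mat2P (A B : 'M[int]_2) : A 0 0 = B 0 0 -> A 0 1 = B 0 1 -> A 1 0 = B 1 0 ->
  A 1 1 = B 1 1 -> A = B.
Proof.
move=> h1 h2 h3 h4; apply/matrixP => i j.
have o (k : 'I_2) : k = 0 \/ k = 1.
  by case: k => -[|[|//]] hk; [left|right]; apply/val_inj.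
by case: (o i) => ->; case: (o j) => ->.
Qed.

(** The relation [(S T)^3 = S^2] with one [S] cancelled; it holds in the double cover because
    [usqrt_prod] controls the sign of the root. *)
Lemma mp_rel : (mpT R * mpS R * mpT R * mpS R * mpT R)%g = mpS R.
Proof.
apply: Mp2Z_eq => [|t].
  by apply: mat2P; rewrite !mulmx2E !mxE.
rewrite !mp_phiM !mp_phiT !mp_phiS !mulr1 mul1r; apply: usqrt_prod.
rewrite !(uval_actT, uval_actS).
have : uval (mp_act (mpT R) t) != 0 by exact/uhp_neq0/uvalP.
rewrite uval_actT => nz; field; exact: nz.
Qed.

Lemma mp_phi_sign (x y : Mp) : mp_mat x = mp_mat y ->
  (forall t, mp_phi x t = mp_phi y t) \/ (forall t, mp_phi x t = - mp_phi y t).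
Proof.
move=> e; pose f t := mp_phi x t / mp_phi y t.
have f2 t : f t ^+ 2 = 1.
  by rewrite /f exprMn exprVn !mp_sqr e divff // -(mp_sqr y) expf_neq0 // mp_phi_neq0.
have cf : continuous (f : uhp R -> R[i]^o).
  move=> t; apply: (@continuousM R[i] _ (mp_phi x) (fun t => (mp_phi y t)^-1)).
    exact: mp_cont.
  apply: (@continuousV R[i] _ (mp_phi y)); first exact: mp_phi_neq0.
  exact: mp_cont.
have fc := uhp_sq_const cf (fun t t' => etrans (f2 t) (esym (f2 t'))).
pose t0 := mk_uhp (@ImI_gt0 R).
have /eqP : f t0 ^+ 2 = 1 by [].
rewrite sqrf_eq1 => /orP[] /eqP ft0; [left|right] => t.
  by apply: (mulIf (invr_neq0 (mp_phi_neq0 y t))); rewrite divff ?mp_phi_neq0 // -/(f t) (fc t t0).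
apply: (mulIf (invr_neq0 (mp_phi_neq0 y t))).
by rewrite mulNr divff ?mp_phi_neq0 // -/(f t) (fc t t0).
Qed.

Variable P : Mp -> Prop.
Hypothesis PT : P (mpT R).
Hypothesis PS : P (mpS R).
Hypothesis PM : forall x y, P x -> P y -> P (x * y)%g.
Hypothesis PV : forall x, P x -> P x^-1%g.

Let P1 : P 1%g. Proof. by rewrite -(mulgV (mpS R)); apply: PM => //; exact: PV. Qed.

Definition mpZ : Mp := (mpS R * mpS R)%g.
Let PZ : P mpZ. Proof. exact: PM. Qed.
Lemma mpZ_mat : mp_mat mpZ = - 1%:M.
Proof. by apply: mat2P; rewrite mulmx2E !mxE. Qed.
Lemma mpZ_phi2 t : mp_phi mpZ t ^+ 2 = -1.
Proof.
rewrite mp_sqr mpZ_mat /jfac !mxE /= oppr0 mul0r add0r mulr1n rmorphN /=.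
by rewrite rmorph1.
Qed.
Lemma mpZZ_phi t : mp_phi (mpZ * mpZ)%g t = -1.
Proof.
rewrite mp_phiM (_ : mp_act mpZ t = t) -?expr2 ?mpZ_phi2 //.
apply: uval_inj; rewrite uval_mk /moebius_val /jfac mpZ_mat !mxE /= oppr0 !mul0r.
by rewrite !mulr1n add0r addr0 !rmorphN /= rmorph1 mulN1r divrNN divr1.
Qed.
Lemma mpZZ_mat : mp_mat (mpZ * mpZ)%g = 1%:M.
Proof. by rewrite mp_matM mpZ_mat mulNmx mulmxN opprK mulmx1. Qed.

(* Two metaplectic elements over the same matrix differ by the central element S^4. *)
Lemma P_same_mat (x y : Mp) : mp_mat x = mp_mat y -> P y -> P x.
Proof.
move=> e Py; case: (mp_phi_sign e) => h.
  by rewrite (Mp2Z_eq e h).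
rewrite (_ : x = (mpZ * mpZ * y)%g); first by do 2![apply: PM => //].
apply: Mp2Z_eq => [|t]; first by rewrite mp_matM mpZZ_mat mul1mx.
by rewrite mp_phiM mpZZ_phi mulN1r.
Qed.

Lemma P_Tn (n : int) : exists2 x : Mp, P x & [/\ mp_mat x 0 0 = 1, mp_mat x 0 1 = n,
  mp_mat x 1 0 = 0 & mp_mat x 1 1 = 1].
Proof.
have nat_case (k : nat) : exists2 x : Mp, P x & [/\ mp_mat x 0 0 = 1, mp_mat x 0 1 = k%:Z,
    mp_mat x 1 0 = 0 & mp_mat x 1 1 = 1].
  elim: k => [|k [x Px [e1 e2 e3 e4]]]; first by exists 1%g => //; rewrite /= !mxE.
  exists (mpT R * x)%g; first exact: PM.
  by rewrite /= !mulmx2E e1 e2 e3 e4 !mxE /=; split; lia.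
case: n => k; first exact: nat_case.
have [x Px [e1 e2 e3 e4]] := nat_case k.+1.
exists x^-1%g; first exact: PV.
have := mulVg x; move/(congr1 (@mp_mat R)); rewrite mp_matM => e.
have h i j : (mp_mat x^-1%g *m mp_mat x) i j = (1%:M : 'M[int]_2) i j by rewrite e.
move: (mp_mat x^-1%g) h => B h.
have := h 0 0; have := h 0 1; have := h 1 0; have := h 1 1.
rewrite !mulmx2E e1 e2 e3 e4 !mxE /= !mulr1 !mulr0 !addr0 NegzE.
move: (B 0 0) (B 0 1) (B 1 0) (B 1 1) => a b c d h11 h10 h01 h00.
by split; nia.
Qed.

(** Euclid's algorithm on the first column: the lower left entry of [S T^q x] is the remainder of
    [a] modulo [c]. When [c = 0] the matrix is a power of [T] up to sign. *)
Lemma Mp2Z_ind (x : Mp) : P x.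
Proof.
have [n] := ubnP (absz (mp_mat x 1 0)); elim: n x => // n IH x; rewrite ltnS => hn.
have dx := mp_det x; rewrite det2 in dx.
have [c0|c0] := eqVneq (mp_mat x 1 0) 0.
  have ad : mp_mat x 0 0 * mp_mat x 1 1 = 1 by rewrite c0 mulr0 subr0 in dx.
  have [[a1 d1]|[a1 d1]] : (mp_mat x 0 0 = 1 /\ mp_mat x 1 1 = 1) \/
     (mp_mat x 0 0 = -1 /\ mp_mat x 1 1 = -1).
    move: (mp_mat x 0 0) (mp_mat x 1 1) ad => a d ad.
    have /andP[/eqP ha /eqP hd] : (absz a == 1)%N && (absz d == 1)%N.
      by rewrite -muln_eq1 -abszM ad.
    have [ea|ea] : a = 1 \/ a = -1 by lia.
      by left; rewrite ea in ad *; lia.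
    by right; rewrite ea in ad *; lia.
    have [y Py [e1 e2 e3 e4]] := P_Tn (mp_mat x 0 1).
    by apply: (P_same_mat _ Py); apply: mat2P; rewrite ?e1 ?e2 ?e3 ?e4.
  have [y Py [e1 e2 e3 e4]] := P_Tn (- mp_mat x 0 1).
  apply: (P_same_mat _ (PM PZ Py)); rewrite mp_matM mpZ_mat mulNmx mul1mx.
  by apply: mat2P; rewrite mxE ?e1 ?e2 ?e3 ?e4 ?opprK.
pose q := - divz (mp_mat x 0 0) (mp_mat x 1 0).
have [y Py [e1 e2 e3 e4]] := P_Tn q.
have Pw : P (mpS R * y * x)%g.
  apply: IH; rewrite !mp_matM !mulmx2E e1 e2 e3 e4 !mxE /=.
  have := divz_eq (mp_mat x 0 0) (mp_mat x 1 0); have := ltz_mod (mp_mat x 0 0) c0.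
  have := modz_ge0 (mp_mat x 0 0) c0.
  rewrite /q; move: (mp_mat x 0 0) (mp_mat x 1 0) hn c0 => a c hn c0.
  move: (a %/ c)%Z (a %% c)%Z => u v v0 vc ->.
  rewrite (_ : (1 * 1 + 0 * 0) * (u * c + v) + (1 * - u + 0 * 1) * c = v); last by ring.
  lia.
have -> : x = ((mpS R * y)^-1 * (mpS R * y * x))%g by rewrite mulKg.
by apply: PM => //; apply: PV; exact: PM.
Qed.
End Mp2Generation.

(** * Theta functions of the lattice *)

Section Diagonalization.
Lemma sformZl (F : comPzRingType) c (S : 'M[F]_c) x a b : sform S (x *: a) b = x * sform S a b.
Proof.
have e : (x *: a)^T = x *: a^T by exact: linearZ.
by rewrite /sform e -!scalemxAl mxE.
Qed.
Lemma sformZr (F : comPzRingType) c (S : 'M[F]_c) x a b : sform S a (x *: b) = x * sform S a b.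
Proof. by rewrite /sform -scalemxAr mxE. Qed.

Lemma psd_ker c (S : 'M[rat]_c) a : S^T = S -> (forall a, 0 <= sform S a a) ->
  sform S a a = 0 -> S *m a = 0.
Proof.
move=> symS psd a0.
have z b : sform S b a = 0.
  set A := sform S b b; set B := sform S b a.
  apply/eqP/negPn/negP => B0.
  (* With this [x] the form at [b + x a] is [A + 2 x B = -1], against semidefiniteness. *)
  pose x := - (A + 1) / (2 * B).
  have := psd (b + x *: a).
  rewrite sformDl !sformDr !sformZl !sformZr a0 (sformC symS a b) -/A -/B.
  have -> : A + x * B + (x * B + x * (x * 0)) = -1.
    by rewrite /x; field.
  by rewrite ler0N1.
apply/colP => i; rewrite [RHS]mxE; have := z (delta_mx i 0).
rewrite /sform (_ : (delta_mx i 0)^T = delta_mx 0 i) ?trmx_delta //.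
by rewrite -rowE -row_mul mxE.
Qed.

(** One pivot is eliminated at a time. If the pivot vanishes, semidefiniteness makes its whole row
    vanish by [psd_ker], so no permutation of the basis is required. *)
Lemma diagonalize n (S : 'M[rat]_n) : S^T = S -> (forall a, 0 <= sform S a a) ->
  exists2 P : 'M[rat]_n, P \in unitmx & is_diag_mx (P^T *m S *m P).
Proof.
elim: n S => [|n IH] S symS psd.
  by exists 1%:M; [exact: unitmx1|apply/is_diag_mxP => -[]].
move: S symS psd; rewrite -add1n => S symS psd.
set s := ulsubmx S; set u := ursubmx S; set S' := drsubmx S.
have Sb : S = block_mx s u u^T S'.
  by rewrite -[LHS]submxK -[X in block_mx _ _ X _](_ : u^T = dlsubmx S) // trmx_ursub symS.
have symS' : S'^T = S' by rewrite trmx_drsub symS.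
have [E uE [T' ET]] : exists2 E : 'M[rat]_(1 + n), E \in unitmx &
    exists T' : 'M[rat]_n, E^T *m S *m E = block_mx s 0 0 T'.
  have [s0|s0] := eqVneq (s 0 0) 0.
    exists 1%:M; first exact: unitmx1.
    exists S'; rewrite trmx1 mul1mx mulmx1.
    have : S *m delta_mx (lshift n 0) 0 = 0 :> 'cV_(1 + n).
      apply: psd_ker => //; rewrite /sform trmx_delta -rowE -colE !mxE.
      by move: s0; rewrite !mxE.
    rewrite -colE => /colP h.
    have u0 : u = 0.
      apply/rowP => j; have := h (rshift 1 j); rewrite !mxE.
      by move=> e; rewrite -symS mxE.
    by rewrite Sb u0 trmx0.
  exists (block_mx 1%:M (- (s 0 0)^-1 *: u) 0 1%:M).
    by rewrite unitmxE det_ublock !det1 mulr1 unitr1.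
  have sE : s = (s 0 0)%:M by rewrite [LHS]mx11_scalar.
  exists (S' - (s 0 0)^-1 *: (u^T *m u)).
  have g3 : (- (s 0 0)^-1 *: u)^T *m s + u^T = 0.
    have -> : (- (s 0 0)^-1 *: u)^T = - (s 0 0)^-1 *: u^T by exact: linearZ.
    by rewrite -scalemxAl {2}sE mul_mx_scalar scalerA mulNr mulVf // scaleN1r addNr.
  rewrite tr_block_mx trmx0 !trmx1 Sb !mulmx_block !mulmx0 !mul0mx !mulmx1 !mul1mx !addr0 g3 mul0mx add0r.
  congr block_mx.
    by rewrite {1}sE mul_scalar_mx scalerA mulrN divff // scaleN1r addNr.
  have -> : (- (s 0 0)^-1 *: u)^T = - (s 0 0)^-1 *: u^T by exact: linearZ.
  by rewrite -scalemxAl scaleNr addrC.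
have symT : T'^T = T'.
  have : (E^T *m S *m E)^T = E^T *m S *m E by rewrite !trmx_mul trmxK symS mulmxA.
  by rewrite ET tr_block_mx => /eq_block_mx[].
have psdT a : 0 <= sform T' a a.
  have := psd (E *m col_mx 0 a); rewrite /sform trmx_mul !mulmxA -(mulmxA _ E^T) -(mulmxA _ (E^T *m S)).
  by rewrite ET tr_col_mx trmx0 mul_row_block !mul0mx mulmx0 !add0r mul_row_col !mulmx0 add0r.
have [P' uP' dP'] := IH T' symT psdT.
exists (E *m block_mx 1%:M 0 0 P').
  by rewrite unitmx_mul uE /= unitmxE det_ublock det1 mul1r -unitmxE.
rewrite trmx_mul !mulmxA -(mulmxA _ E^T) -(mulmxA _ (E^T *m S)) ET.
rewrite tr_block_mx !trmx0 trmx1 !mulmx_block !mulmx0 !mul0mx !mul1mx !mulmx1 !addr0 !add0r.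
by rewrite mul0mx is_diag_block_mx // !eqxx mx11_is_diag.
Qed.

Lemma rank_diag n (d : 'rV[rat]_n) : \rank (diag_mx d) = #|[pred i | d 0 i != 0]|.
Proof.
elim: n d => [|n IH] d.
  by rewrite [diag_mx d]flatmx0 mxrank0 eq_card0 // => -[].
suff h (d1 : 'rV[rat]_1) (d2 : 'rV[rat]_n) :
    \rank (diag_mx (row_mx d1 d2)) = #|[pred i : 'I_(1 + n) | row_mx d1 d2 0 i != 0]|.
  by rewrite -[d](hsubmxK (d : 'rV_(1 + n))); exact: h.
rewrite diag_mx_row rank_diag_block_mx IH.
have e1 : (diag_mx d1 != 0) = (d1 0 0 != 0).
  congr negb; apply/eqP/eqP => [/matrixP/(_ 0 0)|e]; first by rewrite !mxE mulr1n.
  by apply/matrixP => i j; rewrite !mxE !ord1 e mul0rn.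
rewrite rank_rV e1 -!sum1_card [RHS]big_mkcond [X in (_ + X)%N]big_mkcond.
rewrite [RHS](@big_split_ord _ _ _ 1 n); congr (_ + _)%N.
  rewrite (eq_bigr (fun _ : 'I_1 => (d1 0 0 != 0) : nat)) => [|i _].
    by rewrite sum_nat_const card_ord mul1n.
  by rewrite inE row_mxEl (ord1 i); case: eqP.
by apply: eq_bigr => i _; rewrite !inE row_mxEr.
Qed.

(** The rational diagonalizing basis is scaled by a common denominator to become integral and by the
    order of [Delta] to fall into [ker psi]. The form is then integral on it because [qform]
    vanishes at 0. *)
Lemma orth_basis c (S : 'M[rat]_c) (Delta : discForm) (psi : jacobi_index S Delta) :
  exists (P : 'M[int]_c) (q : 'I_c -> nat),
  [/\ map_mx intr P \in (@unitmx rat c), forall i, psi (col i P) = 0,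
      forall i j, sform S (ratcV (col i P)) (ratcV (col j P)) = if i == j then (q i)%:R else 0
    & \rank S = #|[pred i | (0 < q i)%N]|].
Proof.
have symS := index_sym psi; have psd := index_psd psi.
have [P0 uP0 dP0] := diagonalize symS psd.
have [d d0 [P1 dP1]] := common_den P0.
pose N := #|Delta|; have N0 : (0 < N)%N by apply/card_gt0P; exists 0.
pose P := P1 *+ N.
have PE : map_mx intr P = (N%:R * d%:R) *: P0 :> 'M[rat]_c.
  apply/matrixP => i j; rewrite !mxE /P mulmxnE rmorphMn /=.
  by move/matrixP: (dP1) => /(_ i j); rewrite !mxE => <-; rewrite -mulr_natl mulrA.
have nz : N%:R * d%:R != 0 :> rat by rewrite mulf_neq0 // pnatr_eq0 -lt0n.
have pc i : psi (col i P) = 0 by rewrite /P raddfMn /= raddfMn mulrn_card.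
have cO i : ratcV (col i P) \in Omega psi.
  apply/asboolP; exists (col i P), 0; rewrite pc addr0; split=> //; exact: (rpred0 (kerS S)).
have sE i j : sform S (ratcV (col i P)) (ratcV (col j P)) =
   (N%:R * d%:R) ^+ 2 * (P0^T *m S *m P0) i j.
  have cE k : ratcV (col k P) = (N%:R * d%:R) *: col k P0.
    by rewrite /ratcV map_col PE; apply/colP => l; rewrite !mxE.
  rewrite !cE sformZl sformZr mulrA -expr2; congr (_ * _).
  by rewrite /sform tr_col -row_mul [col j P0]colE mulmxA -colE !mxE; apply: eq_bigr => k _; rewrite !mxE.
have ex i : exists k : nat, sform S (ratcV (col i P)) (ratcV (col i P)) = k%:R.
  have /intrP[z hz] := sform_Omega (cO i); have := psd (ratcV (col i P)); rewrite hz ler0z.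
  by case: z hz => // k hk _; exists k; rewrite pmulrn.
have [q hq] := choice ex.
exists P, q; split=> //.
- by rewrite PE unitmxZ // unitfE.
- move=> i j; case: eqVneq => [<- //|ij]; rewrite sE.
  by move/is_diag_mxP: dP0 => -> //; rewrite mulr0.
have rE : \rank (P0^T *m S *m P0) = \rank S.
  rewrite mxrankMfree ?row_free_unit // -mxrank_tr trmx_mul trmxK mxrankMfree ?row_free_unit //.
  by rewrite mxrank_tr.
have /is_diag_mxP hd := dP0.
have -> : \rank S = \rank (diag_mx (\row_i (P0^T *m S *m P0) i i)).
  rewrite -rE; congr (\rank _); apply/matrixP => i j; rewrite [RHS]mxE [in RHS]mxE.
  by case: eqVneq => [<-|ij]; rewrite ?mulr1n ?mulr0n // hd.
rewrite rank_diag; apply: eq_card => i; rewrite !inE mxE.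
have := hq i; rewrite sE => h; rewrite lt0n -(eqr_nat rat) -h mulf_eq0.
by rewrite sqrf_eq0 (negPf nz).
Qed.
End Diagonalization.

(** * One-variable theta functions of a given index and residue *)

Section CongruenceTheta.
Variable R : realType.
Local Notation C := R[i].
Local Notation ee := (@ee R).
Local Notation ImC := (@complex.Im R).

(* A basis vector with [q = 0] lies in [ker S]; the factor attached to it is the
   constant 1, with the single index [k = 0]. *)
Definition uN (q : nat) : nat := if q == 0%N then 1%N else (2 * q)%N.
Lemma uN_gt0 q : (0 < uN q)%N. Proof. by rewrite /uN; case: eqP => // /eqP; lia. Qed.

(** For [x = k / (2 q)] the exponent is [q x^2 t + 2 q x s]: [k] is the dual coordinate along a
    basis vector on which the form is [q]. *)
Definition uterm (q : nat) (t s : C) (k : int) : C :=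
  if q == 0%N then (k == 0)%:R else ee (t / (4 * q%:R) * k%:~R ^+ 2 + s * k%:~R).
Definition ures (q : nat) (r k : int) : bool := ((uN q)%:Z %| k - r)%Z.
Definition urterm q r t s k : C := if ures q r k then uterm q t s k else 0.
(** For [q > 0] this is the classical theta function of index [q] attached to the residue [r] mod
    [2 q], as in the theta decomposition of Jacobi forms in one variable. *)
Definition uu q r t s : C := csum (urterm q r t s).

Lemma nat4E q : 4 * q%:R = (4 * q)%N%:R :> C. Proof. by rewrite natrM. Qed.
Lemma Im_4q q (t : C) : (0 < q)%N -> 0 < ImC t -> 0 < ImC (t / (4 * q%:R)).
Proof. by move=> q0 ht; rewrite nat4E; apply: Im_divn => //; lia. Qed.

Definition uchi q r (k : int) : C := if ures q r k then 1 else 0.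
Lemma uchi_b q r : bchar (uchi q r).
Proof. by move=> k; rewrite /uchi; case: ifP; rewrite ?nc1 ?nc0. Qed.
Lemma urterm_th q r t s k : (0 < q)%N -> urterm q r t s k = thterm (uchi q r) 0 (t / (4 * q%:R)) s k.
Proof.
rewrite lt0n /urterm /uterm /thterm /uchi expr0 mulr1 /qe => /negPf ->.
by case: ifP => _; rewrite ?mul1r ?mul0r.
Qed.
Lemma uu_thw q r t s : (0 < q)%N -> uu q r t s = thw (uchi q r) 0 (t / (4 * q%:R)) s.
Proof. by move=> q0; congr csum; apply/funext => k; rewrite urterm_th. Qed.

Lemma hs_uu q r t s : 0 < ImC t -> hs (urterm q r t s) (uu q r t s).
Proof.
move=> ht; case: (posnP q) => [->|q0]; last first.
  rewrite uu_thw //; apply: hs_ext (hs_thw 0 s (uchi_b q r) (Im_4q q0 ht)) => k.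
  by rewrite urterm_th.
apply: hsP (_ : hs _ 1); apply: hs_ext (hs_delta (0 : int) (1 : C)) => k.
by rewrite /urterm /ures /uN /= dvd1z /uterm /=; case: (k == 0).
Qed.
Lemma uu0 r t s : uu 0 r t s = 1.
Proof.
apply: hs_csum; apply: hs_ext (hs_delta (0 : int) (1 : C)) => k.
by rewrite /urterm /ures /uN /= dvd1z /uterm /=; case: (k == 0).
Qed.

Lemma urterm_half (q : nat) (t s : C) : 0 < ImC t ->
  exists2 K : R, 0 <= K & forall r k, nc (urterm q r t s k) <= K * 2^-1 ^+ `|k|%N.
Proof.
move=> ht; case: (posnP q) => [->|q0].
  exists 1 => // r k; rewrite mul1r /urterm; case: ifP => _; last by rewrite nc0 exprn_ge0.
  rewrite /uterm /=; case: eqP => [->|_]; first by rewrite nc1 expr0.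
  by rewrite nc0 exprn_ge0.
have [K K0 hK] := thterm_half 0 (nc s) (Im_4q q0 ht).
by exists K => // r k; rewrite urterm_th // hK //; exact: uchi_b.
Qed.

Lemma uNC q : (uN q)%:R != 0 :> C. Proof. by rewrite pnatr_eq0 -lt0n uN_gt0. Qed.

Lemma uu_shift1 q r t s (j : int) : 0 < ImC t ->
  uu q r t (s + j%:~R / (uN q)%:R) = ee (r%:~R * j%:~R / (uN q)%:R) * uu q r t s.
Proof.
move=> ht; case: (posnP q) => [->|q0].
  by rewrite !uu0 mulr1 /uN /= divr1 -rmorphM ee_int.
apply: hs_unique (hs_uu _ _ _ ht) _; apply: hs_ext (hsZ _ (hs_uu q r s ht)) => k.
rewrite /urterm; case: ifP => [hk|]; last by rewrite mulr0.
rewrite /uterm; rewrite lt0n in q0; rewrite (negPf q0) -eeD.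
move/dvdzP: hk => [m hm]; have {hm} -> : k = m * (uN q)%:Z + r by rewrite -hm subrK.
have Nz := uNC q; rewrite -[LHS]mulr1 -[X in _ * X = _](ee_int R (m * j)) -eeD; congr ee.
by rewrite rmorphD !rmorphM /= -!pmulrn; field; rewrite Nz pnatr_eq0 q0.
Qed.

Lemma uu_shiftt q r t s (m : int) : 0 < ImC t -> (q = 0%N -> m = 0) ->
  uu q r t (s + t * (m%:~R / (2 * q%:R))) =
  ee (- (t * (m%:~R ^+ 2 / (4 * q%:R))) - m%:~R * s) * uu q (r + m) t s.
Proof.
move=> ht; case: (posnP q) => [->|q0].
  by move=> /(_ erefl) ->; rewrite !uu0 expr0n /= !(mul0r, mulr0) oppr0 ?addr0 ?subr0 ee0 mulr1.
have qz : q%:R != 0 :> C by rewrite pnatr_eq0 -lt0n.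
move=> _; apply: hs_unique (hs_uu _ _ _ ht) _.
have h : hs (fun k => urterm q (r + m) t s (k + m)) (uu q (r + m) t s).
  by apply: (@hs_transport _ _ _ _ _ (fun k => k + m) (fun k => k - m) _ _ _ (hs_uu q (r + m) s ht)) => k _;
    rewrite ?addrK ?subrK.
apply: hs_ext (hsZ _ h) => k; rewrite /urterm /ures opprD addrACA subrr addr0.
case: ifP => _; last by rewrite mulr0.
rewrite /uterm; rewrite lt0n in q0; rewrite (negPf q0) -eeD; congr ee.
by rewrite rmorphD /=; field.
Qed.

Lemma uu_periodr q r t s (m : int) : uu q (r + (uN q)%:Z * m) t s = uu q r t s.
Proof.
congr csum; apply/funext => k; rewrite /urterm /ures opprD addrA.
by rewrite rpredBr // dvdz_mulr.
Qed.

Lemma uu_th q r t s : (0 < q)%N -> 0 < ImC t ->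
  uu q r t s = ee (t / (4 * q%:R) * r%:~R ^+ 2 + s * r%:~R) * th (q%:R * t) (2 * q%:R * s + r%:~R * t).
Proof.
move=> q0 ht; have qz : q%:R != 0 :> C by rewrite pnatr_eq0 -lt0n.
have hq : 0 < ImC (q%:R * t).
  by rewrite mulrC -(rmorph_nat (real_complex R)) Im_scale mulr_gt0 // ltr0n.
apply: hs_unique (hs_uu _ _ _ ht) _.
have NZ : (uN q)%:Z != 0 by rewrite eqz_nat -lt0n uN_gt0.
have NE : (uN q)%:Z = 2 * q%:Z by rewrite /uN ifN -?lt0n.
apply: (@hs_transport _ _ _ _ _ (fun k => ((k - r) %/ (uN q)%:Z)%Z) (fun l => (uN q)%:Z * l + r)
   _ _ _ (hsZ _ (hs_th _ hq))) => [k|l _].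
  rewrite /urterm; case: ifP => [hk _|_]; last by rewrite eqxx.
  rewrite [(uN q)%:Z * _]mulrC divzK // subrK; split=> //.
  move/dvdzP: hk => [m hm]; have -> : k = m * (uN q)%:Z + r by rewrite -hm subrK.
  rewrite addrK mulzK // /uterm; rewrite lt0n in q0; rewrite (negPf q0) /qe -eeD; congr ee.
  by rewrite NE rmorphD !rmorphM /= -!pmulrn; field.
rewrite addrK mulKz // /urterm /ures addrK dvdz_mulr // /uterm; split=> //.
rewrite lt0n in q0; rewrite (negPf q0) /qe -eeD; congr ee.
by rewrite NE rmorphD !rmorphM /= -!pmulrn; field.
Qed.

Lemma uu_nonzero q r t : 0 < ImC t -> exists s, uu q r t s != 0.
Proof.
move=> ht; case: (posnP q) => [->|q0]; first by exists 0; rewrite uu0 oner_eq0.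
have qz : q%:R != 0 :> C by rewrite pnatr_eq0 -lt0n.
have hq : 0 < ImC (q%:R * t).
  by rewrite mulrC -(rmorph_nat (real_complex R)) Im_scale mulr_gt0 // ltr0n.
have [N [j [N0 z]]] := th_nonzero hq.
exists ((j%:R / N%:R - r%:~R * t) / (2 * q%:R)); rewrite uu_th // mulf_neq0 ?ee_neq0 //.
rewrite (_ : 2 * q%:R * _ + _ = j%:R / N%:R) //.
by rewrite mulrCA divff ?mulr1 ?subrK // mulf_neq0 // pnatr_eq0.
Qed.

Lemma ee_mul2 (a b a' b' F : C) : a + b = a' + b' -> ee a * (ee b * F) = ee a' * (ee b' * F).
Proof. by move=> e; rewrite mulrA -eeD e eeD -mulrA. Qed.

(** The substitution [w = 2 q s + r t] and an exponential factor turn the hypotheses into those of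
    [rank1] with modulus [2 q t]; the character under the shift by [1 / (2 q)] is what selects [r].
    The case [q = 0] is [rank0]. *)
Lemma uu_rank q r t (f : C -> C) : 0 < ImC t -> qreg f ->
  (forall s, f (s + (uN q)%:R^-1) = ee (r%:~R / (uN q)%:R) * f s) ->
  (forall s, f (s + t) = ee (- (q%:R * t) - 2 * q%:R * s) * f s) ->
  forall s s0, f s * uu q r t s0 = f s0 * uu q r t s.
Proof.
move=> ht fq f1 ft; case: (posnP q) => [q0|q0].
  move=> s s0; rewrite q0 !uu0 !mulr1; apply: (rank0 ht fq) => x.
    by have := f1 x; rewrite q0 /uN /= invr1 mulr1 ee_int mul1r.
  by rewrite ft q0 !mul0r oppr0 mulr0 mul0r subr0 ee0 mul1r.
have qz : q%:R != 0 :> C by rewrite pnatr_eq0 -lt0n.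
have NE : (uN q)%:R = 2 * q%:R :> C by rewrite /uN ifN -?lt0n // natrM.
have hq : 0 < ImC (2 * q%:R * t).
  by rewrite mulrC -natrM -(rmorph_nat (real_complex R)) Im_scale mulr_gt0 // ltr0n muln_gt0.
pose b : C := (2 * q%:R)^-1; pose d : C := - (r%:~R * t) / (2 * q%:R).
pose g w := ee (- (t / (4 * q%:R) * r%:~R ^+ 2 + (b * w + d) * r%:~R)) * f (b * w + d).
have gq : qreg g.
  apply: qreg_mul; last exact: qreg_affine.
  have -> : (fun w => ee (- (t / (4 * q%:R) * r%:~R ^+ 2 + (b * w + d) * r%:~R))) =
     (fun w => (fun x => ee (- (t / (4 * q%:R) * r%:~R ^+ 2) - x * r%:~R)) (b * w + d)).
    by apply/funext => w; congr ee; ring.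
  apply: (@qreg_affine R (fun x => ee (- (t / (4 * q%:R) * r%:~R ^+ 2) - x * r%:~R)) b d).
  exact: qreg_explin.
have rk := @rank1 R (2 * q%:R * t) g hq gq _ _.
move=> s s0.
have sE x : b * (2 * q%:R * x + r%:~R * t) + d = x by rewrite /b /d; field.
have uE x : f x * ee (- (t / (4 * q%:R) * r%:~R ^+ 2 + x * r%:~R)) = g (2 * q%:R * x + r%:~R * t).
  by rewrite /g sE mulrC.
have tE : 2 * q%:R * t / 2 = q%:R * t by field.
have := rk _ _ (2 * q%:R * s + r%:~R * t) (2 * q%:R * s0 + r%:~R * t).
rewrite tE -!uE !uu_th // => h.
have h1 x : ee (- (t / (4 * q%:R) * r%:~R ^+ 2 + x * r%:~R)) != 0 by exact: ee_neq0.
apply: (mulIf (mulf_neq0 (h1 s) (h1 s0))).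
have K x : ee (t / (4 * q%:R) * r%:~R ^+ 2 + x * r%:~R) * ee (- (t / (4 * q%:R) * r%:~R ^+ 2 + x * r%:~R)) = 1.
  by rewrite -eeD subrr ee0.
set Ts0 := th _ _ in h *; set Ts := th _ _ in h *.
transitivity (f s * ee (- (t / (4 * q%:R) * r%:~R ^+ 2 + s * r%:~R)) * Ts0).
  rewrite -[RHS]mulr1 -[X in _ = _ * X](K s0); ring.
rewrite h; [rewrite -[LHS]mulr1 -[X in _ * X = _](K s); ring| |].
  move=> x; rewrite /g.
  have -> : b * (x + 1) + d = b * x + d + (uN q)%:R^-1 by rewrite NE /b; ring.
  rewrite f1 mulrA -eeD; congr (ee _ * _); rewrite NE /b /d; field; exact: qz.
move=> x; rewrite /g.
have -> : b * (x + 2 * q%:R * t) + d = b * x + d + t by rewrite /b; field.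
rewrite ft; apply: ee_mul2; rewrite /b /d; field; exact: qz.
Qed.

Lemma usqrt_scale (t T : uhp R) (x : R) : 0 < x -> uval T = uval t * x%:C ->
  usqrt T = usqrt t * (Num.sqrt x)%:C.
Proof.
move=> x0 e; have : usqrt T ^+ 2 = (usqrt t * (Num.sqrt x)%:C) ^+ 2.
  by rewrite exprMn /usqrt !sqr_sqrtc -rmorphXn sqr_sqrtr ?ltW // e.
move/eqP; rewrite eqf_sqr => /orP[/eqP //|/eqP h]; exfalso.
have := usqrt_Re T; rewrite h -mulNr ReM /= mulr0 subr0.
have := usqrt_Re t; case: (usqrt t) => a b /= a0.
rewrite mulNr oppr_gt0 ltNge mulr_ge0 ?sqrtr_ge0 // ltW //.
Qed.

Lemma count_res q M (k : int) (v : C) : (uN q %| M)%N -> (0 < M)%N ->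
  \sum_(r < M) (if ures q r%:Z k then v else 0) = (M %/ uN q)%N%:R * v.
Proof.
move=> /dvdnP[d ->] M0; rewrite mulnK ?uN_gt0 //; have N0 := uN_gt0 q.
rewrite -(big_mkord xpredT (fun r : nat => if ures q r%:Z k then v else 0)).
elim: d {M0} => [|d IH]; first by rewrite mul0n big_geq // mul0r.
rewrite mulSn addnC (big_cat_nat _ (n := (d * uN q)%N)) //= ?leq_addr // IH -natr1 mulrDl mul1r; congr (_ + _).
rewrite -{1}[(d * uN q)%N]add0n big_addn addKn big_mkord.
rewrite -[RHS](@sum_residue R (uN q) k v N0); apply: eq_bigr => r _; congr (if _ then _ else _).
rewrite /ures -eqz_mod_dvd PoszD PoszM addrC modzMDl.
by rewrite [(r%:Z %% _)%Z]modz_small // /= ltz_nat.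
Qed.

(** This is [th_inversion] at the point [t / (2 q)]. One [M] serves all coordinates, so the sum runs
    through every residue [M / uN q] times, and [kq] contains the inverse of this number. *)
Lemma uu_S (q M : nat) : (uN q %| M)%N -> (0 < M)%N -> exists kq : C,
  forall (t : uhp R) (r : int) (s : C),
  uu q r (- (uval t)^-1) (s / uval t) =
  kq * (if (0 < q)%N then usqrt t else 1) * ee (q%:R * s ^+ 2 / uval t) *
  \sum_(r' < M) ee (- (r%:~R * r'%:R / (2 * q%:R))) * uu q r'%:Z (uval t) s.
Proof.
move=> NM M0; case: (posnP q) => [q0|q0].
  exists M%:R^-1 => t r s; rewrite q0 uu0 !mul0r ee0 !mulr1.
  under eq_bigr do rewrite mulr0 invr0 mulr0 oppr0 ee0 uu0 mulr1.
  by rewrite sumr_const card_ord mulVf // pnatr_eq0 -lt0n.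
have [kap hk] := th_inversion R.
have qz : q%:R != 0 :> C by rewrite pnatr_eq0 -lt0n.
have NE : (uN q)%:R = 2 * q%:R :> C by rewrite /uN ifN -?lt0n // natrM.
have NE' : uN q = (2 * q)%N by rewrite /uN ifN -?lt0n.
pose x : R := (2 * q)%N%:R^-1.
have x0 : 0 < x by rewrite invr_gt0 ltr0n muln_gt0.
have xE : x%:C = (2 * q%:R)^-1 by rewrite fmorphV rmorph_nat natrM.
pose D : C := (M %/ uN q)%N%:R.
have Dz : D != 0.
  by rewrite pnatr_eq0 -lt0n divn_gt0 ?uN_gt0 // dvdn_leq.
exists (kap * (Num.sqrt x)%:C / D) => t r s.
have ht := uvalP t; have tz := uhp_neq0 ht.
have hT : 0 < complex.Im (uval t * x%:C) by rewrite Im_scale mulr_gt0.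
pose T := mk_uhp hT.
rewrite uu_th //; last exact: Im_inv.
have hkT := hk T (s - r%:~R / (2 * q%:R)).
rewrite uval_mk xE in hkT.
have e1 : - (uval t / (2 * q%:R))^-1 / 2 = q%:R * - (uval t)^-1.
  by field; rewrite qz tz.
have e2 : (s - r%:~R / (2 * q%:R)) / (uval t / (2 * q%:R)) =
  2 * q%:R * (s / uval t) + r%:~R * - (uval t)^-1.
  by field; rewrite qz tz.
rewrite e1 e2 in hkT; rewrite hkT (usqrt_scale x0 (uval_mk hT)) -/T.
have -> : \sum_(r' < M) ee (- (r%:~R * r'%:R / (2 * q%:R))) * uu q r'%:Z (uval t) s =
  D * th (uval t / (2 * q%:R) / 2) (s - r%:~R / (2 * q%:R)).
  have hA : 0 < ImC (uval t / (2 * q%:R) / 2).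
    rewrite -mulrA -invfM -natrM -natrM; apply: Im_divn => //; lia.
  apply: hs_unique (hs_sum (index_enum 'I_M) (fun r' : 'I_M => hsZ _ (hs_uu q r'%:Z s ht))) _.
  apply: hs_ext (hsZ _ (hs_th _ hA)) => k.
  rewrite -(count_res k _ NM M0) /D; apply: eq_bigr => r' _; rewrite /urterm.
  case: ifP => [hr|]; last by rewrite mulr0.
  move/dvdzP: hr => [m hm]; rewrite /uterm ifN -?lt0n // -eeD /qe.
  rewrite -[LHS]mulr1 -[X in _ * X = _](ee_int R (r * m)) -eeD; congr ee.
  have -> : k = m * (2 * q)%N%:Z + r'%:Z by rewrite -NE' -hm subrK.
  by rewrite !rmorphD !rmorphM /= -!pmulrn; field.
set Th := th _ _.
transitivity (kap * (Num.sqrt x)%:C * usqrt t * ee (q%:R * s ^+ 2 / uval t) * Th); last first.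
  by field.
rewrite mulrA [LHS](_ : _ = kap * (Num.sqrt x)%:C * usqrt t *
  (ee (- (uval t)^-1 / (4 * q%:R) * r%:~R ^+ 2 + s / uval t * r%:~R) *
   ee ((s - r%:~R / (2 * q%:R)) ^+ 2 / (2 * (uval t / (2 * q%:R))))) * Th); last by ring.
rewrite -eeD; congr (_ * ee _ * _).
by field; rewrite qz tz.
Qed.
End CongruenceTheta.

(* Keeps unification from unfolding the exponential. *)
Opaque Defs.ee.

(** * The lattice theta series as a finite combination of products *)

Section ThetaProducts.
Variable R : realType.
Local Notation C := R[i].
Local Notation ee := (@ee R).
Local Notation ImC := (@complex.Im R).
Variables (c : nat) (S : 'M[rat]_c) (Delta : discForm) (psi : jacobi_index S Delta).
Local Notation SC := (SC R S).
Local Notation qm a := (map_mx (ratr : rat -> C) a).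

Lemma sform_ratr a b : sform SC (qm a) (qm b) = ratr (sform S a b).
Proof. by rewrite /sform /SC map_trmx -!map_mxM mxE. Qed.
Lemma SC_sym : SC^T = SC.
Proof. by rewrite /SC map_trmx (index_sym psi). Qed.
Lemma ratr2M (x : rat) : ratr (2 * x) = 2 * ratr x :> C.
Proof. by rewrite rmorphM rmorph_nat. Qed.
Lemma qmD (a b : 'cV[rat]_c) : qm (a + b) = qm a + qm b. Proof. exact: raddfD. Qed.
Lemma qmB (a b : 'cV[rat]_c) : qm (a - b) = qm a - qm b. Proof. exact: raddfB. Qed.
Lemma qm_ratcV (u : 'cV[int]_c) : qm (ratcV u) = intC_cV R u.
Proof. by apply/colP => i; rewrite !mxE ratr_int. Qed.
Lemma sformC_ker k z : k \in kerS S -> sform SC (qm k) z = 0.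
Proof.
move=> /eqP kk; rewrite (sformC SC_sym); apply: sform_kerr.
by rewrite /SC -map_mxM kk map_mx0.
Qed.

Lemma kerS_Omega k : k \in kerS S -> k \in Omega psi.
Proof.
move=> kk; apply/asboolP; exists 0, k; rewrite raddf0; split=> //.
by rewrite /ratcV raddf0 add0r.
Qed.
Lemma int_Omega u : psi u = 0 -> ratcV u \in Omega psi.
Proof.
move=> pu; apply/asboolP; exists u, 0; rewrite addr0; split=> //; exact: (rpred0 (kerS S)).
Qed.
Lemma Omega_intP b : b \in Omega psi -> exists u, psi u = 0 /\ b - ratcV u \in kerS S.
Proof. by move=> /asboolP[u [k [pu kk ->]]]; exists u; rewrite addrC addKr. Qed.
Lemma kerS_r a k : k \in kerS S -> sform S a k = 0.
Proof. by move=> /eqP; exact: sform_kerr. Qed.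
Lemma kerS_l a k : k \in kerS S -> sform S k a = 0.
Proof. by move=> kk; rewrite (sformC (index_sym psi)) kerS_r. Qed.

Lemma repr_piV a : repr (piV S a) - a \in kerS S.
Proof. by rewrite unfold_in; apply/eqP; exact: piV_repr. Qed.
Lemma eq_piV a b : a - b \in kerS S -> piV S a = piV S b.
Proof. by rewrite Quotient.idealrBE => /eqP. Qed.
Lemma piV_reprK (v : Vquot S) : piV S (repr v) = v. Proof. exact: reprK. Qed.

Lemma class_Omega0 a : a \in Omega psi -> DOmega_class psi a = 0.
Proof.
move=> aO; have a1 := Omega_sub aO.
apply/eqP; have -> : 0 = DOmega_class psi (a - a) by rewrite DOmega_classB // subrr.
by rewrite eq_DOmega_class ?subrr ?rpred0 // subr0.
Qed.

Lemma qform_class a : a \in Omega_star psi ->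
  qform (DOmega_class psi a : D_Omega psi) = toQZ (sform S a a).
Proof. exact: DOmega_q_class. Qed.
Lemma bform_class a b : a \in Omega_star psi -> b \in Omega_star psi ->
  bform (DOmega_class psi a : D_Omega psi) (DOmega_class psi b) = toQZ (2 * sform S a b).
Proof.
move=> aO bO; rewrite /bform (_ : DOmega_class psi a + DOmega_class psi b = DOmega_class psi (a + b) :> D_Omega psi); last first.
  by rewrite DOmega_classD.
rewrite (qform_class (rpredD aO bO)) (qform_class aO) (qform_class bO) -!raddfB; congr toQZ.
by rewrite sformDl !sformDr (sformC (index_sym psi) b a); ring.
Qed.
Lemma class_surj (x : D_Omega psi) : exists2 a, a \in Omega_star psi & DOmega_class psi a = x.
Proof. by exists (DOmega_repr x); [exact: DOmega_reprP|exact: DOmega_classK]. Qed.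

Definition inOg (g : D_Omega psi) (a : 'cV[rat]_c) : bool :=
  (a \in Omega_star psi) && (DOmega_class psi a == g).

Definition theta_term (t : C) z (g : D_Omega psi) (a : 'cV[rat]_c) : C :=
  if inOg g a then ee (t * ratr (sform S a a) + 2 * sform SC (qm a) z) else 0.

Lemma inOg_Omega g (a b : 'cV[rat]_c) : a - b \in Omega psi -> inOg g a = inOg g b.
Proof.
have aux a' b' : a' - b' \in Omega psi -> inOg g a' -> inOg g b'.
  move=> h /andP[aO /eqP <-].
  have bO : b' \in Omega_star psi.
    by rewrite -[b'](subKr a'); apply: rpredB aO _; exact: Omega_sub.
  by rewrite /inOg bO eq_sym eq_DOmega_class.
move=> h; apply/idP/idP; apply: aux => //.
by rewrite -opprB rpredN.
Qed.
Lemma inOg_ker g (a b : 'cV[rat]_c) : a - b \in kerS S -> inOg g a = inOg g b.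
Proof. by move=> /kerS_Omega; exact: inOg_Omega. Qed.
Lemma inOgD (x : D_Omega psi) (a b : 'cV[rat]_c) : b \in Omega_star psi -> inOg (x + DOmega_class psi b) (a + b) = inOg x a.
Proof.
move=> bO; apply/idP/idP => /andP[aO /eqP h]; apply/andP; last first.
  by rewrite rpredD // DOmega_classD // h.
have aO' : a \in Omega_star psi by rewrite -[a](addrK b) rpredB.
split=> //; move: h; rewrite DOmega_classD // => /eqP.
by rewrite -[x + DOmega_class psi b]/(x + DOmega_class psi b : DOmega psi) (inj_eq (addIr _)).
Qed.

Lemma theta_term_inOg t z g a : theta_term t z g a != 0 -> inOg g a.
Proof. by rewrite /theta_term; case: ifP => // _ /eqP. Qed.

Lemma theta_term_ker t z g (a b : 'cV[rat]_c) : a - b \in kerS S -> theta_term t z g a = theta_term t z g b.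
Proof.
move=> h; rewrite /theta_term.
rewrite (inOg_ker g h).
have -> : sform S a a = sform S b b.
  have -> : a = b + (a - b) by rewrite addrC subrK.
  move: (a - b) h => k kk.
  by rewrite !sformDl !sformDr (kerS_r _ kk) (kerS_l _ kk) (kerS_r _ kk) !addr0.
have -> : sform SC (qm a) z = sform SC (qm b) z.
  have -> : qm a = qm b + qm (a - b) by rewrite qmB addrC subrK.
  by rewrite sformDl (sformC_ker _ h) addr0.
by [].
Qed.

Variables (P : 'M[int]_c) (q : 'I_c -> nat).
Hypothesis uP : map_mx intr P \in (@unitmx rat c).
Hypothesis pP : forall i, psi (col i P) = 0.
Hypothesis dP : forall i j, sform S (ratcV (col i P)) (ratcV (col j P)) = if i == j then (q i)%:R else 0.

Local Notation PQ := (map_mx intr P : 'M[rat]_c).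
Local Notation PC := (map_mx intr P : 'M[C]_c).

Lemma PtSP : PQ^T *m S *m PQ = diag_mx (\row_i (q i)%:R).
Proof.
apply/matrixP => i j; have := dP i j; rewrite /sform /ratcV !map_col tr_col -row_mul.
rewrite [col j _]colE mulmxA -colE => h.
have -> : (PQ^T *m S *m PQ) i j = col j (row i (PQ^T *m S) *m PQ) 0 0 by rewrite -row_mul !mxE.
by rewrite h !mxE; case: eqP => [->|_]; rewrite ?mulr1n ?mulr0n.
Qed.

Lemma PtSPC : PC^T *m SC *m PC = diag_mx (\row_i (q i)%:R).
Proof.
have e : PC = qm PQ by apply/matrixP => i j; rewrite !mxE ratr_int.
rewrite e /SC map_trmx -!map_mxM PtSP map_diag_mx; congr diag_mx.
by apply/rowP => i; rewrite mxE [in LHS]mxE [RHS]mxE; exact: ratr_nat.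
Qed.

Lemma diag_form (F : comPzRingType) (x y : 'cV[F]_c) :
  (x^T *m diag_mx (\row_i (q i)%:R) *m y) 0 0 = \sum_i (q i)%:R * x i 0 * y i 0.
Proof.
rewrite -mulmxA mul_diag_mx mxE; apply: eq_bigr => i _; rewrite !mxE; ring.
Qed.

Lemma sformPP x y : sform S (PQ *m x) (PQ *m y) = \sum_i (q i)%:R * x i 0 * y i 0.
Proof. by rewrite -diag_form -PtSP /sform trmx_mul !mulmxA. Qed.
Lemma sformPPC x y : sform SC (PC *m x) (PC *m y) = \sum_i (q i)%:R * x i 0 * y i 0.
Proof. by rewrite -diag_form -PtSPC /sform trmx_mul !mulmxA. Qed.

(* The vector with dual coordinates [k]; where [q i = 0] the division gives [0], so
   that [k i] is ignored. *)
Definition qvec (k : 'I_c -> int) : 'cV[rat]_c := PQ *m \col_i ((k i)%:~R / (2 * (q i)%:R)).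

Lemma colPQ i : ratcV (col i P) = PQ *m delta_mx i 0.
Proof. by rewrite /ratcV map_col colE. Qed.
Lemma PQ_coord x i : sform S (PQ *m x) (ratcV (col i P)) = (q i)%:R * x i 0.
Proof.
rewrite colPQ sformPP (bigD1 i) //= big1 ?addr0 => [|j ji].
  by rewrite mxE !eqxx mulr1.
by rewrite mxE (negPf ji) mulr0.
Qed.
Lemma qvec_coord k i : 2 * sform S (qvec k) (ratcV (col i P)) = if q i == 0%N then 0 else (k i)%:~R.
Proof.
rewrite PQ_coord mxE; case: eqP => [->|/eqP q0]; first by rewrite mul0r mulr0.
have qz : (q i)%:R != 0 :> rat by rewrite pnatr_eq0.
by field.
Qed.
Lemma PQK (a : 'cV[rat]_c) : a = PQ *m (invmx PQ *m a). Proof. by rewrite mulKVmx. Qed.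

Lemma coord_ker a : (forall i, sform S a (ratcV (col i P)) = 0) -> a \in kerS S.
Proof.
move=> h; rewrite unfold_in; apply/eqP; apply: (psd_ker (index_sym psi) (index_psd psi)).
rewrite {1 2}(PQK a) sformPP big1 // => i _; rewrite -PQ_coord -PQK h mul0r //.
Qed.
Lemma qvec_ker a k : (forall i, 2 * sform S a (ratcV (col i P)) = (k i)%:~R) -> a - qvec k \in kerS S.
Proof.
move=> h; apply: coord_ker => i; rewrite sformDl sformNl.
have := qvec_coord k i; rewrite -h; case: eqP => [q0 e|_ e].
  by rewrite [a]PQK -sformNl -sformDl -mulmxBr PQ_coord q0 mul0r.
by apply: (@mulfI _ (2 : rat)) => //; rewrite mulrBr e subrr mulr0.
Qed.
Lemma Omega_coord a i : a \in Omega_star psi -> 2 * sform S a (ratcV (col i P)) \is a Num.int.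
Proof. by move=> /Omega_starP; apply; exact: int_Omega. Qed.

Lemma colMz (A : 'cV[int]_c) (n : int) j : (A *~ n) j 0 = n * A j 0.
Proof. by rewrite -scaler_int mxE intz. Qed.

Lemma qvec_int (k : 'I_c -> int) :
  (forall i, q i != 0%N -> ((uN (q i))%:Z %| k i)%Z) -> qvec k \in Omega psi.
Proof.
move=> h; rewrite /qvec.
have -> : PQ *m \col_i ((k i)%:~R / (2 * (q i)%:R)) =
    ratcV (P *m \col_i (if q i == 0%N then 0 else divz (k i) (uN (q i))%:Z)).
  rewrite /ratcV map_mxM; congr (_ *m _); apply/colP => i; rewrite !mxE.
  case: eqP => [->|/eqP q0]; first by rewrite mulr0 invr0 mulr0.
  have := h i q0 => /dvdzP[d ->]; rewrite mulzK ?eqz_nat -?lt0n ?uN_gt0 //.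
  rewrite /uN (negPf q0) rmorphM /= -!pmulrn natrM mulfK // mulf_neq0 // pnatr_eq0 //.
set v := \col_i _; have -> : P *m v = \sum_i (col i P *~ v i 0).
  by apply/colP => j; rewrite summxE [LHS]mxE; apply: eq_bigr => i _; rewrite colMz mulrC; congr (_ * _); rewrite mxE.
by apply: int_Omega; rewrite raddf_sum big1 // => i _; rewrite raddfMz pP mul0rz.
Qed.

Variable M0 : nat.
Local Notation M := M0.+1.
Hypothesis NM : forall i, (uN (q i) %| M)%N.
Local Notation G := {ffun 'I_c -> 'I_M}.
Definition vk (n : G) : 'I_c -> int := fun i => (n i : nat)%:Z.
Definition thprod (k : 'I_c -> int) (t : C) (s : 'cV[C]_c) : C := \prod_i uu (q i) (k i) t (s i 0).
(* Each residue class modulo [uN (q i)] is counted [M / uN (q i)] times by ['I_M]. *)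
Definition tw : C := \prod_i ((uN (q i))%:R / M%:R).

Lemma MC : M%:R != 0 :> C. Proof. by rewrite pnatr_eq0. Qed.

Lemma ee_sum (F : 'I_c -> C) : ee (\sum_i F i) = \prod_i ee (F i).
Proof. by rewrite (big_morph ee (@eeD R) (@ee0 R)). Qed.

Lemma qm_PQ (x : 'cV[rat]_c) : qm (PQ *m x) = PC *m qm x.
Proof. by rewrite map_mxM; congr (_ *m _); apply/matrixP => i j; rewrite 2!mxE [RHS]mxE; exact: ratr_int. Qed.

Lemma qvec_term t s (k : 'I_c -> int) : (forall i, q i = 0%N -> k i = 0) ->
  ee (t * ratr (sform S (qvec k) (qvec k)) + 2 * sform SC (qm (qvec k)) (PC *m s)) =
  \prod_i uterm (q i) t (s i 0) (k i).
Proof.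
move=> hk; rewrite /qvec qm_PQ sformPP sformPPC rmorph_sum mulr_sumr mulr_sumr -big_split /= ee_sum.
apply: eq_bigr => i _; rewrite !mxE /uterm.
case: eqP => [q0|/eqP q0].
  by rewrite q0 !mul0r rmorph0 !mulr0 addr0 ee0 (hk i q0) eqxx.
have qz : (q i)%:R != 0 :> C by rewrite pnatr_eq0.
by congr ee; rewrite !(rmorphM, fmorphV, ratr_int, ratr_nat) /=; field.
Qed.

Lemma uterm_q0 i (t s : C) (k : int) : uterm (q i) t s k != 0 -> q i = 0%N -> k = 0.
Proof. by rewrite /uterm => h q0; move: h; rewrite q0 eqxx; case: (eqVneq k 0) => // _ /eqP. Qed.

Lemma qvecB k l : qvec k - qvec l = qvec (fun i => k i - l i).
Proof.
by rewrite /qvec -mulmxBr; congr (_ *m _); apply/colP => i; rewrite !mxE rmorphB mulrBl.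
Qed.
Lemma inOg_res g (k l : 'I_c -> int) : (forall i, ures (q i) (k i) (l i)) ->
  inOg g (qvec k) = inOg g (qvec l).
Proof.
move=> h; apply/esym; apply: inOg_Omega; rewrite qvecB; apply: qvec_int => i _; exact: h.
Qed.

Lemma prod_urterm (k l : 'I_c -> int) (t : C) (s : 'I_c -> C) :
  \prod_i urterm (q i) (l i) t (s i) (k i) =
  if [forall i, ures (q i) (l i) (k i)] then \prod_i uterm (q i) t (s i) (k i) else 0.
Proof.
case: ifPn => [/forallP h|]; first by apply: eq_bigr => i _; rewrite /urterm h.
by rewrite negb_forall => /existsP[i /negPf h]; rewrite (bigD1 i) //= /urterm h mul0r.
Qed.

Lemma mul_if (b : bool) (x y v : C) : (b -> x = y) -> x * (if b then v else 0) = y * (if b then v else 0).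
Proof. by case: b => [->|_] //; rewrite !mulr0. Qed.

(** Whether [qvec k] lies in the class [g] depends only on the residues of the [k i] mod [uN (q i)].
    Sorting by residues turns the lattice sum into finitely many products of one-variable series,
    with [tw] correcting the multiplicities. *)
Lemma theta_series (t : C) (s : 'cV[C]_c) g : 0 < ImC t ->
  hs (fun k : {ffun 'I_c -> int} => if inOg g (qvec k) then \prod_i uterm (q i) t (s i 0) (k i) else 0)
     (tw * \sum_(n : G) (inOg g (qvec (vk n)))%:R * thprod (vk n) t s).
Proof.
move=> ht.
have /choice[K hK] i : exists K : R, 0 <= K /\ forall r k, nc (urterm (q i) r t (s i 0) k) <= K * 2^-1 ^+ `|k|%N.
  by have [K K0 h] := urterm_half (q i) (s i 0) ht; exists K.
pose K1 := \sum_i K i.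
have K10 : 0 <= K1 by apply: sumr_ge0 => i _; case: (hK i).
have hp (n : G) : hs (fun k : {ffun 'I_c -> int} => \prod_i urterm (q i) (vk n i) t (s i 0) (k i)) (thprod (vk n) t s).
  apply: (hs_prod (x := fun i => urterm (q i) (vk n i) t (s i 0)) K10 _ _).2 => [i k|i]; last exact: hs_uu.
  apply: le_trans ((hK i).2 _ _) _; rewrite ler_wpM2r ?exprn_ge0 //.
  by rewrite /K1 (bigD1 i) //= lerDl sumr_ge0 // => j _; case: (hK j).
apply: hs_ext (hsZ tw (hs_sum (index_enum G) (fun n => hsZ (inOg g (qvec (vk n)))%:R (hp n)))) => k.
transitivity (tw * \sum_(n : G) (inOg g (qvec k))%:R * \prod_i urterm (q i) (vk n i) t (s i 0) (k i)).
  apply: (congr1 (fun x => tw * x)); apply: eq_bigr => n _.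
  have E : \prod_i urterm (q i) (vk n i) t (s i 0) (k i) =
    if [forall i, ures (q i) (vk n i) (k i)] then \prod_i uterm (q i) t (s i 0) (k i) else 0.
    exact: (prod_urterm k (vk n) t (fun i => s i 0)).
  rewrite E {E}.
  apply: mul_if => /forallP h; by rewrite (inOg_res g h).
rewrite -mulr_sumr.
have -> : \sum_(n : G) \prod_i urterm (q i) (vk n i) t (s i 0) (k i) =
   \prod_i ((M %/ uN (q i))%N%:R * uterm (q i) t (s i 0) (k i)).
  rewrite -(bigA_distr_bigA (fun i (r : 'I_M) => urterm (q i) (r : nat)%:Z t (s i 0) (k i))).
  by apply: eq_bigr => i _; rewrite -(count_res (k i) _ (NM i)).
rewrite big_split /= mulrCA.
have -> : tw * (\prod_i (M %/ uN (q i))%N%:R * \prod_i uterm (q i) t (s i 0) (k i)) =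
   \prod_i uterm (q i) t (s i 0) (k i).
  rewrite mulrA -big_split /= big1 ?mul1r // => i _.
  by rewrite mulrAC -natrM mulnC divnK ?NM // divff // MC.
by case: (inOg g (qvec k)); rewrite ?mul1r ?mul0r.
Qed.

(** A class modulo [ker S] corresponds to its pairings with the basis [P]. These are integers on
    [Omega_star] and vanish where [q i = 0], which is where [uterm] retains only [k i = 0]. *)
Lemma theta_hsP (t : uhp R) s g :
  hs (fun v : Vquot S => theta_term (uval t) (PC *m s) g (repr v))
     (tw * \sum_(n : G) (inOg g (qvec (vk n)))%:R * thprod (vk n) (uval t) s).
Proof.
pose kf (a : 'cV[rat]_c) : {ffun 'I_c -> int} := [ffun i => Num.floor (2 * sform S a (ratcV (col i P)))].
have kfP a : a \in Omega_star psi -> forall i, 2 * sform S a (ratcV (col i P)) = (kf a i)%:~R.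
  by move=> aO i; rewrite ffunE floorK // Omega_coord.
apply: (@hs_transport R _ _ _ _ (fun v : Vquot S => kf (repr v)) (fun k : {ffun 'I_c -> int} => piV S (qvec k))
  _ _ _ (theta_series s g (uvalP t))) => [v|k].
  move=> /theta_term_inOg hg.
  have aO : repr v \in Omega_star psi by case/andP: hg.
  have hk := qvec_ker (kfP _ aO).
  split; first by rewrite -(eq_piV hk) piV_reprK.
  rewrite (theta_term_ker _ _ _ hk) /theta_term qvec_term // => i q0.
  have := kfP _ aO i; rewrite {1}(PQK (repr v)) PQ_coord q0 mul0r mulr0 => /esym/eqP.
  by rewrite intr_eq0 => /eqP.
case: ifP => [hg hy|_]; last by rewrite eqxx.
have hq i : q i = 0%N -> k i = 0.
  apply: (@uterm_q0 i (uval t) (s i 0)); apply: contraNneq hy => h0.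
  by rewrite (bigD1 i) //= h0 mul0r.
have hr := repr_piV (qvec k).
split.
  apply/ffunP => i; rewrite ffunE.
  have -> : sform S (repr (piV S (qvec k))) (ratcV (col i P)) = sform S (qvec k) (ratcV (col i P)).
    rewrite -[repr (piV S (qvec k))](subrK (qvec k)) sformDl (kerS_l _ hr) add0r //.
  rewrite qvec_coord; case: eqP => [q0|_]; last by rewrite intrKfloor.
  by rewrite (hq _ q0) floor0.
by rewrite (theta_term_ker _ _ _ hr) /theta_term hg qvec_term.
Qed.

Lemma theta_sumE (t : uhp R) z g l : hs (fun v : Vquot S => theta_term (uval t) z g (repr v)) l -> theta psi t z g = l :> C.
Proof. by move=> /hs_sumE h; rewrite /theta ffunE -h. Qed.

Lemma theta_fin (t : uhp R) s g : theta psi t (PC *m s) g =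
  tw * \sum_(n : G) (inOg g (qvec (vk n)))%:R * thprod (vk n) (uval t) s.
Proof. exact: theta_sumE (theta_hsP t s g). Qed.

Lemma uPC : PC \in unitmx.
Proof.
have -> : PC = qm PQ by apply/matrixP => i j; rewrite !mxE ratr_int.
by rewrite map_unitmx.
Qed.
Lemma PCK (z : 'cV[C]_c) : z = PC *m (invmx PC *m z). Proof. by rewrite mulKVmx ?uPC. Qed.

Lemma theta_hs (t : uhp R) z g :
  hs (fun v : Vquot S => theta_term (uval t) z g (repr v)) (theta psi t z g).
Proof. by rewrite (PCK z) theta_fin; exact: theta_hsP. Qed.

Lemma theta_T (t : uhp R) z g : theta psi (mp_act (mpT R) t) z g = eQZ R (qform g) * theta psi t z g.
Proof.
apply: theta_sumE; apply: hs_ext (hsZ _ (theta_hs t z g)) => v; rewrite /theta_term.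
case: ifP => [/andP[aO /eqP <-]|_]; last by rewrite mulr0.
rewrite uval_actT qform_class // eQZ_toQZ -eeD; congr ee; ring.
Qed.

Lemma theta_real (t : uhp R) (z : 'cV[C]_c) g b : b \in Omega_star psi ->
  theta psi t (z + qm b) g = eQZ R (bform g (DOmega_class psi b)) * theta psi t z g.
Proof.
move=> bO; apply: theta_sumE; apply: hs_ext (hsZ _ (theta_hs t z g)) => v; rewrite /theta_term.
case: ifP => [/andP[aO /eqP <-]|_]; last by rewrite mulr0.
rewrite bform_class // eQZ_toQZ -eeD; congr ee.
by rewrite sformDr sform_ratr ratr2M; ring.
Qed.

Lemma theta_tau (t : uhp R) (z : 'cV[C]_c) g b : b \in Omega_star psi ->
  theta psi t (z + uval t *: qm b) g =
  ee (- (uval t * ratr (sform S b b)) - 2 * sform SC (qm b) z) * theta psi t z (g + DOmega_class psi b).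
Proof.
move=> bO; apply: theta_sumE.
have h : hs (fun v : Vquot S => theta_term (uval t) z (g + DOmega_class psi b) (repr v + b))
   (theta psi t z (g + DOmega_class psi b)).
  have kk (v : Vquot S) (d : 'cV[rat]_c) : repr (piV S (repr v + d)) - (repr v + d) \in kerS S by exact: repr_piV.
  have kI (v : Vquot S) (d : 'cV[rat]_c) : piV S (repr (piV S (repr v + d)) - d) = v.
    rewrite -[RHS]piV_reprK; apply: eq_piV; have := kk v d.
    by rewrite opprD addrA addrAC.
  apply: (@hs_transport R _ _ _ _ (fun v : Vquot S => piV S (repr v + b)) (fun v : Vquot S => piV S (repr v - b))
    _ _ _ (theta_hs t z (g + DOmega_class psi b))) => v _.
    split; [exact: kI|apply: theta_term_ker; exact: kk].
  have := kI v (- b); rewrite opprK => e1; split; [exact: e1|apply: theta_term_ker; move: (kk v (- b)); by rewrite opprD opprK addrA addrAC].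
apply: hs_ext (hsZ _ h) => v; rewrite /theta_term (inOgD _ _ bO); case: ifP => [_|_]; last by rewrite mulr0.
rewrite -eeD; congr ee; rewrite qmD !sformDl !sformDr (sformC (index_sym psi) b (repr v)) sformZr sform_ratr.
rewrite !rmorphD /=; move: (ratr (sform S (repr v) (repr v))) (ratr (sform S (repr v) b)) (ratr (sform S b b)).
by move: (sform SC (qm (repr v)) z) (sform SC (qm b) z) (uval t) => *; ring.
Qed.

Lemma thprod_nonzero k t : 0 < ImC t -> exists s, thprod k t s != 0.
Proof.
move=> ht; have /choice[s hs] i := uu_nonzero (q i) (k i) ht.
by exists (\col_i s i); apply/prodf_neq0 => i _; rewrite mxE.
Qed.

Lemma NC i : (uN (q i))%:R != 0 :> C. Proof. exact: uNC. Qed.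

Lemma root_sumN i (d : int) :
  \sum_(j < M) ee (d%:~R * j%:R / (uN (q i))%:R) = if ((uN (q i))%:Z %| d)%Z then M%:R else 0.
Proof.
have /dvdnP[e eM] := NM i; have e0 : (0 < e)%N by case: e eM.
have MN : M%:R = e%:R * (uN (q i))%:R :> C by rewrite eM natrM.
have ez : e%:R != 0 :> C by rewrite pnatr_eq0 -lt0n.
transitivity (\sum_(j < M) ee ((d * e%:Z)%:~R * j%:R / M%:R)).
  apply: eq_bigr => j _; congr ee; rewrite rmorphM /= -pmulrn MN; field; rewrite ?ez ?NC //.
rewrite root_sum // eM PoszM [e%:Z * _]mulrC dvdz_mul2r //.
by rewrite eqz_nat -lt0n.
Qed.

(** The vectors [jv j] represent the shifts by multiples of [1 / uN (q i)] modulo integers. The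
    operator [jproj k] below is the Fourier projector onto the functions on which they act by the
    character [k]. *)
Definition jv (j : G) : 'cV[C]_c := \col_i ((j i)%:R / (uN (q i))%:R).
Definition jchar (k : 'I_c -> int) (j : G) : C := \prod_i ee (- ((k i)%:~R * (j i)%:R / (uN (q i))%:R)).
Definition jproj (k : 'I_c -> int) (F : 'cV[C]_c -> C) (s : 'cV[C]_c) : C :=
  (M%:R ^+ c)^-1 * \sum_(j : G) jchar k j * F (s + jv j).

Lemma thprod_jv k t s j : 0 < ImC t -> thprod k t (s + jv j) =
  (\prod_i ee ((k i)%:~R * (j i)%:R / (uN (q i))%:R)) * thprod k t s.
Proof.
move=> ht; rewrite /thprod -big_split; apply: eq_bigr => i _ /=; rewrite !mxE.
by rewrite -[(j i : nat)%:R]/((Posz (j i))%:~R) uu_shift1.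
Qed.

Lemma thprod_res k l t s : (forall i, ures (q i) (k i) (l i)) -> thprod l t s = thprod k t s.
Proof.
move=> h; apply: eq_bigr => i _; have /dvdzP[d hd] := h i.
by have -> : l i = k i + (uN (q i))%:Z * d; [rewrite mulrC -hd addrC subrK|rewrite uu_periodr].
Qed.

Lemma jproj_thprod k l t s : 0 < ImC t ->
  jproj k (thprod l t) s = if [forall i, ures (q i) (k i) (l i)] then thprod k t s else 0.
Proof.
move=> ht; rewrite /jproj.
transitivity ((M%:R ^+ c)^-1 * (\sum_(j : G) \prod_i ee ((l i - k i)%:~R * (j i)%:R / (uN (q i))%:R)) * thprod l t s).
  rewrite -mulrA mulr_suml; congr (_ * _); apply: eq_bigr => j _.
  rewrite thprod_jv // mulrA -big_split; congr (_ * _); apply: eq_bigr => i _ /=.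
  by rewrite -eeD; congr ee; rewrite rmorphB /=; ring.
rewrite -(bigA_distr_bigA (fun i (r : 'I_M) => ee ((l i - k i)%:~R * r%:R / (uN (q i))%:R))).
case: ifPn => [/forallP h|].
  rewrite (eq_bigr (fun=> M%:R)) => [|i _]; last by rewrite root_sumN -/(ures (q i) (k i) (l i)) h.
  rewrite prodr_const card_ord mulVf ?mul1r; first exact: thprod_res.
  by rewrite expf_neq0 // MC.
rewrite negb_forall => /existsP[i /negPf h].
by rewrite (bigD1 i) //= root_sumN -/(ures (q i) (k i) (l i)) h mul0r mulr0 mul0r.
Qed.

Lemma jprojD k F G' s : jproj k (fun x => F x + G' x) s = jproj k F s + jproj k G' s.
Proof. by rewrite /jproj -mulrDr -big_split; congr (_ * _); apply: eq_bigr => j _; rewrite mulrDr. Qed.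
Lemma jprojZ k a F s : jproj k (fun x => a * F x) s = a * jproj k F s.
Proof. by rewrite /jproj [RHS]mulrCA [X in _ = _ * X]mulr_sumr; congr (_ * _); apply: eq_bigr => j _; rewrite mulrCA. Qed.
Lemma jproj0 k s : jproj k (fun=> 0) s = 0.
Proof. by rewrite /jproj big1 ?mulr0 // => j _; rewrite mulr0. Qed.
Lemma jproj_sum (T : Type) (r : seq T) k (F : T -> 'cV[C]_c -> C) s :
  jproj k (fun x => \sum_(i <- r) F i x) s = \sum_(i <- r) jproj k (F i) s.
Proof.
elim: r => [|a r IH].
  rewrite big_nil -[RHS](jproj0 k s); congr jproj; apply/funext => x; exact: big_nil.
rewrite big_cons -IH -jprojD; congr jproj; apply/funext => x; exact: big_cons.
Qed.

Lemma jproj_theta k (t : uhp R) s g :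
  jproj k (fun x => theta psi t (PC *m x) g) s = (inOg g (qvec k))%:R * thprod k (uval t) s.
Proof.
have -> : (fun x => theta psi t (PC *m x) g) = fun x => tw * \sum_(n : G) (inOg g (qvec (vk n)))%:R * thprod (vk n) (uval t) x.
  by apply/funext => x; exact: theta_fin.
rewrite jprojZ jproj_sum.
transitivity (tw * \sum_(n : G) (\prod_i (if ures (q i) (vk n i) (k i) then 1 else 0)) * ((inOg g (qvec k))%:R * thprod k (uval t) s)).
  congr (_ * _); apply: eq_bigr => n _; rewrite jprojZ jproj_thprod ?uvalP //.
  have sy i : ures (q i) (k i) (vk n i) = ures (q i) (vk n i) (k i) by rewrite /ures -opprB rpredN.
  case: ifPn => [/forallP h|].
    rewrite big1 ?mul1r => [|i _]; last by rewrite -sy h.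
    by rewrite -(inOg_res g h).
  by rewrite negb_forall => /existsP[i /negPf h]; rewrite (bigD1 i) //= -sy h !mul0r mulr0.
rewrite -mulr_suml mulrA -[RHS]mul1r; congr (_ * _).
rewrite -(bigA_distr_bigA (fun i (r : 'I_M) => if ures (q i) (r : nat)%:Z (k i) then 1 else 0 : C)).
rewrite /tw -big_split big1 // => i _ /=.
by rewrite count_res ?NM // mulr1 mulrAC -natrM mulnC divnK ?NM // divff // MC.
Qed.

Lemma class_qvec g : exists k : 'I_c -> int, inOg g (qvec k).
Proof.
have [a aO ag] := class_surj g.
have /choice[k hk] i : exists z : int, 2 * sform S a (ratcV (col i P)) = z%:~R.
  by have /intrP := Omega_coord i aO.
by exists k; rewrite -(inOg_ker g (qvec_ker hk)) /inOg aO ag eqxx.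
Qed.
Lemma inOg_eq g g' a : inOg g a -> inOg g' a = (g' == g).
Proof. by move=> /andP[aO /eqP <-]; rewrite /inOg aO eq_sym. Qed.

(** If [qvec k] lies in the class [g], then [jproj k] kills every component other than [g] and maps
    the latter to a product that is not identically zero. *)
Lemma theta_indep (t : uhp R) (a : D_Omega psi -> C) :
  (forall z, \sum_g a g * theta psi t z g = 0) -> forall g, a g = 0.
Proof.
move=> h g; have [k hk] := class_qvec g; have [s hs] := thprod_nonzero k (uvalP t).
have : jproj k (fun x => \sum_g a g * theta psi t (PC *m x) g) s = 0.
  by rewrite -[RHS](jproj0 k s); congr jproj; apply/funext => x; exact: h.
rewrite jproj_sum (bigD1 g) //= big1 => [|g' g'g].
  by rewrite addr0 jprojZ jproj_theta hk mul1r => /eqP; rewrite mulf_eq0 (negPf hs) orbF => /eqP.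
by rewrite jprojZ jproj_theta (inOg_eq _ hk) (negPf g'g) mul0r mulr0.
Qed.
End ThetaProducts.

(** * Theta under the inversion S *)

Section SLaw.
Variable R : realType.
Local Notation C := R[i].
Local Notation ee := (@ee R).
Local Notation ImC := (@complex.Im R).
Variables (c : nat) (S : 'M[rat]_c) (Delta : discForm) (psi : jacobi_index S Delta).
Local Notation SC := (SC R S).
Local Notation qm a := (map_mx (ratr : rat -> C) a).
Variables (P : 'M[int]_c) (q : 'I_c -> nat).
Hypothesis uP : map_mx intr P \in (@unitmx rat c).
Hypothesis pP : forall i, psi (col i P) = 0.
Hypothesis dP : forall i j, sform S (ratcV (col i P)) (ratcV (col j P)) = if i == j then (q i)%:R else 0.
Local Notation PQ := (map_mx intr P : 'M[rat]_c).
Local Notation PC := (map_mx intr P : 'M[C]_c).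
Variable M0 : nat.
Local Notation M := M0.+1.
Hypothesis NM : forall i, (uN (q i) %| M)%N.
Local Notation G := {ffun 'I_c -> 'I_M}.
Local Notation qv := (qvec P q).
Local Notation thp := (thprod q).

Definition pairing (k l : 'I_c -> int) : rat := 2 * sform S (qv k) (qv l).

Lemma pairingE k l : pairing k l = \sum_i ((k i)%:~R * (l i)%:~R / (2 * (q i)%:R)).
Proof.
rewrite /pairing /qv (sformPP dP) mulr_sumr; apply: eq_bigr => i _; rewrite !mxE.
case: (posnP (q i)) => [->|q0]; first by rewrite mul0r mul0r !mulr0 invr0 mulr0.
have qz : (q i)%:R != 0 :> rat by rewrite pnatr_eq0 -lt0n.
by field.
Qed.
Lemma pairingEC k l : ratr (pairing k l) = \sum_i ((k i)%:~R * (l i)%:~R / (2 * (q i)%:R)) :> C.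
Proof.
rewrite pairingE rmorph_sum; apply: eq_bigr => i _ /=.
by rewrite 2!rmorphM fmorphV rmorphM /= !ratr_int !ratr_nat.
Qed.
Lemma pairing_int k d : (forall i, q i != 0%N -> ((uN (q i))%:Z %| d i)%Z) -> pairing k d \is a Num.int.
Proof.
move=> h; rewrite pairingE; apply: rpred_sum => i _; case: (eqVneq (q i) 0%N) => [->|q0].
  by rewrite mulr0 invr0 mulr0 rpred0.
have /dvdzP[e ->] := h i q0.
have qz : (q i)%:R != 0 :> rat by rewrite pnatr_eq0.
have -> : (k i)%:~R * (e * (uN (q i))%:Z)%:~R / (2 * (q i)%:R) = (k i * e)%:~R :> rat.
  by rewrite !rmorphM /= -pmulrn /uN (negPf q0) natrM; field.
exact: intr_int.
Qed.

Lemma ures_mod i (k : int) : ures (q i) k (modz k M%:Z).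
Proof.
rewrite /ures; have {2}-> := divz_eq k M%:Z; rewrite opprD addrC addrNK rpredN.
by rewrite dvdz_mull // dvdzE /=.
Qed.
Lemma ures_modn i (k : nat) : ures (q i) k%:Z (k %% M)%N%:Z.
Proof. by have := ures_mod i k%:Z; rewrite modz_nat. Qed.

Lemma vkD (n k : G) i : ures (q i) (vk n i + vk k i) (vk (n + k) i).
Proof. by rewrite /vk ffunE /= -PoszD; exact: ures_modn. Qed.

Definition redG (k : 'I_c -> int) : G := [ffun i => inord (absz (modz (k i) M%:Z))].
Lemma redGP k i : ures (q i) (k i) (vk (redG k) i).
Proof.
have -> : vk (redG k) i = modz (k i) M%:Z; last exact: ures_mod.
rewrite /vk /redG ffunE inordK; first by rewrite gez0_abs ?modz_ge0.
by rewrite -ltz_nat gez0_abs ?modz_ge0 // ltz_pmod.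
Qed.

Lemma qvecD k l : qv k + qv l = qv (fun i => k i + l i).
Proof.
by rewrite /qvec -mulmxDr; congr (_ *m _); apply/colP => i; rewrite !mxE rmorphD [RHS]mulrDl.
Qed.

Lemma qvec_vkD (n k : G) : qv (vk (n + k)) - (qv (vk n) + qv (vk k)) \in Omega psi.
Proof. by rewrite qvecD qvecB; apply: (qvec_int pP) => i _; exact: vkD. Qed.

Lemma class_qvecG g : exists n : G, inOg (psi := psi) g (qv (vk n)).
Proof.
have [k hk] := class_qvec uP pP dP g; exists (redG k).
by rewrite -(inOg_res pP g (redGP k)).
Qed.

(** Brings a vector of [Omega] into the finite index set [G] without changing its pairings modulo Z,
    so that translation by it becomes a reindexing of sums over [G]. *)
Lemma Omega_qvecG b : b \in Omega psi -> exists n : G, qv (vk n) \in Omega psi /\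
  forall l, 2 * sform S (qv l) b - pairing l (vk n) \is a Num.int.
Proof.
move=> bO; have /choice[k hk] i : exists z : int, 2 * sform S b (ratcV (col i P)) = z%:~R.
  by have /intrP := Omega_coord pP i (Omega_sub bO).
have kk := qvec_ker psi uP dP hk.
have hd : qv (vk (redG k)) - qv k \in Omega psi.
  by rewrite qvecB; apply: (qvec_int pP) => i _; exact: redGP.
exists (redG k); split.
  rewrite -[qv (vk _)](subrK (qv k)) rpredD // -[qv k](subKr b) rpredB //.
  exact: kerS_Omega.
move=> l; rewrite /pairing -mulrBr -sformNr -sformDr.
have -> : b - qv (vk (redG k)) = (b - qv k) + (qv (fun i => k i - vk (redG k) i)).
  by rewrite -qvecB addrA subrK.
rewrite sformDr (kerS_r _ kk) add0r; apply: pairing_int => i _.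
by rewrite -opprB rpredN; exact: redGP.
Qed.

Lemma ee_ratD_int (x y : rat) : x - y \is a Num.int -> ee (- ratr x) = ee (- ratr y).
Proof.
by move=> h; rewrite -[x](subrK y) rmorphD opprD eeD eeN (ee_intq _ h) invr1 mul1r.
Qed.

Lemma pairingDl k k' l : pairing (fun i => k i + k' i) l = pairing k l + pairing k' l.
Proof. by rewrite /pairing -qvecD sformDl mulrDr. Qed.
Lemma pairingC k l : pairing k l = pairing l k.
Proof. by rewrite /pairing (sformC (index_sym psi)). Qed.
Lemma pairingB_int k k' l : (forall i, ures (q i) (k' i) (k i)) -> pairing k l - pairing k' l \is a Num.int.
Proof.
move=> h; rewrite /pairing -mulrBr -sformNl -sformDl qvecB -/(pairing _ l) pairingC; apply: pairing_int => i _.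
exact: h.
Qed.

Lemma inOg_vkD g (n k : G) : qv (vk k) \in Omega_star psi ->
  inOg (psi := psi) (g + DOmega_class psi (qv (vk k))) (qv (vk (n + k))) = inOg g (qv (vk n)).
Proof. by move=> kO; rewrite (inOg_Omega _ (qvec_vkD n k)) inOgD. Qed.

Lemma sum_shift (k : G) (F : G -> C) : \sum_(n : G) F n = \sum_(n : G) F (n + k).
Proof. by rewrite (reindex_inj (addIr k)). Qed.

Lemma indsum g : \sum_(n : G) (inOg (psi := psi) g (qv (vk n)))%:R =
  \sum_(n : G) (inOg (psi := psi) 0 (qv (vk n)))%:R :> C.
Proof.
have [k hk] := class_qvecG g; have /andP[kO /eqP kg] := hk.
rewrite [LHS](sum_shift k (fun n : G => (inOg (psi := psi) g (qv (vk n)))%:R)).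
by apply: eq_bigr => n _; rewrite -(inOg_vkD 0 n kO) kg add0r.
Qed.

(** If [qv l] is not in [Omega_star], some vector of [Omega] pairs non-integrally with it;
    translating by that vector multiplies the sum by a root of unity other than 1, so the sum is
    zero. Otherwise all terms of the class [g] are equal. *)
Lemma charsum g (l : 'I_c -> int) :
  \sum_(n : G) (inOg (psi := psi) g (qv (vk n)))%:R * ee (- ratr (pairing (vk n) l)) =
  (\sum_(n : G) (inOg (psi := psi) 0 (qv (vk n)))%:R) *
  \sum_d eQZ R (- bform g d) * (inOg d (qv l))%:R.
Proof.
have [lO|lO] := boolP (qv l \in Omega_star psi).
  rewrite -(indsum g) mulr_suml; apply: eq_bigr => n _.
  rewrite (bigD1 (DOmega_class psi (qv l) : D_Omega psi)) //= big1 => [|d dl]; last first.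
    by rewrite /inOg lO eq_sym (negPf dl) mulr0.
  rewrite /inOg lO eqxx mulr1 addr0; case: (boolP (_ \in _)) => nO; last by rewrite !mul0r.
  case: eqP => [<-|_]; last by rewrite !mul0r.
  by rewrite eQZN bform_class // eQZ_toQZ -eeN.
have [b [bO nz]] : exists b, b \in Omega psi /\ ~~ (2 * sform S (qv l) b \is a Num.int).
  apply: contrapT => h; case/negP: lO; apply/Omega_starP => b bO.
  by apply: contrapT => h'; apply: h; exists b; split=> //; apply/negP.
have [k [kO hk]] := Omega_qvecG bO.
rewrite [X in _ * X]big1 => [|d _]; last by rewrite /inOg (negPf lO) mulr0.
rewrite mulr0; set X := LHS.
have E : X = ee (- ratr (pairing (vk k) l)) * X.
  rewrite {1}/X (sum_shift k (fun n : G => (inOg (psi := psi) g (qv (vk n)))%:R * ee (- ratr (pairing (vk n) l)))) mulr_sumr; apply: eq_bigr => n _.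
  have h := inOg_vkD g n (Omega_sub kO); rewrite (class_Omega0 kO) addr0 in h.
  rewrite h [RHS]mulrCA -eeD; congr (_ * _).
  rewrite -opprD -rmorphD; apply: ee_ratD_int; rewrite [pairing (vk k) l + _]addrC -pairingDl; apply: pairingB_int => i; exact: vkD.
have n1 : ee (- ratr (pairing (vk k) l)) != 1.
  apply: contraNneq nz; rewrite eeN => /(congr1 (@GRing.inv _)); rewrite invrK invr1 => /ee_rat_eq1 h.
  by rewrite -[2 * _](subrK (pairing l (vk k))) rpredD ?hk // pairingC.
apply/eqP; move/eqP: E; rewrite -subr_eq0 -{1}[X]mul1r -mulrBl mulf_eq0 subr_eq0 eq_sym (negPf n1) //.
Qed.

Lemma thprod_S : exists K : C, forall (t : uhp R) (k : 'I_c -> int) (s : 'cV[C]_c),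
  thp k (- (uval t)^-1) ((uval t)^-1 *: s) =
  K * usqrt t ^+ #|[pred i | (0 < q i)%N]| * ee ((\sum_i (q i)%:R * s i 0 * s i 0) / uval t) *
  \sum_(n : G) ee (- ratr (pairing k (vk n))) * thp (vk n) (uval t) s.
Proof.
have /choice[kq hq] i := @uu_S R (q i) M (NM i) erefl.
exists (\prod_i kq i) => t k s.
transitivity (\prod_i (kq i * (if (0 < q i)%N then usqrt t else 1) * ee ((q i)%:R * (s i 0) ^+ 2 / uval t) *
   \sum_(r' < M) ee (- ((k i)%:~R * r'%:R / (2 * (q i)%:R))) * uu (q i) r'%:Z (uval t) (s i 0))).
  by apply: eq_bigr => i _; rewrite -hq [in LHS]mxE mulrC.
rewrite 3!big_split /=; congr (_ * _ * _ * _).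
- by rewrite -big_mkcond prodr_const.
- rewrite mulr_suml ee_sum; apply: eq_bigr => i _; congr ee; ring.
rewrite (bigA_distr_bigA (fun i (r' : 'I_M) => ee (- ((k i)%:~R * r'%:R / (2 * (q i)%:R))) * uu (q i) r'%:Z (uval t) (s i 0))).
apply: eq_bigr => n _; rewrite big_split /=; congr (_ * _).
by rewrite pairingEC -sumrN ee_sum; apply: eq_bigr => i _; rewrite /vk -pmulrn.
Qed.

(** Adding up [thprod_S] over a class, [charsum] discards all [l] outside [Omega_star], and what
    remains reassembles into theta. The number [N0] is the common number of elements of [G] in a
    class. *)
Lemma theta_S0 : exists K : C, forall (t : uhp R) z g,
  theta psi (mp_act (mpS R) t) ((uval t)^-1 *: z) g =
  K * usqrt t ^+ #|[pred i | (0 < q i)%N]| * ee (sform SC z z / uval t) *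
  \sum_d eQZ R (- bform g d) * theta psi t z d.
Proof.
have [K hK] := thprod_S.
pose N0 : C := \sum_(n : G) (inOg (psi := psi) 0 (qv (vk n)))%:R.
exists (K * N0).
have fin (t : uhp R) s g : theta psi t (PC *m s) g =
  tw R q M0 * \sum_(n : G) (inOg g (qv (vk n)))%:R * thp (vk n) (uval t) s by exact: (theta_fin uP pP dP NM).
suff main (t : uhp R) (s : 'cV[C]_c) g : theta psi (mp_act (mpS R) t) (PC *m ((uval t)^-1 *: s)) g =
  K * N0 * usqrt t ^+ #|[pred i | (0 < q i)%N]| * ee ((\sum_i (q i)%:R * s i 0 * s i 0) / uval t) *
  \sum_d eQZ R (- bform g d) * theta psi t (PC *m s) d.
  move=> t z g; have e := PCK uP z.
  have := main t (invmx PC *m z) g; rewrite -(sformPPC dP) -scalemxAr -e; exact.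
rewrite [LHS](fin (mp_act (mpS R) t)) uval_actS.
set U := usqrt t ^+ _; set V := ee _.
transitivity (tw R q M0 * (K * U * V * \sum_(l : G) (\sum_(n : G) (inOg g (qv (vk n)))%:R * ee (- ratr (pairing (vk n) (vk l)))) * thp (vk l) (uval t) s)).
  congr (_ * _); under [in RHS]eq_bigr do rewrite mulr_suml.
  rewrite exchange_big /= mulr_sumr; apply: eq_bigr => n _.
  rewrite hK -/U -/V mulrCA; congr (_ * _); rewrite mulr_sumr; apply: eq_bigr => l _.
  by rewrite mulrA.
transitivity (tw R q M0 * (K * U * V * \sum_(l : G) N0 * (\sum_d eQZ R (- bform g d) * (inOg d (qv (vk l)))%:R) * thp (vk l) (uval t) s)).
  by congr (_ * (_ * _)); apply: eq_bigr => l _; rewrite charsum.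
transitivity (K * N0 * U * V * (tw R q M0 * \sum_(l : G) (\sum_d eQZ R (- bform g d) * (inOg d (qv (vk l)))%:R) * thp (vk l) (uval t) s)).
  under eq_bigr do rewrite -mulrA; rewrite -mulr_sumr; ring.
congr (_ * _); under [in RHS]eq_bigr do rewrite fin mulrCA mulr_sumr.
rewrite -mulr_sumr exchange_big /=; congr (_ * _); apply: eq_bigr => l _.
by rewrite mulr_suml; apply: eq_bigr => d _; rewrite mulrA.
Qed.

(** * Expansion of a quasi-periodic function of z at a fixed tau *)

Variable t : uhp R.
Variable f : 'cV[C]_c -> C.
Hypothesis fq : forall z a, qreg (fun x => f (z + x *: a)).
Hypothesis fl : forall z (u v : 'cV[int]_c), psi u = 0 -> psi v = 0 ->
  f (z + uval t *: intC_cV R u + intC_cV R v) =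
  ee (- (uval t * sform SC (intC_cV R u) (intC_cV R u)) - 2 * sform SC (intC_cV R u) z) * f z.

Let F (s : 'cV[C]_c) : C := f (PC *m s).
Local Notation jprojF k := (@jproj R c q M0 k F).
Local Notation jv := (@jv R c q M0).
Local Notation jc := (@jchar R c q M0).

Lemma intC0 : intC_cV R (0 : 'cV[int]_c) = 0. Proof. by apply/colP => i; rewrite !mxE. Qed.
Lemma fv z v : psi v = 0 -> f (z + intC_cV R v) = f z.
Proof.
move=> pv; have := @fl z 0 v (raddf0 psi) pv.
by rewrite intC0 scaler0 addr0 !sform0l !mulr0 oppr0 addr0 ee0 mul1r.
Qed.
Lemma fu z u : psi u = 0 -> f (z + uval t *: intC_cV R u) =
  ee (- (uval t * sform SC (intC_cV R u) (intC_cV R u)) - 2 * sform SC (intC_cV R u) z) * f z.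
Proof. by move=> pu; have := @fl z u 0 pu (raddf0 psi); rewrite intC0 addr0. Qed.

Lemma psi_P (d : 'cV[int]_c) : psi (P *m d) = 0.
Proof.
have -> : P *m d = \sum_i (col i P *~ d i 0).
  by apply/colP => j; rewrite summxE [LHS]mxE; apply: eq_bigr => i _; rewrite colMz mulrC; congr (_ * _); rewrite mxE.
by rewrite raddf_sum big1 // => i _; rewrite raddfMz pP mul0rz.
Qed.
Lemma intC_P (d : 'cV[int]_c) : intC_cV R (P *m d) = PC *m intC_cV R d.
Proof. exact: map_mxM. Qed.

Lemma F_int s (d : 'I_c -> int) : F (s + \col_i (d i)%:~R) = F s.
Proof.
rewrite /F mulmxDr -[RHS](fv _ (psi_P (\col_i d i))) intC_P; congr (f (_ + _ *m _)).
by apply/colP => i; rewrite !mxE.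
Qed.
Lemma F_tau s i : F (s + uval t *: delta_mx i 0) =
  ee (- ((q i)%:R * uval t) - 2 * (q i)%:R * s i 0) * F s.
Proof.
rewrite /F mulmxDr -scalemxAr.
have e : (delta_mx i 0 : 'cV[C]_c) = intC_cV R (delta_mx i 0).
  by apply/colP => j; rewrite !mxE; case: (_ && _).
rewrite e -intC_P (fu _ (psi_P _)) intC_P (sformPPC dP) (sformPPC dP) -e; congr (ee _ * _).
have h (x : 'cV[C]_c) : \sum_j (q j)%:R * (delta_mx i 0 : 'cV[C]_c) j 0 * x j 0 = (q i)%:R * x i 0.
  rewrite (bigD1 i) //= big1 ?addr0 => [|j ji]; rewrite !mxE ?eqxx ?mulr1 //.
  by rewrite (negPf ji) /= mulr0 mul0r.
by rewrite !h mxE !eqxx /=; ring.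
Qed.

Lemma jvD (j l : G) : exists d : 'I_c -> int, jv j + jv l = jv (j + l) + \col_i (d i)%:~R.
Proof.
have /choice[d hd] i : exists d : int, vk j i + vk l i = vk (j + l) i + d * (uN (q i))%:Z.
  have := vkD j l i; rewrite /ures -opprB rpredN => /dvdzP[d hd]; exists d.
  by rewrite -hd; ring.
exists d; apply/colP => i; rewrite !mxE.
have Nz := uNC R (q i).
have e (x : G) : (x i : nat)%:R = (vk x i)%:~R :> C by rewrite /vk pmulrn.
by rewrite !e -mulrDl -rmorphD hd rmorphD rmorphM /= -pmulrn mulrDl mulfK.
Qed.

Lemma ee_opp_int (n : int) : ee (- n%:~R) = 1. Proof. by rewrite eeN ee_int invr1. Qed.

Lemma ee_cong (n : int) (a b : C) : a = - n%:~R + b -> ee a = ee b.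
Proof. by move=> ->; rewrite eeD ee_opp_int mul1r. Qed.

Lemma jcharD k (j l : G) : jc k (j + l) = jc k j * jc k l.
Proof.
rewrite /jchar -big_split; apply: eq_bigr => i _ /=; rewrite -eeD.
have := vkD j l i; rewrite /ures => /dvdzP[d hd].
have Nz := uNC R (q i).
have e (x : G) : (x i : nat)%:R = (vk x i)%:~R :> C by rewrite /vk pmulrn.
rewrite !e; have -> : vk (j + l) i = vk j i + vk l i + d * (uN (q i))%:Z by rewrite -hd; ring.
apply: (@ee_cong (k i * d)).
by rewrite !(rmorphD, rmorphM) /= -pmulrn; field.
Qed.
Lemma jchar_neq0 k j : jc k j != 0.
Proof. by apply/prodf_neq0 => i _; exact: ee_neq0. Qed.

Lemma jproj_jv k s l : jprojF k (s + jv l) = (jc k l)^-1 * jprojF k s.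
Proof.
apply: (mulfI (jchar_neq0 k l)); rewrite [RHS](mulVKf (jchar_neq0 k l)).
rewrite /jproj mulrCA; congr (_ * _).
rewrite [RHS](sum_shift l (fun j : G => jc k j * F (s + jv j))) mulr_sumr; apply: eq_bigr => j _.
rewrite jcharD mulrA [jc k l * _]mulrC; congr (_ * _).
have [d hd] := jvD j l; rewrite -addrA [jv l + _]addrC hd addrA F_int //.
Qed.

Lemma jproj_tau k s i : jprojF k (s + uval t *: delta_mx i 0) =
  ee (- ((q i)%:R * uval t) - 2 * (q i)%:R * s i 0) * jprojF k s.
Proof.
rewrite /jproj mulrCA; congr (_ * _); rewrite mulr_sumr; apply: eq_bigr => j _.
rewrite addrAC F_tau mulrCA; congr (_ * (_ * _)); rewrite !mxE.
case: (posnP (q i)) => [->|q0]; first by congr ee; ring.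
have qz : (q i)%:R != 0 :> C by rewrite pnatr_eq0 -lt0n.
apply: (@ee_cong (vk j i)).
have -> : (uN (q i))%:R = 2 * (q i)%:R :> C by rewrite /uN ifN -?lt0n // natrM.
by rewrite /vk -pmulrn; field.
Qed.

Lemma qreg_cst (a : C) : qreg (fun=> a).
Proof.
exists (fun=> 0) => r; exists (nc a) => s _; split=> // [|h _]; first by rewrite nc0 nc_ge0.
by rewrite subrr mulr0 subr0 nc0 mulr_ge0 ?nc_ge0 // exprn_ge0 // nc_ge0.
Qed.
Lemma qreg_add (g h : C -> C) : qreg g -> qreg h -> qreg (fun x => g x + h x).
Proof.
move=> [g' hg] [h' hh]; exists (fun x => g' x + h' x) => r.
have [M1 h1] := hg r; have [M2 h2] := hh r; exists (M1 + M2) => s sr.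
have [a1 a2 a3] := h1 s sr; have [b1 b2 b3] := h2 s sr; split.
- exact: le_trans (ncD _ _) (lerD a1 b1).
- exact: le_trans (ncD _ _) (lerD a2 b2).
move=> x xr.
have -> : g (s + x) + h (s + x) - (g s + h s) - x * (g' s + h' s) =
  (g (s + x) - g s - x * g' s) + (h (s + x) - h s - x * h' s) by ring.
by rewrite mulrDl; exact: le_trans (ncD _ _) (lerD (a3 x xr) (b3 x xr)).
Qed.
Lemma qreg_sum (T : Type) (r : seq T) (g : T -> C -> C) : (forall i, qreg (g i)) ->
  qreg (fun x => \sum_(i <- r) g i x).
Proof.
move=> h; elim: r => [|a r IH].
  have -> : (fun x => \sum_(i <- [::]) g i x) = fun=> 0 by apply/funext => x; rewrite big_nil.
  exact: qreg_cst.
have -> : (fun x => \sum_(i <- a :: r) g i x) = fun x => g a x + \sum_(i <- r) g i x.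
  by apply/funext => x; rewrite big_cons.
exact: qreg_add.
Qed.

Lemma jproj_qreg k s i : qreg (fun x => jprojF k (s + x *: delta_mx i 0)).
Proof.
apply: qreg_mul; first exact: qreg_cst.
apply: qreg_sum => j; apply: qreg_mul; first exact: qreg_cst.
have -> : (fun x => F (s + x *: delta_mx i 0 + jv j)) = fun x => f (PC *m (s + jv j) + x *: (PC *m delta_mx i 0)).
  by apply/funext => x; rewrite /F addrAC mulmxDr scalemxAr.
exact: fq.
Qed.

(** In the single coordinate [i], the projection has exactly the quasi-periods that [uu_rank] asks
    for. *)
Lemma jproj_step k s i (x x0 : C) :
  jprojF k (s + x *: delta_mx i 0) * uu (q i) (k i) (uval t) (s i 0 + x0) =
  jprojF k (s + x0 *: delta_mx i 0) * uu (q i) (k i) (uval t) (s i 0 + x).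
Proof.
pose g y := jprojF k (s + (1 * y - s i 0) *: delta_mx i 0).
have gE y : jprojF k (s + y *: delta_mx i 0) = g (s i 0 + y) by rewrite /g mul1r [s i 0 + y]addrC addrK.
rewrite !gE; apply: uu_rank (uvalP t) _ _ _ _ _.
- exact: (qreg_affine 1 (- s i 0) (jproj_qreg k s i)).
- move=> y; rewrite /g.
  pose l : G := [ffun j => if j == i then inZp 1 else 0].
  have e : s + (1 * (y + (uN (q i))%:R^-1) - s i 0) *: delta_mx i 0 = s + (1 * y - s i 0) *: delta_mx i 0 + (uN (q i))%:R^-1 *: delta_mx i 0.
    by apply/colP => j; rewrite !mxE; ring.
  rewrite e; set s1 := s + _.
  (* For [M = 1] the residue [inZp 1] is 0; then [uN (q i) = 1] and the shift is integral. *)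
  have [M1|M1] := posnP M0.
    have N1 : uN (q i) = 1%N by have := NM i; rewrite M1 dvdn1 => /eqP.
    rewrite N1 invr1 scale1r mulr1 ee_int mul1r.
    have el : delta_mx i 0 = \col_j ((j == i)%:Z)%:~R :> 'cV[C]_c.
      by apply/colP => j; rewrite !mxE andbT; case: (j == i).
    rewrite /jproj; congr (_ * _); apply: eq_bigr => j _; rewrite addrAC el.
    by rewrite (F_int _ (fun j => (j == i)%:Z)).
  have l1 j : (l j : nat) = (j == i) :> nat.
    by rewrite /l ffunE; case: (j == i) => //=; rewrite modn_small.
  have -> : (uN (q i))%:R^-1 *: delta_mx i 0 = jv l.
    apply/colP => j; rewrite !mxE l1 andbT; case: eqP => [->|_]; rewrite ?mulr1 ?mul1r // mulr0 mul0r //.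
  rewrite jproj_jv; congr (_ * _); rewrite /jchar (bigD1 i) //= big1 => [|j ji].
    by rewrite l1 eqxx mulr1 eeN invrK ?mulr1.
  by rewrite l1 (negPf ji) mulr0 mul0r oppr0 ee0.
move=> y; rewrite /g.
have -> : s + (1 * (y + uval t) - s i 0) *: delta_mx i 0 = s + (1 * y - s i 0) *: delta_mx i 0 + uval t *: delta_mx i 0.
  by apply/colP => j; rewrite !mxE; ring.
rewrite jproj_tau; congr (ee (_ - _ * _) * _); rewrite !mxE !eqxx /=; ring.
Qed.

Definition mix (m : nat) (s s0 : 'cV[C]_c) : 'cV[C]_c := \col_i (if (i < m)%N then s0 i 0 else s i 0).

(** Separation of variables: the coordinates of [s] are exchanged for those of [s0] one by one, and
    cross-multiplication avoids dividing by factors that may vanish. *)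
Lemma mix_prod (h : 'cV[C]_c -> C) (w : 'I_c -> C -> C) (s s0 : 'cV[C]_c) :
  (forall s i x x0, h (s + x *: delta_mx i 0) * w i (s i 0 + x0) =
     h (s + x0 *: delta_mx i 0) * w i (s i 0 + x)) ->
  forall m, (m <= c)%N -> h s * \prod_(i < c | (i < m)%N) w i (s0 i 0) =
    h (mix m s s0) * \prod_(i < c | (i < m)%N) w i (s i 0).
Proof.
move=> step; elim=> [|m IH] hm.
  have -> : mix 0 s s0 = s by apply/colP => i; rewrite mxE.
  by rewrite !big_pred0.
pose i0 : 'I_c := Ordinal hm.
have bs (x : 'I_c -> C) : \prod_(i < c | (i < m.+1)%N) x i = x i0 * \prod_(i < c | (i < m)%N) x i.
  rewrite (bigD1 i0) //=; congr (_ * _); apply: eq_bigl => i.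
  by rewrite -val_eqE /= ltnS ltn_neqAle andbC.
rewrite !bs mulrCA IH ?(ltnW hm) // mulrCA [in RHS]mulrA; set X := \prod_(i < c | _) _.
rewrite mulrA; congr (_ * _).
have := step (mix m s s0) i0 0 (s0 i0 0 - s i0 0).
have -> : mix m s s0 i0 0 = s i0 0 by rewrite mxE ltnn.
rewrite scale0r !addr0 [s i0 0 + _]addrC subrK.
have -> : mix m s s0 + (s0 i0 0 - s i0 0) *: delta_mx i0 0 = mix m.+1 s s0.
  apply/colP => i; rewrite !mxE andbT ltnS.
  have [->|ni] := eqVneq i i0; first by rewrite ltnn leqnn mulr1 addrC subrK.
  by rewrite mulr0 addr0 [(i <= m)%N]leq_eqVlt -[val i == m]/(i == i0) (negPf ni).
by rewrite mulrC.
Qed.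

Lemma jproj_prop k s s0 : jprojF k s * thp k (uval t) s0 = jprojF k s0 * thp k (uval t) s.
Proof.
have := mix_prod (h := jprojF k) (w := fun i => uu (q i) (k i) (uval t)) s s0 (jproj_step k) (leqnn c).
have e (x : 'I_c -> C) : \prod_(i < c | (i < c)%N) x i = \prod_i x i by apply: eq_bigl => i; rewrite ltn_ord.
rewrite !e (_ : mix c s s0 = s0) //; by apply/colP => i; rewrite mxE ltn_ord.
Qed.

Lemma jproj_coef k : exists a, forall s, jprojF k s = a * thp k (uval t) s.
Proof.
have [s0 hs0] := thprod_nonzero q k (uvalP t).
exists (jprojF k s0 / thp k (uval t) s0) => s.
by apply: (mulIf hs0); rewrite jproj_prop [RHS]mulrAC divfK.
Qed.

(** Fourier inversion: summing the characters leaves the [j] for which [jv j] is integral, where [F]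
    is unchanged; [tw] and the normalization of [jproj] cancel their number. *)
Lemma jproj_total s : tw R q M0 * \sum_(n : G) jprojF (vk n) s = F s.
Proof.
have Mz := MC R M0.
have cs (j : G) : \sum_(n : G) jc (vk n) j = \prod_i (if ures (q i) (j i)%:Z 0 then M%:R else 0).
  rewrite /jchar -(bigA_distr_bigA (fun i (r : 'I_M) => ee (- ((r : nat)%:Z%:~R * (j i)%:R / (uN (q i))%:R)))).
  apply: eq_bigr => i _; rewrite /ures -(root_sumN R NM); apply: eq_bigr => r _; congr ee.
  by rewrite rmorphB /= -!pmulrn; ring.
rewrite /jproj -mulr_sumr exchange_big /=.
transitivity (tw R q M0 * ((M%:R ^+ c)^-1 * \sum_(j : G) (\prod_i (if ures (q i) (j i)%:Z 0 then M%:R else 0)) * F s)).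
  congr (_ * (_ * _)); apply: eq_bigr => j _; rewrite -mulr_suml cs.
  have [/forallP h|] := boolP [forall i, ures (q i) (j i)%:Z 0]; last first.
    by rewrite negb_forall => /existsP[i /negPf h]; rewrite (bigD1 i) //= h !mul0r.
  congr (_ * _).
  have /choice[d hd] i : exists d : int, (j i : nat)%:Z = d * (uN (q i))%:Z.
    by have /dvdzP[d hd] := h i; exists (- d); rewrite mulNr -hd sub0r opprK.
  rewrite -[RHS](F_int s d); congr F; congr (_ + _); apply/colP => i; rewrite !mxE.
  by rewrite -[(j i : nat)%:R]/((Posz (j i))%:~R) hd rmorphM /= -pmulrn mulfK // uNC.
rewrite -mulr_suml !mulrA -[RHS]mul1r; congr (_ * _).
rewrite -(bigA_distr_bigA (fun i (r : 'I_M) => if ures (q i) (r : nat)%:Z 0 then M%:R else 0 : C)).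
have -> : M%:R ^+ c = \prod_(i < c) M%:R :> C by rewrite prodr_const card_ord.
rewrite /tw -prodfV -2!big_split big1 // => i _ /=.
rewrite (count_res 0 _ (NM i)) //; have /dvdnP[e eM] := NM i.
have Nz := uNC R (q i).
have -> : (M %/ uN (q i))%N%:R = M%:R / (uN (q i))%:R :> C.
  by rewrite {2}eM natrM mulfK // eM mulnK // uN_gt0.
by move: Nz Mz; move: (uN (q i))%:R M%:R => n m nz mz; field; rewrite nz mz.
Qed.

Section Shift.
Variables (b x : 'cV[rat]_c) (d : 'I_c -> int).
Hypothesis bE : b = PQ *m x.
Hypothesis bd : forall i, 2 * sform S b (ratcV (col i P)) = (d i)%:~R.
Let xd i : 2 * ((q i)%:R * x i 0) = (d i)%:~R.
Proof. by rewrite -bd bE (PQ_coord dP). Qed.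
Let xdC i : (0 < q i)%N -> ratr (x i 0) = (d i)%:~R / (2 * (q i)%:R) :> C.
Proof.
move=> q0; have qz : (q i)%:R != 0 :> C by rewrite pnatr_eq0 -lt0n.
have := congr1 (ratr : rat -> C) (xd i); rewrite !rmorphM /= ratr_int !ratr_nat => <-.
by field.
Qed.

Lemma thprod_real k s : thp k (uval t) (s + qm x) = ee (ratr (2 * sform S (qv k) b)) * thp k (uval t) s.
Proof.
rewrite bE /qvec (sformPP dP) ratr2M rmorph_sum mulr_sumr ee_sum /thprod -big_split /=.
apply: eq_bigr => i _; rewrite !mxE.
case: (posnP (q i)) => [->|q0]; first by rewrite !uu0 !mul0r rmorph0 mulr0 ee0 mulr1.
have qz : (q i)%:R != 0 :> C by rewrite pnatr_eq0 -lt0n.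
rewrite xdC // !rmorphM fmorphV rmorphM /= xdC // !ratr_int !ratr_nat.
have NE : (uN (q i))%:R = 2 * (q i)%:R :> C by rewrite /uN ifN -?lt0n // natrM.
have := uu_shift1 (q i) (k i) (s i 0) (d i) (uvalP t); rewrite NE => ->.
by congr (ee _ * _); field.
Qed.

Lemma thprod_tau k s : thp k (uval t) (s + uval t *: qm x) =
  ee (- (uval t * ratr (sform S b b)) - 2 * sform SC (qm b) (PC *m s)) * thp (fun i => k i + d i) (uval t) s.
Proof.
rewrite bE (sformPP dP) qm_PQ (sformPPC dP) rmorph_sum !mulr_sumr -!sumrN -big_split /= ee_sum.
rewrite /thprod -big_split /=; apply: eq_bigr => i _; rewrite !mxE.
case: (posnP (q i)) => [->|q0]; first by rewrite !uu0 !mul0r rmorph0 !mulr0 oppr0 addr0 ee0 mulr1.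
have qz : (q i)%:R != 0 :> C by rewrite pnatr_eq0 -lt0n.
rewrite !rmorphM /= xdC // !ratr_nat uu_shiftt ?uvalP //; last by move=> q1; rewrite q1 in q0.
by congr (ee _ * _); field.
Qed.

Lemma jproj_shiftr k s : (forall s, F (s + qm x) = F s) -> jprojF k (s + qm x) = jprojF k s.
Proof. by move=> h; rewrite /jproj; congr (_ * _); apply: eq_bigr => j _; rewrite addrAC h. Qed.

(** The exponential factor is linear in [s], so it varies by a root of unity along [jv j]; this
    moves the character from [k] to [k + d]. *)
Lemma jproj_shiftt k s :
  (forall s, F (s + uval t *: qm x) = ee (- (uval t * ratr (sform S b b)) - 2 * sform SC (qm b) (PC *m s)) * F s) ->
  jprojF k (s + uval t *: qm x) =
  ee (- (uval t * ratr (sform S b b)) - 2 * sform SC (qm b) (PC *m s)) * jprojF (fun i => k i + d i) s.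
Proof.
move=> h; rewrite /jproj mulrCA; congr (_ * _); rewrite mulr_sumr; apply: eq_bigr => j _.
have -> : jc (fun i => k i + d i) j = jc k j * ee (- (2 * sform SC (qm b) (PC *m jv j))).
  rewrite [in RHS]bE qm_PQ (sformPPC dP) mulr_sumr -sumrN ee_sum /jchar -big_split /=.
  apply: eq_bigr => i _; rewrite -eeD !mxE; congr ee.
  case: (posnP (q i)) => [q0|q0].
    have := xd i; rewrite q0 mul0r mulr0 => /esym/eqP; rewrite intr_eq0 => /eqP ->.
    by rewrite addr0 !mul0r mulr0 subr0.
  have qz : (q i)%:R != 0 :> C by rewrite pnatr_eq0 -lt0n.
  have NE : (uN (q i))%:R = 2 * (q i)%:R :> C by rewrite /uN ifN -?lt0n // natrM.
  by rewrite xdC // NE rmorphD /=; field.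
rewrite addrAC h mulmxDr sformDr [LHS]mulrA [RHS]mulrA; congr (_ * _).
by rewrite [RHS]mulrCA -eeD; congr (_ * ee _); ring.
Qed.
End Shift.

Variable a : ('I_c -> int) -> C.
Hypothesis aP : forall k s, jprojF k s = a k * thp k (uval t) s.

(** In a coordinate with [q i = 0], neither the constant factor [uu] nor the then trivial character
    depends on [k i]. *)
Lemma a_ext k l : (forall i, q i != 0%N -> k i = l i) -> a k = a l.
Proof.
move=> h; have [s hs] := thprod_nonzero q k (uvalP t).
have e : thp l (uval t) s = thp k (uval t) s.
  apply: eq_bigr => i _; case: (eqVneq (q i) 0%N) => [->|q0]; first by rewrite !uu0.
  by rewrite h.
apply: (mulIf hs); rewrite -{2}e -!aP /jproj; congr (_ * _); apply: eq_bigr => j _; congr (_ * _).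
apply: eq_bigr => i _; case: (eqVneq (q i) 0%N) => [q0|q0]; last by rewrite h.
have n1 (n : int) : ee (- (n%:~R * (j i)%:R / (uN (q i))%:R)) = 1.
  by rewrite q0 /uN /= divr1 -[(j i : nat)%:R]/((Posz (j i))%:~R) -rmorphM ee_opp_int.
by rewrite !n1.
Qed.

Lemma PC_shift (b : 'cV[rat]_c) s : PC *m (s + qm (invmx PQ *m b)) = PC *m s + qm b.
Proof. by rewrite mulmxDr -qm_PQ -PQK. Qed.
Lemma PC_shiftZ (b : 'cV[rat]_c) s (w : C) : PC *m (s + w *: qm (invmx PQ *m b)) = PC *m s + w *: qm b.
Proof. by rewrite mulmxDr -scalemxAr -qm_PQ -PQK. Qed.

Lemma coord_int b : b \in Omega_star psi -> exists d : 'I_c -> int, forall i, 2 * sform S b (ratcV (col i P)) = (d i)%:~R.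
Proof. move=> bO; have /choice[d hd] i : exists z : int, 2 * sform S b (ratcV (col i P)) = z%:~R.
  by have /intrP := Omega_coord pP i bO.
by exists d. Qed.

(** A translation by [v] in [ker psi] leaves [f] unchanged but multiplies the product [k] by a root
    of unity given by the pairing with [v]; a nonzero coefficient forces the pairing to be
    integral. *)
Lemma a_nz k : a k != 0 -> qv k \in Omega_star psi.
Proof.
move=> ak; apply/Omega_starP => b bO; have [v [pv kk]] := Omega_intP bO.
have -> : sform S (qv k) b = sform S (qv k) (ratcV v).
  by rewrite -[b](subrK (ratcV v)) sformDr (kerS_r _ kk) add0r.
have [d hd] := coord_int (ratcV_Omega_star psi v).
have [s hs] := thprod_nonzero q k (uvalP t).
have := jproj_shiftr (x := invmx PQ *m ratcV v) k s; rewrite !aP (thprod_real (PQK uP _) hd) => h.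
apply: (@ee_rat_eq1 R); apply: (mulIf hs); apply: (mulfI ak); rewrite mul1r; apply: h => s'.
by rewrite /F PC_shift qm_ratcV fv.
Qed.

Lemma a_shift k u d : psi u = 0 -> (forall i, 2 * sform S (ratcV u) (ratcV (col i P)) = (d i)%:~R) ->
  a (fun i => k i + d i) = a k.
Proof.
move=> pu hd; have [s hs] := thprod_nonzero q (fun i => k i + d i) (uvalP t).
have := jproj_shiftt (PQK uP _) hd k s; rewrite !aP (thprod_tau (PQK uP _) hd) => h.
apply: (mulIf hs); apply: (mulfI (ee_neq0 (- (uval t * ratr (sform S (ratcV u) (ratcV u))) - 2 * sform SC (qm (ratcV u)) (PC *m s)))).
rewrite -h => [|s']; first by rewrite mulrCA.
by rewrite /F PC_shiftZ -!sform_ratr qm_ratcV fu.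
Qed.

(** Two vectors of one class differ, up to [ker S], by the image of some [u] in [ker psi].
    Translation by [tau u] identifies their coefficients by [a_shift], and [a_ext] settles the
    coordinates with [q i = 0]. *)
Lemma a_class k l g : inOg (psi := psi) g (qv k) -> inOg g (qv l) -> a k = a l.
Proof.
move=> /andP[kO /eqP kg] /andP[lO /eqP lg].
have : qv l - qv k \in Omega psi by rewrite -eq_DOmega_class // kg lg.
move=> /Omega_intP[u [pu kk]].
have [d hd] := coord_int (ratcV_Omega_star psi u).
rewrite -(a_shift k pu hd); apply: a_ext => i q0.
have := hd i; have -> : sform S (ratcV u) (ratcV (col i P)) = sform S (qv l - qv k) (ratcV (col i P)).
  by rewrite -[qv l - _](subrK (ratcV u)) sformDl (kerS_l psi _ kk) add0r.
rewrite sformDl sformNl mulrBr !(qvec_coord dP) (negPf q0) -rmorphB => /intr_inj <-.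
by rewrite addrC subrK.
Qed.

Lemma expansion0 : exists cg : D_Omega psi -> C, forall z, f z = \sum_g cg g * theta psi t z g.
Proof.
have /choice[kg hk] g := class_qvec uP pP dP g.
exists (fun g => a (kg g)) => z; rewrite (PCK uP z) -/(F _); set s := invmx PC *m z.
rewrite -jproj_total.
under [in RHS]eq_bigr do rewrite (theta_fin uP pP dP NM) mulrCA mulr_sumr.
rewrite -[RHS]mulr_sumr [in RHS]exchange_big /=; congr (_ * _); apply: eq_bigr => n _; rewrite aP.
have [nO|nO] := boolP (qv (vk n) \in Omega_star psi); last first.
  rewrite big1 => [|g _]; last by rewrite /inOg (negPf nO) mul0r mulr0.
  by have [->|/a_nz] := eqVneq (a (vk n)) 0; rewrite ?mul0r // (negPf nO).
rewrite (bigD1 (DOmega_class psi (qv (vk n)) : D_Omega psi)) //= big1 => [|g gn]; last first.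
  by rewrite /inOg nO eq_sym (negPf gn) mul0r mulr0.
have ho : inOg (DOmega_class psi (qv (vk n)) : D_Omega psi) (qv (vk n)) by rewrite /inOg nO eqxx.
by rewrite addr0 ho mul1r (a_class (hk _) ho).
Qed.
End SLaw.

(** * Smooth and holomorphic functions *)

Section CnCalc.
Local Open Scope classical_set_scope.
Variables (R : realType) (V : normedModType R).
Implicit Types (U W : set V) (f g : V -> R).

Lemma Cn_sub U W n f : W `<=` U -> Cn U n f -> Cn W n f.
Proof.
move=> sWU; elim: n f => [|n IH] f [c d]; split=> //; try by move=> x /sWU/c.
by move=> v; have [d1 d2] := d v; split; [move=> x /sWU/d1|exact: IH].
Qed.
Lemma Cn_pred U n f : Cn U n.+1 f -> Cn U n f.
Proof.
elim: n f => [|n IH] f [c d]; split=> // v; have [d1 d2] := d v; split=> //; exact: IH.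
Qed.
Lemma Cn_cont U n f x : Cn U n f -> U x -> {for x, continuous f}.
Proof. by case: n => [|n] [c _] /c. Qed.
Lemma Cn_ext U n f g : open U -> (forall x, U x -> f x = g x) -> Cn U n f -> Cn U n g.
Proof.
move=> oU; elim: n f g => [|n IH] f g e [c d].
  split=> // x Ux; suff : g @ x --> g x by []. 
  rewrite -(e x Ux); apply: cvg_trans (c x Ux : f @ x --> f x).
  by apply: near_eq_cvg; apply: filterS (open_nbhs_nbhs (conj oU Ux)).
have nr x : U x -> \forall y \near x, f y = g y.
  by move=> Ux; apply: filterS (open_nbhs_nbhs (conj oU Ux)).
split=> [x Ux|v].
  suff : g @ x --> g x by [].
  rewrite -(e x Ux); apply: cvg_trans (c x Ux : f @ x --> f x).
  by apply: near_eq_cvg; exact: nr.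
have [d1 d2] := d v; split=> [x Ux|].
  by apply: near_eq_derivable (d1 x Ux); exact: nr.
by apply: IH d2 => x Ux; apply: near_eq_derive; exact: nr.
Qed.
Lemma Cn_loc U n f : (forall x, U x -> exists2 W, W x & Cn W n f) -> Cn U n f.
Proof.
elim: n f => [|n IH] f h; first by split=> // x /h[W Wx [c _]]; exact: c.
split=> [x /h[W Wx [c _]]|v]; first exact: c.
split=> [x /h[W Wx [_ d]]|]; first by have [d1 _] := d v; exact: d1.
by apply: IH => x /h[W Wx [_ d]]; exists W => //; have [_ d2] := d v.
Qed.
Lemma CnD U n f g : open U -> Cn U n f -> Cn U n g -> Cn U n (fun x => f x + g x).
Proof.
move=> oU; elim: n f g => [|n IH] f g [c d] [c' d'].
  by split=> // x Ux; apply: continuousD; [exact: c|exact: c'].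
split=> [x Ux|v]; first by apply: continuousD; [exact: c|exact: c'].
have [d1 d2] := d v; have [d1' d2'] := d' v; split=> [x Ux|].
  by apply: (derivableD (d1 x Ux) (d1' x Ux)).
apply: Cn_ext (IH _ _ d2 d2') => // x Ux.
by rewrite -(deriveD (d1 x Ux) (d1' x Ux)).
Qed.
Lemma CnM U n f g : open U -> Cn U n f -> Cn U n g -> Cn U n (fun x => f x * g x).
Proof.
move=> oU; elim: n f g => [|n IH] f g Hf Hg; have [c d] := Hf; have [c' d'] := Hg.
  by split=> // x Ux; apply: continuousM; [exact: c|exact: c'].
split=> [x Ux|v]; first by apply: continuousM; [exact: c|exact: c'].
have [d1 d2] := d v; have [d1' d2'] := d' v; split=> [x Ux|].
  by apply: (derivableM (d1 x Ux) (d1' x Ux)).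
apply: (Cn_ext oU _ (CnD oU (IH _ _ (Cn_pred Hf) d2') (IH _ _ (Cn_pred Hg) d2))) => x Ux.
by rewrite -[RHS]/('D_v (f * g) x) (deriveM (d1 x Ux) (d1' x Ux)).
Qed.
Lemma Cn_cst U n (a : R) : Cn U n (fun=> a).
Proof.
elim: n a => [|n IH] a; first by split=> // x _; exact: cst_continuous.
split=> [x _|v]; first exact: cst_continuous.
split=> [x _|]; first exact: derivable_cst.
have -> : 'D_v (fun=> a) = fun=> 0 by apply/funext => x; exact: derive_cst.
exact: IH.
Qed.
Lemma CnZ U n (a : R) f : open U -> Cn U n f -> Cn U n (fun x => a * f x).
Proof. by move=> oU; apply: CnM => //; exact: Cn_cst. Qed.

Lemma smooth_ext U (f g : V -> R[i]) : open U -> (forall x, U x -> f x = g x) -> smooth_on U f -> smooth_on U g.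
Proof.
move=> oU e h n; have [h1 h2] := h n.
by split; [apply: Cn_ext h1|apply: Cn_ext h2] => // x Ux; rewrite e.
Qed.
Lemma smooth_loc U (f : V -> R[i]) : (forall x, U x -> exists2 W, W x & smooth_on W f) -> smooth_on U f.
Proof.
by move=> h n; split; apply: Cn_loc => x /h[W Wx hW]; exists W => //; have [] := hW n.
Qed.
Lemma smooth_sub U W (f : V -> R[i]) : W `<=` U -> smooth_on U f -> smooth_on W f.
Proof. by move=> s h n; have [h1 h2] := h n; split; [apply: Cn_sub h1|apply: Cn_sub h2]. Qed.
Lemma smoothD U (f g : V -> R[i]) : open U -> smooth_on U f -> smooth_on U g -> smooth_on U (fun x => f x + g x).
Proof.
move=> oU hf hg n; have [f1 f2] := hf n; have [g1 g2] := hg n; split.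
  by apply: Cn_ext (CnD oU f1 g1) => // x _; rewrite ReD.
by apply: Cn_ext (CnD oU f2 g2) => // x _; rewrite ImD.
Qed.
Lemma smoothM U (f g : V -> R[i]) : open U -> smooth_on U f -> smooth_on U g -> smooth_on U (fun x => f x * g x).
Proof.
move=> oU hf hg n; have [f1 f2] := hf n; have [g1 g2] := hg n; split.
  apply: Cn_ext (CnD oU (CnM oU f1 g1) (CnZ (-1) oU (CnM oU f2 g2))) => // x _.
  by rewrite ReM mulN1r.
by apply: Cn_ext (CnD oU (CnM oU f1 g2) (CnM oU f2 g1)) => // x _; rewrite ImM.
Qed.
Lemma smooth0 U : smooth_on U (fun _ : V => 0 : R[i]).
Proof. by move=> n; split; exact: Cn_cst. Qed.
Lemma smooth_sum U (T : Type) (r : seq T) (f : T -> V -> R[i]) : open U -> (forall i, smooth_on U (f i)) ->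
  smooth_on U (fun x => \sum_(i <- r) f i x).
Proof.
move=> oU h; elim: r => [|a r IH].
  by apply: (smooth_ext oU _ (@smooth0 U)) => x _; rewrite big_nil.
by apply: (smooth_ext oU _ (smoothD oU (h a) IH)) => x _; rewrite big_cons.
Qed.
End CnCalc.

Section Affine.
Local Open Scope classical_set_scope.
Variables (R : realType) (V : normedModType R) (w0 c1 c2 : V).
(** Restriction to real planes extracts from joint smoothness both the smoothness in tau for fixed
    [z] and that along a complex line in [z] for fixed tau. *)
Definition aff (p : R * R) : V := w0 + (p.1 *: c1 + p.2 *: c2).
Lemma aff_continuous : continuous aff.
Proof.
move=> p; apply: (@continuousD R V (R * R)%type (fun=> w0) (fun p => p.1 *: c1 + p.2 *: c2)).
  exact: cst_continuous.
apply: (@continuousD R V (R * R)%type (fun p => p.1 *: c1) (fun p => p.2 *: c2)).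
  apply: (@continuousZ _ _ _ (fun p : R * R => p.1) (fun=> c1)); [exact: cvg_fst|exact: cst_continuous].
apply: (@continuousZ _ _ _ (fun p : R * R => p.2) (fun=> c2)); [exact: cvg_snd|exact: cst_continuous].
Qed.
Lemma affE h v p : aff (h *: v + p) = h *: (v.1 *: c1 + v.2 *: c2) + aff p.
Proof.
rewrite /aff /= !scalerDl scalerDr !scalerA [RHS]addrCA; congr (_ + _).
by rewrite addrACA.
Qed.
Lemma Cn_aff (U : set V) n f : Cn U n f -> Cn (aff @^-1` U) n (fun p => f (aff p)).
Proof.
elim: n f => [|n IH] f [c d].
  split=> // p Up; apply: (@continuous_comp _ _ _ aff f); [exact: aff_continuous|exact: c].
split=> [p Up|v].
  apply: (@continuous_comp _ _ _ aff f); [exact: aff_continuous|exact: c].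
have [d1 d2] := d (v.1 *: c1 + v.2 *: c2).
have E p : (fun h : R => h^-1 *: (((fun p => f (aff p)) \o shift p) (h *: v) - f (aff p))) =
  (fun h : R => h^-1 *: ((f \o shift (aff p)) (h *: (v.1 *: c1 + v.2 *: c2)) - f (aff p))).
  by apply/funext => h /=; rewrite affE.
split=> [p Up|]; first by rewrite /derivable E; exact: d1.
have -> : 'D_v (fun p => f (aff p)) = fun p => 'D_(v.1 *: c1 + v.2 *: c2) f (aff p).
  by apply/funext => p; rewrite /derive E.
exact: (IH _ d2).
Qed.
Lemma smooth_aff (U : set V) f : smooth_on U f -> smooth_on (aff @^-1` U) (fun p => f (aff p)).
Proof. by move=> h n; have [h1 h2] := h n; split; [exact: (Cn_aff h1)|exact: (Cn_aff h2)]. Qed.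
End Affine.

Section DirDer.
Local Open Scope classical_set_scope.
Variables (R : realType) (V : normedModType R).
Lemma is_derive_eps (f : V -> R) p v d :
  (forall e : R, 0 < e -> exists2 rho : R, 0 < rho & forall h : R, `|h| <= rho ->
     `|f (h *: v + p) - f p - h * d| <= e * `|h|) -> is_derive p v f d.
Proof.
move=> H.
suff hc : (fun h : R => h^-1 *: ((f \o shift p) (h *: v) - f p)) @ (0 : R)^' --> d.
  by apply: DeriveDef; [apply/cvg_ex; exists d|apply: cvg_lim].
apply/cvgrPdist_le => e e0; have [rho r0 h] := H e e0.
exists rho => [//|x /=]; rewrite sub0r normrN => xr x0.
have := h x (ltW xr) => hx.
have -> : d - x^-1 *: (f (x *: v + p) - f p) = - (x^-1 * (f (x *: v + p) - f p - x * d)).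
  by rewrite /GRing.scale /=; field.
by rewrite normrN normrM normfV ler_pdivrMl ?normr_gt0 // [leRHS]mulrC.
Qed.
End DirDer.

(** * From iterated complex derivatives to smoothness *)

Section HolChain.
Local Open Scope classical_set_scope.
Variable R : realType.
Local Notation C := R[i].
(** Existence of [n + 1] successive derivatives in the sense of [qd]. For theta series the whole
    chain is explicit, since differentiation raises the index [j] of [thw]. *)
Fixpoint HC (U : set C) (n : nat) (f : C -> C) : Prop :=
  exists f' : C -> C, (forall z, U z -> qd f z (f' z)) /\ (if n is m.+1 then HC U m f' else True).

Lemma HC_pred U n f : HC U n.+1 f -> HC U n f.
Proof.
elim: n f => [|n IH] f [f' [h1 h2]]; exists f'; split=> //; exact: IH.
Qed.
Lemma HC_sub (U W : set C) n f : W `<=` U -> HC U n f -> HC W n f.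
Proof.
move=> s; elim: n f => [|n IH] f [f' [h1 h2]]; exists f'; split=> //; try by move=> z /s/h1.
exact: IH.
Qed.
Lemma HC_cst U n a : HC U n (fun=> a).
Proof.
elim: n a => [|n IH] a; exists (fun=> 0); split=> // z _; exact: qd_cst.
Qed.
Lemma HC_add U n f g : HC U n f -> HC U n g -> HC U n (fun z => f z + g z).
Proof.
elim: n f g => [|n IH] f g [f' [h1 h2]] [g' [k1 k2]]; (exists (fun z => f' z + g' z);
  split; first by move=> z Uz; apply: qd_add; [exact: h1|exact: k1]).
- by [].
- exact: IH.
Qed.
Lemma HC_mul U n f g : HC U n f -> HC U n g -> HC U n (fun z => f z * g z).
Proof.
elim: n f g => [|n IH] f g Hf Hg; have [f' [h1 h2]] := Hf; have [g' [k1 k2]] := Hg;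
  (exists (fun z => f' z * g z + f z * g' z);
  split; first by move=> z Uz; apply: qd_mul; [exact: h1|exact: k1]).
- by [].
- by apply: HC_add; apply: IH => //; exact: HC_pred.
Qed.
Lemma HC_inv U n f : (forall z, U z -> f z != 0) -> HC U n f -> HC U n (fun z => (f z)^-1).
Proof.
move=> nz; elim: n f nz => [|n IH] f nz Hf; have [f' [h1 h2]] := Hf;
  (exists (fun z => - f' z / f z ^+ 2);
  split; first by move=> z Uz; apply: qd_inv; [exact: nz|exact: h1]).
  by [].
have -> : (fun z => - f' z / f z ^+ 2) = fun z => (-1 * f' z) * ((f z)^-1 * (f z)^-1).
  by apply/funext => z; rewrite mulN1r expr2 invfM.
have hi := IH _ nz (HC_pred Hf).
apply: HC_mul; last exact: HC_mul.
by apply: HC_mul => //; exact: HC_cst.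
Qed.
Lemma HC_sum U n (T : Type) (r : seq T) (f : T -> C -> C) : (forall i, HC U n (f i)) ->
  HC U n (fun z => \sum_(i <- r) f i z).
Proof.
move=> h; elim: r => [|a r IH].
  have -> : (fun z => \sum_(i <- [::]) f i z) = fun=> 0 by apply/funext => z; rewrite big_nil.
  exact: HC_cst.
have -> : (fun z => \sum_(i <- a :: r) f i z) = fun z => f a z + \sum_(i <- r) f i z.
  by apply/funext => z; rewrite big_cons.
exact: HC_add.
Qed.
Lemma HC_prod U n (T : Type) (r : seq T) (f : T -> C -> C) : (forall i, HC U n (f i)) ->
  HC U n (fun z => \prod_(i <- r) f i z).
Proof.
move=> h; elim: r => [|a r IH].
  have -> : (fun z => \prod_(i <- [::]) f i z) = fun=> 1 by apply/funext => z; rewrite big_nil.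
  exact: HC_cst.
have -> : (fun z => \prod_(i <- a :: r) f i z) = fun z => f a z * \prod_(i <- r) f i z.
  by apply/funext => z; rewrite big_cons.
exact: HC_mul.
Qed.
Lemma HC_qd U n f z : HC U n f -> U z -> exists l, qd f z l.
Proof. by case: n => [|n] [f' [h _]] /h; exists (f' z). Qed.

Definition pc (p : R * R) : C := p.1 +i* p.2.
Lemma pcE h v p : pc (h *: v + p) = pc p + h%:C * pc v.
Proof. by rewrite /pc; apply: cP; rewrite /=; rewrite /GRing.scale /=; ring. Qed.
Lemma pc_continuous : continuous (pc : R * R -> R[i]^o).
Proof. by apply: complex_continuous => p; [exact: cvg_fst|exact: cvg_snd]. Qed.

Lemma ReaM (a z : C) : `|complex.Re (a * z)| <= nc a * nc z.
Proof. by rewrite -ncM; exact: nc_Re. Qed.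

(** The factor [a] makes the induction close: the derivative of [Re (a f)] in the direction [v] is
    [Re (a v f')]. Taking [a = - 'i] gives the imaginary part. *)
Lemma HC_Cn (U : set C) (W : set (R * R)) n f (a : C) : open W -> (forall p, W p -> U (pc p)) ->
  HC U n f -> Cn W n (fun p => complex.Re (a * f (pc p))).
Proof.
move=> oW WU; elim: n f a => [|n IH] f a Hf; have [f' [h1 h2]] := Hf.
  split=> // p Wp.
  apply: (@continuous_comp _ R[i]^o R pc (fun z : R[i]^o => complex.Re (a * f z))); first exact: pc_continuous.
  apply: (@continuous_comp R[i]^o R[i]^o R (fun z => a * f z) (@complex.Re R)).
    apply: (@continuousM R[i] R[i]^o (fun=> a) f); first exact: cst_continuous.
    exact: qd_continuous (h1 _ (WU _ Wp)).
  exact: Re_continuous.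
have Hd v p : W p -> is_derive p v (fun p => complex.Re (a * f (pc p))) (complex.Re ((a * pc v) * f' (pc p))).
  move=> Wp; apply: is_derive_eps => e e0.
  have [M [r [M0 r0 hq]]] := h1 _ (WU _ Wp).
  pose K := nc a * M * nc (pc v) ^+ 2 + 1.
  have K0 : 0 < K by rewrite ltr_wpDl // mulr_ge0 ?exprn_ge0 ?mulr_ge0 ?nc_ge0.
  pose B := nc (pc v) + 1; have B0 : 0 < B by rewrite ltr_wpDl ?nc_ge0.
  exists (Num.min (r / B) (e / K)); first by rewrite lt_min !divr_gt0.
  move=> h; rewrite le_min => /andP[hr1 hr2].
  have hv : nc (h%:C * pc v) <= r.
    rewrite ncM nc_real; rewrite ler_pdivlMr // in hr1; apply: le_trans hr1.
    by rewrite ler_wpM2l // lerDl.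
  have := hq _ hv; rewrite pcE => hh.
  have -> : complex.Re (a * f (pc p + h%:C * pc v)) - complex.Re (a * f (pc p)) - h * complex.Re (a * pc v * f' (pc p))
     = complex.Re (a * (f (pc p + h%:C * pc v) - f (pc p) - h%:C * pc v * f' (pc p))).
    by rewrite !(ReM, ReB, ImM, ImB) /=; ring.
  apply: (le_trans (ReaM _ _)).
  apply: (@le_trans _ _ (nc a * (M * nc (h%:C * pc v) ^+ 2))); first by rewrite ler_wpM2l ?nc_ge0.
  rewrite ncM nc_real exprMn.
  have -> : nc a * (M * (`|h| ^+ 2 * nc (pc v) ^+ 2)) = (nc a * M * nc (pc v) ^+ 2) * `|h| * `|h| by ring.
  rewrite ler_wpM2r //; rewrite ler_pdivlMr // mulrC in hr2; apply: le_trans hr2.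
  by rewrite ler_wpM2r // /K lerDl.
split=> [p Wp|v].
  exact: Cn_cont (IH f a (HC_pred Hf)) Wp.
split=> [p Wp|]; first by case: (Hd v p Wp).
apply: (Cn_ext oW _ (IH f' (a * pc v) h2)) => p Wp.
by case: (Hd v p Wp) => _ ->.
Qed.

Lemma HC_smooth (U : set C) (W : set (R * R)) f : open W -> (forall p, W p -> U (pc p)) ->
  (forall n, HC U n f) -> smooth_on W (fun p => f (pc p)).
Proof.
move=> oW WU h n; split.
  by apply: (Cn_ext oW _ (HC_Cn 1 oW WU (h n))) => p _; rewrite mul1r.
apply: (Cn_ext oW _ (HC_Cn (- 'i) oW WU (h n))) => p _.
by rewrite ReM /=; ring.
Qed.
End HolChain.

(** * Uniform quadratic remainders from smoothness *)

Section QregSmooth.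
Local Open Scope classical_set_scope.
Variable R : realType.
Local Notation C := R[i].

Lemma box_bound (g : R * R -> R) (r : R) : (forall p, {for p, continuous g}) ->
  exists B : R, forall p, `|p.1| <= r -> `|p.2| <= r -> `|g p| <= B.
Proof.
move=> cg; pose K : set (R * R) := `[- r, r] `*` `[- r, r].
have cK : compact K by apply: compact_setX; exact: segment_compact.
have /compact_bounded[B [_ hB]] : compact (g @` K).
  by apply: continuous_compact cK; apply: continuous_subspaceT.
exists (B + 1) => p h1 h2; apply: (hB (B + 1)); first by rewrite ltrDl.
by exists p => //; split; rewrite /= in_itv /= -ler_norml.
Qed.

Lemma mvt_bound_abs (f df : R -> R) (r M : R) : (forall x : R, is_derive x (1 : R) f (df x)) ->
  (forall x, `|x| <= r -> `|df x| <= M) -> forall x y, `|x| <= r -> `|y| <= r ->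
  `|f x - f y| <= M * `|x - y|.
Proof.
move=> hd hM; have aux x y : x <= y -> `|x| <= r -> `|y| <= r -> `|f y - f x| <= M * (y - x).
  move=> xy; rewrite (ler_norml x) (ler_norml y) => /andP[x1 x2] /andP[y1 y2]; apply: (mvt_bound xy hd) => u /andP[u1 u2].
  by apply: hM; rewrite ler_norml (le_trans x1) // (le_trans u2).
move=> x y hx hy; case: (leP x y) => xy.
  by rewrite distrC [`|x - y|]distrC [`|y - x|]ger0_norm ?subr_ge0 // aux.
by rewrite [`|x - y|]ger0_norm ?subr_ge0 ?aux // ltW.
Qed.

Lemma line_derive (g : R * R -> R) p v x : derivable g (p + x *: v) v ->
  is_derive x (1 : R) (fun y : R => g (p + y *: v)) ('D_v g (p + x *: v)).
Proof.
move=> hd.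
have E : (fun h : R => h^-1 *: (((fun y : R => g (p + y *: v)) \o shift x) (h *: 1) - g (p + x *: v))) =
  (fun h : R => h^-1 *: ((g \o shift (p + x *: v)) (h *: v) - g (p + x *: v))).
  apply/funext => h /=; congr (_ *: (g _ - _)).
  by rewrite [h *: 1]mulr1 scalerDl addrCA.
by apply: DeriveDef; [rewrite /derivable E|rewrite /derive E].
Qed.

Lemma C1_lip (g : R * R -> R) (r : R) : Cn setT 1%N g -> exists2 L : R, 0 <= L &
  forall p p', `|p.1| <= r -> `|p.2| <= r -> `|p'.1| <= r -> `|p'.2| <= r ->
  `|g p - g p'| <= L * (`|p.1 - p'.1| + `|p.2 - p'.2|).
Proof.
move=> [_ hg].
have [d1 c1] := hg (1, 0); have [d2 c2] := hg (0, 1).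
have [B1 b1] := box_bound r (fun p => c1.1 p I); have [B2 b2] := box_bound r (fun p => c2.1 p I).
pose L := Num.max 0 (Num.max B1 B2); exists L; first by rewrite le_max lexx.
have L1 : B1 <= L by rewrite !le_max lexx orbT.
have L2 : B2 <= L by rewrite !le_max lexx !orbT.
move=> [x y] [x' y'] /= hx hy hx' hy'; rewrite mulrDr.
have -> : g (x, y) - g (x', y') = (g (x, y) - g (x', y)) + (g (x', y) - g (x', y')) by ring.
apply: le_trans (ler_normD _ _) _; apply: lerD.
  have e u : ((0, y) + u *: (1, 0) : R * R) = (u, y).
    by congr (_, _); rewrite /= /GRing.scale /= ?mulr1 ?mulr0 ?add0r ?addr0.
  have := @mvt_bound_abs (fun u => g (u, y)) (fun u => 'D_(1, 0) g (u, y)) r L _ _ x x' hx hx'; apply.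
    move=> u; have := @line_derive g (0, y) (1, 0) u (d1 _ I); rewrite e.
    by rewrite (_ : (fun y0 : R => _) = fun u => g (u, y)) //; apply/funext => w; rewrite e.
  by move=> u hu; apply: le_trans L1; exact: b1.
have e u : ((x', 0) + u *: (0, 1) : R * R) = (x', u).
  by congr (_, _); rewrite /= /GRing.scale /= ?mulr1 ?mulr0 ?add0r ?addr0.
have := @mvt_bound_abs (fun u => g (x', u)) (fun u => 'D_(0, 1) g (x', u)) r L _ _ y y' hy hy'; apply.
  move=> u; have := @line_derive g (x', 0) (0, 1) u (d2 _ I); rewrite e.
  by rewrite (_ : (fun y0 : R => _) = fun u => g (x', u)) //; apply/funext => w; rewrite e.
by move=> u hu; apply: le_trans L2; exact: b2.
Qed.

Definition cd (f : C -> C) (x l : C) : Prop := forall e : R, 0 < e -> exists2 rho : R, 0 < rho &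
  forall h, nc h <= rho -> nc (f (x + h) - f x - h * l) <= e * nc h.

Lemma cd_line (f : C -> C) (x l w : C) (y : R) : cd f (x + y%:C * w) l ->
  is_derive y (1 : R) (fun u : R => complex.Re (f (x + u%:C * w))) (complex.Re (w * l)) /\
  is_derive y (1 : R) (fun u : R => complex.Im (f (x + u%:C * w))) (complex.Im (w * l)).
Proof.
move=> H; have B0 : 0 < nc w + 1 by rewrite ltr_wpDl ?nc_ge0.
have key (e : R) : 0 < e -> exists2 rho : R, 0 < rho & forall h : R, `|h| <= rho ->
   nc (f (x + (h *: 1 + y)%:C * w) - f (x + y%:C * w) - h%:C * (w * l)) <= e * `|h|.
  move=> e0; have [rho r0 hr] := H (e / (nc w + 1)) (divr_gt0 e0 B0).
  exists (rho / (nc w + 1)); first exact: divr_gt0.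
  move=> h; rewrite ler_pdivlMr // => hh.
  have := hr (h%:C * w); rewrite ncM nc_real.
  have -> : x + y%:C * w + h%:C * w = x + (h *: 1 + y)%:C * w.
    by rewrite [h *: 1]mulr1 rmorphD; ring.
  rewrite -[h%:C * w * l]mulrA => /(_ _) h2.
  apply: le_trans (h2 _) _.
    by apply: le_trans hh; rewrite ler_wpM2l // lerDl.
  have -> : e / (nc w + 1) * (`|h| * nc w) = (e * `|h|) * (nc w / (nc w + 1)) by ring.
  rewrite -[leRHS]mulr1; apply: ler_wpM2l; first by rewrite mulr_ge0 // ltW.
  by rewrite ler_pdivrMr // mul1r lerDl.
have ReyM (h : R) v : complex.Re (h%:C * v) = h * complex.Re v by rewrite ReM /= mul0r subr0.
have ImyM (h : R) v : complex.Im (h%:C * v) = h * complex.Im v by rewrite ImM /= mul0r addr0.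
split; apply: is_derive_eps => e e0; have [rho r0 hr] := key e e0; exists rho => // h /hr; apply: le_trans.
  by rewrite -ReyM -2!ReB nc_Re.
by rewrite -ImyM -2!ImB nc_Im.
Qed.

Lemma pc_Re_Im (s : C) : s = pc (complex.Re s, complex.Im s). Proof. by case: s. Qed.

(** The complex derivative is the partial derivative in the real direction, so it is C^1 and hence
    Lipschitz on squares. The mean value theorem along segments converts this into a quadratic
    remainder. *)
Lemma qreg_smooth (f f' : C -> C) : (forall x, cd f x (f' x)) ->
  smooth_on setT (fun p => f (pc p)) -> qreg f.
Proof.
move=> hd sm.
have [Re2 Im2] := sm 2%N.
have E1 (p : R * R) : 'D_(1, 0) (fun p => complex.Re (f (pc p))) p = complex.Re (f' (pc p)) /\
   'D_(1, 0) (fun p => complex.Im (f (pc p))) p = complex.Im (f' (pc p)).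
  have H0 : cd f (pc p + (0 : R)%:C * 1) (f' (pc p)) by rewrite mul0r addr0.
  have [h1 h2] := cd_line H0.
  have e (h : R) : pc (h *: (1, 0) + p) = pc p + h%:C * 1.
    by rewrite pcE; congr (_ + _ * _); rewrite /pc /=.
  have l1 := @line_derive (fun p => complex.Re (f (pc p))) p (1, 0) 0.
  have l2 := @line_derive (fun p => complex.Im (f (pc p))) p (1, 0) 0.
  have [d1 _] := (Re2.2 (1, 0)); have [d2 _] := (Im2.2 (1, 0)).
  move: (l1 (d1 _ I)) (l2 (d2 _ I)); rewrite !scale0r !addr0.
  have -> : (fun y : R => complex.Re (f (pc (p + y *: (1, 0))))) = fun u : R => complex.Re (f (pc p + u%:C * 1)).
    by apply/funext => u; rewrite addrC e.
  have -> : (fun y : R => complex.Im (f (pc (p + y *: (1, 0))))) = fun u : R => complex.Im (f (pc p + u%:C * 1)).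
    by apply/funext => u; rewrite addrC e.
  move=> k1 k2; split.
    by rewrite -(@derive_val _ _ _ _ _ _ _ k1) (@derive_val _ _ _ _ _ _ _ h1) mul1r.
  by rewrite -(@derive_val _ _ _ _ _ _ _ k2) (@derive_val _ _ _ _ _ _ _ h2) mul1r.
have [_ R1] := Re2.2 (1, 0); have [_ I1] := Im2.2 (1, 0).
have eR : 'D_(1, 0) (fun p => complex.Re (f (pc p))) = fun p => complex.Re (f' (pc p)).
  by apply/funext => p; case: (E1 p).
have eI : 'D_(1, 0) (fun p => complex.Im (f (pc p))) = fun p => complex.Im (f' (pc p)).
  by apply/funext => p; case: (E1 p).
rewrite eR in R1; rewrite eI in I1.
exists f' => r; pose r1 := r + 1.
have [A1 a1] := box_bound r1 (fun p => Cn_cont Re2 I); have [A2 a2] := box_bound r1 (fun p => Cn_cont Im2 I).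
have [B1 b1] := box_bound r1 (fun p => R1.1 p I); have [B2 b2] := box_bound r1 (fun p => I1.1 p I).
have [L1 L10 l1] := C1_lip r1 R1; have [L2 L20 l2] := C1_lip r1 I1.
pose L := L1 + L2.
exists (`|A1| + `|A2| + (`|B1| + `|B2|) + 4 * L) => s sr.
have inb (h : C) : nc h <= 1 -> `|complex.Re (s + h)| <= r1 /\ `|complex.Im (s + h)| <= r1.
  move=> h1; have hs : nc (s + h) <= r1 by apply: le_trans (ncD _ _) _; rewrite lerD.
  by split; [apply: le_trans (nc_Re _) hs|apply: le_trans (nc_Im _) hs].
have z1 : nc (0 : C) <= 1 by rewrite nc0.
have [s1 s2] := inb 0 z1.
rewrite addr0 in s1 s2.
have L0 : 0 <= L by rewrite addr_ge0.
have lipf' (h : C) : nc h <= 1 -> nc (f' (s + h) - f' s) <= L * (2 * nc h).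
  move=> h1; have [h2 h3] := inb h h1.
  have := l1 (complex.Re (s + h), complex.Im (s + h)) (complex.Re s, complex.Im s) h2 h3 s1 s2.
  have := l2 (complex.Re (s + h), complex.Im (s + h)) (complex.Re s, complex.Im s) h2 h3 s1 s2.
  have eRh : complex.Re (s + h) - complex.Re s = complex.Re h by rewrite ReD addrC addKr.
  have eIh : complex.Im (s + h) - complex.Im s = complex.Im h by rewrite ImD addrC addKr.
  rewrite /= eRh eIh -!pc_Re_Im -ReB -ImB => g2 g1.
  apply: le_trans (nc_le _) _; rewrite /L mulrDl; apply: lerD.
    apply: (le_trans g1); rewrite ler_wpM2l // mulr_natl mulr2n lerD ?nc_Re ?nc_Im //.
  by apply: (le_trans g2); rewrite ler_wpM2l // mulr_natl mulr2n lerD ?nc_Re ?nc_Im.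
split.
- have := a1 (complex.Re s, complex.Im s) s1 s2; have := a2 (complex.Re s, complex.Im s) s1 s2.
  rewrite -pc_Re_Im => g2 g1; apply: le_trans (nc_le _) _.
  have := ler_norm A1; have := ler_norm A2; have := normr_ge0 B1; have := normr_ge0 B2; lra.
- have := b1 (complex.Re s, complex.Im s) s1 s2; have := b2 (complex.Re s, complex.Im s) s1 s2.
  rewrite -pc_Re_Im => g2 g1; apply: le_trans (nc_le _) _.
  have := ler_norm B1; have := ler_norm B2; have := normr_ge0 A1; have := normr_ge0 A2; lra.
move=> h h1.
have part (p : C -> R) (pD : forall z w, p (z - w) = p z - p w) (pn : forall z, `|p z| <= nc z)
    (pZ : forall (y : R) z, p (y%:C * z) = y * p z)
    (pd : forall y : R, is_derive y (1 : R) (fun u : R => p (f (s + u%:C * h))) (p (h * f' (s + y%:C * h)))) :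
    `|p (f (s + h) - f s - h * f' s)| <= 2 * L * nc h ^+ 2.
  have hd2 (y : R) : is_derive y (1 : R) ((fun u : R => p (f (s + u%:C * h))) - *%R^~ (p (h * f' s)))
     (p (h * (f' (s + y%:C * h) - f' s))).
    have := is_deriveB (pd y) (is_derive_linear (p (h * f' s)) y).
    by rewrite -pD -mulrBr.
  have hM (y : R) : 0 <= y <= 1 -> `|p (h * (f' (s + y%:C * h) - f' s))| <= 2 * L * nc h ^+ 2.
    move=> /andP[y0 y1]; apply: le_trans (pn _) _; rewrite ncM.
    have yh : nc (y%:C * h) <= nc h by rewrite ncM nc_real ger0_norm // ler_piMl ?nc_ge0.
    have := lipf' (y%:C * h) (le_trans yh h1) => g.
    have g' : nc (f' (s + y%:C * h) - f' s) <= L * (2 * nc h).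
      by apply: le_trans g _; rewrite ler_wpM2l // ler_wpM2l.
    have := ler_wpM2l (nc_ge0 h) g'; rewrite expr2; lra.
  have := mvt_bound ler01 hd2 hM; rewrite subr0 mulr1.
  rewrite -[X in `|X - _|]/(p (f (s + 1%:C * h)) - 1 * p (h * f' s)) -[X in `|_ - X|]/(p (f (s + 0%:C * h)) - 0 * p (h * f' s)).
  by rewrite !mul1r !mul0r addr0 subr0 addrAC -!pD.
have dl y := @cd_line f s (f' (s + y%:C * h)) h y (hd _).
apply: le_trans (nc_le _) _.
have g1 := part (@complex.Re R) (@ReB R) (@nc_Re R) _ (fun y => (dl y).1).
have g2 := part (@complex.Im R) (@ImB R) (@nc_Im R) _ (fun y => (dl y).2).
have {}g1 : `|complex.Re (f (s + h) - f s - h * f' s)| <= 2 * L * nc h ^+ 2.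
  by apply: g1 => y z; rewrite ReM /= mul0r subr0.
have {}g2 : `|complex.Im (f (s + h) - f s - h * f' s)| <= 2 * L * nc h ^+ 2.
  by apply: g2 => y z; rewrite ImM /= mul0r addr0.
have n2 : 0 <= nc h ^+ 2 by rewrite exprn_ge0 ?nc_ge0.
have : 0 <= (`|A1| + `|A2| + (`|B1| + `|B2|)) * nc h ^+ 2 by rewrite mulr_ge0 // !addr_ge0.
lra.
Qed.
End QregSmooth.

(** * Discriminant forms and Weil representations *)

Section Forms.
Variable E : quadMod.
Implicit Types x y z : E.
Lemma bformC x y : bform x y = bform y x.
Proof. by rewrite /bform [x + y]addrC addrAC. Qed.
Lemma bformDl x y z : bform (x + y) z = bform x z + bform y z.
Proof. exact: qform_bilin. Qed.
Lemma bformDr x y z : bform x (y + z) = bform x y + bform x z.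
Proof. by rewrite bformC bformDl !(bformC x). Qed.
Lemma bform0l x : bform 0 x = 0.
Proof. by apply: (addIr (bform 0 x)); rewrite -bformDl !addr0 add0r. Qed.
Lemma bform0r x : bform x 0 = 0. Proof. by rewrite bformC bform0l. Qed.
Lemma bformNl x y : bform (- x) y = - bform x y.
Proof. by apply: (addIr (bform x y)); rewrite -bformDl !addNr bform0l. Qed.
Lemma bformBl x y z : bform (x - y) z = bform x z - bform y z.
Proof. by rewrite bformDl bformNl. Qed.
Lemma qformD x y : qform (x + y) = qform x + qform y + bform x y.
Proof. by rewrite /bform -(addrA (qform (x + y))) -opprD [RHS]addrC subrK. Qed.

Lemma perpP (Y : {set E}) x : reflect (forall y, y \in Y -> bform x y = 0) (x \in perp Y).
Proof.
rewrite inE; apply: (iffP forallP) => [h y yY|h y]; first by have /implyP/(_ yY)/eqP := h y.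
by apply/implyP => yY; rewrite h.
Qed.
Lemma perpB (Y : {set E}) x y : x \in perp Y -> y \in perp Y -> x - y \in perp Y.
Proof. by move=> /perpP hx /perpP hy; apply/perpP => z zY; rewrite bformBl hx ?hy ?subrr. Qed.
Lemma perp0 (Y : {set E}) : 0 \in perp Y.
Proof. by apply/perpP => y _; rewrite bform0l. Qed.
Lemma perpD (Y : {set E}) x y : x \in perp Y -> y \in perp Y -> x + y \in perp Y.
Proof. by move=> hx hy; rewrite -[y]opprK perpB // -[- y]add0r perpB ?perp0. Qed.
End Forms.

Section CharSum.
Variable R : realType.
Local Notation C := R[i].
Variable E : quadMod.
Definition zsub (Y : {set E}) := 0 \in Y /\ forall x y, x \in Y -> y \in Y -> x - y \in Y.

Lemma zsubD Y x y : zsub Y -> x \in Y -> y \in Y -> x + y \in Y.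
Proof. by move=> [Y0 YB] hx hy; rewrite -[y]opprK YB // -[- y]add0r YB. Qed.

Lemma zsub_shift (Y : {set E}) (F : E -> C) y : zsub Y -> y \in Y ->
  \sum_(x in Y) F x = \sum_(x in Y) F (x + y).
Proof.
move=> zY yY; rewrite (reindex_inj (addIr y)) /=; apply: eq_bigl => x.
apply/idP/idP => h; last exact: zsubD.
by rewrite -[x](addrK y) zY.2.
Qed.

Lemma char_sum (Y : {set E}) (chi : E -> C) : zsub Y ->
  (forall x y, x \in Y -> y \in Y -> chi (x + y) = chi x * chi y) ->
  (exists2 y, y \in Y & chi y != 1) -> \sum_(x in Y) chi x = 0.
Proof.
move=> zY hm [y yY ny]; set X := LHS.
have e : X = chi y * X.
  rewrite {1}/X (zsub_shift _ zY yY) mulr_sumr; apply: eq_bigr => x xY.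
  by rewrite hm // mulrC.
apply/eqP; move/eqP: e; rewrite -subr_eq0 -{1}[X]mul1r -mulrBl mulf_eq0 subr_eq0 eq_sym (negPf ny).
by [].
Qed.

Lemma char_sum_perp (Y : {set E}) x : zsub Y ->
  \sum_(y in Y) eQZ R (bform x y) = if x \in perp Y then #|Y|%:R else 0.
Proof.
move=> zY; case: ifPn => [/perpP h|].
  rewrite (eq_bigr (fun=> 1)) => [|y yY]; last by rewrite h // eQZ0.
  by rewrite sumr_const.
rewrite inE negb_forall => /existsP[y]; rewrite negb_imply => /andP[yY ny].
apply: char_sum => // [u v _ _|]; first by rewrite bformDr eQZD.
by exists y => //; apply: contraNneq ny => /eQZ_eq1 ->.
Qed.

Lemma zsubT : zsub [set: E]%SET. Proof. by split=> [|x y _ _]; rewrite finset.in_setT. Qed.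

Lemma char_sumT x : Defs.nondegenerate E ->
  \sum_(y : E) eQZ R (bform x y) = if x == 0 then #|E|%:R else 0.
Proof.
move=> nd; have := char_sum_perp x zsubT; rewrite big_mkcond.
under eq_bigr do rewrite finset.in_setT; move=> ->; rewrite cardsT; congr (if _ then _ else _).
apply/perpP/eqP => [h|->]; last by move=> y _; rewrite bform0l.
by apply: nd => y; apply: h; rewrite finset.in_setT.
Qed.

(** Double counting of the characters [eQZ (bform x y)] over [x] in [E] and [y] in [Y]: one order of
    summation gives [#|Y| * #|perp Y|], the other [#|E|]. *)
Lemma card_perp (Y : {set E}) : Defs.nondegenerate E -> zsub Y -> (#|Y| * #|perp Y|)%N = #|E|.
Proof.
move=> nd zY.
have : \sum_(x : E) \sum_(y in Y) eQZ R (bform x y) = \sum_(y in Y) \sum_(x : E) eQZ R (bform x y).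
  exact: exchange_big.
rewrite (eq_bigr (fun x => if x \in perp Y then #|Y|%:R else 0)) => [|x _]; last exact: char_sum_perp.
rewrite -big_mkcond sumr_const.
rewrite [RHS](eq_bigr (fun y => if y == 0 then #|E|%:R else 0)) => [|y _]; last first.
  by rewrite -(char_sumT _ nd); apply: eq_bigr => x _; rewrite bformC.
rewrite (bigD1 0) ?zY.1 //= eqxx big1 ?addr0 => [|y /andP[_ /negPf ->]] //.
by rewrite -mulrnA => /eqP; rewrite eqr_nat => /eqP.
Qed.

Lemma zsub_perp (Y : {set E}) : zsub (perp Y).
Proof. by split=> [|x y]; [exact: perp0|exact: perpB]. Qed.

Lemma double_perp (Y : {set E}) : Defs.nondegenerate E -> zsub Y -> perp (perp Y) = Y.
Proof.
move=> nd zY; apply/esym/eqP; rewrite eqEcard; apply/andP; split.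
  by apply/fintype.subsetP => y yY; apply/perpP => x /perpP/(_ y yY); rewrite bformC.
have := card_perp nd (zsub_perp Y); rewrite -(card_perp nd zY) mulnC => /eqP.
rewrite eqn_pmul2r; first by move=> /eqP ->.
by apply/card_gt0P; exists 0; exact: perp0.
Qed.

Definition gsum : C := \sum_(x : E) eQZ R (qform x).

Definition opT (f : E -> C) (x : E) : C := eQZ R (qform x) * f x.
Definition opS (k : C) (f : E -> C) (x : E) : C := k * \sum_(y : E) eQZ R (- bform x y) * f y.

(** Evaluation at 0 makes both sides of [T S T S T = S] linear forms in [f]. The coefficients of
    [f 0] are [k^2 G] here and [k] in [opS0]. *)
Lemma opTSTST k f : opT (opS k (opT (opS k (opT f)))) 0 =
  \sum_y (k ^+ 2 * (\sum_x eQZ R (qform x) * eQZ R (- bform x y)) * eQZ R (qform y)) * f y.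
Proof.
rewrite /opT /opS (qform0 E) eQZ0 mul1r mulr_sumr.
under eq_bigr do rewrite bform0l oppr0 eQZ0 mul1r mulrA mulr_sumr mulr_sumr.
rewrite exchange_big /=; apply: eq_bigr => y _.
rewrite [k ^+ 2 * _]mulr_sumr !mulr_suml; apply: eq_bigr => x _.
by move: (eQZ _ _) (eQZ _ _) (eQZ _ _) (f y) => *; ring.
Qed.
Lemma opS0 k f : opS k f 0 = \sum_y k * f y.
Proof.
by rewrite /opS mulr_sumr; apply: eq_bigr => y _; rewrite bform0l oppr0 eQZ0 mul1r.
Qed.
Lemma gsum_coef k : k ^+ 2 * (\sum_x eQZ R (qform x) * eQZ R (- bform x (0 : E))) * eQZ R (qform (0 : E)) = k ^+ 2 * gsum.
Proof.
rewrite (qform0 E) eQZ0 mulr1; congr (_ * _); apply: eq_bigr => x _.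
by rewrite bform0r oppr0 eQZ0 mulr1.
Qed.
Lemma gsum_inv k : k != 0 -> k ^+ 2 * gsum = k -> k * gsum = 1.
Proof. by move=> k0 h; apply: (mulfI k0); rewrite mulrA -expr2 h mulr1. Qed.
End CharSum.

Section Weil.
Variable R : realType.
Local Notation C := R[i].
Variables (E : discForm) (rho : Mp2Z R -> {linear galg R E -> galg R E}).
Hypothesis wr : weil_representation rho.

Definition weil_cst : C := ee (- (dsign R E)%:~R / 8) / (Num.sqrt #|E|%:R)%:C.

Lemma weil_cst_neq0 : weil_cst != 0.
Proof.
rewrite mulf_neq0 ?ee_neq0 // invr_eq0 eq_complex /= negb_and sqrtr_eq0 -ltNge ltr0n.
by rewrite (_ : (0 < #|E|)%N) //; apply/card_gt0P; exists 0.
Qed.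

Lemma galgZE (a : C) (f : galg R E) x : (a *: f) x = a * f x. Proof. by rewrite ffunE. Qed.
Lemma gbasisE (y x : E) : gbasis R y x = (x == y)%:R. Proof. by rewrite ffunE. Qed.
Lemma galg_decomp (f : galg R E) : f = \sum_y f y *: gbasis R y.
Proof.
apply/ffunP => x; rewrite sum_ffunE (bigD1 x) //= big1 => [|y yx].
  by rewrite galgZE gbasisE eqxx mulr1 addr0.
by rewrite galgZE gbasisE eq_sym (negPf yx) mulr0.
Qed.

Lemma rho_T (f : galg R E) x : rho (mpT R) f x = opT f x.
Proof.
case: wr => _ _ hT _; rewrite {1}(galg_decomp f) linear_sum sum_ffunE /=.
rewrite (bigD1 x) //= big1 => [|y yx].
  by rewrite linearZ /= hT !galgZE gbasisE eqxx mulr1 addr0 mulrC.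
by rewrite linearZ /= hT !galgZE gbasisE eq_sym (negPf yx) !mulr0.
Qed.

Lemma rho_S (f : galg R E) x : rho (mpS R) f x = opS weil_cst f x.
Proof.
case: wr => _ _ _ hS; rewrite {1}(galg_decomp f) linear_sum sum_ffunE /= /opS mulr_sumr.
apply: eq_bigr => y _; rewrite linearZ /= hS !galgZE sum_ffunE -/weil_cst.
rewrite (bigD1 x) //= big1 => [|z zx]; last by rewrite galgZE gbasisE eq_sym (negPf zx) mulr0.
by rewrite galgZE gbasisE eqxx mulr1 addr0 bformC mulrCA [f y * _]mulrC.
Qed.

(** Applying [mp_rel] to the basis vector at 0 extracts [k^2 G = k], so the scalar of S is the
    inverse Gauss sum whichever representative [dsign] selects. *)
Lemma weil_milgram : weil_cst * gsum R E = 1.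
Proof.
apply: gsum_inv weil_cst_neq0 _.
have [_ hM _ _] := wr.
have := congr1 (fun A => rho A (gbasis R (0 : E)) 0) (mp_rel R).
rewrite !hM rho_S opS0.
pose f := fun y : E => gbasis R (0 : E) y.
have -> : rho (mpT R) (rho (mpS R) (rho (mpT R) (rho (mpS R) (rho (mpT R) (gbasis R (0 : E)))))) 0 =
  opT (opS weil_cst (opT (opS weil_cst (opT f)))) 0.
  rewrite rho_T; congr (opT _ _); apply/funext => x1.
  rewrite rho_S; congr (opS _ _ _); apply/funext => x2.
  rewrite rho_T; congr (opT _ _); apply/funext => x3.
  rewrite rho_S; congr (opS _ _ _); apply/funext => x4.
  by rewrite rho_T.
have d (G : E -> C) : \sum_y G y * f y = G 0.
  rewrite (bigD1 0) //= big1 ?addr0 => [|y y0]; first by rewrite /f gbasisE eqxx mulr1.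
  by rewrite /f gbasisE (negPf y0) mulr0.
by rewrite opTSTST !d gsum_coef.
Qed.
End Weil.

(** * Gluing along the horizontal subgroup *)

Section Gluing.
Variable R : realType.
Local Notation C := R[i].
Variables (c : nat) (S : 'M[rat]_c) (Delta : discForm) (psi : jacobi_index S Delta).
Variables (D : discForm) (H_D : {group D}) (phi : {morphism H_Omega psi >-> D}).
Hypothesis phi_isom : isom (H_Omega psi) H_D phi.
Hypothesis phi_q : forall x, x \in H_Omega psi -> qform (phi x) = - qform x.
Variable iota : {morphism (perp (graphH phi) / graphH phi)%g >-> Delta}.
Hypothesis iota_isom : isom (perp (graphH phi) / graphH phi) [set: Delta]%SET iota.
Hypothesis iota_q : forall x, x \in perp (graphH phi) ->
      qform (iota (coset (graphH phi) x)) = qform x.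
Hypothesis iota_psi : forall (y : D_Omega psi) (a : 'cV[int]_c),
      y \in D_OmegaS psi -> DOmega_class psi (ratcV a) = y ->
      iota (coset (graphH phi) (y, 0)) = psi a.

Local Notation E1 := (D_Omega psi).
Local Notation Hg := (graphH phi).
Local Notation Pp := (perp (graphH phi)).
Local Notation DS := (dsum E1 D).
Local Notation H1 := (H_Omega psi).

(* Meaningful for [d] in [H^\perp] only. *)
Definition glue (d : DS) : Delta := iota (coset Hg d).

Lemma zsub_H1 : zsub H1. Proof. exact: zsub_perp. Qed.
Lemma phiD x y : x \in H1 -> y \in H1 -> phi (x + y) = phi x + phi y.
Proof. by move=> hx hy; exact: (morphM phi hx hy). Qed.
Lemma phi0 : phi 0 = 0.
Proof. by apply: (addIr (phi 0)); rewrite -phiD ?zsub_H1.1 // !add0r. Qed.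
Lemma phiN x : x \in H1 -> phi (- x) = - phi x.
Proof.
move=> hx; have hN : - x \in H1 by rewrite -[- x]add0r zsub_H1.2 // zsub_H1.1.
by apply: (addIr (phi x)); rewrite -phiD // !addNr phi0.
Qed.
Lemma phi_inj x y : x \in H1 -> y \in H1 -> phi x = phi y -> x = y.
Proof.
move=> hx hy e; apply/eqP; rewrite -subr_eq0; apply: contraT => nz.
have hB : x - y \in H1 by exact: zsub_H1.2.
have hN : - y \in H1 by rewrite -[- y]add0r zsub_H1.2 // zsub_H1.1.
have p0 : phi (x - y) = 0 by rewrite phiD // phiN // e subrr.
have : phi (x - y) \in (H_D^#)%g.
  by rewrite -(eqP phi_isom); apply: imset_f; apply/setD1P; split; [exact: nz|exact: hB].
by rewrite p0 !inE eqxx.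
Qed.

Lemma bform_dsum (p p' : DS) : bform p p' = bform p.1 p'.1 + bform p.2 p'.2.
Proof.
rewrite /bform -[qform (p + p')]/(qform (p.1 + p'.1) + qform (p.2 + p'.2)).
rewrite -[qform p]/(qform p.1 + qform p.2) -[qform p']/(qform p'.1 + qform p'.2).
by rewrite !opprD (addrACA (qform (p.1 + p'.1))) (addrACA (_ - _)).
Qed.
Lemma qform_dsum (p : DS) : qform p = qform p.1 + qform p.2. Proof. by []. Qed.

Lemma graphP (d : DS) : (d \in Hg) = (d.1 \in H1) && (d.2 == phi d.1).
Proof. by rewrite inE. Qed.
Lemma graph_in x : x \in H1 -> ((x, phi x) : DS) \in Hg.
Proof. by move=> hx; rewrite graphP /= hx eqxx. Qed.
Lemma zsub_Hg : @zsub DS Hg.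
Proof.
split=> [|x y]; first by rewrite graphP /= zsub_H1.1 phi0 eqxx.
rewrite !graphP => /andP[hx /eqP ex] /andP[hy /eqP ey].
rewrite -[(x - y).1]/(x.1 - y.1) -[(x - y).2]/(x.2 - y.2) zsub_H1.2 //= ex ey.
by rewrite phiD ?phiN // -[- y.1]add0r zsub_H1.2 // zsub_H1.1.
Qed.
Lemma card_Hg : #|Hg| = #|H1|.
Proof.
have -> : Hg = [set ((x, phi x) : DS) | x in H1]%SET.
  apply/setP => d; rewrite graphP; apply/andP/imsetP => [[h /eqP e]|[x hx ->]].
    by exists d.1 => //; rewrite -e; case: (d).
  by rewrite /= hx eqxx.
by rewrite card_in_imset // => x y _ _ [].
Qed.
Lemma bform_phi x y : x \in H1 -> y \in H1 -> bform (phi x) (phi y) = - bform x y.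
Proof.
move=> hx hy; rewrite /bform -phiD // !phi_q ?(zsubD zsub_H1) //.
by rewrite !opprD.
Qed.
Lemma Hg_isotropic d : d \in Hg -> qform d = 0.
Proof. by rewrite graphP => /andP[h /eqP e]; rewrite qform_dsum e phi_q // subrr. Qed.
Lemma Hg_sub d : d \in Hg -> d \in Pp.
Proof.
rewrite graphP => /andP[hd /eqP ed]; apply/perpP => e; rewrite graphP => /andP[he /eqP ee'].
by rewrite bform_dsum ed ee' bform_phi // subrr.
Qed.

Lemma mulgZ (A : finZmodType) (x y : A) : (x * y)%g = x + y. Proof. by []. Qed.

Lemma group_Hg : group_set (Hg : {set DS}).
Proof.
apply/group_setP; split; first exact: zsub_Hg.1.
by move=> x y hx hy; rewrite mulgZ (zsubD zsub_Hg).
Qed.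
Definition gHg : {group DS} := Group group_Hg.

Lemma norm_all (x : DS) : x \in ('N(Hg))%g.
Proof.
apply/normP; apply/setP => y; rewrite mem_conjg.
have e : (- - x + (y - x) : DS) = y by rewrite opprK addrC subrK.
by have -> : (y ^ x^-1)%g = y by exact: e.
Qed.

Lemma coset_in d : d \in Pp -> coset Hg d \in (Pp / Hg)%g.
Proof. by move=> hd; apply: mem_morphim => //; exact: norm_all. Qed.

Lemma glue_D d e : d \in Pp -> e \in Pp -> glue (d + e) = glue d + glue e.
Proof.
move=> hd he; rewrite /glue -[d + e]/((d * e)%g).
rewrite (@morphM _ _ _ (coset_morphism Hg)) ?norm_all //.
exact: (morphM iota (coset_in hd) (coset_in he)).
Qed.
Lemma coset_eq1 d : (coset Hg d == 1%g) = (d \in Hg).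
Proof. by rewrite -[Hg]/(gval gHg); apply/eqP/idP => [/coset_idr|h]; [apply; exact: norm_all|exact: coset_id]. Qed.
Lemma glue_ker d : d \in Pp -> (glue d == 0) = (d \in Hg).
Proof.
move=> hd; rewrite -coset_eq1; apply/idP/idP => [|/eqP h].
  apply: contraLR => nz; have : glue d \in ([set: Delta]^#)%g.
    by rewrite -(eqP iota_isom); apply: imset_f; rewrite 2!inE nz coset_in.
  by rewrite !inE andbT.
have e0 : coset Hg d = coset Hg (0 : DS).
  by rewrite h; apply/esym/eqP; rewrite coset_eq1 zsub_Hg.1.
have : glue 0 + glue 0 = glue 0 by rewrite -glue_D ?perp0 // addr0.
by rewrite /glue e0 -{3}[iota _]addr0 => /addrI ->.
Qed.
Lemma glue_0 : glue 0 = 0. Proof. by apply/eqP; rewrite glue_ker ?perp0 // zsub_Hg.1. Qed.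
Lemma glue_B d e : d \in Pp -> e \in Pp -> glue (d - e) = glue d - glue e.
Proof.
move=> hd he; apply: (addIr (glue e)); rewrite -glue_D ?perpB //.
by rewrite !subrK.
Qed.
Lemma glue_surj b : exists2 d, d \in Pp & glue d = b.
Proof.
have [->|nb] := eqVneq b 0; first by exists 0; [exact: perp0|exact: glue_0].
have : b \in ([set: Delta]^#)%g by rewrite !inE nb.
rewrite -(eqP iota_isom) => /imsetP[y]; rewrite inE => /andP[_ yP] ->.
by move: yP => /morphimP[d _ dP ->]; exists d.
Qed.
Lemma glue_q d : d \in Pp -> qform (glue d) = qform d. Proof. exact: iota_q. Qed.
Lemma glue_b d e : d \in Pp -> e \in Pp -> bform (glue d) (glue e) = bform d e.
Proof. by move=> hd he; rewrite /bform -glue_D // !glue_q ?perpD. Qed.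

Definition cls (u : 'cV[int]_c) : E1 := DOmega_class psi (ratcV u).
Lemma cls_in u : cls u \in D_OmegaS psi.
Proof. by rewrite inE; apply/asboolP; exists u. Qed.
Lemma glue_psi u : glue ((cls u, 0) : DS) = psi u.
Proof. exact: iota_psi (cls_in u) erefl. Qed.
Lemma DS_clsP x : x \in D_OmegaS psi -> exists u, x = cls u.
Proof. by rewrite inE => /asboolP. Qed.
Lemma zsub_DS : zsub (D_OmegaS psi).
Proof.
split.
  rewrite inE; apply/asboolP; exists 0.
  have r0 : ratcV (0 : 'cV[int]_c) = 0 by rewrite /ratcV raddf0.
  have h := ratcV_Omega_star psi 0; rewrite r0 in h *.
  by rewrite -[X in DOmega_class _ X](subrr 0) DOmega_classB // subrr.
move=> x y /DS_clsP[u ->] /DS_clsP[v ->]; rewrite inE; apply/asboolP; exists (u - v).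
by rewrite /cls /ratcV raddfB DOmega_classB // ratcV_Omega_star.
Qed.
Lemma pair_Pp x : ((x, 0) : DS) \in Pp <-> x \in perp H1.
Proof.
split=> /perpP h; apply/perpP => y.
  by move=> hy; have := h _ (graph_in hy); rewrite bform_dsum /= bform0l addr0.
by rewrite graphP => /andP[hy _]; rewrite bform_dsum /= bform0l addr0 h.
Qed.
Lemma cls_Pp u : ((cls u, 0) : DS) \in Pp.
Proof.
apply/pair_Pp/perpP => y /perpP/(_ _ (cls_in u)); by rewrite bformC.
Qed.

(** If [x] is in the radical, [(x, 0)] lies in [H^\perp] and glues into the radical of [Delta], so
    it lies in [H]. Then [phi x = 0], and injectivity of [phi] gives [x = 0]. *)
Lemma nondeg1 : Defs.nondegenerate E1.
Proof.
move=> x hx.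
have xP : ((x, 0) : DS) \in Pp by apply/pair_Pp/perpP => y _; exact: hx.
have : glue ((x, 0) : DS) = 0.
  apply: (df_nondegenerate (d := Delta)) => b; have [d dP <-] := glue_surj b.
  by rewrite glue_b // bform_dsum /= hx bform0l addr0.
move=> /eqP; rewrite glue_ker // graphP /= => /andP[xH /eqP e].
by apply: phi_inj => //; [exact: zsub_H1.1|rewrite phi0 -e].
Qed.

Lemma perp_H1 : perp H1 = D_OmegaS psi.
Proof. exact: (double_perp R nondeg1 zsub_DS). Qed.

(** Otherwise, for every [x], the pairing of [(x, y)] with the graph is a nontrivial character of
    [H_Omega] and sums to 0. Summing also over [x] leaves the term [h = 0], equal to the order of
    [D_Omega]. *)
Lemma fiber_ex (y : D) : exists x : E1, ((x, y) : DS) \in Pp.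
Proof.
apply: contrapT => hno.
have key x : \sum_(h in H1) eQZ R (bform x h) * eQZ R (bform y (phi h)) = 0.
  apply: (char_sum (chi := fun h => eQZ R (bform x h) * eQZ R (bform y (phi h))) zsub_H1) => [u v hu hv|].
    by rewrite (phiD hu hv) 2!bformDr 2!eQZD; exact: mulrACA.
  apply: contrapT => hno2; apply: hno; exists x; apply/perpP => d; rewrite graphP => /andP[hd /eqP ed].
  rewrite bform_dsum /= ed; apply: (@eQZ_eq1 R); rewrite eQZD.
  by apply: contrapT => /eqP h; apply: hno2; exists d.1.
have : \sum_(x : E1) \sum_(h in H1) eQZ R (bform x h) * eQZ R (bform y (phi h)) = 0.
  by rewrite big1.
rewrite exchange_big /=.
rewrite (eq_bigr (fun h => (if h == 0 then #|E1|%:R else 0) * eQZ R (bform y (phi h)))) => [|h _]; last first.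
  rewrite -[LHS]mulr_suml; congr (_ * _); rewrite -[RHS](char_sumT R _ nondeg1); apply: eq_bigr => x _.
  by rewrite bformC.
rewrite (bigD1 0) ?zsub_H1.1 //= eqxx big1 => [|h /andP[_ /negPf ->]]; last by rewrite mul0r.
rewrite phi0 bform0r eQZ0 mulr1 addr0 => /eqP; rewrite pnatr_eq0 -leqn0 leqNgt.
by have -> : (0 < #|E1|)%N by apply/card_gt0P; exists 0.
Qed.

Definition pd (f : galg R DS) : galg R Delta := push_iso iota (arrow_down Hg f).

Lemma pdE (f : galg R DS) b : pd f b = \sum_(d in Pp | glue d == b) f d.
Proof.
rewrite ffunE.
under eq_bigr do rewrite ffunE.
rewrite (exchange_big_dep (mem Pp)) /=; last by move=> y d _ /andP[].
rewrite [RHS]big_mkcondr; apply: eq_bigr => d dP.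
case: eqP => [e|/eqP e].
  rewrite (big_pred1 (coset Hg d)) // => y; rewrite /= dP /=.
  apply/idP/idP => [/andP[_ /eqP <-] //|/eqP ->]; by rewrite coset_in //= -/(glue d) e !eqxx.
by rewrite big_pred0 // => y; apply/negbTE; apply: contra e => /andP[/andP[_ /eqP <-]] /andP[_ /eqP <-].
Qed.

(** This is where horizontality enters: a graph contains no [(0, y)] with [y] nonzero. *)
Lemma glue_fiber1 d e : d \in Pp -> e \in Pp -> glue d = glue e -> d.1 = e.1 -> d = e.
Proof.
move=> hd he hJ h1.
have : d - e \in Hg by rewrite -glue_ker ?perpB // glue_B // hJ subrr.
rewrite graphP -[(d - e).1]/(d.1 - e.1) -[(d - e).2]/(d.2 - e.2) h1 subrr phi0 subr_eq0 => /andP[_ /eqP h2].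
by case: (d) (e) h1 h2 => [a b] [a' b'] /= -> ->.
Qed.

Lemma glue_fiber_sum (F : DS -> C) d0 : d0 \in Pp ->
  \sum_(d in Pp | glue d == glue d0) F d = \sum_(h in Hg) F (d0 + h).
Proof.
move=> h0; rewrite (reindex_inj (addrI d0)) /=; apply: eq_bigl => h.
apply/andP/idP => [[hP]|hh].
  move=> /eqP e; have hP' : d0 + h - d0 \in Pp by exact: perpB.
  rewrite addrC addKr in hP'.
  by rewrite -glue_ker //; move/eqP: e; rewrite glue_D // -{2}[glue d0]addr0 (inj_eq (addrI _)).
have hP := Hg_sub hh; split; first exact: (@perpD DS).
by rewrite glue_D // (eqP (_ : glue h == 0)) ?addr0 // glue_ker.
Qed.

(** Averaging the Gauss sum of the orthogonal sum over translations by [H] removes everything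
    outside [H^\perp], and on [H^\perp] the form is constant along cosets of [H]. *)
Lemma gauss_glue : gsum R E1 * gsum R D = #|H1|%:R * gsum R Delta.
Proof.
have e1 : gsum R E1 * gsum R D = gsum R DS.
  rewrite /gsum big_distrlr /= pair_big /=; apply: eq_bigr => d _.
  by rewrite -eQZD.
have nz : #|Hg|%:R != 0 :> C.
  by rewrite pnatr_eq0 -lt0n; apply/card_gt0P; exists 0; exact: zsub_Hg.1.
have e2 : gsum R DS = \sum_(d in Pp) eQZ R (qform d).
  apply: (mulfI nz).
  transitivity (\sum_(h in Hg) \sum_(d : DS) eQZ R (qform (d + h))).
    rewrite mulr_natl -sumr_const; apply: eq_bigr => h _.
    by rewrite /gsum (reindex_inj (addIr h)).
  rewrite exchange_big /= [in RHS]big_mkcond mulr_sumr; apply: eq_bigr => d _.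
  transitivity (eQZ R (qform (d : DS)) * \sum_(h in Hg) eQZ R (bform (d : DS) h)).
    rewrite mulr_sumr; apply: eq_bigr => h hh.
    etransitivity; first exact: (congr1 (eQZ R) (qformD (d : DS) h)).
    by rewrite (Hg_isotropic hh) addr0 eQZD.
  by rewrite (@char_sum_perp R DS Hg d zsub_Hg); case: ifP => _; [exact: mulrC|rewrite !mulr0].
rewrite e1 e2 /gsum mulr_sumr (partition_big glue xpredT) //=; apply: eq_bigr => b _.
have [d0 h0 <-] := glue_surj b.
rewrite glue_fiber_sum // (eq_bigr (fun=> eQZ R (qform (glue d0)))) => [|h hh]; last first.
  have hP := Hg_sub hh; have j0 : glue h = 0 by apply/eqP; rewrite glue_ker.
  etransitivity; first exact: (congr1 (eQZ R) (esym (glue_q (perpD h0 hP)))).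
  by rewrite glue_D // j0 addr0.
by rewrite sumr_const card_Hg mulr_natl.
Qed.
End Gluing.

(** * Transformation of theta, and regularity in tau of expansion coefficients *)

Section ThetaTransformation.
Variable R : realType.
Local Notation C := R[i].
Local Notation ee := (@ee R).
Local Notation ImC := (@complex.Im R).
Variables (c : nat) (S : 'M[rat]_c) (Delta : discForm) (psi : jacobi_index S Delta).
Local Notation SC := (SC R S).
Local Notation E1 := (D_Omega psi).

Lemma basis_data : exists (P : 'M[int]_c) (q : 'I_c -> nat) (M0 : nat),
  [/\ map_mx intr P \in (@unitmx rat c), forall i, psi (col i P) = 0,
      forall i j, sform S (ratcV (col i P)) (ratcV (col j P)) = if i == j then (q i)%:R else 0,
      \rank S = #|[pred i | (0 < q i)%N]| & forall i, (uN (q i) %| M0.+1)%N].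
Proof.
have [P [q [uP pP dP rk]]] := orth_basis psi.
exists P, q, (\prod_i uN (q i))%N.-1; split=> // i.
rewrite prednK; last by apply: prodn_gt0 => j; exact: uN_gt0.
by rewrite (bigD1 i) //= dvdn_mulr.
Qed.

Lemma thetaT (t : uhp R) z (g : E1) : theta psi (mp_act (mpT R) t) z g = eQZ R (qform g) * theta psi t z g.
Proof. by have [P [q [M0 [uP pP dP rk NM]]]] := basis_data; exact: (theta_T uP pP dP NM). Qed.

Lemma thetaR (t : uhp R) (z : 'cV[C]_c) (g : E1) u :
  theta psi t (z + intC_cV R u) g = eQZ R (bform g (cls psi u)) * theta psi t z g.
Proof.
have [P [q [M0 [uP pP dP rk NM]]]] := basis_data.
by have := theta_real uP pP dP NM t z g (ratcV_Omega_star psi u); rewrite qm_ratcV.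
Qed.
Lemma thetaU (t : uhp R) (z : 'cV[C]_c) (g : E1) u :
  theta psi t (z + uval t *: intC_cV R u) g =
  ee (- (uval t * sform SC (intC_cV R u) (intC_cV R u)) - 2 * sform SC (intC_cV R u) z) *
  theta psi t z (g + cls psi u).
Proof.
have [P [q [M0 [uP pP dP rk NM]]]] := basis_data.
by have := theta_tau uP pP dP NM t z g (ratcV_Omega_star psi u); rewrite -sform_ratr qm_ratcV.
Qed.
Lemma theta_lin_indep (t : uhp R) (a : E1 -> C) :
  (forall z, \sum_g a g * theta psi t z g = 0) -> forall g, a g = 0.
Proof. by have [P [q [M0 [uP pP dP rk NM]]]] := basis_data; exact: (theta_indep uP pP dP NM). Qed.

Lemma theta_eq (t : uhp R) (a b : E1 -> C) :
  (forall z, \sum_g a g * theta psi t z g = \sum_g b g * theta psi t z g) -> forall g, a g = b g.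
Proof.
move=> h g; apply/eqP; rewrite -subr_eq0; apply/eqP.
apply: (@theta_lin_indep t (fun g => a g - b g)) => z.
by under eq_bigr do rewrite mulrBl; rewrite sumrB h subrr.
Qed.

Lemma theta_Slaw : exists K : C, forall (t : uhp R) z (g : E1),
  theta psi (mp_act (mpS R) t) ((uval t)^-1 *: z) g =
  K * usqrt t ^+ bplus S * ee (sform SC z z / uval t) *
  \sum_d eQZ R (- bform g d) * theta psi t z d.
Proof.
have [P [q [M0 [uP pP dP rk NM]]]] := basis_data.
by have := theta_S0 R uP pP dP NM; rewrite -rk.
Qed.

Lemma theta_expansion (t : uhp R) (f : 'cV[C]_c -> C) :
  (forall z a, qreg (fun x => f (z + x *: a))) ->
  (forall z (u v : 'cV[int]_c), psi u = 0 -> psi v = 0 ->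
    f (z + uval t *: intC_cV R u + intC_cV R v) =
    ee (- (uval t * sform SC (intC_cV R u) (intC_cV R u)) - 2 * sform SC (intC_cV R u) z) * f z) ->
  exists cg : E1 -> C, forall z, f z = \sum_g cg g * theta psi t z g.
Proof.
move=> fq fl; have [P [q [M0 [uP pP dP rk NM]]]] := basis_data.
have /choice[a ha] k := jproj_coef pP dP NM fq fl k.
exact: (expansion0 uP pP dP NM fl ha).
Qed.

Definition Hp : set C := [set w | 0 < ImC w]%classic.

Lemma HC_thw (chi : int -> C) j (q : nat) s n : bchar chi -> (0 < q)%N ->
  HC Hp n (fun w => thw chi j (w / (4 * q%:R)) s).
Proof.
move=> hc q0.
have hd w j' : Hp w -> qd (fun w => thw chi j' (w / (4 * q%:R)) s) w (thw chi j'.+1 (w / (4 * q%:R)) s * (4 * q%:R)^-1).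
  move=> hw; apply: (qd_comp (g := fun w => w / (4 * q%:R)) (f := fun A => thw chi j' A s)).
    have := qd_lin (4 * q%:R)^-1 0 w; apply: qd_ext (ltr01 : 0 < (1 : R)) _ => h _.
    by rewrite addr0 mulrC.
  by apply: qd_thwA => //; exact: Im_4q.
elim: n j => [|n IH] j; exists (fun w => thw chi j.+1 (w / (4 * q%:R)) s * (4 * q%:R)^-1); split=> //.
- by move=> w hw; exact: hd.
- by move=> w hw; exact: hd.
by apply: HC_mul; [exact: IH|exact: HC_cst].
Qed.

Lemma HC_uu q r s n : HC Hp n (fun w => uu q r w s).
Proof.
case: (posnP q) => [->|q0].
  have -> : (fun w => uu 0 r w s) = fun=> 1 by apply/funext => w; exact: uu0.
  exact: HC_cst.
have -> : (fun w => uu q r w s) = fun w => thw (uchi R q r) 0 (w / (4 * q%:R)) s.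
  by apply/funext => w; exact: uu_thw.
by apply: HC_thw => //; exact: uchi_b.
Qed.

Lemma theta_HC z (x : E1) : exists th : C -> C, (forall n, HC Hp n th) /\
  forall t : uhp R, theta psi t z x = th (uval t).
Proof.
have [P [q [M0 [uP pP dP rk NM]]]] := basis_data.
rewrite (PCK uP z); set s := invmx _ *m z.
exists (fun w => tw R q M0 * \sum_(n : {ffun 'I_c -> 'I_M0.+1}) (inOg x (qvec P q (vk n)))%:R * thprod q (vk n) w s).
split=> [n|t]; last exact: (theta_fin uP pP dP NM).
apply: HC_mul; first exact: HC_cst.
apply: HC_sum => k; apply: HC_mul; first exact: HC_cst.
by apply: HC_prod => i; exact: HC_uu.
Qed.

Lemma HC_det U n m (A : C -> 'M[C]_m) : (forall i j, HC U n (fun w => A w i j)) -> HC U n (fun w => \det (A w)).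
Proof.
move=> h; apply: HC_sum => s; apply: HC_mul; first exact: HC_cst.
by apply: HC_prod => i; exact: h.
Qed.
Lemma HC_adj U n m (A : C -> 'M[C]_m) i j : (forall i j, HC U n (fun w => A w i j)) -> HC U n (fun w => \adj (A w) i j).
Proof.
move=> h; have -> : (fun w => \adj (A w) i j) = fun w => (-1) ^+ (j + i) * \det (row' j (col' i (A w))).
  by apply/funext => w; rewrite mxE.
apply: HC_mul; first exact: HC_cst.
apply: HC_det => i' j'; have -> : (fun w => (row' j (col' i (A w))) i' j') = fun w => A w (lift j i') (lift i j').
  by apply/funext => w; rewrite !mxE.
exact: h.
Qed.

(** With [n] points making a minor nonzero, suppose the determinant vanished for every choice [z] of
    the remaining point. Expanding along the column of [z] would give a linear relation whose
    coefficients are cofactors, one of them that minor. *)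
Lemma indep_points (X : Type) n (F : 'I_n -> X -> C) :
  (forall a : 'I_n -> C, (forall z, \sum_i a i * F i z = 0) -> forall i, a i = 0) ->
  exists p : 'I_n -> X, \det (\matrix_(i, j) F i (p j)) != 0.
Proof.
elim: n F => [|n IH] F hF.
  by exists (fun i : 'I_0 => match notF (ltn_ord i) with end); rewrite det_mx00 oner_eq0.
have [p hp] : exists p : 'I_n -> X, \det (\matrix_(i, j) F (lift ord0 i) (p j)) != 0.
  apply: (IH (fun i => F (lift ord0 i))) => a ha i.
  pose b i := if unlift ord0 i is Some j then a j else 0.
  have := hF b _ (lift ord0 i); rewrite /b liftK; apply => z.
  rewrite big_ord_recl unlift_none mul0r add0r -[RHS](ha z).
  by apply: eq_bigr => j _; rewrite liftK.
pose pt z j := if unlift ord0 j is Some j' then p j' else z.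
pose A z : 'M[C]_n.+1 := \matrix_(i, j) F i (pt z j).
apply: contrapT => hno.
have dA z : \det (A z) = 0.
  by apply: contrapT => /eqP h; apply: hno; exists (pt z).
pose a (i : 'I_n.+1) : C := (-1) ^+ (i + 0) * \det (\matrix_(i' < n, j' < n) F (lift i i') (p j')).
have := hF a _ ord0; rewrite /a => h; move: hp; rewrite -[X in X != _]mul1r.
have -> : (1 : C) = (-1) ^+ ((ord0 : 'I_n.+1) + 0) by [].
rewrite h ?eqxx // => z; rewrite -[RHS](dA z) (expand_det_col _ ord0); apply: eq_bigr => i _.
rewrite mulrC [A z i ord0]mxE /pt unlift_none; congr (_ * _).
rewrite /cofactor; congr (_ * \det _); apply/matrixP => i' j'; rewrite !mxE /pt.
by rewrite liftK.
Qed.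

Local Notation N1 := #|E1|.

(** Points [zs] chosen at [t0] keep a nonzero determinant nearby. Solving there expresses each
    expansion coefficient through finitely many values, with multipliers holomorphic in tau. *)
Lemma cramer (t0 : uhp R) : exists (zs : 'I_N1 -> 'cV[C]_c) (cf : 'I_N1 -> E1 -> C -> C) (dt : C -> C),
  [/\ forall n, HC Hp n dt, dt (uval t0) != 0,
      forall n j x, HC [set w | Hp w /\ dt w != 0]%classic n (cf j x)
    & forall (t : uhp R) (a : E1 -> C) x, dt (uval t) != 0 ->
        a x = \sum_j (\sum_y a y * theta psi t (zs j) y) * cf j x (uval t)].
Proof.
have [zs hz] : exists zs : 'I_N1 -> 'cV[C]_c, \det (\matrix_(i, j) theta psi t0 (zs j) (enum_val i)) != 0.
  apply: (@indep_points 'cV[C]_c N1 (fun i z => theta psi t0 z (enum_val i))) => a ha i.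
  have := @theta_lin_indep t0 (fun x => a (enum_rank x)) _ (enum_val i); rewrite enum_valK; apply => z.
  rewrite -[RHS](ha z) (reindex (@enum_val E1 E1)) /=; last exact: onW_bij (enum_val_bij _).
  by apply: eq_bigr => j _; rewrite enum_valK.
have /choice[th hth] (jx : 'I_N1 * E1) := theta_HC (zs jx.1) jx.2.
pose A (w : C) : 'M[C]_N1 := \matrix_(i, j) th (j, enum_val i) w.
have AE (t : uhp R) : A (uval t) = \matrix_(i, j) theta psi t (zs j) (enum_val i).
  by apply/matrixP => i j; rewrite !mxE (hth (j, enum_val i)).2.
have hA U n i j : (U `<=` Hp)%classic -> HC U n (fun w => A w i j).
  move=> sU; have -> : (fun w => A w i j) = th (j, enum_val i) by apply/funext => w; rewrite mxE.
  by apply: HC_sub sU _; exact: (hth (j, enum_val i)).1.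
exists zs, (fun j x w => \adj (A w) j (enum_rank x) * (\det (A w))^-1), (fun w => \det (A w)); split.
- by move=> n; apply: HC_det => i j; exact: hA.
- by rewrite AE.
- have sU : ([set w | Hp w /\ \det (A w) != 0] `<=` Hp)%classic by move=> w [].
  move=> n j x; apply: HC_mul; first by apply: HC_adj => i' j'; exact: hA.
  by apply: HC_inv => [w []//|]; apply: HC_det => i' j'; exact: hA.
move=> t a x nz.
pose v : 'rV[C]_N1 := \row_i a (enum_val i).
have e : v *m A (uval t) *m \adj (A (uval t)) = \det (A (uval t)) *: v.
  by rewrite -mulmxA mul_mx_adj mul_mx_scalar.
have := congr1 (fun M : 'rV[C]_N1 => (\det (A (uval t)))^-1 * M 0 (enum_rank x)) e.
rewrite [in X in _ = X -> _]mxE mulKf // [in X in _ = X -> _]mxE enum_rankK => <-.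
rewrite mxE mulr_sumr; apply: eq_bigr => j _; rewrite mulrC -mulrA; congr (_ * _).
rewrite mxE (reindex (@enum_val E1 E1)) /=; last exact: onW_bij (enum_val_bij _).
by apply: eq_bigr => i _; rewrite AE !mxE.
Qed.

Lemma uhp_ofK (w : C) : 0 < ImC w -> uval (uhp_of w) = w.
Proof. by move=> hw; rewrite /uhp_of; case: pselect. Qed.
Lemma uhp_ofV (t : uhp R) : uhp_of (uval t) = t.
Proof. by apply: uval_inj; rewrite uhp_ofK // uvalP. Qed.

Lemma nonzero_ball (dt : C -> C) (w0 : C) : (forall n, HC Hp n dt) -> Hp w0 -> dt w0 != 0 ->
  exists2 r : R, 0 < r & forall w, nc (w - w0) <= r -> Hp w /\ dt w != 0.
Proof.
move=> hd h0 n0; have [l hl] := HC_qd (hd 0%N) h0; have [rho [r0 hr]] := qd_nz hl n0.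
have h0' : 0 < ImC w0 by exact: h0.
exists (Num.min rho (ImC w0 / 2)); first by rewrite lt_min r0 divr_gt0.
move=> w; rewrite le_min => /andP[w1 w2]; split.
  have := le_trans (nc_Im (w - w0)) w2; rewrite ImB ler_norml /Hp /= => /andP[+ _].
  by move: (ImC w) (ImC w0) h0' => x y h0' hh; lra.
rewrite -nc_gt0; have := hr (w - w0) w1; rewrite addrC subrK; apply: lt_le_trans.
by rewrite divr_gt0 // nc_gt0.
Qed.

Section Coef.
Variables (f : uhp R -> 'cV[C]_c -> C) (g : E1 -> uhp R -> C).
Hypothesis fg : forall t z, f t z = \sum_x g x t * theta psi t z x.

Lemma coef_smooth : (forall z, smooth_uhp (fun t => f t z)) -> forall x, smooth_uhp (g x).
Proof.
move=> fs x; apply: smooth_loc => p0 p00.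
have hw0 : Hp (pc p0) by exact: p00.
have [zs [cf [dt [h1 h2 h3 h4]]]] := cramer (uhp_of (pc p0)).
rewrite uhp_ofK // in h2.
have [r r0 hr] := nonzero_ball h1 hw0 h2.
have r20 : 0 < r / 2 by rewrite divr_gt0.
have hb p : ball p0 (r / 2) p -> Hp (pc p) /\ dt (pc p) != 0.
  move=> [/= b1 b2]; apply: hr; apply: le_trans (nc_le _) _; rewrite ReB ImB /= distrC [`|p.2 - _|]distrC.
  by rewrite [leRHS](splitr r) lerD // ltW.
exists (ball p0 (r / 2)); first exact: ballxx.
have oB : open (ball p0 (r / 2)) by exact: ball_open.
have sm : smooth_on (ball p0 (r / 2)) (fun p : R * R => \sum_j f (uhp_of (p.1 +i* p.2)) (zs j) * cf j x (pc p)).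
  apply: smooth_sum => // j; apply: smoothM => //.
    by apply: smooth_sub (fs (zs j)) => p /hb[].
  by apply: (HC_smooth oB (U := [set w | Hp w /\ dt w != 0]%classic)) => // n; exact: h3.
apply: smooth_ext oB _ sm => p /hb[hp dp].
have e : uval (uhp_of (p.1 +i* p.2)) = pc p by rewrite uhp_ofK.
rewrite (h4 (uhp_of (p.1 +i* p.2)) (fun y => g y (uhp_of (p.1 +i* p.2))) x) e //.
by apply: eq_bigr => j _; rewrite fg.
Qed.

Definition hol (h : C -> C) (z : C) := derivable (h : R[i]^o -> R[i]^o) (z : R[i]^o) (1 : R[i]^o).
Lemma hol_at h z : hol h z <-> holomorphic_at (V := R[i]^o) h z.
Proof. exact: derivable1_diffP. Qed.
Lemma holD h k z : hol h z -> hol k z -> hol (fun w => h w + k w) z.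
Proof. by move=> h1 h2; exact: (derivableD h1 h2). Qed.
Lemma holM h k z : hol h z -> hol k z -> hol (fun w => h w * k w) z.
Proof. by move=> h1 h2; exact: (@derivableM R[i] R[i]^o h k z 1 h1 h2). Qed.
Lemma hol_sum (T : Type) (r : seq T) (h : T -> C -> C) z : (forall i, hol (h i) z) ->
  hol (fun w => \sum_(i <- r) h i w) z.
Proof.
move=> hh; elim: r => [|a r IH].
  have -> : (fun w => \sum_(i <- [::]) h i w) = fun=> 0 by apply/funext => w; rewrite big_nil.
  exact: derivable_cst.
have -> : (fun w => \sum_(i <- a :: r) h i w) = fun w => h a w + \sum_(i <- r) h i w.
  by apply/funext => w; rewrite big_cons.
apply: (holD (hh a) IH).
Qed.
Lemma hol_qd h z l : qd h z l -> hol h z.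
Proof. by move=> /qd_derivable[]. Qed.
Lemma hol_near h k z (r : R) : 0 < r -> (forall w, nc (w - z) <= r -> h w = k w) -> hol h z -> hol k z.
Proof.
move=> r0 e; apply: near_eq_derivable; apply/nbhs_ballP; exists r%:C; first by rewrite /= ltcR.
move=> w; rewrite -ball_normE /= => hw; apply: e.
move: hw; rewrite ncE ltcR ncBC; exact: ltW.
Qed.
Lemma half_ball (w0 : C) : Hp w0 -> exists2 r : R, 0 < r & forall w, nc (w - w0) <= r -> Hp w.
Proof.
move=> h; have [r r0 hr] := @nonzero_ball (fun=> 1) w0 (fun n => HC_cst Hp n 1) h (oner_neq0 _).
by exists r => // w /hr[].
Qed.

Lemma coef_hol : (forall z, holomorphic_uhp (fun t => f t z)) -> forall x, holomorphic_uhp (g x).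
Proof.
move=> fh x t0; apply/hol_at.
have hw0 : Hp (uval t0) by exact: uvalP.
have [zs [cf [dt [h1 h2 h3 h4]]]] := cramer t0.
have [r r0 hr] := nonzero_ball h1 hw0 h2.
apply: (@hol_near (fun w => \sum_j f (uhp_of w) (zs j) * cf j x w) _ _ r r0).
  move=> w /hr[hp dp]; have e : uval (uhp_of w) = w by rewrite uhp_ofK.
  rewrite (h4 (uhp_of w) (fun y => g y (uhp_of w)) x) e //.
  by apply: eq_bigr => j _; rewrite fg.
apply: hol_sum => j; apply: holM; first by apply/hol_at; exact: (fh (zs j) t0).
by have [l] := HC_qd (h3 0%N j x) (conj hw0 h2); exact: hol_qd.
Qed.

Lemma hol_coef : (forall x, holomorphic_uhp (g x)) -> forall z, holomorphic_uhp (fun t => f t z).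
Proof.
move=> gh z t0; apply/hol_at.
have hw0 : Hp (uval t0) by exact: uvalP.
have [r r0 hr] := half_ball hw0.
have /choice[th hth] x := theta_HC z x.
apply: (@hol_near (fun w => \sum_x g x (uhp_of w) * th x w) _ _ r r0).
  move=> w /hr hp; rewrite fg; apply: eq_bigr => x _.
  by rewrite (hth x).2 uhp_ofK.
apply: hol_sum => x; apply: holM; first by apply/hol_at; exact: (gh x t0).
by have [l] := HC_qd ((hth x).1 0%N) hw0; exact: hol_qd.
Qed.
End Coef.

(** Automorphy factor of weight [bplus S / 2] and index [S], the part of the Jacobi law that theta
    accounts for. *)
Definition autf (A : Mp2Z R) (t : uhp R) (z : 'cV[C]_c) : C :=
  mp_phi A t ^+ bplus S * ee ((mp_mat A 1 0)%:~R * sform SC z z / mp_j A t).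

Lemma mp_j_neq0 (A : Mp2Z R) t : mp_j A t != 0. Proof. exact: jfac_neq0 (mp_det A). Qed.
Lemma autf_neq0 A t z : autf A t z != 0.
Proof. by rewrite mulf_neq0 ?ee_neq0 // expf_neq0 // mp_phi_neq0. Qed.

Lemma autfM (A B : Mp2Z R) t z :
  autf (A * B)%g t z = autf A (mp_act B t) ((mp_j B t)^-1 *: z) * autf B t z.
Proof.
rewrite /autf mp_phiM exprMn [RHS]mulrACA -eeD; congr (_ * ee _).
rewrite sformZl sformZr mp_jM mp_matM mulmx2E.
have jA := mp_j_neq0 A (mp_act B t); have jB := mp_j_neq0 B t.
set Q := sform SC z z.
have dB : (mp_mat B 0 0)%:~R * (mp_mat B 1 1)%:~R - (mp_mat B 0 1)%:~R * (mp_mat B 1 0)%:~R = 1 :> C.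
  by rewrite -!rmorphM -rmorphB -det2 (mp_det B).
have jAB : mp_j A (mp_act B t) * mp_j B t =
   ((mp_mat A 1 0)%:~R * (mp_mat B 0 0)%:~R + (mp_mat A 1 1)%:~R * (mp_mat B 1 0)%:~R) * uval t +
   ((mp_mat A 1 0)%:~R * (mp_mat B 0 1)%:~R + (mp_mat A 1 1)%:~R * (mp_mat B 1 1)%:~R).
  by rewrite -mp_jM /mp_j /jfac mp_matM !mulmx2E !rmorphD !rmorphM.
(* The cocycle identity for lower left entries, [c_AB * j_B = c_A + c_B * j_AB], a consequence of
   [det B = 1]. *)
have key : ((mp_mat A 1 0)%:~R * (mp_mat B 0 0)%:~R + (mp_mat A 1 1)%:~R * (mp_mat B 1 0)%:~R) * mp_j B t =
   (mp_mat A 1 0)%:~R + (mp_mat B 1 0)%:~R * (mp_j A (mp_act B t) * mp_j B t).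
  rewrite jAB /mp_j /jfac -[X in _ = X + _]mulr1 -[X in _ = _ * X + _]dB; ring.
rewrite rmorphD !rmorphM /=.
apply: (mulIf (mulf_neq0 (mulf_neq0 jA jB) jB)).
transitivity (((mp_mat A 1 0)%:~R * (mp_mat B 0 0)%:~R + (mp_mat A 1 1)%:~R * (mp_mat B 1 0)%:~R) * mp_j B t * Q).
  by field; rewrite jA jB.
by rewrite key; field; rewrite jA jB.
Qed.
Lemma autfT t z : autf (mpT R) t z = 1.
Proof. by rewrite /autf mp_phiT expr1n /= mxE /= !mul0r ee0 mulr1. Qed.
Lemma autfS t z : autf (mpS R) t z = usqrt t ^+ bplus S * ee (sform SC z z / uval t).
Proof. by rewrite /autf mp_phiS mp_jS /= mxE /= mul1r. Qed.
Lemma autf1 t z : autf 1%g t z = 1.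
Proof. by rewrite /autf /= expr1n mxE /= !mul0r ee0 mulr1. Qed.

Definition thv (A : Mp2Z R) t z (x : E1) : C := theta psi (mp_act A t) ((mp_j A t)^-1 *: z) x.
(** Theta slashed by [A]. Left multiplication of [A] by T and S acts through [opT] and [opS], which
    turns [mp_rel] into an identity of operators. *)
Definition ntheta (A : Mp2Z R) t z (x : E1) : C := thv A t z x / autf A t z.

Lemma nthetaT A t z x : ntheta (mpT R * A)%g t z x = opT (ntheta A t z) x.
Proof.
rewrite /ntheta /opT /thv mp_actM mp_jM mp_jT mul1r thetaT autfM autfT mul1r -mulrA //.
Qed.
Section WithK.
Variable K : C.
Hypothesis hK : forall (t : uhp R) z (g : E1),
  theta psi (mp_act (mpS R) t) ((uval t)^-1 *: z) g =
  K * usqrt t ^+ bplus S * ee (sform SC z z / uval t) *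
  \sum_d eQZ R (- bform g d) * theta psi t z d.
Lemma thvS A t z x : thv (mpS R * A)%g t z x =
  K * usqrt (mp_act A t) ^+ bplus S * ee (sform SC ((mp_j A t)^-1 *: z) ((mp_j A t)^-1 *: z) / uval (mp_act A t)) *
  \sum_d eQZ R (- bform x d) * thv A t z d.
Proof. by rewrite -(hK (mp_act A t)) /thv mp_actM mp_jM mp_jS invfM scalerA. Qed.
Lemma nthetaS A t z x : ntheta (mpS R * A)%g t z x = opS K (ntheta A t z) x.
Proof.
etransitivity; first exact: (congr1 (fun u => u / autf (mpS R * A)%g t z) (thvS A t z x)).
rewrite /opS /ntheta autfM autfS.
have u0 : usqrt (mp_act A t) ^+ bplus S != 0 by rewrite expf_neq0 // usqrt_neq0.
have e0 := ee_neq0 (sform SC ((mp_j A t)^-1 *: z) ((mp_j A t)^-1 *: z) / uval (mp_act A t)).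
have a0 := autf_neq0 A t z.
under [in RHS]eq_bigr do rewrite mulrA; rewrite -mulr_suml.
set X := \sum_d _; move: u0 e0 a0; set u := usqrt _ ^+ _; set e := ee _; set a := autf _ _ _.
by move=> u0 e0 a0; field; rewrite u0 e0 a0.
Qed.
(** At [A = 1] and component 0, [mp_rel] equates two combinations of the theta components; linear
    independence allows comparing the coefficients at 0, so [K^2 G = K]. A zero [K] would make a
    component of theta vanish for all [z]. *)
Lemma theta_milgram : K * gsum R E1 = 1.
Proof.
have K0 : K != 0.
  apply/eqP => k0; have := @theta_lin_indep (mp_act (mpS R) (uhp_of 'i)) (fun x => (x == 0)%:R) _ 0.
  rewrite eqxx => h; have h1 : 1%:R = 0 :> C; last by move/eqP: h1; rewrite oner_eq0.
  apply: h => z.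
  rewrite (bigD1 0) //= big1 ?addr0 => [|x /negPf ->]; last by rewrite mul0r.
  have w0 : uval (uhp_of 'i) != 0 :> C by apply: uhp_neq0; exact: uvalP.
  have ez : z = (uval (uhp_of 'i))^-1 *: (uval (uhp_of 'i) *: z) by rewrite scalerA mulVf // scale1r.
  by rewrite eqxx mul1r ez hK k0 !mul0r.
apply: gsum_inv K0 _; pose t := uhp_of 'i : uhp R.
pose L (y : E1) := K ^+ 2 * (\sum_x eQZ R (qform x) * eQZ R (- bform x y)) * eQZ R (qform y).
have <- : L 0 = K ^+ 2 * gsum R E1 by exact: gsum_coef.
apply: (@theta_eq t L (fun=> K)) => z.
have e1 x : theta psi t z x = ntheta 1%g t z x.
  by rewrite /ntheta /thv autf1 divr1 mp_act1 /mp_j jfac1 invr1 scale1r.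
under eq_bigr do rewrite e1; under [in RHS]eq_bigr do rewrite e1.
rewrite -opTSTST -opS0.
have eT A : opT (ntheta A t z) = ntheta (mpT R * A)%g t z by apply/funext => x; rewrite nthetaT.
have eS A : opS K (ntheta A t z) = ntheta (mpS R * A)%g t z by apply/funext => x; rewrite nthetaS.
by rewrite !(eT, eS) !mulg1 !mulgA mp_rel.
Qed.
End WithK.
End ThetaTransformation.

(** * Jacobi forms *)

Section Regularity.
Local Open Scope classical_set_scope.
Variable R : realType.
Local Notation C := R[i].

Lemma diff_cd c (f : 'cV[C]_c -> C) (z a : 'cV[C]_c) (x : C) :
  holomorphic_at (V := 'cV[C]_c) f (z + x *: a) -> exists l, cd (fun y => f (z + y *: a)) x l.
Proof.
move=> hd; have /cvg_ex[l hl] := @diff_derivable _ _ _ _ _ a hd.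
exists l => e e0.
have e0' : 0 < e%:C by rewrite ltcR.
have := hl; move=> /(@cvgrPdist_le R[i] R[i]^o) /(_ _ e0')[r r0 hr].
have [r' r'0 er] := normC_lt r0.
exists (r' / 2); first by rewrite divr_gt0.
move=> h hh; have [->|h0] := eqVneq h 0.
  by rewrite addr0 subrr mul0r subr0 nc0 mulr0.
have hb : ball_ [eta Num.Def.normr] 0 r h.
  rewrite /ball_ /= sub0r normrN er ncE ltcR; apply: le_lt_trans hh _.
  by rewrite ltr_pdivrMr // ltr_pMr // ltr1n.
have := hr h hb h0; rewrite /= ncE lecR => hn.
have -> : f (z + (x + h) *: a) - f (z + x *: a) - h * l =
   - h * (l - h^-1 * (f (h *: a + (z + x *: a)) - f (z + x *: a))).
  have -> : h *: a + (z + x *: a) = z + (x + h) *: a by rewrite addrCA scalerDl [h *: a + _]addrC.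
  by field.
by rewrite ncM ncN mulrC ler_wpM2r ?nc_ge0.
Qed.

Section OneFunction.
Variables (c : nat) (G : uhp R -> 'cV[C]_c -> C).
Hypothesis Gs : smooth_uhp_cV G.
Local Notation rem v := (map_mx (@complex.Re R) v).
Local Notation imm v := (map_mx (@complex.Im R) v).

Lemma smooth_fixz z : smooth_uhp (fun t => G t z).
Proof.
pose w0 : (R * R) * ('cV[R]_c * 'cV[R]_c) := ((0, 0), (rem z, imm z)).
pose c1 : (R * R) * ('cV[R]_c * 'cV[R]_c) := ((1, 0), (0, 0)).
pose c2 : (R * R) * ('cV[R]_c * 'cV[R]_c) := ((0, 1), (0, 0)).
have := smooth_aff w0 c1 c2 Gs.
have -> : (fun p : R * R => G (uhp_of ((aff w0 c1 c2 p).1.1 +i* (aff w0 c1 c2 p).1.2))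
    (\col_i ((aff w0 c1 c2 p).2.1 i 0 +i* (aff w0 c1 c2 p).2.2 i 0))) =
    fun p => G (uhp_of (p.1 +i* p.2)) z.
  apply/funext => p; congr (G (uhp_of _) _).
    by rewrite /aff /= /GRing.scale /=; congr (_ +i* _); ring.
  have e1 : (aff w0 c1 c2 p).2.1 = rem z + (p.1 *: 0 + p.2 *: 0) by [].
  have e2 : (aff w0 c1 c2 p).2.2 = imm z + (p.1 *: 0 + p.2 *: 0) by [].
  apply/colP => i; rewrite mxE e1 e2 !scaler0 !addr0 !mxE; by case: (z i 0).
apply: smooth_sub => p /= p0; rewrite /aff /= /GRing.scale /=.
by rewrite mulr0 mulr1 !add0r.
Qed.

Hypothesis Gh : forall t, holomorphic_cV (G t).

Lemma smooth_qreg t z a : qreg (fun x => G t (z + x *: a)).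
Proof.
have /choice[l hl] x := diff_cd (Gh t (z + x *: a)).
apply: (qreg_smooth hl).
pose w0 : (R * R) * ('cV[R]_c * 'cV[R]_c) := ((complex.Re (uval t), complex.Im (uval t)), (rem z, imm z)).
pose c1 : (R * R) * ('cV[R]_c * 'cV[R]_c) := ((0, 0), (rem a, imm a)).
(* In real coordinates [c1] is the direction [a] and [c2] is [i a], so the plane is the complex line
   through [z]. *)
pose c2 : (R * R) * ('cV[R]_c * 'cV[R]_c) := ((0, 0), (- imm a, rem a)).
have := smooth_aff w0 c1 c2 Gs.
have -> : (fun p : R * R => G (uhp_of ((aff w0 c1 c2 p).1.1 +i* (aff w0 c1 c2 p).1.2))
    (\col_i ((aff w0 c1 c2 p).2.1 i 0 +i* (aff w0 c1 c2 p).2.2 i 0))) =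
    fun p => G t (z + pc p *: a).
  apply/funext => p; congr (G _ _).
    rewrite -[RHS]uhp_ofV; congr uhp_of; rewrite /aff /= /GRing.scale /= !mulr0 !addr0.
    by case: (uval t).
  have e1 : (aff w0 c1 c2 p).2.1 = rem z + (p.1 *: rem a + p.2 *: - imm a) by [].
  have e2 : (aff w0 c1 c2 p).2.2 = imm z + (p.1 *: imm a + p.2 *: rem a) by [].
  apply/colP => i; rewrite mxE e1 e2 !mxE /pc; case: (z i 0) (a i 0) => u v [u' v'] /=.
  by apply: cP => /=; ring.
apply: smooth_sub => p _ /=; rewrite /aff /= /GRing.scale /= !mulr0 !addr0.
exact: uvalP.
Qed.
End OneFunction.
End Regularity.

(** * From Jacobi forms to vector-valued modular forms *)

Section Final.
Variable R : realType.
Local Notation C := R[i].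
Local Notation ee := (@ee R).
Variables (c : nat) (S : 'M[rat]_c) (Delta : discForm) (psi : jacobi_index S Delta).
Variables (D : discForm) (H_D : {group D}) (phi : {morphism H_Omega psi >-> D}).
Hypothesis phi_isom : isom (H_Omega psi) H_D phi.
Hypothesis phi_q : forall x, x \in H_Omega psi -> qform (phi x) = - qform x.
Variable iota : {morphism (perp (graphH phi) / graphH phi)%g >-> Delta}.
Hypothesis iota_isom : isom (perp (graphH phi) / graphH phi) [set: Delta]%SET iota.
Hypothesis iota_q : forall x, x \in perp (graphH phi) ->
      qform (iota (coset (graphH phi) x)) = qform x.
Hypothesis iota_psi : forall (y : D_Omega psi) (a : 'cV[int]_c),
      y \in D_OmegaS psi -> DOmega_class psi (ratcV a) = y ->
      iota (coset (graphH phi) (y, 0)) = psi a.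
Local Notation SC := (SC R S).
Local Notation E1 := (D_Omega psi).
Local Notation Hg := (graphH phi).
Local Notation Pp := (perp (graphH phi)).
Local Notation DS := (dsum E1 D).
Local Notation H1 := (H_Omega psi).
Local Notation glue := (glue iota).
Local Notation cls := (cls psi).
Local Notation th := (theta psi).

Definition pdt (t : uhp R) z (F : galg R D) : galg R Delta := pd iota (tensor (th t z) F).

Lemma pdtE t z F b : pdt t z F b = \sum_(d in Pp | glue d == b) th t z d.1 * F d.2.
Proof. by rewrite /pdt pdE; apply: eq_bigr => d _; rewrite ffunE. Qed.
Lemma pdtZ t z a F : pdt t z (a *: F) = a *: pdt t z F.
Proof.
apply/ffunP => b; rewrite galgZE !pdtE mulr_sumr; apply: eq_bigr => d _.
by rewrite galgZE mulrCA.
Qed.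

Lemma fiber_exJ (y : D) : exists x : E1, ((x, y) : DS) \in Pp.
Proof. exact: (fiber_ex R phi_isom iota_isom iota_q y). Qed.

(** Each [y] has a lift [(x, y)] in [H^\perp]. In the component at its glue class the coefficient of
    [theta_x] is [F y] alone, because [(x, y)] is the only element of that fibre over [x]. *)
Lemma pdt_inj t (F F' : galg R D) : (forall z, pdt t z F = pdt t z F') -> F = F'.
Proof.
move=> h; apply/ffunP => y; have [x xP] := fiber_exJ y.
pose co (G : galg R D) (x' : E1) := \sum_(d in Pp | (glue d == glue (x, y)) && (d.1 == x')) G d.2.
have coE G z : pdt t z G (glue (x, y)) = \sum_x' co G x' * th t z x'.
  rewrite pdtE (partition_big (fun d : DS => d.1) xpredT) //=; apply: eq_bigr => x' _.
  rewrite mulr_suml; apply: eq_big => [d|d /andP[_ /eqP ->]]; last exact: mulrC.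
  by rewrite andbA.
have e : co F x = co F' x.
  by apply: (@theta_eq _ _ _ _ psi t (co F) (co F')) => z; rewrite -!coE h.
have co1 G : co G x = G y.
  rewrite /co (big_pred1 ((x, y) : DS)) // => d /=.
  apply/idP/idP => [/and3P[dP /eqP dJ /eqP d1]|/eqP ->]; last by rewrite xP !eqxx.
  by apply/eqP; apply: (glue_fiber1 iota_isom).
by rewrite -!co1.
Qed.

Variables (rho_Delta : Mp2Z R -> {linear galg R Delta -> galg R Delta})
    (rho_D : Mp2Z R -> {linear galg R D -> galg R D}).
Hypothesis wrDelta : weil_representation rho_Delta.
Hypothesis wrD : weil_representation rho_D.

Definition intertwines (A : Mp2Z R) := forall t z F,
  pdt (mp_act A t) ((mp_j A t)^-1 *: z) (rho_D A F) = autf S A t z *: rho_Delta A (pdt t z F).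

Lemma intertwinesT : intertwines (mpT R).
Proof.
move=> t z F; apply/ffunP => b; rewrite autfT scale1r (rho_T wrDelta) mp_jT invr1 scale1r.
rewrite /opT !pdtE mulr_sumr; apply: eq_bigr => d /andP[dP /eqP <-].
by rewrite thetaT (rho_T wrD) /opT mulrACA -eQZD -qform_dsum (glue_q iota_q dP).
Qed.

(** All three constants are inverse Gauss sums, so this is [gauss_glue] inverted. *)
Lemma cst_rel (K : C) : K * gsum R E1 = 1 -> K * weil_cst R D * #|H1|%:R = weil_cst R Delta.
Proof.
move=> hK; have hD := weil_milgram wrD; have hDe := weil_milgram wrDelta.
have g := gauss_glue R phi_q iota_isom iota_q.
transitivity (K * weil_cst R D * weil_cst R Delta * (#|H1|%:R * gsum R Delta)).
  by rewrite -{1}[K * weil_cst R D * _]mulr1 -{1}hDe; ring.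
rewrite -g; transitivity (K * gsum R E1 * (weil_cst R D * gsum R D) * weil_cst R Delta); first by ring.
by rewrite hK hD !mul1r.
Qed.

(** Summing the kernel of S over a coset [d0 + H] projects the sum over [D_Omega] and [D] onto
    [H^\perp], with a factor [#|H_Omega|] that [cst_rel] absorbs into the constant of [Delta]. *)
Lemma intertwinesS : intertwines (mpS R).
Proof.
have [K hK] := theta_Slaw R psi; have mK := theta_milgram hK.
move=> t z F; apply/ffunP => b; rewrite mp_jS galgZE autfS (rho_S wrDelta).
set U := usqrt t ^+ _; set V := ee _.
have [d0 d0P <-] := glue_surj iota_isom b.
pose TF (d : DS) : C := th t z d.1 * F d.2.
have -> : opS (weil_cst R Delta) (pdt t z F) (glue d0) =
   weil_cst R Delta * \sum_(d in Pp) eQZ R (- bform d0 d) * TF d.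
  rewrite /opS; congr (_ * _); rewrite [RHS](partition_big glue xpredT) //=; apply: eq_bigr => b' _.
  rewrite pdtE mulr_sumr; apply: eq_bigr => d /andP[dP /eqP <-].
  by rewrite (glue_b iota_q) //.
rewrite pdtE.
transitivity (\sum_(d in Pp | glue d == glue d0) (K * U * V * weil_cst R D) * \sum_(d' : DS) eQZ R (- bform d d') * TF d').
  apply: eq_bigr => d _; rewrite hK -/U -/V (rho_S wrD) /opS mulrACA; congr (_ * _).
  rewrite big_distrlr /= pair_big /=; apply: eq_bigr => d' _.
  by rewrite mulrACA -eQZD -opprD -bform_dsum.
rewrite (glue_fiber_sum phi_q iota_isom) // -mulr_sumr exchange_big /=.
transitivity (K * U * V * weil_cst R D * (#|H1|%:R * \sum_(d in Pp) eQZ R (- bform d0 d) * TF d)); last first.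
  rewrite -(cst_rel mK); ring.
congr (_ * _); rewrite mulr_sumr [RHS]big_mkcond; apply: eq_bigr => d _.
transitivity (eQZ R (- bform d0 d) * TF d * \sum_(h in Hg) eQZ R (bform (- (d : DS)) h)).
  rewrite mulr_sumr; apply: eq_bigr => h _.
  by rewrite -[bform (d0 + h) d]/(bform (d0 + (h : DS)) (d : DS)) bformDl opprD eQZD bformNl (@bformC DS d h) mulrAC.
rewrite (@char_sum_perp R DS Hg (- (d : DS)) (zsub_Hg phi)) card_Hg.
have -> : (- (d : DS) \in Pp) = ((d : DS) \in Pp).
  by apply/idP/idP => h; [rewrite -[d : DS]opprK -[- - _]add0r|rewrite -[- _]add0r]; apply: perpB => //; exact: perp0.
by case: ifP => _; [exact: mulrC|rewrite mulr0].
Qed.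

Lemma intertwinesM A B : intertwines A -> intertwines B -> intertwines (A * B)%g.
Proof.
move=> hA hB t z F; have [_ hM _ _] := wrD; have [_ hM' _ _] := wrDelta.
rewrite mp_actM mp_jM invfM -scalerA hM hA hB linearZ scalerA -autfM hM' //.
Qed.

Lemma intertwinesV A : intertwines A -> intertwines A^-1%g.
Proof.
move=> hA t z F; have [h1 hM _ _] := wrD; have [h1' hM' _ _] := wrDelta.
set t' := mp_act A^-1%g t; set z' := (mp_j A^-1%g t)^-1 *: z.
have := hA t' z' (rho_D A^-1%g F); rewrite -hM mulgV h1.
have -> : mp_act A t' = t by rewrite /t' -mp_actM mulgV mp_act1.
have -> : (mp_j A t')^-1 *: z' = z.
  rewrite /z' scalerA -invfM -mp_jM mulgV /mp_j jfac1 invr1 scale1r //.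
move=> ->; rewrite linearZ scalerA -hM' mulVg h1'.
have -> : autf S A^-1%g t z * autf S A t' z' = 1.
  by rewrite mulrC -autfM mulgV autf1.
by rewrite scale1r.
Qed.

Lemma intertwinesP A : intertwines A.
Proof. exact: (Mp2Z_ind intertwinesT intertwinesS intertwinesM intertwinesV). Qed.

Variables (Gamma : groupClosed (Mp2Z R)) (k2 : int) (Phi : uhp R -> 'cV[C]_c -> galg R Delta).
Hypothesis jf : jacobi_form psi Gamma k2 rho_Delta Phi.

Lemma Phi_shift t z u v b : Phi t (z + uval t *: intC_cV R u + intC_cV R v) b =
  ee (- (uval t * sform SC (intC_cV R u) (intC_cV R u)) - 2 * sform SC (intC_cV R u) z) *
  (eQZ R (bform (psi v) b) * Phi t z (b + psi u)).
Proof. by case: jf => _ _ h _ _; rewrite h galgZE !ffunE. Qed.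

(** The coefficients are chosen independently for each tau and [b]; nothing is claimed yet about
    their dependence on tau. *)
Lemma Phi_expansion : exists g : Delta -> E1 -> uhp R -> C,
  forall t z b, Phi t z b = \sum_x g b x t * th t z x.
Proof.
have [hs hh _ _ _] := jf.
have /choice[g hg] (tb : uhp R * Delta) : exists a : E1 -> C, forall z, Phi tb.1 z tb.2 = \sum_x a x * th tb.1 z x.
  apply: theta_expansion => [z a|z u v pu pv].
    exact: (smooth_qreg (hs tb.2) (hh tb.2)).
  by rewrite Phi_shift pu pv bform0l eQZ0 mul1r addr0.
by exists (fun b x t => g (t, b) x) => t z b; exact: (hg (t, b)).
Qed.

Variable g : Delta -> E1 -> uhp R -> C.
Hypothesis gE : forall t z b, Phi t z b = \sum_x g b x t * th t z x.

Lemma g_smooth b x : smooth_uhp (g b x).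
Proof.
have [hs _ _ _ _] := jf.
apply: (coef_smooth (f := fun t z => Phi t z b) (g := g b)) => [t z|z]; first exact: gE.
exact: smooth_fixz (hs b) z.
Qed.

Lemma g_growth b x : exp_growth (g b x).
Proof. by have [_ _ _ _ h] := jf; apply: (h g) => // b' x'; exact: g_smooth. Qed.

Lemma sum_shift_cls (w : E1) (G : E1 -> C) : \sum_x G x = \sum_x G (x + w).
Proof. exact: (reindex_inj (addIr w)). Qed.

(** Under [z + tau u] theta permutes its components by [cls u] and [Phi] by [psi u], with the same
    exponential factor; linear independence compares the coefficients. *)
Lemma gU b x t u : g (b + psi u) (x + cls u) t = g b x t.
Proof.
apply/esym.
have := @theta_eq _ _ _ _ psi t (fun x' => g b (x' - cls u) t) (fun x' => g (b + psi u) x' t) _ (x + cls u).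
rewrite addrK; apply => z.
rewrite -(gE t z (b + psi u)).
have := Phi_shift t z u 0 b; rewrite raddf0 bform0l eQZ0 mul1r.
have -> : intC_cV R (0 : 'cV[int]_c) = 0 by apply/colP => i; rewrite !mxE.
rewrite addr0 gE => h; apply: (mulfI (ee_neq0 (- (uval t * sform SC (intC_cV R u) (intC_cV R u)) - 2 * sform SC (intC_cV R u) z))).
rewrite -[RHS]h [X in _ * X = _](sum_shift_cls (cls u)) mulr_sumr; apply: eq_bigr => x' _.
by rewrite addrK mulrCA; apply: (congr1 (fun w => g b x' t * w)); rewrite [RHS](thetaU t z x' u).
Qed.

(** Under the real shift by [v], [theta_x] and [Phi_b] are multiplied by characters, which must
    agree wherever the coefficient is nonzero. *)
Lemma gV b x t v : g b x t != 0 -> bform x (cls v) = bform b (psi v).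
Proof.
move=> nz.
have : eQZ R (bform x (cls v)) * g b x t = eQZ R (bform b (psi v)) * g b x t.
  apply: (@theta_eq _ _ _ _ psi t (fun x' => eQZ R (bform x' (cls v)) * g b x' t)
    (fun x' => eQZ R (bform b (psi v)) * g b x' t)) => z.
  have := Phi_shift t z 0 v b; rewrite raddf0 addr0.
  have -> : intC_cV R (0 : 'cV[int]_c) = 0 by apply/colP => i; rewrite !mxE.
  rewrite scaler0 addr0 !sform0l !mulr0 oppr0 addr0 ee0 mul1r gE gE mulr_sumr bformC => h.
  under [in RHS]eq_bigr do rewrite -mulrA; rewrite -h; apply: eq_bigr => x' _.
  by rewrite -[LHS]mulrA mulrCA; apply: (congr1 (fun w => g b x' t * w)); rewrite [RHS](thetaR t z x' v).
move=> /(mulIf nz) h; apply/eqP; rewrite -subr_eq0; apply/eqP; apply: (@eQZ_eq1 R).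
by rewrite eQZD eQZN h divff // eQZ_neq0.
Qed.

(** For any [d0] in [H^\perp] gluing to [b], [gV] makes [x - d0.1] orthogonal to [D_OmegaS], hence
    an element of [H_Omega]. Adding its graph element moves the first coordinate to [x] within the
    glue class. *)
Lemma g_support b x t : g b x t != 0 -> exists2 d : DS, d \in Pp & glue d = b /\ d.1 = x.
Proof.
move=> nz; have [d0 d0P d0b] := glue_surj iota_isom b.
have hH : x - d0.1 \in H1.
  apply/perpP => y /DS_clsP[v ->]; rewrite bformBl (gV v nz) -d0b -(glue_psi iota_psi v).
  by rewrite (glue_b iota_q d0P (cls_Pp phi v)) bform_dsum /= bform0r addr0 subrr.
pose h : DS := (x - d0.1, phi (x - d0.1)).
have hh : h \in Hg by exact: graph_in.
have hP := Hg_sub phi_q hh.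
exists (d0 + h); first exact: perpD.
split; last by rewrite -[(d0 + h).1]/(d0.1 + (x - d0.1)) addrC subrK.
by rewrite glue_D // (eqP (_ : glue h == 0)) ?addr0 // (glue_ker iota_isom hP).
Qed.

Lemma exists_lift : exists xy : D -> E1, forall y, ((xy y, y) : DS) \in Pp.
Proof. by have /choice[xy hxy] y := fiber_exJ y; exists xy. Qed.

Variable xy : D -> E1.
Hypothesis xyP : forall y, ((xy y, y) : DS) \in Pp.

Definition Fm (t : uhp R) : galg R D := [ffun y => g (glue (xy y, y)) (xy y) t].

(** Two lifts of the same [y] differ by [(x, 0)] with [x] in the orthogonal of [H_Omega], that is,
    by the class of an integer vector; [gU] says that such a change is invisible. Hence the choice
    of [xy] in [Fm] is harmless. *)
Lemma g_Fm d t : d \in Pp -> g (glue d) d.1 t = Fm t d.2.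
Proof.
move=> dP; rewrite ffunE.
pose e : DS := d - (xy d.2, d.2).
have eP : e \in Pp by exact: perpB.
have eE : e = (d.1 - xy d.2, 0) by rewrite /e -[LHS]/(d.1 - xy d.2, d.2 - d.2) subrr.
have : d.1 - xy d.2 \in D_OmegaS psi.
  rewrite -(perp_H1 R phi_isom iota_isom iota_q); apply/(pair_Pp phi).
  by rewrite -eE.
move=> /DS_clsP[u hu].
have d1 : d.1 = xy d.2 + cls u by rewrite -hu addrC subrK.
have glued : glue d = glue (xy d.2, d.2) + psi u.
  rewrite -(glue_psi iota_psi u) -hu -eE -glue_D // /e; congr glue.
  by rewrite addrC subrK.
by rewrite glued d1 gU.
Qed.

Lemma Phi_pdt t z : Phi t z = pdt t z (Fm t).
Proof.
apply/ffunP => b; rewrite gE pdtE.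
rewrite (partition_big (fun d : DS => d.1) xpredT) //=; apply: eq_bigr => x _.
have [/existsP[d /and3P[dP /eqP dJ /eqP dx]]|hno] := boolP [exists d : DS, [&& d \in Pp, glue d == b & d.1 == x]].
  rewrite (big_pred1 d) => [|d' /=]; first by rewrite -dJ -dx g_Fm // mulrC.
  rewrite -andbA; apply/idP/idP => [/and3P[d'P /eqP d'glue /eqP d'x]|/eqP ->].
    by apply/eqP; apply: (glue_fiber1 iota_isom) => //; rewrite ?d'glue ?d'x.
  by rewrite dP dJ dx !eqxx.
rewrite big_pred0 => [|d /=]; last first.
  by apply/negbTE; apply: contra hno => h; apply/existsP; exists d; rewrite andbA.
have [->|/g_support[d dP [dJ dx]]] := eqVneq (g b x t) 0; first by rewrite mul0r.
by case/existsP: hno; exists d; rewrite dP dJ dx !eqxx.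
Qed.

Lemma Fm_modular : modular_form Gamma (k2 - (bplus S)%:Z) rho_D Fm.
Proof.
split=> [y|A t AG|y].
- have -> : (fun t => Fm t y) = g (glue (xy y, y)) (xy y) by apply/funext => t; rewrite ffunE.
  exact: g_smooth.
(* By injectivity it is enough to compare after [pdt], where the law of [Phi] meets [intertwinesP];
   cancelling [autf] lowers the exponent [k2] by [bplus S]. *)
- apply: (@pdt_inj (mp_act A t)) => z'.
  have jn := mp_j_neq0 A t; have pn := mp_phi_neq0 A t.
  pose z := mp_j A t *: z'.
  have -> : z' = (mp_j A t)^-1 *: z by rewrite /z scalerA mulVf // scale1r.
  have [_ _ _ hG _] := jf.
  rewrite pdtZ intertwinesP -Phi_pdt -Phi_pdt hG // scalerA; congr (_ *: _).
  rewrite /autf [RHS]mulrA; congr (_ * _).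
  by rewrite -[mp_phi A t ^+ bplus S]/(exprz (mp_phi A t) (bplus S)%:Z) -expfzDr // subrK.
have -> : (fun t => Fm t y) = g (glue (xy y, y)) (xy y) by apply/funext => t; rewrite ffunE.
exact: g_growth.
Qed.

(** By [g_Fm] and [g_support] every coefficient [g b x] is a component of [F] or identically zero,
    so holomorphy passes through [coef_hol] and [hol_coef] in both directions. *)
Lemma Fm_hol : (forall y, holomorphic_uhp (fun t => Fm t y)) <->
  (forall z b, holomorphic_uhp (fun t => Phi t z b)).
Proof.
split=> [hF z b|hP y].
  apply: (hol_coef (f := fun t z => Phi t z b) (g := g b)) => [t z'|x]; first exact: gE.
  have [[d dP [dJ dx]]|hno] := pselect (exists2 d : DS, d \in Pp & glue d = b /\ d.1 = x).
    have -> : g b x = fun t => Fm t d.2 by apply/funext => t; rewrite -g_Fm // dJ dx.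
    exact: hF.
  have -> : g b x = fun=> 0.
    by apply/funext => t; apply/eqP; apply: contraT => /g_support h; exfalso; exact: hno.
  by move=> t; apply/hol_at; exact: derivable_cst.
have -> : (fun t => Fm t y) = g (glue (xy y, y)) (xy y) by apply/funext => t; rewrite ffunE.
apply: (coef_hol (f := fun t z => Phi t z (glue (xy y, y))) (g := g (glue (xy y, y)))) => [t z|z]; first exact: gE.
exact: hP.
Qed.
End Final.

Theorem theorem6p9 (R : realType) (c : nat) (S : 'M[rat]_c) (Delta : discForm)
    (psi : jacobi_index S Delta)
    (D : discForm) (H_D : {group D}) (phi : {morphism H_Omega psi >-> D})
    (phi_isom : isom (H_Omega psi) H_D phi)
    (phi_q : forall x, x \in H_Omega psi -> qform (phi x) = - qform x)
    (iota : {morphism (perp (graphH phi) / graphH phi)%g >-> Delta})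
    (iota_isom : isom (perp (graphH phi) / graphH phi) [set: Delta]%SET iota)
    (iota_q : forall x, x \in perp (graphH phi) ->
      qform (iota (coset (graphH phi) x)) = qform x)
    (iota_psi : forall (y : D_Omega psi) (a : 'cV[int]_c),
      y \in D_OmegaS psi -> DOmega_class psi (ratcV a) = y ->
      iota (coset (graphH phi) (y, 0)) = psi a)
    (Gamma : groupClosed (Mp2Z R)) (Gamma_fi : finite_index Gamma) (k2 : int)
    (rho_Delta : Mp2Z R -> {linear galg R Delta -> galg R Delta})
    (rho_Delta_weil : weil_representation rho_Delta)
    (rho_D : Mp2Z R -> {linear galg R D -> galg R D})
    (rho_D_weil : weil_representation rho_D)
    (Phi : uhp R -> 'cV[R[i]%C]_c -> galg R Delta) :
  jacobi_form psi Gamma k2 rho_Delta Phi ->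
  exists F : uhp R -> galg R D,
    [/\ modular_form Gamma (k2 - (bplus S)%:Z) rho_D F /\
        (forall t z, Phi t z =
           push_iso iota (arrow_down (graphH phi) (tensor (theta psi t z) (F t)))),
        forall F' : uhp R -> galg R D,
          modular_form Gamma (k2 - (bplus S)%:Z) rho_D F' ->
          (forall t z, Phi t z =
             push_iso iota (arrow_down (graphH phi) (tensor (theta psi t z) (F' t)))) ->
          F' = F
      & (forall x, holomorphic_uhp (fun t => F t x)) <->
        (forall z b, holomorphic_uhp (fun t => Phi t z b))].
Proof.
move=> jf; have [g gE] := Phi_expansion jf.
have [xy xyP] := exists_lift R phi_isom iota_isom iota_q.
have hPhi t z := Phi_pdt phi_isom phi_q iota_isom iota_q iota_psi jf gE xyP t z.
exists (Fm iota g xy); split.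
- split; last exact: hPhi.
  exact: (Fm_modular phi_isom phi_q iota_isom iota_q iota_psi rho_Delta_weil rho_D_weil jf gE xyP).
- move=> F' _ hF'; apply/funext => t.
  by apply: (pdt_inj phi_isom iota_isom iota_q (t := t)) => z; rewrite -hPhi.
exact: (Fm_hol phi_isom phi_q iota_isom iota_q iota_psi jf gE xyP).
Qed.
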